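(* Let $\ell\in(0,+\infty)$ and let $f^\ell_{\rm hom}$ be the homogenized volume integrand (as defined in the context). Then there exists a constant $\gamma_0>0$ such that $f^\ell_{\rm hom}(\xi)=|\xi|^2$ for every $\xi\in\mathbb R^n$ with $|\xi|\le\gamma_0$.
   Context: Let $n\ge2$ and let $\Omega\subset\mathbb R^n$ be open, bounded, with Lipschitz boundary; $\mathcal A(\Omega)$ is the class of open subsets of $\Omega$. $Q_r:=(-r/2,r/2)^n$, $Q:=Q_1$, $P:=\mathbb R^n\setminus\bigcup_{i\in\mathbb Z^n}(i+\overline{Q_{1/2}})$, and $\varepsilon P$ is its $\varepsilon$-dilation. The weights satisfy $0<\beta_\varepsilon\le1$, $\beta_\varepsilon\searrow0$ as $\varepsilon\to0$, and $\ell:=\lim_{\varepsilon\to0}\beta_\varepsilon/\varepsilon$ exists. $GSBV(U)$ is the set of $u\in L^1(U)$ with $(u\wedge m)\vee(-m)\in SBV(U)$ for all $m\in\mathbb N$; $GSBV^2(U)$ is the set of $u\in GSBV(U)$ with $\nabla u\in L^2(U)$ and $\mathcal H^{n-1}(S_u)<+\infty$. For $u\in L^1(\Omega)$, $U\in\mathcal A(\Omega)$, $$F_\varepsilon(u,U):=\int_U|\nabla u|^2dx+\mathcal H^{n-1}(S_u\cap(U\cap\varepsilon P))+\beta_\varepsilon\mathcal H^{n-1}(S_u\cap(U\setminus\varepsilon P))$$ if $u\in GSBV^2(U)$, and $+\infty$ otherwise. Convergence in $\Omega\cap\varepsilon P$: $u_\varepsilon\to u$ means there is $(\tilde u_\varepsilon)\subset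 L^1(\Omega)$ with $\tilde u_\varepsilon=u_\varepsilon$ in $\Omega\cap\varepsilon P$ and $\tilde u_\varepsilon\to u$ strongly in $L^1(\Omega)$. For a sequence $\varepsilon_k\searrow0$ put $F'(u,U):=\inf\{\liminf_kF_{\varepsilon_k}(u_k,U):u_k\to u\}$ and $F''(u,U):=\inf\{\limsup_kF_{\varepsilon_k}(u_k,U):u_k\to u\}$, with this convergence. Homogenized volume integrand: $(\varepsilon_k)$ is a fixed sequence of positive numbers decreasing to $0$ for which there are a convex function $f^\ell_{\rm hom}\colon\mathbb R^n\to[0,+\infty)$ and a Borel function $g^\ell_{\rm hom}\colon\mathbb R\times\mathbb S^{n-1}\to[0,+\infty)$ with $$F'(u,U)=F''(u,U)=\int_Uf^\ell_{\rm hom}(\nabla u)\,dx+\int_{S_u\cap U}g^\ell_{\rm hom}([u],\nu_u)\,d\mathcal H^{n-1}$$ for all $u\in GSBV^2(\Omega)$, $U\in\mathcal A(\Omega)$, where $[u]=u^+-u^-$ (every sequence decreasing to zero has such a subsequence; $f^\ell_{\rm hom}$ may depend on it). *)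

(* Defs.v *)
From HB Require Import structures.
From mathcomp Require Import all_boot all_order all_algebra.
From mathcomp Require Import all_classical all_reals all_analysis.

Set Implicit Arguments.
Unset Strict Implicit.
Unset Printing Implicit Defensive.

Import Order.TTheory GRing.Theory Num.Theory.
Import numFieldNormedType.Exports.

Local Open Scope classical_set_scope.
Local Open Scope ring_scope.

(* The library norm on 'rV[R]_n is the sup norm.  It is used here only through
   the notions that do not depend on the choice of an equivalent norm (open,
   compact, bounded, lipschitz); everything metric uses [enorm]. *)

Definition dot (R : realType) (n : nat) (x y : 'rV[R]_n) : R :=
  \sum_(i < n) x 0 i * y 0 i.

Definition enorm (R : realType) (n : nat) (x : 'rV[R]_n) : R :=
  Num.sqrt (dot x x).

Definition eball (R : realType) (n : nat) (x : 'rV[R]_n) (r : R) :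
  set 'rV[R]_n := [set y | enorm (y - x) < r].

Definition box (R : realType) (n : nat) (p : 'rV[R]_n * 'rV[R]_n) :
  set 'rV[R]_n := [set x | forall i, p.1 0 i < x 0 i < p.2 0 i].

(* The product vanishes as soon as one side is degenerate, i.e. when the box
   is empty. *)
Definition box_volume (R : realType) (n : nat) (p : 'rV[R]_n * 'rV[R]_n) : R :=
  \prod_(i < n) Num.max 0 (p.2 0 i - p.1 0 i).

(* Infimum of the total weights of the countable coverings of A by sets C i,
   where i ranges over D.  The value None stands for a missing member of the
   covering, so that finite coverings are included. *)
Definition cover_outer (R : realType) (T I : Type) (D : set I) (C : I -> set T)
    (h : I -> R) (A : set T) : \bar R :=
  ereal_inf [set (\sum_(k <oo) (oapp h 0 (F k))%:E)%E |
    F in [set F : nat -> option I |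
      (forall k i, F k = Some i -> D i) /\
      A `<=` \bigcup_k oapp C set0 (F k)]].

Section cover_outer_is_outer.
Local Open Scope ereal_scope.
Context (R : realType) (T I : Type) (D : set I) (C : I -> set T) (h : I -> R).
Hypothesis h_ge0 : forall i, (0 <= h i)%R.

Local Notation mu := (cover_outer D C h).

Let oh_ge0 (i : option I) : (0 <= oapp h 0 i)%R.
Proof. by case: i => /=. Qed.

Lemma le_cover_outer : {homo mu : A B / A `<=` B >-> A <= B}.
Proof.
move=> A B AB; apply/ereal_inf_le_tmp => x [F [DF BF]].
by move=> <-{x}; exists F => //; split => //; apply: subset_trans AB BF.
Qed.

Lemma cover_outer_ge0 A : 0 <= mu A.
Proof.
apply: le_ereal_inf_tmp => x [F _ <-{x}].
by apply: nneseries_ge0 => k _ _; rewrite lee_fin.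
Qed.

Lemma cover_outer0 : mu set0 = 0.
Proof.
apply/eqP; rewrite eq_le; apply/andP; split; last exact/cover_outer_ge0.
apply: ereal_inf_lbound; exists (fun=> None); first by split.
by rewrite eseries0.
Qed.

Lemma cover_outer_sigma_subadditive : sigma_subadditive mu.
Proof.
move=> A; have [[i ioo]|] := pselect (exists i, mu (A i) = +oo).
  rewrite (eseries_pinfty _ _ ioo) ?leey// => n _.
  by rewrite -ltNye (lt_le_trans _ (cover_outer_ge0 _)).
rewrite -forallNE => Aoo.
suff add2e (e : {posnum R}) :
    mu (\bigcup_n A n) <= \sum_(i <oo) mu (A i) + e%:num%:E.
  by apply/lee_addgt0Pr => _/posnumP[].
rewrite (le_trans _ (epsilon_trick _ _ _))//; last first.
  by move=> n; exact: cover_outer_ge0.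
pose P n (F : nat -> option I) :=
  ((forall k i, F k = Some i -> D i) /\
     A n `<=` \bigcup_k oapp C set0 (F k)) /\
  \sum_(k <oo) (oapp h 0%R (F k))%:E <= mu (A n) + (e%:num / (2 ^ n.+1)%:R)%:E.
have [G PG] : {G : nat -> nat -> option I & forall n, P n (G n)}.
  apply: (@choice _ _ P) => n; rewrite /P.
  have An_fin : mu (A n) \is a fin_num.
    by rewrite ge0_fin_numE ?cover_outer_ge0// ltey; apply/eqP/Aoo.
  have en1 : (0 < e%:num / (2 ^ n.+1)%:R)%R by [].
  have [x [F DF <-] xS] := lb_ereal_inf_adherent en1 An_fin.
  by exists F; split => //; exact/ltW.
pose H (p : nat * nat) : \bar R := (oapp h 0%R (G p.1 p.2))%:E.
have H_ge0 p : 0 <= H p by rewrite lee_fin.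
apply: (@le_trans _ _ (\esum_(i in setT) H i)).
  apply: ereal_inf_lbound => /=.
  have /card_esym/ppcard_eqP[f] := card_nat2.
  exists (fun k => G (f k).1 (f k).2).
    split => [k i|]; first exact: (PG (f k).1).1.1.
    apply: (@subset_trans _  (\bigcup_n \bigcup_k oapp C set0 (G n k))) => [t [i _]|].
      by move=> /((PG i).1.2) -[j _ ?]; exists i => //; exists j.
    move=> t [i _ [j _ Bijt]]; exists (f^-1%FUN (i, j)) => //=.
    by rewrite invK ?inE.
  transitivity (\sum_(k <oo) (H \o f) k); first by [].
  rewrite -(esum_pred_image H _ xpredT) ?[fun=> _]set_true//.
  by rewrite image_eq.
rewrite (_ : esum _ _ = \sum_(i <oo) \sum_(j <oo) H (i, j)); last first.
  pose J : nat -> set (nat * nat) := fun i => [set (i, j) | j in setT].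
  rewrite (_ : setT = \bigcup_k J k); last first.
    by rewrite predeqE => -[a b]; split => // _; exists a => //; exists b.
  rewrite esum_bigcupT /=; last 2 first.
    - apply/trivIsetP => i j _ _ ij.
      rewrite predeqE => -[n m] /=; split => //= -[] [_] _ [<-{n} _].
      by move=> [m' _] [] /esym/eqP; rewrite (negbTE ij).
    - by move=> /= [n m].
  rewrite -(image_id [set: nat]) -fun_true esum_pred_image//; last first.
    by move=> n _; exact: esum_ge0.
  apply: eq_eseriesr => /= j _.
  rewrite -(esum_pred_image H (pair j) predT)//=; last first.
    by move=> ? ? _ _; exact: (@can_inj _ _ _ snd).
  by congr esum; rewrite predeqE => -[a b]; split; move=> [i _ <-]; exists i.
apply: lee_nneseries => [i _ _|i _]; last exact: (PG i).2.
by apply: nneseries_ge0 => m _ _; exact: H_ge0.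
Qed.

End cover_outer_is_outer.

Definition leb_outer (R : realType) (n : nat) : set 'rV[R]_n -> \bar R :=
  cover_outer setT (@box R n) (@box_volume R n).

Section leb_outer_instance.
Context (R : realType) (n : nat).

Let box_volume_ge0 (p : 'rV[R]_n * 'rV[R]_n) : 0 <= box_volume p.
Proof. by apply: prodr_ge0 => i _; rewrite le_max lexx. Qed.

HB.instance Definition _ := isOuterMeasure.Build R 'rV[R]_n (@leb_outer R n)
  (cover_outer0 setT (@box R n) box_volume_ge0)
  (cover_outer_ge0 setT (@box R n) box_volume_ge0)
  (@le_cover_outer R _ _ setT (@box R n) (@box_volume R n))
  (cover_outer_sigma_subadditive setT (@box R n) box_volume_ge0).

End leb_outer_instance.

(* R^n with the sigma-algebra of Lebesgue measurable sets *)
Definition lebT (R : realType) (n : nat) := caratheodory_type (@leb_outer R n).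

Definition leb (R : realType) (n : nat) :
    {measure set (lebT R n) -> \bar R} :=
  (@leb_outer R n : {outer_measure set 'rV[R]_n -> \bar R})
    : set (caratheodory_type (@leb_outer R n)) -> \bar R.

Definition unit_ball_volume (R : realType) (s : nat) : R :=
  fine (@leb_outer R s (eball 0 1)).

Definition diam (R : realType) (n : nat) (E : set 'rV[R]_n) : R :=
  sup [set enorm (p.1 - p.2) | p in E `*` E].

Definition haus_delta (R : realType) (n s : nat) (delta : R) :
    set 'rV[R]_n -> \bar R :=
  cover_outer
    [set E : set 'rV[R]_n | forall x y, E x -> E y -> enorm (x - y) <= delta]
    id (fun E => unit_ball_volume R s * (diam E / 2) ^+ s).

Definition haus_outer (R : realType) (n s : nat) (A : set 'rV[R]_n) : \bar R :=
  ereal_sup [set haus_delta s delta A | delta in [set d : R | 0 < d]].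

Section haus_outer_instance.
Local Open Scope ereal_scope.
Context (R : realType) (n s : nat).
Implicit Types A B : set 'rV[R]_n.

Let weight_ge0 (E : set 'rV[R]_n) :
  (0 <= unit_ball_volume R s * (diam E / 2) ^+ s)%R.
Proof.
apply: mulr_ge0; first by rewrite fine_ge0// outer_measure_ge0.
apply: exprn_ge0; apply: divr_ge0 => //.
have [[E0 Eb]|nE] := pselect (has_sup [set enorm (p.1 - p.2) | p in E `*` E]).
  have [_ [p Ep _]] := E0.
  apply: (@le_trans _ _ (enorm (p.1 - p.2))); first exact: sqrtr_ge0.
  by apply: ub_le_sup => //; exists p.
by rewrite /diam sup_out.
Qed.

Let haus_ge0 A : 0 <= haus_outer s A.
Proof.
apply: (@le_trans _ _ (haus_delta s 1%R A)); first exact: cover_outer_ge0.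
by apply: ereal_sup_ubound; exists 1%R => //=.
Qed.

Let haus0 : haus_outer s (set0 : set 'rV[R]_n) = 0.
Proof.
apply/eqP; rewrite eq_le haus_ge0 andbT.
by apply: ge_ereal_sup => _ [d _ <-]; rewrite /haus_delta cover_outer0.
Qed.

Let haus_le : {homo @haus_outer R n s : A B / A `<=` B >-> A <= B}.
Proof.
move=> A B AB; apply: ge_ereal_sup => _ [d d0 <-].
apply: (@le_trans _ _ (haus_delta s d B)); first exact: le_cover_outer.
by apply: ereal_sup_ubound; exists d.
Qed.

Let haus_sigma_subadditive : sigma_subadditive (@haus_outer R n s).
Proof.
move=> F; apply: ge_ereal_sup => _ [d d0 <-].
apply: (le_trans (cover_outer_sigma_subadditive _ _ weight_ge0 F)).
apply: lee_nneseries => [i _ _|i _]; first exact: cover_outer_ge0.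
by apply: ereal_sup_ubound; exists d.
Qed.

HB.instance Definition _ := isOuterMeasure.Build R 'rV[R]_n
  (@haus_outer R n s) haus0 haus_ge0 haus_le haus_sigma_subadditive.

End haus_outer_instance.

(* R^n with the sigma-algebra of H^s-measurable sets *)
Definition hausT (R : realType) (n s : nat) :=
  caratheodory_type (@haus_outer R n s).

Definition haus (R : realType) (n s : nat) :
    {measure set (hausT R n s) -> \bar R} :=
  (@haus_outer R n s : {outer_measure set 'rV[R]_n -> \bar R})
    : set (caratheodory_type (@haus_outer R n s)) -> \bar R.

Definition borelT (T : topologicalType) := g_sigma_algebraType (@open T).

Definition L1 (R : realType) (n : nat) (U : set 'rV[R]_n) (u : 'rV[R]_n -> R) :
  Prop := (@leb R n).-integrable U (fun x => (u x)%:E).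

(* A has n-dimensional density 0 at x. *)
Definition density0 (R : realType) (n : nat) (A : set 'rV[R]_n)
    (x : 'rV[R]_n) : Prop :=
  (fun r : R => leb_outer (A `&` eball x r) * (r ^- n)%:E)%E @ 0^'+ --> 0%E.

(* u^\vee and u^\wedge.  They depend only on u near x, so that a function
   given on an open set may be extended arbitrarily to R^n. *)
Definition approx_sup (R : realType) (n : nat) (u : 'rV[R]_n -> R)
    (x : 'rV[R]_n) : \bar R :=
  ereal_inf [set t%:E | t in [set t : R | density0 [set y | t < u y] x]].

Definition approx_inf (R : realType) (n : nat) (u : 'rV[R]_n -> R)
    (x : 'rV[R]_n) : \bar R :=
  ereal_sup [set t%:E | t in [set t : R | density0 [set y | u y < t] x]].

Definition disc_set (R : realType) (n : nat) (u : 'rV[R]_n -> R) :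
  set 'rV[R]_n := [set x | (approx_inf u x < approx_sup u x)%E].

(* z is the approximate limit at x of the restriction of u to H. *)
Definition approx_lim (R : realType) (n : nat) (u : 'rV[R]_n -> R)
    (H : set 'rV[R]_n) (x : 'rV[R]_n) (z : R) : Prop :=
  forall e : R, 0 < e -> density0 (H `&` [set y | e < `|u y - z|]) x.

Definition is_approx_grad (R : realType) (n : nat) (u : 'rV[R]_n -> R)
    (x xi : 'rV[R]_n) : Prop :=
  exists2 z : R, approx_lim u setT x z &
    forall e : R, 0 < e ->
      density0 [set y | e * enorm (y - x) < `|u y - z - dot xi (y - x)|] x.

Definition approx_grad (R : realType) (n : nat) (u : 'rV[R]_n -> R)
    (x : 'rV[R]_n) : 'rV[R]_n := xget 0 (is_approx_grad u x).

(* The triple (u^+, u^-, nu) at an approximate jump point, which is determined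
   up to the change to (u^-, u^+, -nu); the representative with u^- < u^+ is
   the one used, so that nu points to the side of the larger trace. *)
Definition is_jump (R : realType) (n : nat) (u : 'rV[R]_n -> R)
    (x : 'rV[R]_n) (j : R * R * 'rV[R]_n) : Prop :=
  let: (up, um, nu) := j in
  [/\ um < up, enorm nu = 1,
      approx_lim u [set y | 0 < dot (y - x) nu] x up &
      approx_lim u [set y | dot (y - x) nu < 0] x um].

Definition jump_triple (R : realType) (n : nat) (u : 'rV[R]_n -> R)
    (x : 'rV[R]_n) : R * R * 'rV[R]_n := xget (0, 0, 0) (is_jump u x).

Definition jump (R : realType) (n : nat) (u : 'rV[R]_n -> R)
  (x : 'rV[R]_n) : R := (jump_triple u x).1.1 - (jump_triple u x).1.2.

Definition jump_normal (R : realType) (n : nat) (u : 'rV[R]_n -> R)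
  (x : 'rV[R]_n) : 'rV[R]_n := (jump_triple u x).2.

Definition partial (R : realType) (n : nat) (i : 'I_n) (phi : 'rV[R]_n -> R) :
  'rV[R]_n -> R := fun x => 'D_(delta_mx 0 i) phi x.

Definition smooth (R : realType) (n : nat) (phi : 'rV[R]_n -> R) : Prop :=
  forall s : seq 'I_n, let psi := foldr (@partial R n) phi s in
    continuous psi /\ forall i x, derivable psi x (delta_mx 0 i).

Definition test_fun (R : realType) (n : nat) (U : set 'rV[R]_n)
    (phi : 'rV[R]_n -> R) : Prop :=
  smooth phi /\
  exists K : set 'rV[R]_n,
    [/\ compact K, K `<=` U & forall x, ~ K x -> phi x = 0].

(* Integral with respect to a signed measure, through its Jordan
   decomposition *)
Definition charge_integral d (T : measurableType d) (R : realType)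
    (nu : {charge set T -> \bar R}) (f : T -> R) : R :=
  let P := cid (Hahn_decomposition nu) in
  let N := cid (projT2 P) in
  \int[jordan_pos (projT2 N)]_x f x - \int[jordan_neg (projT2 N)]_x f x.

(* The signed measures mu i represent the distributional partial derivatives
   of u in U.  They live on R^n, but only their restriction to U matters. *)
Definition distr_deriv (R : realType) (n : nat) (U : set 'rV[R]_n)
    (u : 'rV[R]_n -> R)
    (mu : 'I_n -> {charge set (borelT 'rV[R]_n) -> \bar R}) : Prop :=
  forall phi i, test_fun U phi ->
    \int[@leb R n]_(x in U) (u x * partial i phi x) =
      - charge_integral (mu i) phi.

(* Du = Da + Ds is the Lebesgue decomposition of the distributional derivative
   with respect to the Lebesgue measure, and the last clause says that the
   Cantor part, which is the restriction of Ds to the complement of disc_set u,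
   vanishes. *)
Definition SBV (R : realType) (n : nat) (U : set 'rV[R]_n)
    (u : 'rV[R]_n -> R) : Prop :=
  L1 U u /\
  exists Da Ds : 'I_n -> {charge set (borelT 'rV[R]_n) -> \bar R},
    [/\ distr_deriv U u (fun i => cadd (Da i) (Ds i)),
        forall i, Da i `<<
          (@leb_outer R n : set (borelT 'rV[R]_n) -> \bar R),
        exists N : set (borelT 'rV[R]_n),
          [/\ measurable N, leb_outer N = 0%E &
            forall i B, measurable B -> B `<=` ~` N -> Ds i B = 0%E] &
        forall i (B : set (borelT 'rV[R]_n)), measurable B ->
          B `<=` U `\` disc_set u -> Ds i B = 0%E].

Definition truncation (R : realType) (n m : nat) (u : 'rV[R]_n -> R) :
  'rV[R]_n -> R := fun x => Num.max (Num.min (u x) m%:R) (- m%:R).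

Definition GSBV (R : realType) (n : nat) (U : set 'rV[R]_n)
    (u : 'rV[R]_n -> R) : Prop :=
  L1 U u /\ forall m : nat, SBV U (truncation m u).

Definition GSBV2 (R : realType) (n : nat) (U : set 'rV[R]_n)
    (u : 'rV[R]_n -> R) : Prop :=
  [/\ GSBV U u,
      forall i, measurable_fun (U : set (lebT R n))
        (fun x => approx_grad u x 0 i),
      (\int[@leb R n]_(x in U) (enorm (approx_grad u x) ^+ 2)%:E < +oo)%E &
      (haus_outer n.-1 (disc_set u `&` U) < +oo)%E].

(* Near each boundary point, U is the epigraph in some direction nu of a
   Lipschitz function defined on the hyperplane orthogonal to nu (and extended
   to R^n). *)
Definition lipschitz_boundary (R : realType) (n : nat) (U : set 'rV[R]_n) :
    Prop :=
  forall x, (closure U `\` interior U) x ->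
    exists (r : R) (nu : 'rV[R]_n) (gamma : 'rV[R]_n -> R),
      [/\ 0 < r, enorm nu = 1, lipschitz gamma &
        forall y, eball x r y ->
          (U y <-> gamma (y - dot y nu *: nu) < dot y nu)].

Definition cube (R : realType) (n : nat) (r : R) : set 'rV[R]_n :=
  [set x | forall j, - (r / 2) < x 0 j < r / 2].

Definition perforated (R : realType) (n : nat) : set 'rV[R]_n :=
  ~` \bigcup_(i in [set: 'rV[int]_n])
       [set map_mx intr i + y | y in closure (@cube R n (1 / 2))].

Definition dilation (R : realType) (n : nat) (e : R) (A : set 'rV[R]_n) :
  set 'rV[R]_n := [set e *: x | x in A].

Definition F_energy (R : realType) (n : nat) (beta : R -> R) (e : R)
    (u : 'rV[R]_n -> R) (U : set 'rV[R]_n) : \bar R :=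
  let eP := dilation e (@perforated R n) in
  if `[< GSBV2 U u >] then
    (\int[@leb R n]_(x in U) (enorm (approx_grad u x) ^+ 2)%:E
     + haus_outer n.-1 (disc_set u `&` (U `&` eP))
     + (beta e)%:E * haus_outer n.-1 (disc_set u `&` (U `\` eP)))%E
  else +oo%E.

(* Convergence in Omega `&` eP along eps of a sequence of functions of
   L^1(Omega) *)
Definition perforated_cvg (R : realType) (n : nat) (Omega : set 'rV[R]_n)
    (eps : R^nat) (u_ : nat -> 'rV[R]_n -> R) (u : 'rV[R]_n -> R) : Prop :=
  (forall k, L1 Omega (u_ k)) /\
  exists v_ : nat -> 'rV[R]_n -> R,
    [/\ forall k, L1 Omega (v_ k),
        forall k, ae_eq (@leb R n)
          (Omega `&` dilation (eps k) (@perforated R n)) (v_ k) (u_ k) &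
        (fun k => \int[@leb R n]_(x in Omega) `|v_ k x - u x|%:E)%E
          @ \oo --> 0%E].

Definition F_lower (R : realType) (n : nat) (Omega : set 'rV[R]_n)
    (beta : R -> R) (eps : R^nat) (u : 'rV[R]_n -> R) (U : set 'rV[R]_n) :
    \bar R :=
  ereal_inf [set limn_einf (fun k => F_energy beta (eps k) (u_ k) U) |
    u_ in [set u_ : nat -> 'rV[R]_n -> R | perforated_cvg Omega eps u_ u]].

Definition F_upper (R : realType) (n : nat) (Omega : set 'rV[R]_n)
    (beta : R -> R) (eps : R^nat) (u : 'rV[R]_n -> R) (U : set 'rV[R]_n) :
    \bar R :=
  ereal_inf [set limn_esup (fun k => F_energy beta (eps k) (u_ k) U) |
    u_ in [set u_ : nat -> 'rV[R]_n -> R | perforated_cvg Omega eps u_ u]].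

Definition F_hom (R : realType) (n : nat) (f : 'rV[R]_n -> R)
    (g : R * 'rV[R]_n -> R) (u : 'rV[R]_n -> R) (U : set 'rV[R]_n) : \bar R :=
  (\int[@leb R n]_(x in U) (f (approx_grad u x))%:E
   + \int[@haus R n n.-1]_(x in disc_set u `&` U)
       (g (jump u x, jump_normal u x))%:E)%E.

(* R x S^{n-1} *)
Definition jump_directions (R : realType) (n : nat) : set (R * 'rV[R]_n) :=
  [set p | enorm p.2 = 1].

Definition homogenized_integrands (R : realType) (n : nat)
    (Omega : set 'rV[R]_n) (beta : R -> R) (eps : R^nat)
    (f : 'rV[R]_n -> R) (g : R * 'rV[R]_n -> R) : Prop :=
  [/\ forall xi, 0 <= f xi,
      convex_function setT f,
      forall p, jump_directions p -> 0 <= g p,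
      measurable_fun (@jump_directions R n : set (borelT (R * 'rV[R]_n)%type))
        (g : borelT (R * 'rV[R]_n)%type -> R) &
      forall u, GSBV2 Omega u -> forall U, open U -> U `<=` Omega ->
        F_lower Omega beta eps u U = F_hom f g u U /\
        F_upper Omega beta eps u U = F_hom f g u U].

(* Main.v *)
Require Import Defs.
From HB Require Import structures.
From mathcomp Require Import all_boot all_order all_algebra.
From mathcomp Require Import all_classical all_reals all_analysis.
From mathcomp Require Import measurable_realfun finmap ring lra zify.

Set Implicit Arguments.
Unset Strict Implicit.
Unset Printing Implicit Defensive.

Import Order.TTheory GRing.Theory Num.Theory.
Import numFieldNormedType.Exports.

Local Open Scope classical_set_scope.
Local Open Scope ring_scope.

(* Test the homogenization formula with u = xi . x on a cube U inside Omega; as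
   Omega is bounded, small xi give |u| < 1 and truncations are harmless.  The
   constant sequence gives f_hom(xi) <= |xi|^2.  For the converse let u_k be a
   competitor, a its approximate gradient, w = u_k - xi . x and b = a - xi.
   Since |a|^2 = |xi|^2 + 2 b . xi + |b|^2, it suffices to bound the integral of
   phi b . xi from below, phi being a cutoff, by the available terms |b|^2,
   H(S) outside the holes and beta H(S) inside.  Write xi = zeta + kappa, both
   divergence free, where kappa is supported in small cells around the holes and
   zeta vanishes on the holes.  Replacing w by a bounded function G(w) in the
   integration by parts against phi zeta (resp. phi kappa) costs only the
   oscillation of G times H(S), plus the integral of |1 - G'(w)| |b|.  Off the
   holes G saturates at a small height delta, and w is small in L1.  In a cell
   of size eps nothing controls w on the hole, but G can saturate at height
   K |xi| eps around a suitable constant, the defect being controlled by a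
   Poincare inequality; the resulting cost C |xi|^2 eps H(S) is dominated by
   beta H(S) as soon as C |xi|^2 < l / 2, because beta / eps tends to l. *)

(** Inside the holes the weight is of order e, so a jump there may only be charged e times a small
    constant, however large its amplitude. A profile saturating at height lam charges about lam |xi|
    per unit of jump set, hence in a cell lam must be of order |xi| e, and the real difficulty is
    the gradient lost by saturating so early. The lost part is at most 3 |b| Theta((w - c) / lam),
    where Theta(s) = s^2 / (1 + s^2). Tested against a field of size |xi|, it costs by Young's
    inequality |b|^2 / 16 plus a multiple of |xi|^2 times the integral of Theta. For lam = M r on a
    cube of half-side r, that integral is at most C / M^2 times the integral of |b|^2, plus C r
    H(S). With M = K |xi| the powers of |xi| cancel in the first term, which a large K makes
    absorbable, and the second is again of order |xi|^2 e H(S). The energy contains approximate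
    gradients while integration by parts concerns distributional ones: they are identified almost
    everywhere, for truncations of u, by an approximate differentiability theorem of
    Calderon-Zygmund type. *)

Lemma compact_cover_nat (T : ptopologicalType) (K : set T) (U : nat -> set T) :
  compact K -> (forall k, open (U k)) -> K `<=` \bigcup_k U k ->
  exists N, K `<=` \bigcup_(k < N) U k.
Proof.
move=> cK oU KU; move: cK; rewrite compact_cover.
move=> /(_ nat setT U); case=> [//|//|D _ KD].
exists (\max_(k <- D) k).+1 => x /KD[k /= kD Ukx]; exists k => //=.
by rewrite ltnS; apply: leq_bigmax_seq.
Qed.

(** * Lebesgue outer measure *)

Section euclidean.
Context (R : realType) (n : nat).
Implicit Types (x y v : 'rV[R]_n) (r s : R) (A B : set 'rV[R]_n).

(** Balls of the library norm are open cubes. The local arguments are carried out on them, because a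
    cube is stable under axis-parallel moves between its points; Euclidean balls enter only through
    inclusions. *)
Lemma ball_rVP x r y : ball x r y <-> 0 < r /\ forall i, `|x 0 i - y 0 i| < r.
Proof.
split=> [[r0 xy]|[r0 xy]]; first by split => // i; exact: xy.
by split=> // i j; rewrite ord1; exact: xy.
Qed.

Lemma rV_norm_lt x r : `|x| < r <-> 0 < r /\ forall i, `|x 0 i| < r.
Proof.
have -> : `|x| < r <-> ball 0 r x.
  by rewrite -ball_normE /ball_ /= sub0r normrN.
by rewrite ball_rVP; split=> -[? H]; split=> // i; move: (H i); rewrite mxE sub0r normrN.
Qed.

Lemma rV_norm_le x r : 0 <= r -> (forall i, `|x 0 i| <= r) -> `|x| <= r.
Proof.
move=> r0 H; apply/ler_addgt0Pr => e e0; apply/ltW/rV_norm_lt.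
by split=> [|i]; [rewrite ltr_wpDl|rewrite (le_lt_trans (H i))// ltrDl].
Qed.

Lemma rV_coord_le x i : `|x 0 i| <= `|x|.
Proof.
apply/ler_addgt0Pr => e e0.
have /rV_norm_lt[_ /(_ i)/ltW//] : `|x| < `|x| + e by rewrite ltrDl.
Qed.

Lemma ball_box x r : 0 < r -> ball x r = box (x - const_mx r, x + const_mx r).
Proof.
move=> r0; apply/seteqP; split=> y.
  by move=> /ball_rVP[_ H] i; move: (H i); rewrite ltr_distl !mxE /=; lra.
move=> H; apply/ball_rVP; split=> // i; move: (H i).
by rewrite ltr_distl !mxE /=; lra.
Qed.

Lemma dotC x y : dot x y = dot y x.
Proof. by apply: eq_bigr => i _; rewrite mulrC. Qed.

Lemma dotDl x y v : dot (x + y) v = dot x v + dot y v.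
Proof. by rewrite /dot -big_split; apply: eq_bigr => i _; rewrite mxE mulrDl. Qed.

Lemma dotZl (a : R) x v : dot (a *: x) v = a * dot x v.
Proof. by rewrite /dot mulr_sumr; apply: eq_bigr => i _; rewrite mxE mulrA. Qed.

Lemma dotNl x v : dot (- x) v = - dot x v.
Proof. by rewrite -scaleN1r dotZl mulN1r. Qed.

Lemma dotBl x y v : dot (x - y) v = dot x v - dot y v.
Proof. by rewrite dotDl dotNl. Qed.

Lemma dotDr x y v : dot v (x + y) = dot v x + dot v y.
Proof. by rewrite dotC dotDl !(dotC v). Qed.

Lemma dotZr (a : R) x v : dot v (a *: x) = a * dot v x.
Proof. by rewrite dotC dotZl (dotC v). Qed.

Lemma dotBr x y v : dot v (x - y) = dot v x - dot v y.
Proof. by rewrite dotC dotBl !(dotC v). Qed.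

Lemma dot_ge0 x : 0 <= dot x x.
Proof. by apply: sumr_ge0 => i _; rewrite -expr2 sqr_ge0. Qed.

Lemma enorm_ge0 x : 0 <= enorm x. Proof. exact: sqrtr_ge0. Qed.

Lemma enorm_sqr x : enorm x ^+ 2 = dot x x.
Proof. by rewrite sqr_sqrtr// dot_ge0. Qed.

Lemma norm_le_enorm x : `|x| <= enorm x.
Proof.
apply: rV_norm_le => [|i]; first exact: enorm_ge0.
rewrite -ler_sqr ?nnegrE ?enorm_ge0// enorm_sqr /dot (bigD1 i)//=.
rewrite real_normK ?num_real// -expr2 lerDl.
by apply: sumr_ge0 => j _; rewrite -expr2 sqr_ge0.
Qed.

Lemma enorm_sqr_le x : enorm x ^+ 2 <= n%:R * `|x| ^+ 2.
Proof.
rewrite enorm_sqr /dot -[in X in _ <= X * _](card_ord n) mulr_natl -sumr_const.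
apply: ler_sum => i _; rewrite -expr2 -real_normK ?num_real//.
by rewrite lerXn2r ?nnegrE//; exact: rV_coord_le.
Qed.

Lemma enorm_le x : enorm x <= n%:R * `|x|.
Proof.
rewrite -ler_sqr ?nnegrE ?enorm_ge0 ?mulr_ge0//.
apply: (le_trans (enorm_sqr_le _)); rewrite exprMn ler_wpM2r ?sqr_ge0//.
by rewrite -natrX ler_nat; case: (n) => // m; rewrite leq_pmulr.
Qed.

Lemma dot_le x y : `|dot x y| <= n%:R * `|x| * `|y|.
Proof.
rewrite /dot (le_trans (ler_norm_sum _ _ _))//.
rewrite -mulrA mulr_natl -[X in _ *+ X](card_ord n) -sumr_const.
apply: ler_sum => i _; rewrite normrM ler_pM//; exact: rV_coord_le.
Qed.

End euclidean.

Section lebesgue_boxes.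
Context (R : realType) (n : nat).
Implicit Types (x y v : 'rV[R]_n) (r s : R) (A B : set 'rV[R]_n)
  (p : 'rV[R]_n * 'rV[R]_n).
Local Notation L := (@leb_outer R n).

Lemma box_volume_ge0 p : 0 <= box_volume p.
Proof. by apply: prodr_ge0 => i _; rewrite le_max lexx. Qed.

Lemma leb_box_le p : (L (box p) <= (box_volume p)%:E)%E.
Proof.
apply: ereal_inf_lbound; exists (fun k => if k == 0%N then Some p else None).
  by split=> // x px; exists 0%N.
rewrite (nneseries_split 0%N 1%N)/=; last first.
  by move=> k _; case: ifP => //= _; rewrite lee_fin box_volume_ge0.
rewrite eseries0 ?adde0; last by move=> [].
by rewrite big_nat1.
Qed.

Lemma box_volume_ball x r : 0 < r ->
  box_volume (x - const_mx r, x + const_mx r) = (2 * r) ^+ n.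
Proof.
move=> r0; rewrite /box_volume (eq_bigr (fun=> 2 * r)) ?prodr_const ?card_ord//.
by move=> i _; rewrite !mxE /= (_ : _ - _ = 2 * r) ?max_r//; lra.
Qed.

Lemma leb_ball_le x r : 0 < r -> (L (ball x r) <= ((2 * r) ^+ n)%:E)%E.
Proof. by move=> r0; rewrite ball_box// -(box_volume_ball x r0) leb_box_le. Qed.

Definition preshift v A : set 'rV[R]_n := [set y | A (y + v)].

Lemma leb_shift_le A v : (L (preshift v A) <= L A)%E.
Proof.
apply: le_ereal_inf_tmp => _ [F [DF AF] <-].
apply: ereal_inf_lbound.
exists (fun k => omap (fun p => (p.1 - v, p.2 - v)) (F k)).
  split=> // y /= /AF[k _ Fk]; exists k => //.
  by case: (F k) Fk => //= p H i; have := H i; rewrite !mxE; lra.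
apply: eq_eseriesr => k _; case: (F k) => //= p; congr (_%:E).
by apply: eq_bigr => i _; rewrite !mxE; congr (Num.max _ _); ring.
Qed.

Lemma leb_shift A v : L (preshift v A) = L A.
Proof.
apply/eqP; rewrite eq_le leb_shift_le /=.
have := leb_shift_le (preshift v A) (- v); congr (L _ <= _)%E.
by apply/seteqP; split=> y /=; rewrite /preshift/= subrK.
Qed.

(** The indices satisfying [P] lie in a window of length [w] above the smallest of them, which holds
    at most [Num.truncn w + 1] integers. *)
Lemma card_ord_between (N : nat) (P : pred 'I_N) (w : R) :
  (forall i j, P i -> P j -> (j : nat)%:R - (i : nat)%:R < w :> R) ->
  (#|P|)%:R <= Num.max 0 w + 1.
Proof.
move=> H; have [P0|[i0 Pi0]] := set_0Vmem [set i | P i]%SET.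
  rewrite (_ : #|P| = 0%N) ?addr_ge0 ?le_max ?lexx//.
  by rewrite -(cards0 'I_N) -P0 cardsE.
rewrite inE in Pi0.
pose m := [arg min_(i < i0 | P i) (i : nat)].
have [Pm mmin] : P m /\ forall j, P j -> (m <= j)%N.
  by rewrite /m; case: arg_minnP.
have w0 : 0 < w by have := H _ _ Pm Pm; rewrite subrr.
have w0' := ltW w0.
pose K := (Num.truncn w).+1.
have sub (j : 'I_N) : P j -> (j - m < K)%N.
  move=> Pj; rewrite ltnS truncn_ge_nat// natrB ?mmin//.
  exact/ltW/H.
have -> : #|P| = #|(fun j : 'I_N => inord (j - m) : 'I_K) @: P|.
  rewrite card_in_imset// => i j Pi Pj /(congr1 val); rewrite /= !inordK ?sub//.
  move=> ij; apply: val_inj => /=.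
  by rewrite -(subnK (mmin _ Pi)) ij subnK ?mmin.
apply: (@le_trans _ _ K%:R).
  by rewrite ler_nat -[leqRHS]card_ord max_card.
by rewrite /K -natr1 lerD2r max_r// truncn_le.
Qed.

(* A box contains at most prod_i (N len_i / s + 1) points of the grid of mesh
   s / N; comparing with the N ^ n grid points of the cube and letting N tend
   to infinity bounds the total volume of a covering from below. *)
Lemma grid_count (N : nat) (a : 'rV[R]_n) s p : (0 < N)%N -> 0 < s ->
  (#|[pred g : {ffun 'I_n -> 'I_N} |
      [forall i, p.1 0 i < a 0 i + s / N%:R * (g i)%:R < p.2 0 i]]|)%:R <=
  \prod_(i < n) (N%:R / s * Num.max 0 (p.2 0 i - p.1 0 i) + 1).
Proof.
move=> N0 s0.
have sN0 : 0 < s / N%:R by rewrite divr_gt0// ltr0n.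
pose F i := [pred j : 'I_N | p.1 0 i < a 0 i + s / N%:R * (j : nat)%:R < p.2 0 i].
rewrite (_ : #|_| = #|(family F : {pred {ffun 'I_n -> 'I_N}})|); last first.
  apply: eq_card => g; apply/idP/idP => [/forallP H|/familyP H].
    by apply/familyP => i; exact: H.
  by apply/forallP => i; exact: (H i).
rewrite card_family foldrE big_map big_enum/= natr_prod.
apply: ler_prod => i _; rewrite ler0n/=.
apply: (le_trans (card_ord_between (w := N%:R / s * (p.2 0 i - p.1 0 i)) _)).
  move=> j k /= /andP[j1 j2] /andP[k1 k2].
  rewrite -(ltr_pM2l sN0) mulrA (_ : s / N%:R * (N%:R / s) = 1) ?mul1r ?mulrBr.
    by move: j1 k2; lra.
  by rewrite mulrA mulfVK ?divff ?gt_eqF// ltr0n.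
rewrite lerD2r maxr_pMr ?mulr0// ltW// divr_gt0// ltr0n//.
Qed.

Lemma volume_cover (a : 'rV[R]_n) s (D : seq ('rV[R]_n * 'rV[R]_n)) :
  0 < s ->
  (forall x, (forall i, a 0 i <= x 0 i <= a 0 i + s) ->
    exists2 p, p \in D & box p x) ->
  s ^+ n <= \sum_(p <- D) box_volume p.
Proof.
move=> s0 cover.
(* The grid bound is the value at [s / N] of a polynomial whose value at 0 is the total volume, so
   the passage to the limit in [N] is continuity of [P] at 0. *)
pose P : {poly R} :=
  \sum_(p <- D) \prod_(i < n) ('X + (Num.max 0 (p.2 0 i - p.1 0 i))%:P).
have PE t : P.[t] =
    \sum_(p <- D) \prod_(i < n) (t + Num.max 0 (p.2 0 i - p.1 0 i)).
  rewrite /P horner_sum; apply: eq_bigr => p _; rewrite horner_prod.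
  by apply: eq_bigr => i _; rewrite !hornerE.
have Plow N : (0 < N)%N -> s ^+ n <= P.[s / N%:R].
  move=> N0; have N0' : 0 < N%:R :> R by rewrite ltr0n.
  pose pt (g : {ffun 'I_n -> 'I_N}) : 'rV[R]_n :=
    \row_i (a 0 i + s / N%:R * (g i : nat)%:R).
  pose Q p := [pred g : {ffun 'I_n -> 'I_N} |
      [forall i, p.1 0 i < a 0 i + s / N%:R * (g i)%:R < p.2 0 i]].
  have ptc g : exists2 p, p \in D & g \in Q p.
    have [|p pD bp] := cover (pt g).
      move=> i; rewrite mxE lerDl mulr_ge0 ?ler0n ?divr_ge0 ?(ltW s0) ?(ltW N0')//=.
      rewrite ltW// ltrD2l mulrAC ltr_pdivrMr// ltr_pM2l// ltr_nat//.
    by exists p => //; apply/forallP => i; move: (bp i); rewrite mxE.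
  have cnt : (N ^ n)%:R <= \sum_(p <- D) (#|Q p|)%:R :> R.
    rewrite -natr_sum ler_nat.
    have -> : (N ^ n = \sum_(g : {ffun 'I_n -> 'I_N}) 1)%N.
      by rewrite sum1_card card_ffun !card_ord.
    under [leqRHS]eq_bigr do rewrite -sum1_card big_mkcond/=.
    rewrite exchange_big/=; apply: leq_sum => g _.
    have [p pD gp] := ptc g.
    by rewrite (big_rem p pD)/= gp.
  have sNn : 0 < (s / N%:R) ^+ n by rewrite exprn_gt0// divr_gt0.
  have -> : s ^+ n = (s / N%:R) ^+ n * (N ^ n)%:R.
    by rewrite natrX expr_div_n mulfVK// gt_eqF// exprn_gt0.
  apply: (le_trans (ler_wpM2l (ltW sNn) cnt)).
  rewrite PE mulr_sumr; apply: ler_sum => p _.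
  apply: (le_trans (ler_wpM2l (ltW sNn) (grid_count _ _ N0 s0))).
  rewrite -[X in _ ^+ X](card_ord n) -prodr_const -big_split/= le_eqVlt.
  apply/orP; left; apply/eqP/eq_bigr => i _.
  rewrite mulrDr mulr1 addrC mulrA; congr (_ + _).
  by rewrite mulrA mulfVK ?divff ?mul1r ?gt_eqF.
rewrite (_ : \sum_(p <- D) _ = P.[0]); last first.
  rewrite PE; apply: eq_bigr => p _.
  by apply: eq_bigr => i _; rewrite add0r.
have Pc : P.[s / k.+1%:R] @[k --> \oo] --> P.[0].
  apply: (cvg_comp (fun k => s / k.+1%:R) (horner P) _ (@continuous_horner _ P 0)).
  rewrite (_ : nbhs (0 : R) = nbhs (s * 0)); last by rewrite mulr0.
  by apply: cvgMl_tmp; exact: cvg_harmonic.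
apply: (cvgr_to_ge Pc); apply: nearW => k; exact: Plow.
Qed.

Lemma open_box p : open (box p).
Proof.
rewrite openE => x px; apply: (@filter_forall _ _ (fun i y => p.1 0 i < y 0 i < p.2 0 i) (nbhs x)) => i.
have oI : open `]p.1 0 i, p.2 0 i[%classic by exact: itv_open.
have xI : nbhs (x 0 i) `]p.1 0 i, p.2 0 i[%classic.
  by apply: open_nbhs_nbhs; split => //=; rewrite in_itv/= px.
have : \forall y \near (x : 'rV[R]_n), `]p.1 0 i, p.2 0 i[%classic ((y : 'rV[R]_n) 0 i).
  exact: (@coord_continuous R 1 n 0 i x _ xI).
by apply: filterS => y; rewrite /= in_itv.
Qed.

(** The closed cube is compact and the boxes are open, so a countable cover reduces to a finite one,
    to which [volume_cover] applies. *)
Lemma leb_ccube_ge (a : 'rV[R]_n) s : 0 < s ->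
  ((s ^+ n)%:E <= L [set x : 'rV[R]_n | forall i, a 0%R i <= x 0%R i <= a 0%R i + s]%R)%E.
Proof.
move=> s0; apply: le_ereal_inf_tmp => _ [F [_ AF] <-].
set A := (X in X `<=` _) in AF.
have cA : compact A.
  have := @rV_compact R n (fun i => `[a 0 i, a 0 i + s]%classic)
    (fun=> @segment_compact _ _ _).
  by congr compact; apply/seteqP; split=> x /= H i; move: (H i); rewrite /= in_itv.
have [k||N cov] := @compact_cover_nat _ A (fun k => oapp (@box R n) set0 (F k)) cA.
- by case: (F k) => [p|]; [exact: open_box|exact: open0].
- exact: AF.
apply: (@le_trans _ _ (\sum_(0 <= k < N) (oapp (@box_volume R n) 0 (F k))%:E)%E).
  rewrite sumEFin lee_fin.
  have := @volume_cover a s (pmap F (iota 0 N)) s0.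
  rewrite big_pmap /index_iota subn0.
  rewrite (eq_bigr (fun k => oapp (@box_volume R n) 0 (F k))); last first.
    by move=> k _; case: (F k).
  apply=> x /cov[k /= kN Fk].
  case Fkp : (F k) Fk => [p|]//= px; exists p => //.
  by rewrite mem_pmap; apply/mapP; exists k => //; rewrite mem_iota.
apply: nneseries_lim_ge => k _ _.
by rewrite lee_fin; case: (F k) => //= p; exact: box_volume_ge0.
Qed.

Lemma leb_ball x r : 0 < r -> L (ball x r) = ((2 * r) ^+ n)%:E.
Proof.
move=> r0; apply/eqP; rewrite eq_le leb_ball_le//=.
(* The open cube contains closed cubes of side [2 * r - r / (k + 1)]; the lower bound passes to the
   limit. *)
have lim1 : (2 * r - r * k.+1%:R^-1) ^+ n @[k --> \oo] --> (2 * r) ^+ n.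
  apply: (cvg_comp (fun k => 2 * r - r * k.+1%:R^-1) (fun t : R => t ^+ n)
    _ (@exprn_continuous _ n _)).
  rewrite (_ : nbhs (2 * r) = nbhs (2 * r - r * 0)); last by rewrite mulr0 subr0.
  apply: cvgB; first exact: cvg_cst.
  by apply: cvgMl_tmp; exact: cvg_harmonic.
have lt1 k : 0 < (k.+1%:R^-1 : R) <= 1 by rewrite invr_gt0 ltr0n invf_le1 ?ltr0n// ler1n.
have sub k : (((2 * r - r * k.+1%:R^-1) ^+ n)%:E <= L (ball x r))%E.
  have /andP[h0 h1] := lt1 k; set h := k.+1%:R^-1 in h0 h1 *.
  have s0 : 0 < 2 * r - r * h by nra.
  apply: (le_trans (leb_ccube_ge (x - const_mx (r - r * h / 2)) s0)).
  apply: le_outer_measure => y /= Hy; apply/ball_rVP; split=> // i.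
  by have := Hy i; rewrite !mxE ltr_distl; nra.
have := leb_ball_le x r0; move: sub.
case: (L (ball x r)) => [w sub _|_ _|sub _]; last by have := sub 0%N.
  rewrite lee_fin; apply: (cvgr_to_le lim1); apply: nearW => k.
  by have := sub k; rewrite lee_fin.
exact: leey.
Qed.

Lemma leb_ball_fin x r : (L (ball x r) < +oo)%E.
Proof.
have [r0|r0] := ltP 0 r; first by rewrite leb_ball// ltry.
rewrite (_ : ball x r = set0) ?outer_measure0//.
by apply/seteqP; split=> // y /ball_rVP[]; rewrite ltNge r0.
Qed.

Lemma leb_hyperplane i (a : R) : L [set x : 'rV[R]_n | x 0 i = a] = 0.
Proof.
have Hk (k : nat) : L [set x : 'rV[R]_n | x 0 i = a /\ forall j, `|x 0 j| < k.+1%:R] = 0.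
  apply/eqP; rewrite eq_le outer_measure_ge0 andbT.
  apply/lee_addgt0Pr => e e0; rewrite add0e.
  pose c := (2 * k.+1%:R) ^+ n.-1 : R.
  have c0 : 0 < c by rewrite exprn_gt0// mulr_gt0.
  pose d := e / (2 * c).
  have d0 : 0 < d by rewrite divr_gt0// mulr_gt0.
  pose p : 'rV[R]_n * 'rV[R]_n :=
    (\row_j (if j == i then a - d else - k.+1%:R),
     \row_j (if j == i then a + d else k.+1%:R)).
  apply: (@le_trans _ _ (L (box p))).
    apply: le_outer_measure => x [xi xk] j; rewrite !mxE.
    have := xk j; rewrite ltr_norml; case: eqVneq => [->|] //.
    by rewrite xi => _; lra.
  apply: (le_trans (leb_box_le _)); rewrite lee_fin /box_volume (bigD1 i)//=.
  rewrite !mxE eqxx (_ : a + d - _ = 2 * d); last by ring.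
  rewrite max_r; last by rewrite mulr_ge0// ltW.
  rewrite (eq_bigr (fun=> 2 * k.+1%:R)); last first.
    have k0 : 0 < k.+1%:R :> R by [].
    by move=> j ji; rewrite !mxE (negbTE ji) max_r; lra.
  rewrite prodr_const cardC1 card_ord -/c /d le_eqVlt; apply/orP; left.
  by apply/eqP; field; rewrite gt_eqF.
rewrite (_ : [set x : 'rV[R]_n | _] =
    \bigcup_k [set x : 'rV[R]_n | x 0 i = a /\ forall j, `|x 0 j| < k.+1%:R]); last first.
  apply/seteqP; split=> [x /= xi|x [k _ []]//].
  exists (Num.truncn `|x|) => //; split=> // j.
  by apply: (le_lt_trans (rV_coord_le x j)); rewrite truncnS_gt.
apply/eqP; rewrite eq_le outer_measure_ge0 andbT.
apply: (le_trans (outer_measure_sigma_subadditive L _)).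
by rewrite eseries0// => k _ _; exact: Hk.
Qed.

Lemma box_volume_split i (a : R) p :
  box_volume (p.1, \row_j (if j == i then Num.min a (p.2 0 j) else p.2 0 j)) +
  box_volume (\row_j (if j == i then Num.max a (p.1 0 j) else p.1 0 j), p.2) <=
  box_volume p.
Proof.
have E q : box_volume q = Num.max 0 (q.2 0 i - q.1 0 i) *
    \prod_(j < n | j != i) Num.max 0 (q.2 0 j - q.1 0 j).
  by rewrite /box_volume (bigD1 i).
rewrite !E/= !mxE eqxx.
rewrite (eq_bigr (fun j => Num.max 0 (p.2 0 j - p.1 0 j))); last first.
  by move=> j ji; rewrite !mxE (negbTE ji).
rewrite [X in _ + _ * X](eq_bigr (fun j => Num.max 0 (p.2 0 j - p.1 0 j))); last first.
  by move=> j ji; rewrite !mxE (negbTE ji).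
rewrite -mulrDl ler_wpM2r//.
  by apply: prodr_ge0 => j _; rewrite le_max lexx.
set u := p.2 0 i; set l := p.1 0 i.
rewrite /Num.min /Num.max; repeat case: ifP; lra.
Qed.

(** Cutting every box of a cover of [X] along the hyperplane gives covers of the two open halves
    without increasing the total volume. The hyperplane itself is missed by the open boxes, but it
    is null. *)
Lemma caratheodory_halfspace i (a : R) :
  L.-caratheodory [set x : 'rV[R]_n | x 0 i < a].
Proof.
apply: le_caratheodory_measurable => X.
apply: le_ereal_inf_tmp => _ [F [_ XF] <-].
pose lo p : 'rV[R]_n * 'rV[R]_n :=
  (p.1, \row_j (if j == i then Num.min a (p.2 0 j) else p.2 0 j)).
pose hi p : 'rV[R]_n * 'rV[R]_n :=
  (\row_j (if j == i then Num.max a (p.1 0 j) else p.1 0 j), p.2).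
have Lge : (L (X `&` ~` [set x : 'rV[R]_n | x 0%R i < a]%R) <=
    L (X `&` [set x : 'rV[R]_n | a < x 0 i]%R))%E.
  rewrite -[leRHS]adde0 -(leb_hyperplane i a).
  apply: le_trans (outer_measureU2 _ _ _).
  apply: le_outer_measure => x [Xx /negP]; rewrite -leNgt le_eqVlt.
  by move=> /predU1P[->|]; [right|left].
apply: (le_trans (leeD (lexx _) Lge)).
have H1 : (L (X `&` [set x : 'rV[R]_n | x 0%R i < a]%R) <=
    \sum_(k <oo) (oapp (@box_volume R n) 0 (omap lo (F k)))%:E)%E.
  apply: ereal_inf_lbound; exists (fun k => omap lo (F k)) => //; split=> //.
  move=> x [/XF[k _ Fk] xa]; exists k => //.
  case: (F k) Fk => //= p xp j; rewrite mxE; have := xp j.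
  by case: eqVneq => [->|]// /andP[-> /=]; rewrite lt_min => ->; rewrite andbT.
have H2 : (L (X `&` [set x : 'rV[R]_n | a < x 0%R i]%R) <=
    \sum_(k <oo) (oapp (@box_volume R n) 0 (omap hi (F k)))%:E)%E.
  apply: ereal_inf_lbound; exists (fun k => omap hi (F k)) => //; split=> //.
  move=> x [/XF[k _ Fk] xa]; exists k => //.
  case: (F k) Fk => //= p xp j; rewrite mxE; have := xp j.
  by case: eqVneq => [->|]// /andP[+ ->]; rewrite gt_max => ->; rewrite !andbT.
apply: (le_trans (leeD H1 H2)).
rewrite -nneseriesD; last 2 first.
- by move=> k _ _; case: (F k) => //= p; rewrite lee_fin box_volume_ge0.
- by move=> k _ _; case: (F k) => //= p; rewrite lee_fin box_volume_ge0.
apply: lee_nneseries => k _.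
  by case: (F k) => //= [p|] _; rewrite ?adde0// lee_fin addr_ge0 ?box_volume_ge0.
by case: (F k) => [p|]/=; rewrite ?adde0// lee_fin box_volume_split.
Qed.

End lebesgue_boxes.

Section lebesgue_open.
Context (R : realType) (n : nat).
Implicit Types (x y v : 'rV[R]_n) (r s : R) (A B : set 'rV[R]_n).
Local Notation L := (@leb_outer R n).
Local Notation T := (lebT R n).

Lemma measurable_coord_lt i (a : R) :
  measurable ([set x : 'rV[R]_n | x 0 i < a] : set T).
Proof. exact: caratheodory_halfspace. Qed.

Lemma measurable_coord_gt i (a : R) :
  measurable ([set x : 'rV[R]_n | a < x 0 i] : set T).
Proof.
rewrite (_ : [set x : 'rV[R]_n | _] =
    \bigcup_k ~` [set x : 'rV[R]_n | x 0 i < a + k.+1%:R^-1]).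
  apply: bigcupT_measurable => k; apply: measurableC.
  exact: measurable_coord_lt.
apply/seteqP; split=> [x /= ax|x [k _ /negP]]; last first.
  by rewrite -leNgt; apply: lt_le_trans; rewrite ltrDl invr_gt0.
have d0 : 0 < (x 0 i - a)^-1 by rewrite invr_gt0 subr_gt0.
exists (Num.truncn (x 0 i - a)^-1) => //; apply/negP; rewrite -leNgt -lerBrDl.
by rewrite invf_ple ?posrE ?subr_gt0// ltW// truncnS_gt.
Qed.

Lemma measurable_ball_leb x r : measurable (ball x r : set T).
Proof.
have [r0|r0] := ltP 0 r; last first.
  rewrite (_ : ball x r = set0); first exact: measurable0.
  by apply/seteqP; split=> // y /ball_rVP[]; rewrite ltNge r0.
rewrite (_ : ball x r = \bigcap_(i in [set: 'I_n])
    ([set y : 'rV[R]_n | x 0 i - r < y 0 i] `&`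
     [set y : 'rV[R]_n | y 0 i < x 0 i + r])).
  apply: fin_bigcap_measurable; first exact: finite_finset.
  move=> i _; apply: measurableI; first exact: measurable_coord_gt.
  exact: measurable_coord_lt.
apply/seteqP; split=> [y /ball_rVP[_ H] i _|y H] /=.
  by move: (H i); rewrite ltr_distl; lra.
by apply/ball_rVP; split=> // i; have /= := H i I; rewrite ltr_distl; lra.
Qed.

Lemma open_bigcup_ball A : open A -> A = \bigcup_(k in
  [set k : 'rV[rat]_n * nat |
    ball (map_mx ratr k.1 : 'rV[R]_n) k.2.+1%:R^-1 `<=` A])
  ball (map_mx ratr k.1 : 'rV[R]_n) k.2.+1%:R^-1.
Proof.
move=> oA; apply/seteqP; split=> [x Ax|x [k Ak]]; last exact: Ak.
have [e e0 xeA] : exists2 e : R, 0 < e & ball x e `<=` A.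
  by have /nbhs_ballP[e e0 H] := open_nbhs_nbhs (conj oA Ax); exists e.
pose k := Num.truncn (2 / e).
have k0 : 0 < k.+1%:R^-1 :> R by rewrite invr_gt0.
have ke : 2 * k.+1%:R^-1 < e.
  by rewrite ltr_pdivrMr// mulrC -ltr_pdivrMr// truncnS_gt.
have /choice[q Hq] : forall i, exists q : rat, `|x 0 i - ratr q| < k.+1%:R^-1.
  move=> i; have lt : x 0 i - k.+1%:R^-1 < x 0 i + k.+1%:R^-1.
    by rewrite ltrD2l gtrN.
  have [q] := rat_in_itvoo lt; rewrite in_itv/= => Hq; exists q.
  by rewrite distrC ltr_distl.
exists (\row_i q i, k) => /=; last first.
  by apply/ball_rVP; split=> // i; rewrite !mxE distrC.
move=> y /ball_rVP[_ Hy]; apply: xeA; apply/ball_rVP; split=> // i.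
have := Hy i; have := Hq i; rewrite !mxE => H1 H2.
rewrite (le_lt_trans (ler_distD (ratr (q i)) _ _))//.
apply: (lt_trans (ltrD H1 H2)); rewrite -mulr2n -[X in X < _]mulr_natl; exact: ke.
Qed.

Lemma open_measurable_leb A : open A -> measurable (A : set T).
Proof.
move=> /open_bigcup_ball ->; rewrite bigcup_mkcond.
apply: countable_bigcupT_measurable; first exact: countableP.
by move=> k; case: ifP => _; [exact: measurable_ball_leb|exact: measurable0].
Qed.

Lemma closed_measurable_leb A : closed A -> measurable (A : set T).
Proof.
by move=> cA; rewrite -(setCK A); apply/measurableC/open_measurable_leb/closed_openC.
Qed.

Lemma borel_measurable_leb (A : set (borelT 'rV[R]_n)) :
  measurable A -> measurable (A : set T).
Proof.
apply: smallest_sub => [|B]; last exact: open_measurable_leb.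
exact: (sigma_algebra_measurable T).
Qed.

Lemma null_measurable_leb A : L A = 0 -> measurable (A : set T).
Proof.
move=> A0; apply: le_caratheodory_measurable => X.
apply: (@le_trans _ _ (0 + L X)%E); last by rewrite add0e.
apply: leeD; last by apply: le_outer_measure; exact: subIsetl.
by rewrite -A0; apply: le_outer_measure; exact: subIsetr.
Qed.

Lemma ae_leb_null (P : set 'rV[R]_n) :
  {ae @leb R n, forall x, P x} -> L (~` P) = 0.
Proof.
move=> [N [mN N0 PN]]; apply/eqP; rewrite eq_le outer_measure_ge0 andbT.
by rewrite -N0 le_outer_measure.
Qed.

End lebesgue_open.

(** The derivative of a product is a sum of products. With this closure, infinite differentiability
    is checked on generators only, whose derivatives may be sums of generators. *)
Inductive sum_closure (R : realType) (T : Type) (A : set (T -> R)) :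
  set (T -> R) :=
| sum_in f : A f -> sum_closure A f
| sum_add f g : sum_closure A f -> sum_closure A g ->
    sum_closure A (fun x => f x + g x).

(** * Test functions *)

Section smooth_one_variable.
Context (R : realType).
Implicit Types f g h : R -> R.

(* Infinite differentiability, coinductively: [f] lies in a set of functions
   that is stable under taking derivatives. *)
Definition smooth1 f := exists S : set (R -> R),
  S f /\ forall g, S g -> exists2 g', S g' & forall x, is_derive (x : R) (1 : R) g (g' x).

Lemma smooth1_deriv f : smooth1 f ->
  exists2 g, smooth1 g & forall x, is_derive (x : R) (1 : R) f (g x).
Proof. by move=> [S [Sf HS]]; have [g Sg fg] := HS f Sf; exists g => //; exists S. Qed.

Lemma smooth1_coind (S : set (R -> R)) :
  (forall g, S g -> exists2 g', S g' & forall x, is_derive (x : R) (1 : R) g (g' x)) ->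
  forall f, S f -> smooth1 f.
Proof. by move=> HS f Sf; exists S. Qed.

Lemma smooth1_sum (A : set (R -> R)) :
  (forall u, A u -> exists2 u', sum_closure A u' &
    forall x, is_derive (x : R) (1 : R) u (u' x)) ->
  forall u, sum_closure A u -> smooth1 u.
Proof.
move=> HA; apply: smooth1_coind => u; elim=> [{}u /HA//|{}u v _ [u' Hu du] _ [v' Hv dv]].
exists (fun x => u' x + v' x); first exact: sum_add.
by move=> x; exact: is_deriveD.
Qed.

Lemma smooth1M f g : smooth1 f -> smooth1 g -> smooth1 (fun x => f x * g x).
Proof.
pose A := [set u | exists v w, [/\ smooth1 v, smooth1 w & u = fun x => v x * w x]].
move=> sf sg; apply: (@smooth1_sum A); last by apply: sum_in; exists f, g.
move=> _ [v [w [sv sw ->]]].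
have [v' sv' dv] := smooth1_deriv sv; have [w' sw' dw] := smooth1_deriv sw.
exists (fun x => v' x * w x + v x * w' x).
  by apply: sum_add; apply: sum_in; [exists v', w|exists v, w'].
move=> x; have := is_deriveM (dv x) (dw x).
by rewrite /GRing.scale/= addrC (mulrC (w x)).
Qed.

Lemma smooth1_cst (c : R) : smooth1 (fun=> c).
Proof.
apply: (@smooth1_coind [set f | exists c, f = fun=> c]); last by exists c.
by move=> _ [{}c ->]; exists (fun=> 0); [exists 0|move=> x; exact: is_derive_cst].
Qed.

Lemma smooth1D f g : smooth1 f -> smooth1 g -> smooth1 (fun x => f x + g x).
Proof.
move=> sf sg; apply: (@smooth1_sum smooth1); last by apply: sum_add; exact: sum_in.
by move=> u /smooth1_deriv[u' su' du]; exists u' => //; exact: sum_in.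
Qed.

Lemma smooth1_id : smooth1 id.
Proof.
apply: (@smooth1_coind [set f | f = id \/ smooth1 f]); last by left.
move=> f [->|sf]; first exists (fun=> 1).
- by right; exact: smooth1_cst.
- by move=> x; exact: is_derive_id.
- by have [g sg dg] := smooth1_deriv sf; exists g => //; right.
Qed.

Lemma smooth1_comp f g : smooth1 f -> smooth1 g -> smooth1 (fun x => f (g x)).
Proof.
move=> sf sg; have [g' sg' dg] := smooth1_deriv sg.
(* The functions [v \o g] alone are not stable under derivation: the chain rule brings out a factor
   [g'], which is collected in [w]. *)
pose A := [set u | exists v w,
  [/\ smooth1 v, smooth1 w & u = fun x => v (g x) * w x]].
have A1 v w : smooth1 v -> smooth1 w -> A (fun x => v (g x) * w x).
  by move=> sv sw; exists v, w.
rewrite (_ : (fun x => _) = (fun x => f (g x) * 1)); last first.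
  by apply/funext => x; rewrite mulr1.
apply: (@smooth1_sum A); last first.
  by apply: sum_in; apply: A1 => //; exact: smooth1_cst.
move=> _ [v [w [sv sw ->]]].
have [v' sv' dv] := smooth1_deriv sv; have [w' sw' dw] := smooth1_deriv sw.
exists (fun x => v' (g x) * (g' x * w x) + v (g x) * w' x).
  by apply: sum_add; apply: sum_in; apply: A1 => //; exact: smooth1M.
move=> x; have H := is_derive1_comp (dv (g x)) (dg x).
by apply: (is_derive_eq (is_deriveM H (dw x))); rewrite /GRing.scale/=; ring.
Qed.

(** [psi 0] is the classical smooth function that is flat at 0. The powers of [t^-1] are carried
    along so that the family is stable under derivation up to linear combinations. *)
Definition psi (k : nat) (t : R) : R :=
  if 0 < t then t^-1 ^+ k * expR (- t^-1) else 0.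

Lemma psi_ge0 k t : 0 <= psi k t.
Proof.
rewrite /psi; case: ifP => // t0.
by rewrite mulr_ge0 ?expR_ge0// exprn_ge0// invr_ge0 ltW.
Qed.

Lemma psi_gt0 t : 0 < t -> 0 < psi 0 t.
Proof. by move=> t0; rewrite /psi t0 mulr_gt0 ?expR_gt0// exprn_gt0. Qed.

Lemma psi_le0 k t : t <= 0 -> psi k t = 0.
Proof. by move=> t0; rewrite /psi ltNge t0. Qed.

(** The inequality [1 + x <= expR x] at [x = t^-1 / (k + 2)], raised to the power [k + 2], shows
    that the exponential beats any power. The factor [t ^+ 2] is what makes the difference quotient
    of [psi k] at 0 vanish in the limit. *)
Lemma psi_bound k t : 0 < t -> psi k t <= k.+2%:R ^+ k.+2 * t ^+ 2.
Proof.
move=> t0; rewrite /psi t0.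
have s0 : 0 < t^-1 by rewrite invr_gt0.
have E : t^-1 ^+ k.+2 <= k.+2%:R ^+ k.+2 * expR (t^-1).
  have -> : expR t^-1 = expR (t^-1 / k.+2%:R) ^+ k.+2.
    by rewrite -expRM_natl; congr expR; rewrite mulrCA divff ?mulr1.
  rewrite -exprMn; apply: lerXn2r; rewrite ?nnegrE ?mulr_ge0 ?expR_ge0 ?(ltW s0)//.
  rewrite mulrC -ler_pdivrMr//; apply: le_trans (expR_ge1Dx _).
  by rewrite lerDr.
rewrite expRN ler_pdivrMr ?expR_gt0// mulrAC -ler_pdivrMr ?exprn_gt0//.
by rewrite -exprVn -exprD addn2.
Qed.

Lemma psi_is_derive k t :
  is_derive (t : R) (1 : R) (psi k) (- k%:R * psi k.+1 t + psi k.+2 t).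
Proof.
have [t0|t0] := ltP 0 t; last first.
  rewrite !psi_le0// mulr0 addr0.
  suff : h^-1 *: (psi k (h *: 1 + t) - psi k t) @[h --> 0^'] --> (0 : R).
    by move=> H; split; [exact: cvgP H|exact: cvg_lim H].
  apply/cvgrPdist_le => e e0.
  pose C : R := k.+2%:R ^+ k.+2.
  have C0 : 0 < C by rewrite exprn_gt0.
  near=> h.
  have h0 : h != 0 by near: h; exact: nbhs_dnbhs_neq.
  have he : `|h| <= e / C.
    near: h; apply: dnbhs0_le; exact: divr_gt0.
  rewrite sub0r normrN [psi k t]psi_le0// subr0 normrZ normfV.
  rewrite ler_pdivrMl ?normr_gt0// ger0_norm ?psi_ge0//.
  rewrite /GRing.scale/= mulr1.
  have [ht|ht] := ltP 0 (h + t); last first.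
    by rewrite psi_le0// mulr_ge0// ltW.
  apply: (le_trans (psi_bound _ ht)); rewrite -/C.
  apply: (@le_trans _ _ (C * (`|h| * (e / C)))); last first.
    by rewrite mulrCA [C * _]mulrC divfK ?gt_eqF.
  rewrite ler_pM2l// expr2.
  have hh : h + t <= `|h| by rewrite -[leRHS]addr0 lerD// ler_norm.
  apply: ler_pM; rewrite ?(ltW ht)//; exact: (le_trans hh).
have dV : is_derive (t : R) (1 : R) (fun x : R => x^-1) (- t ^- 2).
  by have := is_deriveV (lt0r_neq0 t0) (is_derive_id (t : R) (1 : R)); rewrite /GRing.scale/= mulr1.
have dE : is_derive (t : R) (1 : R) (fun x : R => expR (- x^-1)) (t^-1 ^+ 2 * expR (- t^-1)).
  have dN := is_deriveN dV.
  have := @is_derive1_comp _ expR (fun x : R => - x^-1) t _ _ (is_derive_expR _) dN.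
  by rewrite opprK mulrC -exprVn.
have dX : is_derive (t : R) (1 : R) (fun x : R => x^-1 ^+ k) (- k%:R * t^-1 ^+ k.+1).
  have := is_deriveX k dV; rewrite exprfctE /GRing.scale/= => H.
  apply: (is_derive_eq H); rewrite -exprVn mulrN mulNr; congr (- _).
  by case: (k) => [|m]; rewrite ?mul0r//= -mulrA -exprD addn2.
refine (near_eq_is_derive (f := fun x : R => x^-1 ^+ k * expR (- x^-1)) _ _).
  near=> x; rewrite /psi ifT//; near: x; exact: lt_nbhsr.
apply: (is_derive_eq (is_deriveM dX dE)); rewrite /psi t0 /GRing.scale/=.
by rewrite !exprS; ring.
Unshelve. all: by end_near. Qed.

Lemma smooth1_psi k : smooth1 (psi k).
Proof.
pose A := [set u | exists (c : R) j, u = fun x => c * psi j x].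
rewrite (_ : psi k = fun x => 1 * psi k x); last first.
  by apply/funext => x; rewrite mul1r.
apply: (@smooth1_sum A); last by apply: sum_in; exists 1, k.
move=> _ [c [j ->]].
exists (fun x => - (c * j%:R) * psi j.+1 x + c * psi j.+2 x).
  by apply: sum_add; apply: sum_in; [exists (- (c * j%:R)), j.+1|exists c, j.+2].
move=> x; have H := is_deriveM (is_derive_cst c (x : R) (1 : R)) (psi_is_derive j x).
by apply: (is_derive_eq H); rewrite /GRing.scale/= mulr0 addr0; ring.
Qed.

Lemma le_psi0 : {homo psi 0 : s t / s <= t}.
Proof.
move=> s t st; have [s0|s0] := ltP 0 s; last by rewrite [leLHS]psi_le0// psi_ge0.
have t0 : 0 < t by exact: lt_le_trans st.
by rewrite /psi s0 t0 !expr0 !mul1r ler_expR lerN2 lef_pV2// posrE.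
Qed.

(** For [|t| <= 1] both inner terms vanish and the quotient is 1; for [3 / 2 <= |t|] one of them is
    at least [psi 0 2^-1], so the outer argument is nonpositive. Differences are written with
    [-1 *], in the form handled by the closure of [smooth1] under sums and products. *)
Definition theta (t : R) : R :=
  (psi 0 (psi 0 2^-1))^-1 *
  psi 0 (psi 0 2^-1 + -1 * (psi 0 (t + -1) + psi 0 (-1 * t + -1))).

Let psi00 : 0 < psi 0 (psi 0 2^-1).
Proof. by apply: psi_gt0; apply: psi_gt0; rewrite invr_gt0. Qed.

Lemma smooth1_theta : smooth1 theta.
Proof.
apply: smooth1M; first exact: smooth1_cst.
apply: (smooth1_comp (smooth1_psi 0)).
apply: smooth1D; first exact: smooth1_cst.
apply: smooth1M; first exact: smooth1_cst.
by apply: smooth1D; apply: (smooth1_comp (smooth1_psi 0)); apply: smooth1D;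
  rewrite ?(smooth1M, smooth1_cst, smooth1_id)//; repeat
  (apply: smooth1_cst || apply: smooth1_id || apply: smooth1M).
Qed.

Lemma theta_ge0 t : 0 <= theta t.
Proof. by rewrite mulr_ge0 ?psi_ge0// invr_ge0 ltW. Qed.

Lemma theta_le1 t : theta t <= 1.
Proof.
rewrite /theta ler_pdivrMl// mulr1; apply: le_psi0.
by rewrite mulN1r gerBl addr_ge0 ?psi_ge0.
Qed.

Lemma theta1 t : `|t| <= 1 -> theta t = 1.
Proof.
rewrite ler_norml => /andP[t1 t2].
by rewrite /theta !(@psi_le0 0 (_ + -1)) ?addr0 ?mulr0 ?addr0 ?mulVf ?gt_eqF//; lra.
Qed.

Lemma theta0 t : 3 / 2 <= `|t| -> theta t = 0.
Proof.
move=> t32; rewrite /theta [X in _ * X]psi_le0 ?mulr0// mulN1r subr_le0.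
move: t32; rewrite ler_normr => /orP[t0|t0].
  by rewrite -[leLHS]addr0 lerD ?psi_ge0//; apply: le_psi0; lra.
by rewrite -[leLHS]add0r lerD ?psi_ge0//; apply: le_psi0; lra.
Qed.

Lemma smooth1_continuous f : smooth1 f -> continuous f.
Proof.
move=> /smooth1_deriv[g _ df] x.
by apply: differentiable_continuous; apply/derivable1_diffP; exact: ex_derive.
Qed.

Lemma smooth1_bounded f (a : R) : smooth1 f ->
  (forall t, a <= `|t| -> f t = 0) -> exists2 C, 0 < C & forall t, `|f t| <= C.
Proof.
move=> /smooth1_continuous cf f0.
have cK : compact (f @` `[- a, a]).
  apply: continuous_compact; last exact: segment_compact.
  exact: continuous_subspaceT.
have [M [_ HM]] := compact_bounded cK.
exists (`|M| + 1); first by rewrite ltr_wpDl.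
move=> t; have [ta|ta] := leP a `|t|; first by rewrite f0// normr0 addr_ge0.
apply: (HM (`|M| + 1)); first by rewrite (le_lt_trans (ler_norm M))// ltrDl.
by exists t => //=; rewrite in_itv/= -ler_norml ltW.
Qed.

Lemma theta_deriv : exists2 g, smooth1 g & exists2 C, 0 < C &
  forall t, is_derive (t : R) (1 : R) theta (g t) /\ `|g t| <= C.
Proof.
have [g sg dg] := smooth1_deriv smooth1_theta.
have [|C C0 HC] := @smooth1_bounded g 2 sg.
  move=> t t2; have := dg t => -[_ <-].
  rewrite (@near_eq_derive _ _ _ _ (cst 0)) ?derive_cst//.
  near=> s; apply: theta0; near: s.
  apply/nbhs_ballP; exists 4^-1 => //= s; rewrite /ball/= => ts.
  by have := ler_normD (t - s) s; rewrite subrK; lra.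
by exists g => //; exists C.
Unshelve. all: by end_near. Qed.

End smooth_one_variable.

(** * Smooth functions of several variables *)

Section smooth_functions.
Context (R : realType) (n : nat).
Implicit Types (x y v : 'rV[R]_n) (r s : R) (phi f g : 'rV[R]_n -> R).
Local Notation e_ i := (delta_mx 0 i : 'rV[R]_n).

Lemma is_derive_line f x v (d : R) :
  is_derive (0 : R) (1 : R) (fun t : R => f (t *: v + x)) d -> is_derive x v f d.
Proof.
have E : (fun h : R => h^-1 *: (f (h *: v + x) - f x)) =
    (fun h : R => h^-1 *: ((fun t : R => f (t *: v + x)) (h *: (1 : R) + 0) -
      (fun t : R => f (t *: v + x)) 0)).
  by apply/funext => h; rewrite /= scaler1 addr0 scale0r add0r.
move=> [dv <-]; split; first by rewrite /derivable E.
by rewrite /derive E.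
Qed.

(** Cutoffs and stream functions will all be products of one-variable functions: a partial
    derivative then just replaces one factor. *)
Definition prodfun (h : 'I_n -> R -> R) y : R := \prod_(l < n) h l (y 0 l).

Lemma is_derive_prodfun (h : 'I_n -> R -> R) i x (d : R) :
  is_derive (x 0 i : R) (1 : R) (h i) d ->
  is_derive x (e_ i) (prodfun h) (d * \prod_(l < n | l != i) h l (x 0 l)).
Proof.
move=> hd; apply: is_derive_line.
rewrite (_ : (fun t => _) = fun t => h i (t + x 0 i) *
    \prod_(l < n | l != i) h l (x 0 l)); last first.
  apply/funext => t; rewrite /prodfun (bigD1 i)//= !mxE !eqxx mulr1.
  congr (_ * _); apply: eq_bigr => l li.
  by rewrite !mxE (negbTE li) andbF mulr0 add0r.
have H1 : is_derive (0 : R) (1 : R) (fun t : R => t + x 0 i) 1.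
  by have := is_deriveD (is_derive_id (0 : R) (1 : R)) (is_derive_cst (x 0 i) (0 : R) (1 : R)); rewrite addr0.
have H2 : is_derive (0 : R) (1 : R) (fun t : R => h i (t + x 0 i)) (1 * d).
  rewrite mulrC; apply: (@is_derive1_comp _ (h i) (fun t : R => t + x 0 i) 0 d 1) => //.
  by rewrite add0r.
apply: (is_derive_eq (is_deriveM H2 (is_derive_cst _ (0 : R) (1 : R)))).
by rewrite /GRing.scale/= mulr0 add0r mul1r mulrC.
Qed.

Lemma partial_prodfun (h : 'I_n -> R -> R) i (g : R -> R) :
  (forall t, is_derive (t : R) (1 : R) (h i) (g t)) ->
  partial i (prodfun h) = prodfun (fun l => if l == i then g else h l).
Proof.
move=> dg; apply/funext => x; rewrite /partial.
have [_ ->] := is_derive_prodfun (dg (x 0 i)).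
rewrite [in RHS]/prodfun [RHS](bigD1 i)//= eqxx; congr (_ * _).
by apply: eq_bigr => l /negbTE ->.
Qed.

Lemma smooth_coind (S : set ('rV[R]_n -> R)) :
  (forall f, S f -> continuous f /\
    forall i, (forall x, derivable f x (e_ i)) /\ S (partial i f)) ->
  forall f, S f -> smooth f.
Proof.
move=> HS f Sf s.
have Sp : S (foldr (@partial R n) f s).
  by elim: s => //= i s IH; have [_ /(_ i)[]] := HS _ IH.
have [cf df] := HS _ Sp.
by split=> // i x; have [+ _] := df i; apply.
Qed.

Lemma smooth_partial f i : smooth f -> smooth (partial i f).
Proof. by move=> sf s; have := sf (rcons s i); rewrite foldr_rcons. Qed.

Lemma smooth_continuous f : smooth f -> continuous f.
Proof. by move=> /(_ [::])[]. Qed.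

Lemma smooth_derivable f i x : smooth f -> derivable f x (e_ i).
Proof. by move=> /(_ [::])[_]; apply. Qed.

Lemma smooth_is_derive f i x : smooth f -> is_derive x (e_ i) f (partial i f x).
Proof. by move=> sf; apply: DeriveDef => //; exact: smooth_derivable. Qed.

Opaque smooth.

Lemma smooth_sum (A : set ('rV[R]_n -> R)) :
  (forall u, A u -> continuous u /\ forall i, (forall x, derivable u x (e_ i)) /\
    sum_closure A (partial i u)) ->
  forall u, sum_closure A u -> smooth u.
Proof.
move=> HA; apply: smooth_coind => u; elim=> [{}u /HA//|{}u v _ [cu du] _ [cv dv]].
split=> [x|i]; first by apply: continuousD; [exact: cu|exact: cv].
have [dui Su] := du i; have [dvi Sv] := dv i.
split=> [x|]; first exact: derivableD.
rewrite (_ : partial i _ = fun x => partial i u x + partial i v x).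
  exact: sum_add.
by apply/funext => x; rewrite /partial deriveD.
Qed.

Lemma smoothD f g : smooth f -> smooth g -> smooth (fun x => f x + g x).
Proof.
move=> sf sg; apply: (@smooth_sum (@smooth R n)); last by apply: sum_add; exact: sum_in.
move=> u su; split; first exact: smooth_continuous.
move=> i; split; first by move=> x; exact: smooth_derivable.
by apply: sum_in; exact: smooth_partial.
Qed.

Lemma partialM f g i : smooth f -> smooth g ->
  partial i (fun x => f x * g x) = fun x => partial i f x * g x + f x * partial i g x.
Proof.
move=> sf sg; apply/funext => x.
have [_] := is_deriveM (smooth_is_derive i x sf) (smooth_is_derive i x sg).
by rewrite /partial /GRing.scale/= addrC (mulrC (g x)).
Qed.

Lemma partialD f g i : smooth f -> smooth g ->
  partial i (fun x => f x + g x) = fun x => partial i f x + partial i g x.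
Proof.
move=> sf sg; apply/funext => x.
by have [_] := is_deriveD (smooth_is_derive i x sf) (smooth_is_derive i x sg).
Qed.

Lemma partial_cst (c : R) i : partial i (fun _ : 'rV[R]_n => c) = fun=> 0.
Proof. by apply/funext => x; rewrite /partial derive_cst. Qed.

Lemma smoothM f g : smooth f -> smooth g -> smooth (fun x => f x * g x).
Proof.
pose A : set ('rV[R]_n -> R) := [set u |
  exists v w : 'rV[R]_n -> R, [/\ smooth v, smooth w & u = fun x => v x * w x]].
move=> sf sg; apply: (@smooth_sum A); last by apply: sum_in; exists f, g.
move=> _ [v [w [sv sw ->]]]; split=> [x|i].
  by apply: continuousM; exact: smooth_continuous.
split=> [x|]; first by apply: derivableM; exact: smooth_derivable.
rewrite (partialM _ sv sw); apply: sum_add; apply: sum_in.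
  by exists (partial i v), w; split; [exact: smooth_partial|exact: sw|].
by exists v, (partial i w); split; [exact: sv|exact: smooth_partial|].
Qed.

Lemma smooth_cst (c : R) : smooth (fun _ : 'rV[R]_n => c).
Proof.
apply: (@smooth_coind [set f : 'rV[R]_n -> R | exists c : R, f = fun=> c]); last by exists c.
move=> _ [{}c ->]; split=> [x|i]; first exact: cst_continuous.
split=> [x|]; first exact: derivable_cst.
by exists 0; rewrite partial_cst.
Qed.

Lemma smooth_prodfun (h : 'I_n -> R -> R) : (forall l, smooth1 (h l)) ->
  smooth (prodfun h).
Proof.
move=> sh; apply: (@smooth_coind [set f | exists h, (forall l, smooth1 (h l)) /\
  f = prodfun h]); last by exists h.
move=> _ [{sh}h [sh ->]]; split=> [x|i].
  rewrite /prodfun; elim: (index_enum _) => [|l q IH].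
    rewrite (_ : (fun y => _) = (fun=> 1)) ?big_nil; first exact: cst_continuous.
    by apply/funext => y; rewrite big_nil.
  rewrite (_ : (fun y => _) = (fun y => h l (y 0 l) * \prod_(l <- q) h l (y 0 l))).
    apply: continuousM => //.
    apply: (cvg_comp _ _ (@coord_continuous R 1 n 0 l x)).
    exact: smooth1_continuous.
  by apply/funext => y; rewrite big_cons.
have [g sg dg] := smooth1_deriv (sh i).
split=> [x|]; first by have [] := is_derive_prodfun (dg (x 0 i)).
exists (fun l => if l == i then g else h l); split; last exact: partial_prodfun.
by move=> l; case: ifP.
Qed.

Lemma partial_shift f v i : partial i (fun x => f (x - v)) = fun x => partial i f (x - v).
Proof.
apply/funext => x; rewrite /partial /derive.
rewrite (_ : (fun h => _) =
  (fun h => h^-1 *: (f (h *: delta_mx 0 i + (x - v)) - f (x - v))))//.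
by apply/funext => h; rewrite addrA.
Qed.

Lemma smooth_shift f v : smooth f -> smooth (fun x => f (x - v)).
Proof.
move=> sf; apply: (@smooth_coind [set g | exists2 f, smooth f & g = fun x => f (x - v)]).
  move=> _ [{sf}f sf ->]; split=> [x|i].
    apply: continuous_comp; last exact: smooth_continuous.
    exact: (@continuousD _ _ _ id (cst (- v)) x (@cvg_id _ _) (@cst_continuous _ _ _ _)).
  split=> [x|]; last first.
    by exists (partial i f); [exact: smooth_partial|exact: partial_shift].
  have := @smooth_derivable f i (x - v) sf.
  rewrite /derivable (_ : (fun h => _) =
    (fun h => h^-1 *: (f (h *: delta_mx 0 i + x - v) - f (x - v))))//.
  by apply/funext => h; rewrite /= addrA.
by exists f.
Qed.

Lemma smoothZ (c : R) f : smooth f -> smooth (fun x => c * f x).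
Proof. by move=> sf; apply: smoothM; [exact: smooth_cst|exact: sf]. Qed.

Lemma partialZ (c : R) f i : smooth f ->
  partial i (fun x => c * f x) = fun x => c * partial i f x.
Proof.
move=> sf; rewrite partialM; [|exact: smooth_cst|exact: sf].
by apply/funext => x; rewrite partial_cst mul0r add0r.
Qed.

End smooth_functions.

(** * Cutoff functions *)

Section cutoff_functions.
Context (R : realType) (n : nat).
Implicit Types (x y v : 'rV[R]_n) (r : R) (phi f g : 'rV[R]_n -> R)
  (U K : set 'rV[R]_n).

Definition ccube x r : set 'rV[R]_n := [set y | forall i, `|y 0 i - x 0 i| <= r].

Lemma compact_ccube x r : compact (ccube x r).
Proof.
have := @rV_compact R n (fun i => `[x 0 i - r, x 0 i + r]%classic)
  (fun=> @segment_compact _ _ _).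
congr compact; apply/seteqP; split=> y /= H i; move: (H i).
  by rewrite /= in_itv/= ler_distl.
by rewrite /= in_itv/= ler_distl.
Qed.

Lemma ball_ccube x r : ball x r `<=` ccube x r.
Proof. by move=> y /ball_rVP[_ H] i; rewrite distrC ltW. Qed.

Lemma ccube_ball x r s : 0 <= r -> r < s -> ccube x r `<=` ball x s.
Proof.
move=> r0 rs y H; apply/ball_rVP; split; first exact: le_lt_trans rs.
by move=> i; rewrite distrC (le_lt_trans (H i)).
Qed.

Definition bump x r : 'rV[R]_n -> R :=
  prodfun (fun l t => theta (r^-1 * (t + - x 0 l))).

Lemma smooth1_affine (h : R -> R) (a b : R) : smooth1 h ->
  smooth1 (fun t => h (a * (t + b))).
Proof.
move=> sh; apply: (smooth1_comp sh); apply: smooth1M; first exact: smooth1_cst.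
by apply: smooth1D; [exact: smooth1_id|exact: smooth1_cst].
Qed.

Lemma is_derive_affine (h : R -> R) (a b d t : R) :
  is_derive (a * (t + b)) (1 : R) h d ->
  is_derive (t : R) (1 : R) (fun t => h (a * (t + b))) (a * d).
Proof.
move=> hd; have H1 : is_derive (t : R) (1 : R) (fun t => a * (t + b)) a.
  apply: (is_derive_eq (is_deriveM (is_derive_cst a t (1 : R))
    (is_deriveD (is_derive_id t (1 : R)) (is_derive_cst b t (1 : R))))).
  by rewrite /GRing.scale/= addr0 mulr0 addr0 mulr1.
by rewrite mulrC; exact: (@is_derive1_comp _ h (fun t => a * (t + b)) t d a).
Qed.

Lemma smooth_bump x r : smooth (bump x r).
Proof. by apply: smooth_prodfun => l; apply: smooth1_affine; exact: smooth1_theta. Qed.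

Lemma bump_ge0 x r y : 0 <= bump x r y.
Proof. by apply: prodr_ge0 => l _; exact: theta_ge0. Qed.

Lemma bump_le1 x r y : bump x r y <= 1.
Proof.
rewrite -[leRHS](@big1 _ 1 *%R 'I_n (index_enum _) xpredT (fun=> 1))//.
by apply: ler_prod => l _; rewrite theta_ge0 theta_le1.
Qed.

Lemma bump1 x r y : 0 < r -> ccube x r y -> bump x r y = 1.
Proof.
move=> r0 H; rewrite /bump /prodfun big1// => l _; apply: theta1.
by rewrite normrM gtr0_norm ?invr_gt0// ler_pdivrMl// mulr1 H.
Qed.

Lemma bump0 x r y : 0 < r -> ~ ccube x (3 / 2 * r) y -> bump x r y = 0.
Proof.
move=> r0 /existsNP[l /negP]; rewrite -ltNge => H.
rewrite /bump /prodfun (bigD1 l)//= theta0 ?mul0r//.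
by rewrite normrM gtr0_norm ?invr_gt0// ler_pdivlMl// mulrC ltW.
Qed.

Lemma partial_bump_le : exists2 C : R, 0 < C & forall x r i y, 0 < r ->
  `|partial i (bump x r) y| <= C / r.
Proof.
have [g sg [C C0 HC]] := theta_deriv R; exists C => // x r i y r0.
have dh t : is_derive (t : R) (1 : R) (fun t => theta (r^-1 * (t + - x 0 i)))
    (r^-1 * g (r^-1 * (t + - x 0 i))).
  by apply: is_derive_affine; have [] := HC (r^-1 * (t + - x 0 i)).
rewrite /bump (@partial_prodfun _ _
  (fun l t => theta (r^-1 * (t + - x 0 l))) i _ dh).
rewrite /prodfun (bigD1 i)//= eqxx normrM.
rewrite -[leRHS]mulr1; apply: ler_pM => //.
  rewrite normrM gtr0_norm ?invr_gt0// mulrC ler_pM2r ?invr_gt0//.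
  by have [] := HC (r^-1 * (y 0 i + - x 0 i)).
rewrite normr_prod -[leRHS](@big1 _ 1 *%R 'I_n (index_enum _) (fun l => l != i) (fun=> 1))//.
by apply: ler_prod => l li; rewrite normr_ge0 (negbTE li) ger0_norm ?theta_ge0 ?theta_le1.
Qed.

(** This is 1 minus the product of the [1 - bump], a smooth substitute for the maximum: it is 1
    where one bump is 1, stays in [0, 1], and its derivatives are bounded by the sums of those of
    the bumps. *)
Fixpoint bumps (s : seq ('rV[R]_n * R)) : 'rV[R]_n -> R :=
  if s is p :: s' then
    fun y => bump p.1 p.2 y + (1 + -1 * bump p.1 p.2 y) * bumps s' y
  else fun=> 0.

Lemma smooth_bumps s : smooth (bumps s).
Proof.
elim: s => [|p s IH] /=; first exact: smooth_cst.
apply: smoothD; first exact: smooth_bump.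
apply: smoothM; last exact: IH.
by apply: smoothD; [exact: smooth_cst|apply: smoothZ; exact: smooth_bump].
Qed.

Lemma bumps_itv s y : 0 <= bumps s y <= 1.
Proof.
elim: s => [|p s IH] /=; first by rewrite lexx ler01.
by have := bump_ge0 p.1 p.2 y; have := bump_le1 p.1 p.2 y; nra.
Qed.

Lemma bumps1 s y p : p \in s -> 0 < p.2 -> ccube p.1 p.2 y -> bumps s y = 1.
Proof.
elim: s => [//|q s IH]; rewrite inE => /predU1P[->|ps] p0 py /=.
  by rewrite bump1// mulr1 subrr mul0r addr0.
by rewrite IH// mulr1 mulN1r addrC subrK.
Qed.

Lemma bumps0 s y : (forall p, p \in s -> 0 < p.2 /\ ~ ccube p.1 (3 / 2 * p.2) y) ->
  bumps s y = 0.
Proof.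
elim: s => [//|q s IH] H /=.
have [q0 qy] := H q (mem_head _ _).
rewrite bump0// IH ?mulr0 ?addr0// => p ps.
by apply: H; rewrite inE ps orbT.
Qed.

Lemma partial_bumps_le s i y :
  `|partial i (bumps s) y| <= \sum_(p <- s) `|partial i (bump p.1 p.2) y|.
Proof.
elim: s => [|p s IH] /=; first by rewrite big_nil partial_cst normr0.
have s1 : smooth (fun y => 1 + -1 * bump p.1 p.2 y).
  by apply: smoothD; [exact: smooth_cst|apply: smoothZ; exact: smooth_bump].
rewrite big_cons partialD; [|exact: smooth_bump|apply: smoothM=> //; exact: smooth_bumps].
rewrite partialM; [|exact: s1|exact: smooth_bumps].
rewrite partialD; [|exact: smooth_cst|apply: smoothZ; exact: smooth_bump].
rewrite partial_cst partialZ; last exact: smooth_bump.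
rewrite add0r addrA (_ : _ + _ * bumps s y =
  partial i (bump p.1 p.2) y * (1 - bumps s y)); last by ring.
have /andP[b0 b1] := bumps_itv s y.
have c0 := bump_ge0 p.1 p.2 y; have c1 := bump_le1 p.1 p.2 y.
rewrite (le_trans (ler_normD _ _))// !normrM lerD//.
  by rewrite ler_piMr// ger0_norm ?subr_ge0// gerBl.
apply: le_trans IH; rewrite ler_piMl// ger0_norm; lra.
Qed.

Lemma compact_closed_rV K : compact K -> closed K.
Proof. by apply: compact_closed; exact: norm_hausdorff. Qed.

Lemma test_fun_smooth U phi : test_fun U phi -> smooth phi.
Proof. by case. Qed.

Lemma test_fun_sub U V phi : U `<=` V -> test_fun U phi -> test_fun V phi.
Proof. by move=> UV [sp [K [cK KU K0]]]; split=> //; exists K; split=> // x /KU/UV. Qed.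

Lemma test_funMr U phi f : test_fun U phi -> smooth f ->
  test_fun U (fun x => phi x * f x).
Proof.
move=> [sp [K [cK KU K0]]] sf; split; first exact: smoothM.
by exists K; split=> // x /K0 ->; rewrite mul0r.
Qed.

Lemma test_funD U phi f : test_fun U phi -> test_fun U f ->
  test_fun U (fun x => phi x + f x).
Proof.
move=> [sp [K [cK KU K0]]] [sf [K' [cK' KU' K0']]]; split; first exact: smoothD.
exists (K `|` K'); split; first exact: compactU.
  by move=> x [/KU|/KU'].
by move=> x /not_orP[/K0 -> /K0' ->]; rewrite addr0.
Qed.

Lemma test_funZ U phi (c : R) : test_fun U phi -> test_fun U (fun x => c * phi x).
Proof.
move=> [sp [K [cK KU K0]]]; split; first exact: smoothZ.
by exists K; split=> // x /K0 ->; rewrite mulr0.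
Qed.

Lemma test_fun_partial U phi i : test_fun U phi -> test_fun U (partial i phi).
Proof.
move=> [sp [K [cK KU K0]]]; split; first exact: smooth_partial.
exists K; split=> // x Kx; rewrite /partial.
rewrite (@near_eq_derive _ _ _ _ (cst 0)) ?derive_cst//.
have oK : open (~` K) by apply: closed_openC; exact: compact_closed_rV.
by have := open_nbhs_nbhs (conj oK Kx); apply: filterS => y /K0.
Qed.

Lemma test_fun_shift U V phi v : test_fun U phi ->
  (forall x, U x -> V (x + v)) -> test_fun V (fun x => phi (x - v)).
Proof.
move=> [sp [K [cK KU K0]]] UV; split; first exact: smooth_shift.
exists [set x | K (x - v)]; split.
- have : compact ((fun x => x + v) @` K).
    apply: continuous_compact => //; apply: continuous_subspaceT => x.
    exact: (@continuousD _ _ _ id (cst v) x (@cvg_id _ _) (@cst_continuous _ _ _ _)).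
  congr compact; apply/seteqP; split=> [_ [x Kx <-]|x Kx] /=; first by rewrite addrK.
  by exists (x - v); rewrite // subrK.
- by move=> x /= /KU/UV; rewrite subrK.
- by move=> x /= /K0.
Qed.

Lemma compact_cover_balls K (rho : 'rV[R]_n -> R) : compact K ->
  (forall x, K x -> 0 < rho x) ->
  exists s : seq 'rV[R]_n, (forall x, x \in s -> K x) /\
    forall y, K y -> exists2 x, x \in s & ball x (rho x) y.
Proof.
move=> cK r0; move: cK; rewrite compact_cover.
move=> /(_ _ K (fun x => ball x (rho x))); case=> [x Kx|x Kx|D DK KD].
- exact: ball_open.
- by exists x => //; apply: ballxx; exact: r0.
exists (enum_fset D); split=> [x xD|y /KD[x /= xD xy]]; last by exists x.
by apply/set_mem/DK.
Qed.

Lemma bumps_test U s : (forall p, p \in s -> 0 < p.2) ->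
  (forall p, p \in s -> ccube p.1 (3 / 2 * p.2) `<=` U) -> test_fun U (bumps s).
Proof.
move=> s0 sU; split; first exact: smooth_bumps.
exists (\bigcup_(p in [set` s]) ccube p.1 (3 / 2 * p.2)); split.
- elim: s {s0 sU} => [|p s IH].
    rewrite (_ : \bigcup_(_ in _) _ = set0); first exact: compact0.
    by apply/seteqP; split=> // x [].
  rewrite (_ : \bigcup_(_ in _) _ = ccube p.1 (3 / 2 * p.2) `|`
      \bigcup_(p in [set` s]) ccube p.1 (3 / 2 * p.2)).
    by apply: compactU => //; exact: compact_ccube.
  apply/seteqP; split=> x.
    by move=> [q /=]; rewrite inE => /predU1P[->|qs] qx; [left|right; exists q].
  move=> [px|[q /= qs qx]]; first by exists p => //=; rewrite mem_head.
  by exists q => //=; rewrite inE qs orbT.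
- by move=> x [p /= ps px]; exact: sU px.
- move=> x H; apply: bumps0 => p ps; split; first exact: s0.
  by move=> px; apply: H; exists p.
Qed.

Lemma urysohn_test K U : compact K -> open U -> K `<=` U ->
  exists2 phi, test_fun U phi & (forall x, 0 <= phi x <= 1) /\
    exists2 V, open V /\ K `<=` V & forall x, V x -> phi x = 1.
Proof.
move=> cK oU KU.
have /choice[rho Hrho] : forall x : 'rV[R]_n, exists r : R, 0 < r /\
    (K x -> ccube x (3 / 2 * r) `<=` U).
  move=> x; have [Kx|nKx] := pselect (K x); last by exists 1.
  have /nbhs_ballP[e /= e0 He] := open_nbhs_nbhs (conj oU (KU _ Kx)).
  exists (e / 2); split=> [|_]; first by rewrite divr_gt0.
  apply: subset_trans He; apply: ccube_ball; lra.
have [s [sK sc]] := compact_cover_balls cK (fun x _ => (Hrho x).1).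
exists (bumps [seq (x, rho x) | x <- s]).
  apply: bumps_test => _ /mapP[x xs ->] /=; first exact: (Hrho x).1.
  by apply: (Hrho x).2; exact: sK.
split; first exact: bumps_itv.
exists (\bigcup_(x in [set` s]) ball x (rho x)).
  split; last by move=> y /sc[x xs xy]; exists x.
  by apply: bigcup_open => x _; apply: ball_open; exact: (Hrho x).1.
move=> y [x /= xs xy]; apply: (@bumps1 _ _ (x, rho x)).
- exact: map_f.
- exact: (Hrho x).1.
- exact: ball_ccube.
Qed.

End cutoff_functions.

Import HBSimple.

(** * Integrals and duality in L1 *)

Section real_integrable.
Context d (T : measurableType d) (R : realType) (mu : {measure set T -> \bar R}).
Implicit Types (D : set T) (f g : T -> R) (M : R).

Definition rint D f := mu.-integrable D (fun x => (f x)%:E).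

Lemma rint_measurable D f : rint D f -> measurable_fun D f.
Proof. by move=> /measurable_int/measurable_EFinP. Qed.

Lemma rint_le D f g : measurable D -> measurable_fun D f -> rint D g ->
  (forall x, D x -> `|f x| <= g x) -> rint D f.
Proof.
move=> mD mf ig fg; apply: le_integrable ig => //; first exact/measurable_EFinP.
by move=> x Dx /=; rewrite lee_fin (le_trans (fg x Dx))// ler_norm.
Qed.

Lemma rint_bounded D f M : measurable D -> (mu D < +oo)%E -> measurable_fun D f ->
  (forall x, D x -> `|f x| <= M) -> rint D f.
Proof.
move=> mD Dfin mf fM; apply: measurable_bounded_integrable => //.
exists M; split; first exact: num_real.
by move=> y My x Dx; exact: le_trans (fM x Dx) (ltW My).
Qed.

Lemma rintMr D f g M : measurable D -> rint D f -> measurable_fun D g ->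
  (forall x, D x -> `|g x| <= M) -> rint D (fun x => f x * g x).
Proof.
move=> mD If mg gM; have := integrableMl mD If mg.
rewrite /rint; under [in X in _ -> X]eq_fun do rewrite EFinM; apply.
exists M; split; first exact: num_real.
by move=> y My x Dx; exact: le_trans (gM x Dx) (ltW My).
Qed.

Lemma rintZ D f (c : R) : measurable D -> rint D f -> rint D (fun x => c * f x).
Proof.
by move=> mD If; rewrite /rint; under eq_fun do rewrite EFinM; exact: integrableZl.
Qed.

Lemma rintD D f g : measurable D -> rint D f -> rint D g -> rint D (fun x => f x + g x).
Proof.
by move=> mD If Ig; rewrite /rint; under eq_fun do rewrite EFinD; exact: integrableD.
Qed.

Lemma rintB D f g : measurable D -> rint D f -> rint D g -> rint D (fun x => f x - g x).
Proof.
by move=> mD If Ig; rewrite /rint; under eq_fun do rewrite EFinB; exact: integrableB.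
Qed.

Lemma rint_norm D f : measurable D -> rint D f -> rint D (fun x => `|f x|).
Proof. by move=> mD; exact: integrable_norm. Qed.

Lemma rint_sum (I : Type) (s : seq I) D (f : I -> T -> R) : measurable D ->
  (forall i, rint D (f i)) -> rint D (fun x => \sum_(i <- s) f i x).
Proof.
move=> mD If; rewrite /rint; under eq_fun do rewrite -sumEFin.
by apply: integrable_sum => // i _; exact: If.
Qed.

Lemma rint_sub D (E : set T) f : measurable D -> measurable E -> E `<=` D ->
  rint D f -> rint E f.
Proof. by move=> mD mE ED; exact: integrableS. Qed.

Lemma rint_eq D f g : measurable D -> (forall x, D x -> f x = g x) -> rint D f -> rint D g.
Proof. by move=> mD fg; apply: eq_integrable => // x /set_mem Dx; rewrite fg. Qed.

Lemma Rint_eq D f g : (forall x, D x -> f x = g x) ->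
  \int[mu]_(x in D) f x = \int[mu]_(x in D) g x.
Proof. by move=> fg; apply: eq_Rintegral => x /set_mem Dx; exact: fg. Qed.

Lemma Rint_sum (I : Type) (s : seq I) D (f : I -> T -> R) : measurable D ->
  (forall i, rint D (f i)) ->
  \int[mu]_(x in D) (\sum_(i <- s) f i x) = \sum_(i <- s) \int[mu]_(x in D) f i x.
Proof.
move=> mD If; elim: s => [|i s IH].
  rewrite big_nil (@Rint_eq _ _ (fun=> 0)) ?Rintegral_cst ?mul0r// => x _.
  by rewrite big_nil.
rewrite big_cons -IH -RintegralD//; [|exact: If|exact: rint_sum].
by apply: Rint_eq => x _; rewrite big_cons.
Qed.

Lemma Rint_norm_le D f g : measurable D -> rint D f -> rint D g ->
  (forall x, D x -> `|f x| <= g x) ->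
  `|\int[mu]_(x in D) f x| <= \int[mu]_(x in D) g x.
Proof.
move=> mD If Ig fg; apply: (le_trans (le_normr_Rintegral mD If)).
by apply: le_Rintegral => //; exact: rint_norm.
Qed.

Lemma Rint_ge0 D f : (forall x, D x -> 0 <= f x) -> 0 <= \int[mu]_(x in D) f x.
Proof. exact: Rintegral_ge0. Qed.

Lemma Rint_sub D (E : set T) f : measurable D -> measurable E -> E `<=` D ->
  rint D f -> (forall x, D x -> 0 <= f x) ->
  \int[mu]_(x in E) f x <= \int[mu]_(x in D) f x.
Proof.
move=> mD mE ED If f0.
have -> : \int[mu]_(x in E) f x = \int[mu]_(x in D) ((f \_ E) x).
  by rewrite -Rintegral_mkcondr setIidr.
apply: le_Rintegral => //.
  have := rint_sub mD mE ED If; rewrite /rint integrable_mkcond//.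
  rewrite [X in _ -> X]integrable_mkcond// => H; apply: eq_integrable H => // x _.
  rewrite /patch /=; case: ifPn => [/set_mem Ex|_]; last by case: ifP.
  by rewrite ifT//; apply/mem_set/ED.
by move=> x Dx; rewrite /patch; case: ifP => // _; exact: f0.
Qed.

Lemma Rint_support D (E : set T) f : E `<=` D ->
  (forall x, D x -> ~ E x -> f x = 0) ->
  \int[mu]_(x in D) f x = \int[mu]_(x in E) f x.
Proof.
move=> ED f0; rewrite -[in RHS](setIidr ED) Rintegral_mkcondr.
apply: Rint_eq => x Dx; rewrite /patch; case: ifPn => //.
by rewrite notin_setE; exact: f0.
Qed.

Lemma Rint_bound D f M : measurable D -> (mu D < +oo)%E -> measurable_fun D f ->
  (forall x, D x -> `|f x| <= M) ->
  `|\int[mu]_(x in D) f x| <= M * fine (mu D).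
Proof.
move=> mD Dfin mf fM; rewrite -Rintegral_cst//.
apply: Rint_norm_le => //; first exact: rint_bounded fM.
by apply: (rint_bounded (M := `|M|)) => //.
Qed.

Lemma Rint_setU D (E : set T) f : measurable D -> measurable E ->
  D `&` E = set0 -> rint (D `|` E) f ->
  \int[mu]_(x in D `|` E) f x = \int[mu]_(x in D) f x + \int[mu]_(x in E) f x.
Proof. by move=> mD mE DE If; apply: Rintegral_setU => //; apply/disj_set2P. Qed.

Lemma Rint_EFin D f : measurable D -> rint D f ->
  (\int[mu]_(x in D) f x)%:E = (\int[mu]_(x in D) (f x)%:E)%E.
Proof. by move=> mD If; rewrite fineK//; exact: integrable_fin_num. Qed.

Lemma Rint_markov D f (t : R) : measurable D -> rint D f -> 0 < t ->
  (forall x, D x -> 0 <= f x) ->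
  t * fine (mu (D `&` [set x | t <= f x])) <= \int[mu]_(x in D) f x.
Proof.
move=> mD If t0 f0.
have mE : measurable (D `&` [set x | t <= f x]).
  have := rint_measurable If mD (measurable_itv `[t, +oo[).
  by congr measurable; apply/seteqP; split=> x /= [Dx]; rewrite in_itv/= andbT.
rewrite -Rintegral_cst//; apply: le_trans (Rint_sub _ mE _ If f0) => //.
set E := D `&` _.
have fE x : E x -> t <= f x by case.
have IE : rint E f by apply: rint_sub If => //; exact: subIsetl.
apply: le_Rintegral => //; apply: (rint_le _ _ IE) => // x Ex.
by rewrite ger0_norm ?fE// ltW.
Qed.

End real_integrable.

Section lebesgue_integral.
Context (R : realType) (n : nat).
Implicit Types (x y v : 'rV[R]_n) (r s : R) (D U K : set 'rV[R]_n)
  (f g : 'rV[R]_n -> R).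
Local Notation L := (@leb_outer R n).
Local Notation T := (lebT R n).
Local Notation mu := (@leb R n).

Lemma continuous_measurable_leb D f : measurable (D : set T) -> continuous f ->
  measurable_fun (D : set T) f.
Proof.
move=> mD cf; apply: (@measurable_funTS _ _ T R).
apply: (measurability _ (RGenOInfty.measurableE R)) => // _ [_ [a ->] <-].
rewrite setTI; apply: open_measurable_leb; by apply: open_comp => // x _; exact: cf.
Qed.

Lemma measurable_preshift v D : measurable (D : set T) ->
  measurable (preshift v D : set T).
Proof.
move=> mD; have H : L.-caratheodory D := mD.
suff : L.-caratheodory (preshift v D) by [].
move=> X; have E A : L (preshift (- v) A) = L A by exact: leb_shift.
rewrite -(E X) (H (preshift (- v) X)) -!(E (X `&` _)).
by congr (L _ + L _)%E; apply/seteqP; split=> y; rewrite /preshift/= subrK.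
Qed.

Lemma leb_fin_ball D x r : D `<=` ball x r -> (L D < +oo)%E.
Proof. by move=> H; apply: le_lt_trans (leb_ball_fin x r); exact: le_outer_measure. Qed.

Lemma measurable_shift v : measurable_fun [set: T] (fun x : T => (x : 'rV[R]_n) + v : T).
Proof. by move=> _ B mB; rewrite setTI; exact: (measurable_preshift v mB). Qed.

Lemma pushforward_shift v (A : set T) : pushforward mu (fun x : T => (x : 'rV[R]_n) + v : T) A = mu A.
Proof. exact: leb_shift. Qed.

Lemma integral_shift v D (F : 'rV[R]_n -> \bar R) : measurable (D : set T) ->
  measurable_fun (D : set T) F -> (forall x, D x -> 0 <= F x)%E ->
  (\int[mu]_(x in preshift v D) F (x + v)%R = \int[mu]_(x in D) F x)%E.
Proof.
move=> mD mF F0.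
rewrite integral_mkcond [RHS]integral_mkcond.
pose G := (F \_ D)%E.
have mG : measurable_fun [set: T] G by apply/(measurable_restrictT _ mD).
have G0 x : (0 <= G x)%E.
  by rewrite /G /patch; case: ifPn => // /set_mem; exact: F0.
pose phi (x : T) : T := (x : 'rV[R]_n) + v.
have mphi : measurable_fun [set: T] phi by exact: measurable_shift.
have E1 := @ge0_integral_pushforward _ _ _ _ R phi mphi mu setT G measurableT mG
  (fun y _ => G0 y).
have E2 : (\int[pushforward mu phi]_y G y = \int[mu]_y G y)%E.
  by apply: eq_measure_integral => A mA _; exact: pushforward_shift.
by rewrite -[RHS]E2 E1; apply: eq_integral.
Qed.

Lemma rint_shift v D f : measurable (D : set T) -> rint mu D f ->
  rint mu (preshift v D) (fun x => f (x + v)).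
Proof.
move=> mD If; have mf := rint_measurable If.
apply/integrableP; split.
  apply/measurable_EFinP => mpD B mB.
  have := measurable_preshift v (mf mD _ mB).
  by congr measurable; apply/seteqP; split.
have mF : measurable_fun (D : set T) (fun x => `|(f x)%:E|)%E.
  apply/measurable_EFinP; apply: (measurableT_comp _ mf).
  exact: normr_measurable.
rewrite (@integral_shift v D (fun x => `|(f x)%:E|)%E mD mF (fun x _ => abse_ge0 _)).
by case/integrableP : If.
Qed.

Lemma Rint_shift v D f : measurable (D : set T) -> rint mu D f ->
  \int[mu]_(x in preshift v D) f (x + v) = \int[mu]_(x in D) f x.
Proof.
move=> mD If; have mf := rint_measurable If.
have mE : measurable_fun (D : set T) (fun x : T => (f x)%:E).
  exact/measurable_EFinP.
rewrite /Rintegral integralE [in RHS]integralE; congr (fine (_ - _)%E).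
  apply: etrans (@integral_shift v D (fun x : T => (f x)%:E)^\+%E mD
    (measurable_funepos mE) (fun x _ => funepos_ge0 _ x)).
  by apply: eq_integral => x _; rewrite !funeposE.
apply: etrans (@integral_shift v D (fun x : T => (f x)%:E)^\-%E mD
  (measurable_funeneg mE) (fun x _ => funeneg_ge0 _ x)).
by apply: eq_integral => x _; rewrite !funenegE.
Qed.

Lemma openD_compact U K : open U -> compact K -> open (U `\` K).
Proof.
by move=> oU cK; apply: openI => //; apply: closed_openC; exact: compact_closed_rV.
Qed.

Lemma leb_outer_open (A : set 'rV[R]_n) (e : R) : (L A < +oo)%E -> 0 < e ->
  exists W, [/\ open W, A `<=` W & (L W <= L A + e%:E)%E].
Proof.
move=> Afin e0.
have An : L A \is a fin_num by rewrite ge0_fin_numE// outer_measure_ge0.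
have [_ [F [DF AF] <-] Fe] := lb_ereal_inf_adherent e0 An.
exists (\bigcup_k oapp (@box R n) set0 (F k)); split=> //.
  by apply: bigcup_open => k _; case: (F k) => [p|]; [exact: open_box|exact: open0].
apply: (@le_trans _ _ (\sum_(k <oo) (oapp (@box_volume R n) 0 (F k))%:E)%E).
  by apply: ereal_inf_lbound; exists F => //; split.
exact: (ltW Fe).
Qed.

(** Inner regularity follows from outer regularity of the complement: if [B] is a closed cube
    containing [D] and [W] is an open set slightly larger than [B] minus [D], the compact set is [B]
    minus [W]. *)
Lemma leb_inner_compact D (e : R) : measurable (D : set T) -> bounded_set D -> 0 < e ->
  exists K, [/\ compact K, K `<=` D & (L (D `\` K) < e%:E)%E].
Proof.
move=> mD [N [_ DN]] e0.
pose M := `|N| + 1; pose B := ccube (0 : 'rV[R]_n) M.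
have DB : D `<=` B.
  move=> x Dx i; rewrite mxE subr0 (le_trans (rV_coord_le x i))//.
  by apply: DN Dx; rewrite (le_lt_trans (ler_norm N))// ltrDl.
have M0 : 0 <= M by rewrite addr_ge0.
have Bfin : (L B < +oo)%E.
  by apply: (@leb_fin_ball _ 0 (M + 1)); apply: ccube_ball => //; rewrite ltrDl.
have BDfin : (L (B `\` D) < +oo)%E.
  by apply: le_lt_trans Bfin; apply: le_outer_measure; exact: subDsetl.
have e20 : 0 < e / 2 by rewrite divr_gt0.
have [W [oW BW LW]] := leb_outer_open BDfin e20.
have cB : compact B by exact: compact_ccube.
exists (B `\` W); split.
- apply: (subclosed_compact _ cB); last exact: subDsetl.
  by apply: closedI; [exact: compact_closed_rV|exact: open_closedC].
- by move=> x [Bx Wx]; apply: contrapT => nDx; apply: Wx; apply: BW.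
apply: (@le_lt_trans _ _ (e / 2)%:E); last by rewrite lte_fin ltr_pdivrMr// ltr_pMr// ltr1n.
apply: (@le_trans _ _ (L (W `&` D))).
  apply: le_outer_measure => x [Dx nBW]; split=> //; apply: contrapT => nWx.
  by apply: nBW; split=> //; exact: DB.
have H : L.-caratheodory D := mD.
have := LW; rewrite (H W) => HW.
have le1 : (L (B `\` D) <= L (W `&` ~` D))%E.
  by apply: le_outer_measure => x [Bx Dx]; split=> //; apply: BW.
have fin1 : L (B `\` D) \is a fin_num by rewrite ge0_fin_numE// outer_measure_ge0.
have := le_trans HW (leeD2r _ le1).
have fin2 : L (W `&` ~` D) \is a fin_num.
  rewrite ge0_fin_numE ?outer_measure_ge0//; apply: (@le_lt_trans _ _ (L W)).
    by apply: le_outer_measure; exact: subIsetl.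
  by apply: le_lt_trans LW _; rewrite lte_add_pinfty ?ltry.
by rewrite addeC leeD2lE.
Qed.

Lemma rint_abs_cont D f (e : R) : measurable (D : set T) -> rint mu D f -> 0 < e ->
  exists2 d : R, 0 < d & forall A, measurable (A : set T) -> A `<=` D ->
    (L A < d%:E)%E -> \int[mu]_(x in A) `|f x| < e.
Proof.
move=> mD If e0.
have Ig : mu.-integrable setT (EFin \o (f \_ D)).
  have := If; rewrite /rint integrable_mkcond//; apply: eq_integrable => // x _.
  by rewrite /patch/=; case: ifP.
have [d [d0 Hd]] := integral_normr_continuous Ig e0.
exists d => // A mA AD LA; have := Hd A mA LA; congr (_ < _).
by apply: Rint_eq => x Ax; rewrite /patch ifT//; apply/mem_set/AD.
Qed.

Lemma bounded_setS A D : A `<=` D -> bounded_set D -> bounded_set A.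
Proof. by move=> AD [N [Nr HN]]; exists N; split=> // M NM x /AD; exact: HN. Qed.

Lemma bounded_leb_fin D : bounded_set D -> (L D < +oo)%E.
Proof.
move=> [N [_ DN]]; apply: (@leb_fin_ball _ 0 (`|N| + 2)) => x Dx.
rewrite -ball_normE /ball_/= sub0r normrN.
by apply: (@le_lt_trans _ _ (`|N| + 1)); [apply: DN Dx; rewrite (le_lt_trans (ler_norm N))// ltrDl|rewrite ltrD2l ltr1n].
Qed.

Lemma test_bounded U phi : test_fun U phi -> exists2 M, 0 <= M & forall x, `|phi x| <= M.
Proof.
move=> [sp [K [cK _ K0]]].
have cpK : compact (phi @` K).
  by apply: continuous_compact => //; apply: continuous_subspaceT; exact: smooth_continuous.
have [M [_ HM]] := compact_bounded cpK.
exists (`|M| + 1); first by rewrite addr_ge0.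
move=> x; have [Kx|nKx] := pselect (K x); last by rewrite K0// normr0 addr_ge0.
apply: (HM (`|M| + 1)); last by exists x.
by rewrite (le_lt_trans (ler_norm M))// ltrDl.
Qed.

Lemma smooth_measurable D f : measurable (D : set T) -> smooth f ->
  measurable_fun (D : set T) f.
Proof. by move=> mD /smooth_continuous; exact: continuous_measurable_leb. Qed.

Lemma rintM_test D f U phi : measurable (D : set T) -> rint mu D f -> test_fun U phi ->
  rint mu D (fun x => f x * phi x).
Proof.
move=> mD If tp; have [M _ HM] := test_bounded tp.
by apply: (rintMr mD If (smooth_measurable mD (test_fun_smooth tp)) (fun x _ => HM x)).
Qed.

Lemma rint_test D U phi : measurable (D : set T) -> (L D < +oo)%E -> test_fun U phi ->
  rint mu D phi.
Proof.
move=> mD Dfin tp; have [M _ HM] := test_bounded tp.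
apply: (@rint_bounded _ T R mu D phi M);
  [exact: mD|exact: Dfin|exact: (smooth_measurable mD (test_fun_smooth tp))|by move=> x _].
Qed.

(* On the compact sets approximating [0 < f] and [f < 0] from inside, psi is
   the sign of f. *)
Lemma L1_duality U f (e : R) : open U -> bounded_set U -> rint mu U f -> 0 < e ->
  exists psi, [/\ test_fun U psi, forall x, `|psi x| <= 1 &
    \int[mu]_(x in U) `|f x| <= \int[mu]_(x in U) (f x * psi x) + e].
Proof.
move=> oU bU If e0; have mU := open_measurable_leb oU.
have mf := rint_measurable If.
have e40 : 0 < e / 4 by rewrite divr_gt0.
have [d d0 Hd] := rint_abs_cont mU If e40.
pose P := U `&` f @^-1` `]0, +oo[%classic; pose N := U `&` f @^-1` `]-oo, 0[%classic.
have mP : measurable (P : set T) by apply: mf => //; exact: measurable_itv.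
have mN : measurable (N : set T) by apply: mf => //; exact: measurable_itv.
have PU : P `<=` U by exact: subIsetl.
have NU : N `<=` U by exact: subIsetl.
have [K1 [cK1 K1P LK1]] := leb_inner_compact mP (bounded_setS PU bU) d0.
have [K2 [cK2 K2N LK2]] := leb_inner_compact mN (bounded_setS NU bU) d0.
have oU1 : open (U `\` K2) by exact: openD_compact.
have oU2 : open (U `\` K1) by exact: openD_compact.
have K12 x : K1 x -> ~ K2 x.
  move=> /K1P[_ /=]; rewrite in_itv/= andbT => fx /K2N[_ /=].
  by rewrite in_itv/= ltNge ltW.
have K1U : K1 `<=` U `\` K2 by move=> x K1x; split; [exact/PU/K1P|exact: K12].
have K2U : K2 `<=` U `\` K1.
  by move=> x K2x; split; [exact/NU/K2N|move=> /K12].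
have [p1 tp1 [p1b [V1 [_ KV1] V1p]]] := urysohn_test cK1 oU1 K1U.
have [p2 tp2 [p2b [V2 [_ KV2] V2p]]] := urysohn_test cK2 oU2 K2U.
have t1 := test_fun_sub (@subDsetl _ U K2) tp1.
have t2 := test_fun_sub (@subDsetl _ U K1) tp2.
have z2 x : K1 x -> p2 x = 0.
  by move=> K1x; have [_ [C [_ CU C0]]] := tp2; apply: C0 => /CU[].
have z1 x : K2 x -> p1 x = 0.
  by move=> K2x; have [_ [C [_ CU C0]]] := tp1; apply: C0 => /CU[].
pose psi x := p1 x + -1 * p2 x.
have tpsi : test_fun U psi by apply: test_funD => //; exact: test_funZ.
have psi1 x : `|psi x| <= 1.
  by rewrite ler_norml /psi; have := p1b x; have := p2b x; lra.
exists psi; split=> //.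
have mK (K : set 'rV[R]_n) : compact K -> measurable (K : set T).
  by move=> cK; apply: closed_measurable_leb; exact: compact_closed_rV.
pose A1 := P `\` K1; pose A2 := N `\` K2.
have mA1 : measurable (A1 : set T) by apply: measurableD => //; exact: mK.
have mA2 : measurable (A2 : set T) by apply: measurableD => //; exact: mK.
have In : rint mu U (fun x => `|f x|) by exact: rint_norm.
have Ip : rint mu U (fun x => f x * psi x) by exact: rintM_test tpsi.
rewrite -lerBlDl -RintegralB//.
have A12 : A1 `&` A2 = set0.
  apply/seteqP; split=> // x [[[_ /=]]]; rewrite in_itv/= andbT => fx _ [[_ /=]].
  by rewrite in_itv/= ltNge ltW.
have AU : A1 `|` A2 `<=` U by move=> x [[/PU]|[/NU]].
rewrite (@Rint_support _ T R mu U (A1 `|` A2) _ AU); last first.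
  move=> x Ux nA; have [fx|fx|fx] := ltgtP (f x) 0.
  - have Nx : N x by split=> //=; rewrite in_itv.
    have K2x : K2 x by apply: contrapT => nK; apply: nA; right.
    by rewrite /psi z1// V2p ?ltr0_norm//; [ring|exact: KV2].
  - have Px : P x by split=> //=; rewrite in_itv/= fx.
    have K1x : K1 x by apply: contrapT => nK; apply: nA; left.
    by rewrite /psi z2// V1p ?gtr0_norm//; [ring|exact: KV1].
  - by rewrite fx normr0 mul0r subr0.
have mA : measurable (A1 `|` A2 : set T) by exact: measurableU.
have InA := rint_sub mU mA AU In.
have IpA := rint_sub mU mA AU Ip.
apply: (@le_trans _ _ (\int[mu]_(x in A1 `|` A2) (2 * `|f x|))).
  apply: le_Rintegral => //.
  - exact: rintB.
  - exact: rintZ.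
  - move=> x _; rewrite mulr_natl mulr2n lerD2l -mulrN (le_trans (ler_norm _))//.
    by rewrite normrM normrN ler_piMr.
rewrite RintegralZl// Rint_setU//.
have H1 := Hd A1 mA1 (subset_trans (@subDsetl _ _ _) PU) LK1.
have H2 := Hd A2 mA2 (subset_trans (@subDsetl _ _ _) NU) LK2.
lra.
Qed.

Definition L1_approx U f := rint mu U f /\ forall e : R, 0 < e ->
  exists2 p, test_fun U p & \int[mu]_(x in U) `|f x - p x| < e.

Lemma test_fun0 U : test_fun U (fun=> 0).
Proof. by split; [exact: smooth_cst|exists set0; split=> //; exact: compact0]. Qed.

Lemma L1_approxD U f g : measurable (U : set T) -> (L U < +oo)%E ->
  L1_approx U f -> L1_approx U g -> L1_approx U (fun x => f x + g x).
Proof.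
move=> mU Ufin [If Hf] [Ig Hg]; split; first exact: rintD.
move=> e e0; have e20 : 0 < e / 2 by rewrite divr_gt0.
have [p tp fp] := Hf _ e20; have [q tq gq] := Hg _ e20.
exists (fun x => p x + q x); first exact: test_funD.
have Ip := rint_test mU Ufin tp; have Iq := rint_test mU Ufin tq.
have I1 := rint_norm mU (rintB mU If Ip); have I2 := rint_norm mU (rintB mU Ig Iq).
apply: (@le_lt_trans _ _ (\int[mu]_(x in U) (`|f x - p x| + `|g x - q x|))).
  apply: le_Rintegral => //.
  - by apply: rint_norm => //; apply: rintB => //; exact: rintD.
  - exact: rintD.
  - by move=> x _; rewrite opprD addrACA ler_normD.
by rewrite RintegralD//; lra.
Qed.

Lemma L1_approxZ U f (c : R) : measurable (U : set T) -> (L U < +oo)%E ->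
  L1_approx U f -> L1_approx U (fun x => c * f x).
Proof.
move=> mU Ufin [If Hf]; split; first exact: rintZ.
move=> e e0; have c0 : 0 < `|c| + 1 by rewrite ltr_wpDl.
have [p tp fp] := Hf _ (divr_gt0 e0 c0).
exists (fun x => c * p x); first exact: test_funZ.
have Ip := rint_test mU Ufin tp; have I1 := rint_norm mU (rintB mU If Ip).
rewrite (@Rint_eq _ T R mu U _ (fun x => `|c| * `|f x - p x|)); last first.
  by move=> x _; rewrite -mulrBr normrM.
rewrite RintegralZl//; rewrite ltr_pdivlMr// in fp.
apply: le_lt_trans fp; rewrite mulrC ler_wpM2l//; first exact: Rint_ge0.
by rewrite lerDl.
Qed.

Lemma L1_approx_close U f g : measurable (U : set T) -> (L U < +oo)%E -> rint mu U f ->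
  (forall e : R, 0 < e -> exists2 h, L1_approx U h & \int[mu]_(x in U) `|f x - h x| < e) ->
  L1_approx U f.
Proof.
move=> mU Ufin If H; split=> // e e0; have e20 : 0 < e / 2 by rewrite divr_gt0.
have [h [Ih Hh] fh] := H _ e20; have [p tp hp] := Hh _ e20; exists p => //.
have Ip := rint_test mU Ufin tp.
have I1 := rint_norm mU (rintB mU If Ih); have I2 := rint_norm mU (rintB mU Ih Ip).
apply: (@le_lt_trans _ _ (\int[mu]_(x in U) (`|f x - h x| + `|h x - p x|))).
  apply: le_Rintegral => //.
  - by apply: rint_norm => //; apply: rintB.
  - exact: rintD.
  - by move=> x _; rewrite ler_distD.
by rewrite RintegralD//; lra.
Qed.

Lemma rint_indic U A : measurable (U : set T) -> (L U < +oo)%E ->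
  measurable (A : set T) -> rint mu U (\1_A : 'rV[R]_n -> R).
Proof.
move=> mU Ufin mA; apply: (@rint_bounded _ T R mu U _ 1) => //.
by move=> x _; rewrite indicE; case: (x \in A); rewrite ?normr1 ?normr0.
Qed.

Lemma L1_approx_indic U A : open U -> bounded_set U -> measurable (A : set T) ->
  L1_approx U (\1_A : 'rV[R]_n -> R).
Proof.
move=> oU bU mA; have mU := open_measurable_leb oU; have Ufin := bounded_leb_fin bU.
split; first exact: rint_indic.
move=> e e0; have e40 : 0 < e / 4 by rewrite divr_gt0.
have mUA : measurable (U `&` A : set T) by exact: measurableI.
have mUC : measurable (U `\` A : set T) by exact: measurableD.
have [K1 [cK1 K1A LK1]] := leb_inner_compact mUA (bounded_setS (@subIsetl _ _ _) bU) e40.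
have [K2 [cK2 K2A LK2]] := leb_inner_compact mUC (bounded_setS (@subIsetl _ _ _) bU) e40.
have oU1 : open (U `\` K2) by exact: openD_compact.
have K1U : K1 `<=` U `\` K2.
  by move=> x /K1A[Ux Ax]; split=> // /K2A[_ /(_ Ax)].
have [p tp [p01 [V [_ KV] Vp]]] := urysohn_test cK1 oU1 K1U.
have tpU := test_fun_sub (@subDsetl _ _ _) tp.
exists p => //.
have mK (K : set 'rV[R]_n) : compact K -> measurable (K : set T).
  by move=> cK; apply: closed_measurable_leb; exact: compact_closed_rV.
pose A1 := (U `&` A) `\` K1; pose A2 := (U `\` A) `\` K2.
have mA1 : measurable (A1 : set T) by apply: measurableD => //; exact: mK.
have mA2 : measurable (A2 : set T) by apply: measurableD => //; exact: mK.
have A12U : A1 `|` A2 `<=` U by move=> x [[[]]|[[]]].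
have mA12 : measurable (A1 `|` A2 : set T) by exact: measurableU.
have A12fin : (L (A1 `|` A2) < +oo)%E.
  by apply: le_lt_trans Ufin; exact: le_outer_measure.
rewrite (@Rint_support _ T R mu U (A1 `|` A2) _ A12U); last first.
  move=> x Ux nA; rewrite indicE; have [Ax|nAx] := pselect (A x).
    rewrite mem_set// Vp ?subrr ?normr0//; apply: KV; apply: contrapT => nK.
    by apply: nA; left.
  rewrite memNset// (_ : p x = 0) ?subrr ?normr0//.
  have K2x : K2 x by apply: contrapT => nK; apply: nA; right.
  by have [_ [C [_ CU C0]]] := tp; apply: C0 => /CU[].
have Ib : rint mu (A1 `|` A2) (fun x => \1_A x - p x).
  by apply: (rint_sub mU) => //; apply: rintB => //; [exact: rint_indic|exact: rint_test tpU].
apply: (@le_lt_trans _ _ (1 * fine (mu (A1 `|` A2)))).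
  apply: (le_trans (ler_norm _)).
  apply: (@Rint_bound _ T R mu _ _ 1 mA12 A12fin).
    exact: (rint_measurable (rint_norm mA12 Ib)).
  move=> x _; rewrite normr_id indicE; have := p01 x.
  by case: (x \in A); rewrite ler_norml /=; lra.
rewrite mul1r -lte_fin fineK; last by rewrite ge0_fin_numE.
apply: (@le_lt_trans _ _ (L A1 + L A2)%E); first exact: outer_measureU2.
apply: (lt_trans (lteD LK1 LK2)).
by rewrite -EFinD lte_fin; lra.
Qed.

Lemma L1_density U f : open U -> bounded_set U -> rint mu U f -> L1_approx U f.
Proof.
move=> oU bU If; have mU := open_measurable_leb oU; have Ufin := bounded_leb_fin bU.
apply: L1_approx_close => // e e0.
have [g [Ig _ gf]] := approximation_sfun_integrable mU If.
have /fine_cvgP[gfin /cvgrPdist_lt/(_ _ e0)] := gf.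
move=> near_g; have [N _ /(_ N (leqnn N))/= H] := filterI gfin near_g.
exists (HBSimple.SimpleFun.sort (g N)).
  have -> : HBSimple.SimpleFun.sort (g N) = fun x => \sum_(y <- fset_set (range (g N))) y * \1_(g N @^-1` [set y]) x.
    apply/funext => x; rewrite fimfunE fsbig_finite//=; exact: fimfunP.
  elim: (fset_set _ : seq _) => [|y s IH].
    rewrite (_ : (fun x => _) = fun=> 0); last by apply/funext => x; rewrite big_nil.
    split; first by apply: (@rint_bounded _ T R mu U _ 0) => // x _; rewrite normr0.
    move=> r r0; exists (fun=> 0); first exact: test_fun0.
    rewrite (@Rint_eq _ T R mu U _ (fun=> 0)) ?Rintegral_cst ?mul0r// => x _.
    by rewrite subrr normr0.
  rewrite (_ : (fun x => _) = fun x => y * \1_(g N @^-1` [set y]) x +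
      \sum_(y <- s) y * \1_(g N @^-1` [set y]) x); last first.
    by apply/funext => x; rewrite big_cons.
  apply: L1_approxD => //; apply: L1_approxZ => //; apply: L1_approx_indic => //.
have [_ H2] := H; rewrite sub0r normrN in H2.
apply: le_lt_trans H2; apply: le_trans (ler_norm _).
exact: lexx.
Qed.

Lemma smooth_line psi y i t : smooth psi ->
  is_derive (t : R) (1 : R) (fun t : R => psi (y + t *: delta_mx 0 i))
    (partial i psi (y + t *: delta_mx 0 i)).
Proof.
move=> sp; have [dp] := smooth_is_derive i (y + t *: delta_mx 0 i) sp.
have E : (fun h : R => h^-1 *: ((fun t : R => psi (y + t *: delta_mx 0 i)) (h *: (1 : R) + t) -
   psi (y + t *: delta_mx 0 i))) = (fun h : R => h^-1 *: (psi (h *: delta_mx 0 i +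
     (y + t *: delta_mx 0 i)) - psi (y + t *: delta_mx 0 i))).
  by apply/funext => h; rewrite /= scaler1 scalerDl addrCA.
move=> <-; split; first by rewrite /derivable E.
by rewrite /partial /derive E.
Qed.

(** The derivative falls on the test function, so [f] need only be integrable: a bound [M] on
    [partial i psi] gives the dominating function [M * |f|]. *)
Lemma derive_shift_integral U f psi V i t : measurable (U : set T) -> rint mu U f ->
  test_fun V psi ->
  is_derive (t : R) (1 : R) (fun t => \int[mu]_(x in U) (f x * psi (x + t *: delta_mx 0 i)))
    (\int[mu]_(x in U) (f x * partial i psi (x + t *: delta_mx 0 i))).
Proof.
move=> mU If tp; have tpi := test_fun_partial i tp.
have [M M0 HM] := test_bounded tpi.
have ts s : test_fun [set: 'rV[R]_n] (fun x => psi (x + s *: delta_mx 0 i)).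
  have := @test_fun_shift R n V setT psi (- (s *: delta_mx 0 i)) tp (fun _ _ => I).
  by congr test_fun; apply/funext => x; rewrite opprK.
pose h (s : R) (x : 'rV[R]_n) := f x * psi (x + s *: delta_mx 0 i).
have dh s x : is_derive (s : R) (1 : R) (h ^~ x) (f x * partial i psi (x + s *: delta_mx 0 i)).
  have := is_deriveM (is_derive_cst (f x) (s : R) (1 : R)) (smooth_line x i s (test_fun_smooth tp)).
  by rewrite /GRing.scale/= mulr0 addr0.
have ti : `]t - 1, t + 1[%classic t by rewrite /= in_itv/=; lra.
have Ih s : `]t - 1, t + 1[%classic s -> mu.-integrable U (EFin \o h s).
  by move=> _; exact: (rintM_test mU If (ts s)).
have IG : mu.-integrable U (EFin \o (fun x => M * `|f x|)).
  by apply: rintZ => //; exact: rint_norm.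
have dd s x : `]t - 1, t + 1[%classic s -> U x -> derivable (h ^~ x) s 1.
  by move=> _ _; have [] := dh s x.
have G0 x : 0 <= M * `|f x| by rewrite mulr_ge0.
have Gb s x : `]t - 1, t + 1[%classic s -> U x -> `|partial1of2 h s x| <= M * `|f x|.
  move=> _ _; rewrite partial1of2E; have [_ ->] := dh s x.
  by rewrite normrM mulrC ler_wpM2r.
split; first exact: (@derivable_under_integral _ _ _ mu h U mU t _ _ ti Ih dd _ G0 IG Gb).
have := @differentiation_under_integral _ _ _ mu h U mU t _ _ ti Ih dd _ G0 IG Gb.
rewrite derive1E => ->; apply: Rint_eq => x _.
by rewrite partial1of2E; have [_ ->] := dh t x.
Qed.

Lemma preshiftK v D : preshift (- v) (preshift v D) = D.
Proof. by apply/seteqP; split=> x; rewrite /preshift/= subrK. Qed.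

Lemma rint_unshift v D f : measurable (preshift v D : set T) ->
  rint mu (preshift v D) f -> rint mu D (fun x => f (x - v)).
Proof.
by move=> mD If; have := rint_shift (- v) mD If; rewrite preshiftK.
Qed.

(** Only the support of [phi], translated on the left-hand side, contributes to the integrals; this
    is why the domains [U] and [W] may differ. *)
Lemma Rint_test_shift U V W phi f v : measurable (U : set T) -> measurable (W : set T) ->
  rint mu U f -> test_fun V phi -> V `<=` W -> preshift v V `<=` U ->
  \int[mu]_(x in U) (f x * phi (x + v)) = \int[mu]_(x in W) (f (x - v) * phi x).
Proof.
move=> mU mW If tp VW VU; have [_ [K [cK KV K0]]] := tp.
have mK : measurable (K : set T).
  by apply: closed_measurable_leb; exact: compact_closed_rV.
have mpK := measurable_preshift v mK.
have pKU : preshift v K `<=` U by move=> x Kx; apply: VU; exact: KV.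
have KW : K `<=` W by move=> x /KV/VW.
have IpK := rint_sub mU mpK pKU If.
have IK : rint mu K (fun x => f (x - v) * phi x).
  by apply: rintM_test tp => //; exact: rint_unshift.
rewrite (@Rint_support _ T R mu U (preshift v K) _ pKU); last first.
  by move=> x _ nK; rewrite K0 ?mulr0.
rewrite (@Rint_support _ T R mu W K _ KW); last first.
  by move=> x _ nK; rewrite K0 ?mulr0.
rewrite -(Rint_shift v mK IK); apply: (@Rint_eq _ T R mu) => x _.
by rewrite addrK.
Qed.

Lemma compact_sub_ball K : compact K -> exists2 N : R, 0 < N & K `<=` ball 0 N.
Proof.
move=> /compact_bounded[M [_ HM]]; exists (`|M| + 2); first by rewrite ltr_wpDl.
move=> x Kx; rewrite -ball_normE /ball_/= sub0r normrN.
apply: (@le_lt_trans _ _ (`|M| + 1)); last by rewrite ltrD2l ltr1n.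
by apply: HM Kx; rewrite (le_lt_trans (ler_norm M))// ltrDl.
Qed.

Lemma norm_delta_le i : `|delta_mx 0 i : 'rV[R]_n| <= 1.
Proof.
apply: rV_norm_le => // j; rewrite mxE /=.
by case: (j == i); rewrite ?normr1 ?normr0.
Qed.

(** Over a large cube the integral of [phi (x + t e_i)] is constant for small [t] by translation
    invariance, and its derivative at 0 is the integral of the partial derivative. Fubini's theorem
    is thereby avoided. *)
Lemma Rint_partial0 U phi i : test_fun U phi -> \int[mu]_(x in U) partial i phi x = 0.
Proof.
move=> tp; have [_ [K [cK KU K0]]] := tp.
have [_ [K' [cK' KU' K0']]] := test_fun_partial i tp.
have [N N0 KN] := compact_sub_ball (compactU cK cK').
have tpN : test_fun (ball (0 : 'rV[R]_n) N) phi.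
  by split; [exact: test_fun_smooth tp|exists K; split=> // x Kx; apply: KN; left].
pose B : set 'rV[R]_n := ball 0 (N + 1).
have NB : ball 0 N `<=` B by apply: le_ball; rewrite lerDl.
have K'B : K' `<=` B by move=> x Kx; apply/NB/KN; right.
have mB : measurable (B : set T) by exact: measurable_ball_leb.
have Bfin : (L B < +oo)%E by exact: leb_ball_fin.
rewrite (@Rint_support _ T R mu U K' _ KU'); last by move=> x _ /K0'.
rewrite -(@Rint_support _ T R mu B K' _ K'B); last by move=> x _ /K0'.
have I1 : rint mu B (fun=> 1).
  by apply: (@rint_bounded _ T R mu B _ 1 mB Bfin) => // x _; rewrite normr1.
have [_] := derive_shift_integral i 0 mB I1 tpN.
rewrite (@near_eq_derive _ _ _ _ (cst (\int[mu]_(x in B) (1 * phi x)))); last first.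
  apply/nbhs_ballP; exists 1 => //= t; rewrite /ball/= sub0r normrN => t1.
  rewrite (Rint_test_shift mB mB I1 tpN NB)// => x.
  rewrite /preshift/= /B -!ball_normE /ball_/= !sub0r !normrN => xt.
  rewrite -(addrK (t *: delta_mx 0 i) x) (le_lt_trans (ler_normB _ _))// ltr_leD//.
  by rewrite normrZ (le_trans (ler_wpM2l _ (norm_delta_le i)))// mulr1 ltW.
rewrite derive_cst => E; rewrite [RHS]E; apply: (@Rint_eq _ T R mu) => x _.
by rewrite scale0r addr0 mul1r.
Qed.

End lebesgue_integral.

(** * Translations and the Poincare inequality *)

Section shift_estimates.
Context (R : realType) (n : nat).
Implicit Types (x y v : 'rV[R]_n) (r s : R) (O U V K : set 'rV[R]_n)
  (f g phi psi : 'rV[R]_n -> R).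
Local Notation L := (@leb_outer R n).
Local Notation T := (lebT R n).
Local Notation mu := (@leb R n).
Local Notation e_ i := (delta_mx 0 i : 'rV[R]_n).

(* Mean value theorem for t |-> int_O g psi(. + t s e_i), then duality in psi. *)
Lemma shift_duality O V g b i s (B : R) : open O -> bounded_set O -> open V ->
  rint mu O g -> rint mu V b ->
  (forall y t, V y -> 0 <= t <= 1 -> O (y - (t * s) *: e_ i)) ->
  (forall t psi, 0 <= t <= 1 -> test_fun V psi -> (forall x, `|psi x| <= 1) ->
    `|s * \int[mu]_(y in O) (g y * partial i psi (y + (t * s) *: e_ i))
      + \int[mu]_(y in V) (b y * psi y)| <= B) ->
  \int[mu]_(y in V) `|g (y - s *: e_ i) - g y + b y| <= B.
Proof.
move=> oO bO oV Ig Ib VO HB.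
have mO := open_measurable_leb oO; have mV := open_measurable_leb oV.
have VsubO : V `<=` O.
  by move=> y Vy; have := VO y 0 Vy; rewrite mul0r scale0r subr0 lexx ler01; apply.
have pVO t : 0 <= t <= 1 -> preshift ((t * s) *: e_ i) V `<=` O.
  by move=> t01 y /VO/(_ t01); rewrite addrK.
have bV := bounded_setS VsubO bO.
have mpV := measurable_preshift (s *: e_ i) mV.
have pV1 : preshift (s *: e_ i) V `<=` O.
  by have := pVO 1; rewrite mul1r lexx ler01; apply.
have Igs : rint mu V (fun y => g (y - s *: e_ i)).
  by apply: rint_unshift => //; exact: (rint_sub mO mpV pV1 Ig).
have IgV := rint_sub mO mV VsubO Ig.
have Isub := rintB mV Igs IgV.
have IF := rintD mV Isub Ib.
apply/ler_addgt0Pr => e e0.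
have [psi [tp psi1 Hpsi]] := L1_duality oV bV IF e0.
apply: (le_trans Hpsi); rewrite lerD2r.
pose H (t : R) := \int[mu]_(y in O) (g y * psi (y + (t * s) *: e_ i)).
have dH t : is_derive (t : R) (1 : R) H
    (s * \int[mu]_(y in O) (g y * partial i psi (y + (t * s) *: e_ i))).
  have H1 := derive_shift_integral i (t * s) mO Ig tp.
  have H2 : is_derive (t : R) (1 : R) (fun t => t * s) s.
    apply: (is_derive_eq (is_deriveM (is_derive_id t (1 : R)) (is_derive_cst s t (1 : R)))).
    by rewrite /GRing.scale/= mulr0 add0r mulr1.
  rewrite mulrC.
  exact: (@is_derive1_comp _ (fun t => \int[mu]_(y in O) (g y * psi (y + t *: e_ i)))
    (fun t => t * s) t _ _ H1 H2).
have HE t : 0 <= t <= 1 -> H t = \int[mu]_(y in V) (g (y - (t * s) *: e_ i) * psi y).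
  move=> t01; apply: (Rint_test_shift mO mV Ig tp) => //; exact: pVO.
have cH : {within `[0, 1], continuous H}.
  apply: continuous_subspaceT => t.
  by apply: differentiable_continuous; apply/derivable1_diffP; exact: ex_derive.
have [c c01 Hc] := MVT (@ltr01 R) (fun t _ => dH t) cH.
have {}c01 : 0 <= c <= 1 by move: c01; rewrite in_itv/= => /andP[/ltW-> /ltW->].
have := HB c psi c01 tp psi1; move: Hc; rewrite subr0 mulr1 => <-.
rewrite !HE ?lexx ?ler01// mul1r mul0r => HB'.
have I1 := rintM_test mV Igs tp; have I2 := rintM_test mV IgV tp.
have I3 := rintM_test mV Ib tp.
have E2 : \int[mu]_(y in V) (g (y - 0 *: e_ i) * psi y) = \int[mu]_(y in V) (g y * psi y).
  by apply: (@Rint_eq _ T R mu) => y _; rewrite scale0r subr0.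
rewrite E2 -RintegralB// -RintegralD// in HB'; last by exact: (rintB mV I1 I2).
apply: le_trans (le_trans (ler_norm _) HB').
rewrite le_eqVlt; apply/orP; left; apply/eqP.
by apply: (@Rint_eq _ T R mu) => y _; rewrite mulrDl mulrBl.
Qed.

Lemma is_derive_linear (xi : 'rV[R]_n) (c : R) i x :
  is_derive x (e_ i) (fun x => dot xi x + c) (xi 0 i).
Proof.
apply: is_derive_line.
rewrite (_ : (fun t => _) = fun t => t * xi 0 i + (dot xi x + c)); last first.
  apply/funext => t; rewrite dotDr dotZr -addrA; congr (_ * _ + _).
  rewrite /dot (bigD1 i)//= big1 ?addr0 ?mxE ?eqxx ?mulr1// => j ji.
  by rewrite mxE (negbTE ji) andbF mulr0.
apply: (is_derive_eq (is_deriveD (is_deriveM (is_derive_id (0 : R) (1 : R))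
  (is_derive_cst (xi 0 i) (0 : R) (1 : R))) (is_derive_cst (dot xi x + c) (0 : R) (1 : R)))).
by rewrite /GRing.scale/= mulr0 add0r addr0 mulr1.
Qed.

Lemma partial_linear (xi : 'rV[R]_n) (c : R) i :
  partial i (fun x => dot xi x + c) = fun=> xi 0 i.
Proof.
by apply/funext => x; rewrite /partial; have [_ ->] := is_derive_linear xi c i x.
Qed.

Lemma linear_continuous (xi : 'rV[R]_n) (c : R) : continuous (fun x => dot xi x + c).
Proof.
move=> x; apply: continuousD; last exact: cst_continuous.
rewrite /dot; elim: (index_enum _) => [|l q IH].
  rewrite (_ : (fun y => _) = (fun=> 0)); first exact: cst_continuous.
  by apply/funext => y; rewrite big_nil.
rewrite (_ : (fun y => _) = (fun y : 'rV[R]_n => xi 0 l * y 0 l +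
    \sum_(l <- q) xi 0 l * y 0 l)); last by apply/funext => y; rewrite big_cons.
apply: continuousD => //; apply: continuousM; first exact: cst_continuous.
exact: coord_continuous.
Qed.

Lemma linear_smooth (xi : 'rV[R]_n) (c : R) : smooth (fun x => dot xi x + c).
Proof.
apply: (@smooth_coind R n [set f | exists xi c, f = fun x => dot xi x + c]); last first.
  by exists xi, c.
move=> _ [{}xi [{}c ->]]; split=> [|i]; first exact: linear_continuous.
split=> [x|]; first by have [] := is_derive_linear xi c i x.
exists 0, (xi 0 i); rewrite partial_linear; apply/funext => x.
by rewrite /dot big1 ?add0r// => j _; rewrite mxE mul0r.
Qed.

Lemma Rint_linear_partial U phi (xi : 'rV[R]_n) (c : R) i : measurable (U : set T) ->
  (L U < +oo)%E -> test_fun U phi ->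
  \int[mu]_(x in U) ((dot xi x + c) * partial i phi x) =
  - (xi 0 i * \int[mu]_(x in U) phi x).
Proof.
move=> mU Ufin tp; have sl := linear_smooth xi c; have sp := test_fun_smooth tp.
have tpl := test_funMr tp sl.
have := Rint_partial0 i tpl; rewrite (partialM i sp sl) partial_linear.
have I1 := rint_test mU Ufin (test_funMr (test_fun_partial i tp) sl).
have I2 := rint_test mU Ufin (test_funMr tp (@smooth_cst R n (xi 0 i))).
have Ip := rint_test mU Ufin tp.
rewrite RintegralD// RintegralZr// => /eqP; rewrite addr_eq0 => /eqP E.
rewrite mulrC -E; apply: (@Rint_eq _ T R mu) => x _; exact: mulrC.
Qed.

(* Only the size of the singular part enters: [sigma] dominates the difference
   between the distributional gradient of u and [a] times Lebesgue measure. *)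
Definition bv_on U u (a : 'I_n -> 'rV[R]_n -> R)
    (sigma : {finite_measure set (borelT 'rV[R]_n) -> \bar R}) :=
  [/\ rint mu U u, forall i, rint mu U (a i) &
    forall O phi i, open O -> O `<=` U -> test_fun O phi ->
      (forall x, `|phi x| <= 1) ->
      `|\int[mu]_(x in U) (u x * partial i phi x) + \int[mu]_(x in U) (a i x * phi x)|
        <= fine (sigma O)].

Lemma bv_on_sub U V u a sigma : open U -> open V -> V `<=` U ->
  bv_on U u a sigma -> bv_on V u a sigma.
Proof.
move=> oU oV VU [Iu Ia H].
have mU := open_measurable_leb oU; have mV := open_measurable_leb oV.
split; first exact: (rint_sub mU mV VU Iu).
  by move=> i; exact: (rint_sub mU mV VU (Ia i)).
move=> W phi i oW WV tp p1.
have := H W phi i oW (subset_trans WV VU) tp p1.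
have [_ [K [_ KW K0]]] := test_fun_partial i tp.
have [_ [K' [_ KW' K0']]] := tp.
rewrite (@Rint_support _ T R mu U V _ VU); last first.
  by move=> x _ nV; rewrite K0 ?mulr0// => /KW/WV.
rewrite [X in _ + X](@Rint_support _ T R mu U V _ VU)//.
by move=> x _ nV; rewrite K0' ?mulr0// => /KW'/WV.
Qed.

Lemma bv_on_affine U u a sigma (xi : 'rV[R]_n) (c : R) : open U -> bounded_set U ->
  bv_on U u a sigma ->
  bv_on U (fun x => u x - (dot xi x + c)) (fun i x => a i x - xi 0 i) sigma.
Proof.
move=> oU bU [Iu Ia H].
have mU := open_measurable_leb oU; have Ufin := bounded_leb_fin bU.
have Icst (k : R) : rint mu U (fun=> k).
  by apply: (@rint_bounded _ T R mu U _ `|k| mU Ufin).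
have Il : rint mu U (fun x => dot xi x + c).
  have [N _ UN] : exists2 N : R, 0 < N & forall x, U x -> `|x| <= N.
    have [M [_ HM]] := bU; exists (`|M| + 1); first by rewrite ltr_wpDl.
    by move=> x; apply: HM; rewrite (le_lt_trans (ler_norm M))// ltrDl.
  apply: (@rint_bounded _ T R mu U _ (n%:R * `|xi| * N + `|c|) mU Ufin).
    by apply: continuous_measurable_leb => //; exact: linear_continuous.
  move=> x Ux; rewrite (le_trans (ler_normD _ _))// lerD2r (le_trans (dot_le _ _))//.
  by rewrite ler_wpM2l ?mulr_ge0// UN.
split=> [|i|W phi i oW WU tp p1]; first exact: rintB.
  by apply: rintB => //.
have tpU := test_fun_sub WU tp.
have I1 := rintM_test mU Iu (test_fun_partial i tpU).
have I2 := rintM_test mU Il (test_fun_partial i tpU).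
have I3 := rintM_test mU (Ia i) tpU; have I4 := rintM_test mU (Icst (xi 0 i)) tpU.
have Ip := rint_test mU Ufin tpU.
have := H W phi i oW WU tp p1; congr (`|_| <= _).
have -> : \int[mu]_(x in U) ((u x - (dot xi x + c)) * partial i phi x) =
    \int[mu]_(x in U) (u x * partial i phi x) -
    \int[mu]_(x in U) ((dot xi x + c) * partial i phi x).
  by rewrite -RintegralB//; apply: (@Rint_eq _ T R mu) => x _; rewrite mulrBl.
have -> : \int[mu]_(x in U) ((a i x - xi 0 i) * phi x) =
    \int[mu]_(x in U) (a i x * phi x) - xi 0 i * \int[mu]_(x in U) phi x.
  rewrite -RintegralZl// -RintegralB//.
  by apply: (@Rint_eq _ T R mu) => x _; rewrite mulrBl.
by rewrite Rint_linear_partial//; ring.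
Qed.

End shift_estimates.

Lemma rint_patch d (T : measurableType d) (R : realType) (mu : {measure set T -> \bar R})
    (D E : set T) (f : T -> R) : measurable D -> measurable E ->
  rint mu (D `&` E) f -> rint mu D (f \_ E).
Proof.
move=> mD mE; rewrite /rint integrable_mkcond; last exact: measurableI.
rewrite [X in _ -> X]integrable_mkcond//; apply: eq_integrable => // x _.
rewrite /patch /= in_setI; case: (x \in D) => //=.
by case: ifP.
Qed.

Section poincare.
Context (R : realType) (n : nat).
Implicit Types (x y v : 'rV[R]_n) (r s : R) (O U V K : set 'rV[R]_n)
  (f g phi psi : 'rV[R]_n -> R).
Local Notation L := (@leb_outer R n).
Local Notation T := (lebT R n).
Local Notation mu := (@leb R n).
Local Notation e_ i := (delta_mx 0 i : 'rV[R]_n).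

Lemma preshift_test U V phi v : test_fun V phi -> preshift v V `<=` U ->
  test_fun U (fun x => phi (x + v)).
Proof.
move=> tp VU.
have H y : V y -> U (y - v) by move=> Vy; apply: VU; rewrite /preshift/= subrK.
by have := test_fun_shift tp H; congr test_fun; apply/funext => y; rewrite opprK.
Qed.

Lemma partial_translate f v i : partial i (fun x => f (x + v)) = fun x => partial i f (x + v).
Proof.
have := partial_shift f (- v) i.
by congr (partial i _ = _); apply/funext => y; rewrite opprK.
Qed.

Lemma rint_shift_sub O V f v : open O -> open V -> preshift v V `<=` O ->
  rint mu O f -> rint mu V (fun y => f (y - v)).
Proof.
move=> oO oV VO If; have mO := open_measurable_leb oO; have mV := open_measurable_leb oV.
have mpV := measurable_preshift v mV.
by apply: rint_unshift => //; exact: (rint_sub mO mpV VO If).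
Qed.

Lemma variation_shift O V g i s (B : R) : open O -> bounded_set O -> open V ->
  rint mu O g ->
  (forall y t, V y -> 0 <= t <= 1 -> O (y - (t * s) *: e_ i)) ->
  (forall psi, test_fun O psi -> (forall x, `|psi x| <= 1) ->
    `|\int[mu]_(y in O) (g y * partial i psi y)| <= B) ->
  \int[mu]_(y in V) `|g (y - s *: e_ i) - g y| <= `|s| * B.
Proof.
move=> oO bO oV Ig VO HB.
have mO := open_measurable_leb oO; have mV := open_measurable_leb oV.
have I0 : rint mu V (fun=> 0) by exact: integrable0.
have := @shift_duality R n O V g (fun=> 0) i s (`|s| * B) oO bO oV Ig I0 VO.
rewrite (@Rint_eq _ T R mu V _ (fun y => `|g (y - s *: e_ i) - g y|)); last first.
  by move=> y _; rewrite addr0.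
apply=> t psi t01 tp p1.
rewrite [X in _ + X](@Rint_eq _ T R mu V _ (fun=> 0)); last by move=> y _; rewrite mul0r.
rewrite Rintegral_cst// mul0r addr0 normrM ler_wpM2l//.
have pVO : preshift ((t * s) *: e_ i) V `<=` O by move=> y /VO/(_ t01); rewrite addrK.
have tq := preshift_test tp pVO.
by have := HB _ tq (fun x => p1 _); rewrite partial_translate.
Qed.

(** A first-order Taylor formula in L1. The error is [|s|] times the mass of the singular part plus
    the L1 modulus of continuity [W] of the density under translations. *)
Lemma bv_shift U V u a sigma i s (W : R) : open U -> bounded_set U -> open V ->
  bv_on U u a sigma ->
  (forall y t, V y -> 0 <= t <= 1 -> U (y - (t * s) *: e_ i)) ->
  (forall t, 0 <= t <= 1 ->
    \int[mu]_(y in V) `|a i (y - (t * s) *: e_ i) - a i y| <= W) ->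
  \int[mu]_(y in V) `|u (y - s *: e_ i) - u y + s * a i y| <= `|s| * (fine (sigma U) + W).
Proof.
move=> oU bU oV [Iu Ia H] VU HW.
have mU := open_measurable_leb oU; have mV := open_measurable_leb oV.
have VsubU : V `<=` U.
  by move=> y Vy; have := VU y 0 Vy; rewrite mul0r scale0r subr0 lexx ler01; apply.
have IaV := rint_sub mU mV VsubU (Ia i).
apply: (shift_duality oU bU oV Iu (rintZ s mV IaV) VU) => t psi t01 tp p1.
have pVU : preshift ((t * s) *: e_ i) V `<=` U by move=> y /VU/(_ t01); rewrite addrK.
have tq := preshift_test tp pVU.
have := H U _ i oU (@subset_refl _ U) tq (fun x => p1 _).
rewrite (Rint_test_shift mU mV (Ia i) tp (@subset_refl _ V) pVU).
rewrite partial_translate.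
have Ish : rint mu V (fun y => a i (y - (t * s) *: e_ i)) by apply: rint_shift_sub oU oV pVU (Ia i).
have I1 := rintM_test mV Ish tp; have I2 := rintM_test mV IaV tp.
set A := \int[mu]_(y in U) _; set B := \int[mu]_(y in V) _ => AB.
rewrite (@Rint_eq _ T R mu V _ (fun y => s * (a i y * psi y))); last first.
  by move=> y _; rewrite mulrA.
rewrite RintegralZl// -mulrDr normrM ler_wpM2l//.
set C := \int[mu]_(y in V) _.
have BC : `|C - B| <= W.
  rewrite /C /B -RintegralB//; apply: le_trans (HW t t01).
  apply: Rint_norm_le => //; first exact: rintB.
    by apply: rint_norm => //; exact: rintB.
  by move=> y _; rewrite -mulrBl normrM distrC ler_piMr.
rewrite (_ : A + C = (A + B) + (C - B)); last by ring.
by rewrite (le_trans (ler_normD _ _))// lerD.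
Qed.

Lemma coord_lipschitz p i M y s : smooth p -> (forall x, `|partial i p x| <= M) ->
  `|p (y + s *: e_ i) - p y| <= `|s| * M.
Proof.
move=> sp HM; have M0 : 0 <= M by exact: le_trans (HM 0).
pose q (t : R) := p (y + t *: e_ i).
have dq t : is_derive (t : R) (1 : R) q (partial i p (y + t *: e_ i)) by exact: smooth_line.
have cq : continuous q.
  by move=> t; apply: differentiable_continuous; apply/derivable1_diffP; exact: ex_derive.
have qd a b : a < b -> `|q b - q a| <= (b - a) * M.
  move=> ab; have [c _ ->] := MVT ab (fun t _ => dq t) (continuous_subspaceT cq).
  by rewrite normrM (gtr0_norm (_ : 0 < b - a)) ?subr_gt0// mulrC ler_wpM2l// subr_ge0 ltW.
have -> : p (y + s *: e_ i) - p y = q s - q 0 by rewrite /q scale0r addr0.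
have [s0|s0|->] := ltgtP s 0; last by rewrite subrr normr0 mul0r.
  by have := qd _ _ s0; rewrite sub0r distrC (ltr0_norm s0).
by have := qd _ _ s0; rewrite subr0 (gtr0_norm s0).
Qed.

Lemma translation_continuity U V f i : open U -> bounded_set U -> open V -> rint mu U f ->
  forall e : R, 0 < e -> exists2 d : R, 0 < d & forall s, `|s| < d ->
    preshift (s *: e_ i) V `<=` U -> V `<=` U ->
    \int[mu]_(y in V) `|f (y - s *: e_ i) - f y| <= e.
Proof.
move=> oU bU oV If e e0.
have mU := open_measurable_leb oU; have mV := open_measurable_leb oV.
have Ufin := bounded_leb_fin bU.
have e40 : 0 < e / 4 by rewrite divr_gt0.
have [_ /(_ _ e40)[p tp fp]] := L1_density oU bU If.
have tpi := test_fun_partial i tp.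
have [M M0 HM] := test_bounded tpi.
pose k := M * fine (L U) + 1.
have k0 : 0 < k by rewrite ltr_wpDl// mulr_ge0// fine_ge0// outer_measure_ge0.
exists (e / 2 / k); first by rewrite !divr_gt0.
move=> s sd pVU VU.
have Ip := rint_test mU Ufin tp.
have Ifp := rint_norm mU (rintB mU If Ip).
have Is g : rint mu U g -> rint mu V (fun y => g (y - s *: e_ i)).
  exact: rint_shift_sub oU oV pVU.
have IV g : rint mu U g -> rint mu V g by exact: rint_sub mU mV VU.
have plip y : `|p (y - s *: e_ i) - p y| <= `|s| * M.
  by rewrite -scaleNr -(normrN s); apply: coord_lipschitz => //; exact: test_fun_smooth tp.
apply: (@le_trans _ _ (\int[mu]_(y in V) (`|f (y - s *: e_ i) - p (y - s *: e_ i)| +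
   (`|f y - p y| + `|s| * M)))).
  apply: le_Rintegral => //.
  - by apply: rint_norm => //; apply: rintB => //; [exact: Is|exact: IV].
  - apply: rintD => //; first exact: (Is (fun y => `|f y - p y|)).
    apply: rintD => //; first exact: IV.
    apply: (@rint_bounded _ T R mu V _ `|(`|s| * M)| mV) => //.
    by apply: le_lt_trans Ufin; exact: le_outer_measure.
  move=> y _.
  have := plip y; have := ler_normD (f (y - s *: e_ i) - p (y - s *: e_ i)) ((p (y - s *: e_ i) - p y) + (p y - f y)).
  have := ler_normD (p (y - s *: e_ i) - p y) (p y - f y).
  rewrite (distrC (p y) (f y)).
  by rewrite (_ : _ + (_ + (p y - f y)) = f (y - s *: e_ i) - f y); [lra|ring].
have Vfin : (L V < +oo)%E by apply: le_lt_trans Ufin; exact: le_outer_measure.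
have Ic : rint mu V (fun=> `|s| * M).
  by apply: (@rint_bounded _ T R mu V _ `|(`|s| * M)| mV).
rewrite RintegralD//; [|exact: (Is (fun y => `|f y - p y|))|by apply: rintD => //; exact: IV].
rewrite RintegralD//; last exact: IV.
rewrite Rintegral_cst//.
have mpV := measurable_preshift (s *: e_ i) mV.
have E1 : \int[mu]_(y in V) `|f (y - s *: e_ i) - p (y - s *: e_ i)| <= e / 4.
  apply: le_trans (ltW fp).
  apply: le_trans (Rint_sub mU mpV pVU Ifp _); last by [].
  rewrite -(Rint_shift (s *: e_ i) mV (Is (fun y => `|f y - p y|) Ifp)).
  rewrite le_eqVlt; apply/orP; left; apply/eqP.
  by apply: (@Rint_eq _ T R mu) => y _; rewrite addrK.
have E2 : \int[mu]_(y in V) `|f y - p y| <= e / 4.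
  by apply: le_trans (ltW fp); apply: (Rint_sub mU mV VU Ifp).
have E3 : `|s| * M * fine (mu V) <= e / 2.
  have fV : fine (mu V) <= fine (L U).
    by apply: fine_le; rewrite ?ge0_fin_numE ?outer_measure_ge0//; exact: le_outer_measure.
  rewrite ltr_pdivlMr// in sd.
  apply: le_trans (ltW sd); rewrite -mulrA ler_wpM2l//.
  apply: (le_trans (ler_wpM2l M0 fV)); by rewrite lerDl.
by lra.
Qed.

(** The successive corners of an axis-parallel path from 0 to [v], indexed by the coordinates
    already travelled. *)
Definition psum v (q : seq 'I_n) : 'rV[R]_n := \sum_(i <- q) v 0 i *: e_ i.

Lemma psumE v q j : uniq q -> psum v q 0 j = (j \in q)%:R * v 0 j.
Proof.
elim: q => [|i q IH]; first by rewrite /psum big_nil mxE mul0r.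
rewrite /psum big_cons !mxE => /andP[iq uq]; have := IH uq; rewrite /psum => ->.
rewrite inE eqxx; have [->|ji] := eqVneq j i.
  by rewrite (negbTE iq)/=; ring.
by rewrite /=; ring.
Qed.

Lemma psum_enum v : psum v (enum 'I_n) = v.
Proof. by apply/rowP => j; rewrite psumE ?enum_uniq// mem_enum mul1r. Qed.

Lemma test_lipschitz U p : test_fun U p ->
  exists2 M, 0 <= M & forall y z, `|p y - p z| <= M * `|y - z|.
Proof.
move=> tp; have sp := test_fun_smooth tp.
have /choice[M HM] i : exists M : R, 0 <= M /\ forall x, `|partial i p x| <= M.
  by have [M M0 HM] := test_bounded (test_fun_partial i tp); exists M.
exists (\sum_i M i); first by apply: sumr_ge0 => i _; exact: (HM i).1.
move=> z y; rewrite -(subrK y z) addrK; set v := z - y.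
have H q : `|p (psum v q + y) - p y| <= \sum_(i <- q) `|v| * M i.
  elim: q => [|i q IH]; first by rewrite /psum !big_nil add0r subrr normr0.
  rewrite /psum !big_cons -addrA [_ + (_ + y)]addrC.
  have := coord_lipschitz (psum v q + y) (v 0 i) sp (HM i).2.
  have := ler_wpM2r (HM i).1 (rV_coord_le v i).
  have := ler_normD (p (psum v q + y + v 0 i *: e_ i) - p (psum v q + y)) (p (psum v q + y) - p y).
  by move: IH; rewrite addrA subrK; lra.
have := H (enum 'I_n); rewrite psum_enum big_enum/= => /le_trans; apply.
by rewrite -mulr_sumr mulrC.
Qed.

Lemma bounded_ball x r : bounded_set (ball x r : set 'rV[R]_n).
Proof.
exists (`|x| + r); split; first exact: num_real.
move=> M HM y xy; apply: le_trans (ltW HM).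
move: xy; rewrite -ball_normE /ball_/= => xy.
by have := ler_normB x (x - y); rewrite subKr; lra.
Qed.

(** The parameter [t] may change with the coordinate: a cube contains the whole box spanned by two
    of its points, hence also the axis-parallel paths joining them. *)
Lemma ball_between x r y v (z : 'rV[R]_n) : ball x r y -> ball x r (y + v) ->
  (forall j, exists t, 0 <= t <= 1 /\ z 0 j = y 0 j + t * v 0 j) -> ball x r z.
Proof.
move=> /ball_rVP[r0 Hy] /ball_rVP[_ Hv] Hz; apply/ball_rVP; split=> // j.
have [t [/andP[t0 t1] ->]] := Hz j; move: (Hy j) (Hv j); rewrite !mxE !ltr_distl.
have [v0|v0] := leP 0 (v 0 j).
  have := mulr_ge0 t0 v0; have := ler_wpM2r v0 t1; rewrite mul1r.
  by move=> ? ? /andP[? ?] /andP[? ?]; apply/andP; split; lra.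
have := mulr_ge0_le0 t0 (ltW v0); have := ler_wnM2r (ltW v0) t1; rewrite mul1r.
by move=> ? ? /andP[? ?] /andP[? ?]; apply/andP; split; lra.
Qed.

(** [y] is joined to [y + v] by an axis-parallel path, and each of its [n] edges costs one
    application of [variation_shift]. *)
Lemma variation_path x r g v (B : R) : 0 < r -> rint mu (ball x r) g ->
  (forall i psi, test_fun (ball x r) psi -> (forall x, `|psi x| <= 1) ->
    `|\int[mu]_(y in ball x r) (g y * partial i psi y)| <= B) ->
  \int[mu]_(y in ball x r `&` preshift v (ball x r)) `|g (y + v) - g y|
    <= n%:R * `|v| * B.
Proof.
move=> r0 Ig HB; set O := ball x r in Ig HB *; set V := O `&` preshift v O.
have oO : open O by exact: ball_open.
have bO : bounded_set O by exact: bounded_ball.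
have opre w (D : set 'rV[R]_n) : open D -> open (preshift w D).
  move=> oD; apply: (@open_comp _ _ (fun y => y + w)) => // y _.
  by apply: continuousD => //; exact: cst_continuous.
have oV : open V by apply: openI => //; exact: opre.
have mO := open_measurable_leb oO; have mV := open_measurable_leb oV.
have VO : V `<=` O by exact: subIsetl.
have VOv : V `<=` preshift v O by exact: subIsetr.
have B0 (i : 'I_n) : 0 <= B.
  apply: le_trans (HB i (fun=> 0) (test_fun0 O) _) => //.
  by move=> y; rewrite normr0.
have between q y : uniq q -> V y -> O (y + psum v q).
  move=> uq [Oy Oyv]; apply: (ball_between Oy Oyv) => j.
  exists (j \in q)%:R; split; first by case: (j \in q); rewrite ?lexx ?ler01.
  by rewrite mxE psumE.
have Isub q : uniq q -> rint mu V (fun y => g (y + psum v q)).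
  move=> uq; have VO' : preshift (- psum v q) V `<=` O.
    by move=> y; rewrite /preshift/= => Vy; have := between q _ uq Vy; rewrite subrK.
  have := rint_shift_sub oO oV VO' Ig.
  by congr rint; apply/funext => y; rewrite opprK.
have IgV : rint mu V g by exact: (rint_sub mO mV VO Ig).
suff H q : uniq q -> \int[mu]_(y in V) `|g (y + psum v q) - g y| <= (size q)%:R * (`|v| * B).
  by have := H (enum 'I_n) (enum_uniq _); rewrite psum_enum size_enum_ord mulrA.
elim: q => [_|i q IH /= /andP[iq uq]].
  rewrite (@Rint_eq _ T R mu V _ (fun=> 0)) ?Rintegral_cst ?mul0r// => y _.
  by rewrite /psum big_nil addr0 subrr normr0.
have uiq : uniq (i :: q) by rewrite /= iq.
pose w := psum v q.
have E y : y + psum v (i :: q) = (y + w) + v 0 i *: e_ i.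
  by rewrite /psum big_cons addrCA [RHS]addrC.
(* The positions reached from [V] after the edges of [q]. The next edge is a translation by
   [- v 0 i] in the sign convention of [variation_shift]. *)
pose V' := preshift (- w) V.
have oV' : open V' by exact: opre.
have mV' := open_measurable_leb oV'.
have V'O z t : V' z -> 0 <= t <= 1 -> O (z - (t * - v 0 i) *: e_ i).
  rewrite /V' /preshift/= => Vz /andP[t0 t1]; apply: (ball_between (VO _ Vz) (VOv _ Vz)) => j.
  have := @psumE v q j uq; rewrite -/w => wj.
  rewrite !mxE wj eqxx/=; have [->|ji] := eqVneq j i.
    by exists t; rewrite t0 t1 (negbTE iq) mulr1n mulr0n; split=> //; ring.
  exists (j \in q)%:R; split; first by case: (j \in q); rewrite ?lexx ?ler01.
  by rewrite mulr0n; ring.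
have := @variation_shift O V' g i (- v 0 i) B oO bO oV' Ig V'O (HB i).
rewrite normrN => H1.
have Iw : rint mu V (fun y => g (y + w)) by exact: Isub.
have Ii : rint mu V (fun y => g (y + w + v 0 i *: e_ i)).
  by have := Isub _ uiq; congr rint; apply/funext => y; rewrite E.
have Idiff := rint_norm mV (rintB mV Ii Iw).
have IV' : rint mu V' (fun z => `|g (z - - v 0 i *: e_ i) - g z|).
  have := rint_shift (- w) mV Idiff.
  by congr rint; apply/funext => z; rewrite subrK scaleNr opprK.
have E1 : \int[mu]_(z in V') `|g (z - - v 0 i *: e_ i) - g z| =
    \int[mu]_(y in V) `|g (y + w + v 0 i *: e_ i) - g (y + w)|.
  rewrite -(Rint_shift (- w) mV Idiff).
  by apply: (@Rint_eq _ T R mu) => z _; rewrite subrK scaleNr opprK.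
rewrite E1 in H1.
apply: (@le_trans _ _ (\int[mu]_(y in V) (`|g (y + w + v 0 i *: e_ i) - g (y + w)|
   + `|g (y + w) - g y|))).
  have I1 : rint mu V (fun y => `|g (y + psum v (i :: q)) - g y|).
    exact: (rint_norm mV (rintB mV (Isub _ uiq) IgV)).
  have I2 := rintD mV Idiff (rint_norm mV (rintB mV Iw IgV)).
  apply: (le_Rintegral mV I1 I2).
  - by move=> y _; rewrite E (le_trans _ (ler_normD _ _))// addrA subrK.
rewrite (RintegralD mV Idiff (rint_norm mV (rintB mV Iw IgV))).
rewrite -[(size q).+1%:R]natr1 mulrDl mul1r [leRHS]addrC; apply: lerD (IH uq).
by apply: (le_trans H1); rewrite ler_wpM2r ?(B0 i)//; exact: rV_coord_le.
Qed.

Lemma sum_le_injective (I J : finType) (h : I -> J) (F : J -> R) : injective h ->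
  (forall j, 0 <= F j) -> \sum_i F (h i) <= \sum_j F j.
Proof.
move=> hinj F0; rewrite [leLHS](eq_bigl (fun i => i \in [set: I]%SET)); last by move=> i; rewrite inE.
rewrite -(big_imset F) /=; last by move=> i j _ _; exact: hinj.
rewrite [leRHS](bigID (mem (h @: [set: I]%SET)))/= lerDl.
exact: sumr_ge0.
Qed.

Section grid.
Variables (x : 'rV[R]_n) (r : R) (N : nat).
Hypotheses (r0 : 0 < r) (N0 : (0 < N)%N).
(** Dividing by [N + 2] leaves a margin of one mesh below the grid points and of two meshes above: a
    grid point moved upwards by less than one mesh in each coordinate stays in the open cube. *)
Let s := 2 * r / (N + 2)%:R.

Definition grid_point (z : {ffun 'I_n -> 'I_N}) : 'rV[R]_n :=
  \row_i (x 0 i - r + (z i).+1%:R * s).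

Definition grid_vector (w : {ffun 'I_n -> 'I_(2 * N).+1}) : 'rV[R]_n :=
  \row_i (((w i)%:R - N%:R) * s).

Let s0 : 0 < s.
Proof. by rewrite /s !mulr_gt0// invr_gt0 ltr0n addn_gt0 orbT. Qed.

Let Ns : (N%:R + 2) * s = 2 * r.
Proof. by rewrite /s -natrD mulrC divfK// pnatr_eq0 addn_eq0 andbF. Qed.

Lemma grid_vector_le w : `|grid_vector w| <= 2 * r.
Proof.
apply: rV_norm_le; first by rewrite mulr_ge0// ltW.
move=> i; rewrite mxE normrM (gtr0_norm s0) -Ns ler_wpM2r ?ltW//.
have := ltn_ord (w i); rewrite ltnS -(ler_nat R) natrM.
have : 0 <= (w i)%:R :> R by [].
by rewrite ltr_norml; lra.
Qed.

(** [y] is moved to the same relative position in the mesh cell above the grid point [z]. In each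
    coordinate [h] shifts the index by the cell number of [y], whence its injectivity. *)
Lemma grid_point_near y : ball x r y ->
  exists h : {ffun 'I_n -> 'I_N} -> {ffun 'I_n -> 'I_(2 * N).+1}, injective h /\
    forall z, ball x r (y + grid_vector (h z)) /\
      `|y + grid_vector (h z) - grid_point z| <= s.
Proof.
move=> /ball_rVP[_ xy].
pose t i := (y 0 i - (x 0 i - r)) / s.
have t0 i : 0 <= t i.
  by rewrite /t divr_ge0 ?(ltW s0)//; move: (xy i); rewrite ltr_distl; lra.
have t2 i : t i < N%:R + 2.
  by rewrite /t ltr_pdivrMr// Ns; move: (xy i); rewrite ltr_distl; lra.
pose j i := Num.truncn (t i).
have jt i : (j i)%:R <= t i < (j i)%:R + 1.
  by have := truncn_itv (t0 i); rewrite -natr1.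
have jN i : (j i <= N.+1)%N.
  rewrite -ltnS -(ltr_nat R); have /andP[jt1 _] := jt i; apply: (le_lt_trans jt1).
  by rewrite -addn2 natrD.
have hlt (z : {ffun 'I_n -> 'I_N}) i : ((z i).+1 + N - j i < (2 * N).+1)%N.
  by have := ltn_ord (z i); have := jN i; lia.
exists (fun z => [ffun i => Ordinal (hlt z i)]); split.
  move=> z1 z2 /ffunP H; apply/ffunP => i; have := H i; rewrite !ffunE => /(congr1 val)/= E.
  by apply: val_inj => /=; move: E; have := jN i; lia.
move=> z.
have E i : (y + grid_vector [ffun i => Ordinal (hlt z i)]) 0 i =
    x 0 i - r + ((z i).+1%:R + (t i - (j i)%:R)) * s.
  rewrite !mxE ffunE/= natrB; last by have := jN i; lia.
  have -> : y 0 i = x 0 i - r + t i * s by rewrite /t divfK ?gt_eqF//; ring.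
  by rewrite natrD; ring.
split.
  apply/ball_rVP; split=> // i; rewrite E distrC ltr_distl.
  have /andP[j1 j2] := jt i.
  have zN : (z i).+1%:R <= N%:R :> R by rewrite ler_nat; exact: ltn_ord.
  have z0 : 1 <= (z i).+1%:R :> R by rewrite ler1n.
  by apply/andP; split; move: Ns s0; nra.
apply: rV_norm_le; first exact: ltW.
move=> i; rewrite mxE [X in _ + X]mxE E mxE.
rewrite (_ : _ - _ = (t i - (j i)%:R) * s); last by ring.
have /andP[j1 j2] := jt i.
rewrite ger0_norm; last by rewrite mulr_ge0 ?subr_ge0// ltW.
by rewrite -[leRHS]mul1r ler_wpM2r ?(ltW s0)//; lra.
Qed.

End grid.

(** [g] is replaced by a Lipschitz approximation [p], and [c] is the value of [p] at a grid point
    found by averaging. For fixed [y], the differences [|p y - p z|] over the grid are bounded, up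
    to the mesh, by differences under distinct grid vectors, each of which costs [variation_path].
    There are at most [(3 * N) ^ n] vectors for [N ^ n] points, whence the factor [3 ^+ n]; a finite
    double sum replaces a double integral. *)
Lemma poincare x r g (B eta : R) : 0 < r -> rint mu (ball x r) g ->
  (forall i psi, test_fun (ball x r) psi -> (forall x, `|psi x| <= 1) ->
    `|\int[mu]_(y in ball x r) (g y * partial i psi y)| <= B) -> 0 < eta ->
  exists c, \int[mu]_(y in ball x r) `|g y - c| <= 3 ^+ n * (2 * n%:R * r * B) + eta.
Proof.
move=> r0 Ig HB eta0; set O := ball x r in Ig HB *.
have oO : open O by exact: ball_open.
have bO : bounded_set O by exact: bounded_ball.
have mO := open_measurable_leb oO.
have Ofin : (L O < +oo)%E by exact: bounded_leb_fin.
have fO0 : 0 <= fine (L O) by rewrite fine_ge0// outer_measure_ge0.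
have e0 : 0 < eta / 2 / (2 * 3 ^+ n + 1).
  by rewrite !divr_gt0// ltr_wpDl// mulr_ge0// exprn_ge0.
set e := eta / 2 / (2 * 3 ^+ n + 1) in e0.
have [_ /(_ _ e0)[p tp gp]] := L1_density oO bO Ig.
have [M M0 HM] := test_lipschitz tp.
have [N [N0 HN]] : exists N, (0 < N)%N /\
    M * (2 * r / (N + 2)%:R) * fine (L O) <= eta / 2.
  have k0 : 0 <= M * (2 * r) * fine (L O) by rewrite !mulr_ge0// ltW.
  pose N := (Num.truncn (M * (2 * r) * fine (L O) / (eta / 2))).+1.
  exists N; split=> //.
  rewrite (_ : _ * _ = M * (2 * r) * fine (L O) / (N + 2)%:R); last by rewrite /=; ring.
  rewrite ler_pdivrMr ?ltr0n ?addn_gt0 ?orbT//.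
  rewrite [leRHS]mulrC -ler_pdivrMr ?divr_gt0//.
  have /andP[_ H] := truncn_itv (divr_ge0 k0 (ltW (divr_gt0 eta0 (ltr0n R 2)))).
  by apply: (le_trans (ltW H)); rewrite ler_nat /N leq_addr.
have N3 : ((2 * N).+1 <= N * 3)%N by clear -N0; lia.
pose gv := @grid_vector r N; pose gp' := @grid_point x r N.
set s := 2 * r / (N + 2)%:R in HN.
have Ip := rint_test mO Ofin tp.
have Igp := rint_norm mO (rintB mO Ig Ip).
have Icst (c : R) : rint mu O (fun=> c).
  exact: (@rint_bounded _ T R mu O _ `|c| mO Ofin).
have Ipc c : rint mu O (fun y => `|p y - c|) by apply: rint_norm => //; exact: rintB.
pose h w : 'rV[R]_n -> R := (fun y => `|p (y + gv w) - p y|) \_ (preshift (gv w) O).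
have h_ge0 w y : 0 <= h w y by rewrite /h /patch; case: ifP.
have opre w : open (preshift w O).
  apply: (@open_comp _ _ (fun y => y + w)) => // y _.
  by apply: continuousD => //; exact: cst_continuous.
pose V w := O `&` preshift (gv w) O.
have mV w : measurable (V w : set T) by apply: open_measurable_leb; exact: openI.
have VO w : V w `<=` O by exact: subIsetl.
have Iv f w : rint mu O f -> rint mu (V w) (fun y => f (y + gv w)).
  move=> If; have := rint_shift (gv w) mO If.
  by apply: rint_sub => //; [exact: measurable_preshift|exact: subIsetr].
have Ihv w : rint mu (V w) (fun y => `|p (y + gv w) - p y|).
  apply: rint_norm => //; apply: rintB => //; first exact: (Iv p).
  exact: (rint_sub mO (mV w) (VO w) Ip).
have Ih w : rint mu O (h w).
  by apply: rint_patch; [exact: mO|exact: measurable_preshift|exact: Ihv].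
pose W := 2 * n%:R * r * B + 2 * e.
have hW w : \int[mu]_(y in O) h w y <= W.
  rewrite /h -Rintegral_mkcondr.
  have := @variation_path x r g (gv w) B r0 Ig HB; rewrite -/O -/(V w) => HV.
  have I1 : rint mu (V w) (fun y => g (y + gv w) - g y).
    by apply: rintB => //; [exact: (Iv g)|exact: (rint_sub mO (mV w) (VO w) Ig)].
  have I2 := Iv _ w Igp; have I3 := rint_sub mO (mV w) (VO w) Igp.
  apply: (@le_trans _ _ (\int[mu]_(y in V w) (`|g (y + gv w) - g y| +
      (`|g (y + gv w) - p (y + gv w)| + `|g y - p y|)))).
    apply: le_Rintegral => //.
    - exact: Ihv.
    - by apply: rintD => //; [exact: rint_norm|exact: rintD].
    move=> y _; rewrite (distrC (g (y + gv w)) (p _)).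
    rewrite (le_trans _ (le_trans (ler_normD _ _) (lerD (lexx _) (ler_normD _ _))))//.
    by rewrite (_ : g _ - _ + _ = p (y + gv w) - p y)//; ring.
  rewrite RintegralD//; [|exact: rint_norm|exact: rintD].
  rewrite RintegralD//.
  have E3 : \int[mu]_(y in V w) `|g y - p y| <= e.
    by apply: le_trans (ltW gp); exact: (Rint_sub mO (mV w) (VO w) Igp).
  have E2 : \int[mu]_(y in V w) `|g (y + gv w) - p (y + gv w)| <= e.
    apply: le_trans (ltW gp); rewrite -(Rint_shift (gv w) mO Igp).
    apply: Rint_sub => //; [exact: measurable_preshift|exact: subIsetr|exact: (rint_shift (gv w) mO Igp)].
  (* The bound [B] is known to be nonnegative only if there is a direction [i]; in dimension 0 the
     terms containing [B] vanish. *)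
  have B0 : 0 <= B \/ n = 0%N.
    case: (posnP n) => [->|n0]; [by right|left].
    apply: le_trans (HB (Ordinal n0) (fun=> 0) (test_fun0 O) _) => //.
    by move=> y; rewrite normr0.
  have E1 : n%:R * `|gv w| * B <= 2 * n%:R * r * B.
    case: B0 => [B0|n00]; last first.
      have nR0 : n%:R = 0 :> R by rewrite n00.
      by rewrite nR0 mulr0 !mul0r.
    rewrite (_ : 2 * _ * r * B = n%:R * (2 * r) * B); last by ring.
    by rewrite ler_wpM2r// ler_wpM2l//; exact: grid_vector_le.
  by rewrite /W; lra.
have pw y : O y -> \sum_z `|p y - p (gp' z)| <= \sum_w h w y + (N ^ n)%:R * (M * s).
  move=> Oy; have [k [kinj Hk]] := grid_point_near r0 N0 Oy.
  have le1 : \sum_z h (k z) y <= \sum_w h w y.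
    apply: (@sum_le_injective _ _ k (fun w => h w y) kinj) => w; exact: h_ge0.
  apply: (@le_trans _ _ (\sum_z (h (k z) y + M * s))).
    apply: ler_sum => z _; have [H1 H2] := Hk z.
    rewrite /h /patch ifT; last exact/mem_set.
    have := HM (y + gv (k z)) (gp' z); have := ler_wpM2l M0 H2.
    have := ler_distD (p (y + gv (k z))) (p y) (p (gp' z)).
    by rewrite (distrC (p y) (p (y + _))); rewrite -/s; lra.
  rewrite big_split/= sumr_const card_ffun !card_ord -[_ *+ _]mulr_natl.
  by rewrite lerD2r.
have Nn0 : 0 < (N ^ n)%:R :> R by rewrite ltr0n expn_gt0 N0.
pose K := 3 ^+ n * W + M * s * fine (L O).
have [z Hz] : exists z, \int[mu]_(y in O) `|p y - p (gp' z)| <= K.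
  apply: contrapT => /forallNP Hz.
  have : \sum_(z : {ffun 'I_n -> 'I_N}) K < \sum_z \int[mu]_(y in O) `|p y - p (gp' z)|.
    apply: ltr_sum; first by apply/hasP; exists [ffun=> Ordinal N0]; rewrite ?mem_index_enum.
    by move=> z _; rewrite ltNge; apply/negP.
  rewrite sumr_const card_ffun !card_ord -[_ *+ _]mulr_natl ltNge => /negP; apply.
  rewrite -Rint_sum//.
  apply: (@le_trans _ _ (\int[mu]_(y in O) (\sum_w h w y + (N ^ n)%:R * (M * s)))).
    apply: le_Rintegral => //; first exact: rint_sum.
    by apply: rintD => //; exact: rint_sum.
  rewrite (RintegralD mO (@rint_sum _ T R mu _ _ O h mO Ih) (Icst _)).
  rewrite Rint_sum// Rintegral_cst// /K mulrDr -!mulrA lerD//.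
  have W0 : 0 <= W.
    have := hW [ffun=> ord0]; apply: le_trans; apply: Rint_ge0 => y _; exact: h_ge0.
  apply: (@le_trans _ _ (\sum_(w : {ffun 'I_n -> 'I_(2 * N).+1}) W)).
    by apply: ler_sum => w _; exact: hW.
  rewrite sumr_const card_ffun !card_ord -[_ *+ _]mulr_natl mulrA ler_wpM2r//.
  rewrite -natrX -natrM ler_nat -expnMn.
  have [n0|n0] := posnP n; first by rewrite n0.
  by rewrite (leq_exp2r _ _ n0).
exists (p (gp' z)).
apply: (@le_trans _ _ (\int[mu]_(y in O) (`|g y - p y| + `|p y - p (gp' z)|))).
  apply: le_Rintegral => //.
  - exact: (rint_norm mO (rintB mO Ig (Icst _))).
  - exact: (rintD mO Igp (Ipc _)).
  - by move=> y _; rewrite ler_distD.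
rewrite (RintegralD mO Igp (Ipc _)).
have : (2 * 3 ^+ n + 1) * e = eta / 2.
  by rewrite /e mulrC divfK// gt_eqF// ltr_wpDl// mulr_ge0// exprn_ge0.
by move: Hz HN gp; rewrite /K /W; lra.
Qed.

End poincare.

(** * Differentiation of measures *)

Section differentiation.
Context (R : realType) (n : nat).
Implicit Types (x y v : 'rV[R]_n) (r s : R) (U V W K : set 'rV[R]_n)
  (f g phi psi : 'rV[R]_n -> R).
Local Notation L := (@leb_outer R n).
Local Notation T := (lebT R n).
Local Notation mu := (@leb R n).

Definition disjoint_balls (D : seq ('rV[R]_n * R)) :=
  {in D &, forall p q, p != q -> ball p.1 p.2 `&` ball q.1 q.2 = set0}.

Lemma max_radius (s : seq ('rV[R]_n * R)) : s != [::] ->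
  exists2 p, p \in s & forall q, q \in s -> q.2 <= p.2.
Proof.
elim: s => // p [|q s] IH _.
  by exists p; rewrite ?mem_head// => q; rewrite inE => /eqP->.
have [//|m ms Hm] := IH _.
have [pm|mp] := leP p.2 m.2.
  exists m; first by rewrite inE ms orbT.
  by move=> t; rewrite inE => /predU1P[->//|]; exact: Hm.
exists p; first exact: mem_head.
by move=> t; rewrite inE => /predU1P[->//|/Hm/le_trans]; apply; exact: ltW.
Qed.

(** Greedy selection of a ball of largest radius. A ball meeting it has a smaller or equal radius,
    hence lies in the ball dilated by 3; the balls that do not meet it are treated by induction. *)
Lemma vitali_balls (s : seq ('rV[R]_n * R)) : (forall p, p \in s -> 0 < p.2) ->
  exists D, [/\ uniq D, {subset D <= s}, disjoint_balls D &
    forall p, p \in s -> exists2 q, q \in D & ball p.1 p.2 `<=` ball q.1 (3 * q.2)].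
Proof.
have [k] := ubnP (size s); elim: k s => // k IH s sk s0.
have [->|sn] := eqVneq s [::]; first by exists [::].
have [p ps Hp] := max_radius sn.
pose s' := [seq q <- s | `[< ball q.1 q.2 `&` ball p.1 p.2 = set0 >]].
have ps' : p \notin s'.
  rewrite mem_filter ps andbT; apply/asboolP => E.
  have : (ball p.1 p.2 `&` ball p.1 p.2) p.1 by split; apply: ballxx; exact: s0.
  by rewrite E.
have [|q|D [uD Ds dD HD]] := IH s'.
- rewrite -ltnS; apply: leq_trans sk; rewrite ltnS size_filter.
  rewrite ltn_neqAle count_size andbT -all_count; apply/allPn; exists p => //.
  by apply/negP => H; move: ps'; rewrite mem_filter H ps.
- by rewrite mem_filter => /andP[_]; exact: s0.
have pD : p \notin D by apply: contra ps' => /Ds.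
have disj q : q \in D -> ball q.1 q.2 `&` ball p.1 p.2 = set0.
  by move=> /Ds; rewrite mem_filter => /andP[/asboolP].
exists (p :: D); split.
- by rewrite /= pD.
- move=> q; rewrite inE => /predU1P[->//|/Ds].
  by rewrite mem_filter => /andP[].
- move=> q t; rewrite !inE => /predU1P[->|qD] /predU1P[->|tD]; first by rewrite eqxx.
  + by move=> _; rewrite setIC; exact: disj.
  + by move=> _; exact: disj.
  + exact: dD.
move=> q qs; have [E|/eqP/set0P[z [qz pz]]] := pselect (ball q.1 q.2 `&` ball p.1 p.2 = set0).
  have [|t tD Ht] := HD q; first by rewrite mem_filter qs andbT; apply/asboolP.
  by exists t => //; rewrite inE tD orbT.
exists p; first exact: mem_head.
move=> y qy; have := Hp _ qs; move: qy qz pz; rewrite -!ball_normE /ball_/= => h1 h2 h3 h4.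
have := ler_normD (p.1 - z) (z - q.1); have := ler_normD (p.1 - z + (z - q.1)) (q.1 - y).
rewrite (distrC z); rewrite (_ : p.1 - z + (z - q.1) + (q.1 - y) = p.1 - y); last first.
  by rewrite subrKA subrKA.
by lra.
Qed.

(* [m x r] plays the role of the mass of [ball x r] for a measure of total
   mass at most [M] on [W]. *)
Lemma vitali_weak (E W : set 'rV[R]_n) (m : 'rV[R]_n -> R -> R) (t M : R) :
  bounded_set W -> 0 < t ->
  (forall x, E x -> exists r, [/\ 0 < r, ball x r `<=` W & t * r ^+ n <= m x r]) ->
  (forall D, uniq D -> disjoint_balls D -> (forall p, p \in D -> 0 < p.2 /\ ball p.1 p.2 `<=` W) ->
    \sum_(p <- D) m p.1 p.2 <= M) ->
  (L E <= (6 ^+ n * (M / t))%:E)%E.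
Proof.
move=> bW t0 HE HM.
have /choice[rho Hrho] : forall x, exists r : R, E x ->
    [/\ 0 < r, ball x r `<=` W & t * r ^+ n <= m x r].
  move=> x; have [Ex|nEx] := pselect (E x); last by exists 0.
  by have [r Hr] := HE x Ex; exists r.
pose V := \bigcup_(x in E) ball x (rho x).
have oV : open V by apply: bigcup_open => x _; exact: ball_open.
have EV : E `<=` V by move=> x Ex; exists x => //; apply: ballxx; have [] := Hrho x Ex.
have VW : V `<=` W by move=> y [x Ex xy]; have [_ H _] := Hrho x Ex; exact: H.
have mV := open_measurable_leb oV.
have bV := bounded_setS VW bW.
apply/lee_addgt0Pr => e e0.
have [K [cK KV LK]] := leb_inner_compact mV bV e0.
have [s [sE Ks]] : exists s : seq 'rV[R]_n, (forall x, x \in s -> E x) /\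
    forall y, K y -> exists2 x, x \in s & ball x (rho x) y.
  move: cK; rewrite compact_cover.
  move=> /(_ _ E (fun x => ball x (rho x))); case=> [x Ex|x Kx|D DE KD].
  - exact: ball_open.
  - by have [y Ey xy] := KV x Kx; exists y.
  exists (enum_fset D); split=> [x xD|y Ky]; first exact: set_mem (DE x xD).
  by have [x xD xy] := KD y Ky; exists x.
pose s' := [seq (x, rho x) | x <- s].
have s'P p : p \in s' -> [/\ 0 < p.2, ball p.1 p.2 `<=` W & t * p.2 ^+ n <= m p.1 p.2].
  by move=> /mapP[x xs ->]; exact: Hrho (sE x xs).
have [|D [uD Ds dD HD]] := @vitali_balls s'; first by move=> p /s'P[].
have D0 p : p \in D -> 0 < p.2 by move=> /Ds/s'P[].
have KD : K `<=` \bigcup_(p in [set` D]) ball p.1 (3 * p.2).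
  move=> y /Ks[x xs xy].
  have [|q qD Hq] := HD (x, rho x); first by apply/mapP; exists x.
  by exists q => //; exact: Hq.
have LU (D' : seq ('rV[R]_n * R)) : (forall p, p \in D' -> 0 < p.2) ->
    (L (\bigcup_(p in [set` D']) ball p.1 (3 * p.2)) <= (\sum_(p <- D') (6 * p.2) ^+ n)%:E)%E.
  elim: D' => [|p D' IH] D'0.
    rewrite big_nil (_ : \bigcup_(_ in _) _ = set0) ?outer_measure0//.
    by apply/seteqP; split=> // y [].
  rewrite big_cons (_ : \bigcup_(_ in _) _ = ball p.1 (3 * p.2) `|`
     \bigcup_(p in [set` D']) ball p.1 (3 * p.2)); last first.
    apply/seteqP; split=> y.
      by move=> [q /=]; rewrite inE => /predU1P[->|qD]; [left|right; exists q].
    by move=> [py|[q qD qy]]; [exists p => //=; rewrite mem_head|exists q => //=; rewrite inE (qD : is_true _) orbT].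
  apply: (le_trans (outer_measureU2 _ _ _)); rewrite EFinD; apply: leeD.
    rewrite (_ : 6 * p.2 = 2 * (3 * p.2)); last by ring.
    by apply: leb_ball_le; rewrite mulr_gt0// D'0// mem_head.
  by apply: IH => q qD; apply: D'0; rewrite inE qD orbT.
have le1 : (L K <= (6 ^+ n * (M / t))%:E)%E.
  apply: (le_trans (le_outer_measure L _ _ KD)); apply: (le_trans (LU D D0)).
  rewrite lee_fin; apply: (@le_trans _ _ (6 ^+ n * ((\sum_(p <- D) m p.1 p.2) / t))).
    rewrite mulr_suml mulr_sumr big_seq [leRHS]big_seq; apply: ler_sum => p pD.
    have [_ _ H] := s'P p (Ds p pD).
    by rewrite exprMn ler_wpM2l ?exprn_ge0// ler_pdivlMr// mulrC.
  rewrite ler_wpM2l ?exprn_ge0// ler_wpM2r ?invr_ge0 ?(ltW t0)//.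
  by apply: HM => // p /Ds/s'P[].
apply: (le_trans (le_outer_measure L _ _ EV)).
have mK : measurable (K : set T).
  by apply: closed_measurable_leb; exact: compact_closed_rV.
rewrite (_ : V = K `|` (V `\` K)); last first.
  by apply/seteqP; split=> y; [move=> Vy; have [Ky|nKy] := pselect (K y); [left|right]|case=> [/KV|[]]].
apply: (le_trans (outer_measureU2 _ _ _)); apply: leeD => //; exact: ltW.
Qed.

(** Stated for a set function [m], so as to cover both a Borel measure and the integral of a fixed
    nonnegative function on Lebesgue sets; [P] is the class of admissible sets. *)
Lemma disjoint_balls_sum (P : set (set 'rV[R]_n)) (m : set 'rV[R]_n -> R) (W : set 'rV[R]_n)
    (D : seq ('rV[R]_n * R)) :
  (forall A, 0 <= m A) -> (forall A x r, P A -> P (A `\` ball x r)) ->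
  (forall A x r, P A -> ball x r `<=` A -> m (ball x r) + m (A `\` ball x r) <= m A) ->
  P W -> uniq D -> disjoint_balls D -> (forall p, p \in D -> ball p.1 p.2 `<=` W) ->
  \sum_(p <- D) m (ball p.1 p.2) <= m W.
Proof.
move=> m0 PD madd; elim: D W => [|p D IH] W PW; first by rewrite big_nil.
move=> /= /andP[pD uD] dD DW; rewrite big_cons.
apply: le_trans (madd _ _ _ PW (DW p (mem_head _ _))); rewrite lerD2l.
apply: IH => //; first exact: PD.
  by move=> q t qD tD; apply: dD; rewrite inE ?qD ?tD orbT.
move=> q qD y qy; split; first by apply: (DW q) => //; rewrite inE qD orbT.
move=> py; have : (ball q.1 q.2 `&` ball p.1 p.2) y by [].
rewrite (dD q p) ?mem_head ?inE ?qD ?orbT//.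
by apply: contra pD => /eqP <-.
Qed.

Section measure_density.
Variable sigma : {finite_measure set (borelT 'rV[R]_n) -> \bar R}.

Lemma open_borel (U : set (borelT 'rV[R]_n)) : open (U : set 'rV[R]_n) -> measurable U.
Proof. by move=> oU; exact: sub_sigma_algebra. Qed.

Lemma closed_borel (U : set (borelT 'rV[R]_n)) : closed (U : set 'rV[R]_n) -> measurable U.
Proof.
move=> cU; rewrite -(setCK U); apply: measurableC.
by apply: open_borel; exact: closed_openC.
Qed.

Lemma sigma_fin (A : set (borelT 'rV[R]_n)) : measurable A -> sigma A \is a fin_num.
Proof. by move=> mA; exact: fin_num_measure. Qed.

Lemma measure_inc_approx (A : nat -> set (borelT 'rV[R]_n)) (e : R) :
  (forall k, measurable (A k)) -> (forall k, A k `<=` A k.+1) -> 0 < e ->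
  exists k, (sigma ((\bigcup_j A j) `\` A k) < e%:E)%E.
Proof.
move=> mA iA e0; pose B k := (\bigcup_j A j) `\` A k.
have mB k : measurable (B k) by apply: measurableD => //; exact: bigcup_measurable.
have B0 : \bigcap_k B k = set0.
  apply/seteqP; split=> // x Bx; have [[j _ Ajx] _] := Bx 0%N I.
  by have [_] := Bx j I.
have Bfin : (sigma (B 0%N) < +oo)%E by rewrite ltey_eq sigma_fin.
have niB : {homo B : i j / (i <= j)%N >-> (j <= i)%O}.
  move=> i j ij; apply/subsetPset => x [Ax nA]; split=> // Aix; apply: nA.
  elim: j ij => [|j IH]; first by rewrite leqn0 => /eqP <-.
  by rewrite leq_eqVlt => /predU1P[<-//|]; rewrite ltnS => /IH; exact: iA.
have := nonincreasing_cvg_mu Bfin mB _ niB; rewrite B0 => /(_ measurable0).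
rewrite measure0 => /fine_cvgP[_ /cvgrPdist_lt/(_ _ e0)[k _ /(_ k (leqnn k))/=]].
rewrite sub0r normrN => H; exists k.
rewrite -(fineK (sigma_fin (mB k))) lte_fin; apply: le_lt_trans H; exact: ler_norm.
Qed.

Lemma inv_truncn_le (e : R) : 0 < e -> (Num.truncn e^-1).+1%:R^-1 <= e.
Proof.
move=> e0; rewrite invf_ple ?posrE//; apply: ltW.
have ei : 0 <= e^-1 by rewrite invr_ge0 ltW.
by have /andP[] := truncn_itv ei.
Qed.

Lemma sigma_le (A B : set (borelT 'rV[R]_n)) : measurable A -> measurable B ->
  A `<=` B -> (sigma A <= sigma B)%E.
Proof. by move=> mA mB AB; apply: le_measure => //; exact: mem_set. Qed.

Lemma open_closed_approx (U : set 'rV[R]_n) (e : R) : open U -> 0 < e ->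
  exists F, [/\ closed F, F `<=` U & (sigma (U `\` F) < e%:E)%E].
Proof.
move=> oU e0; pose F k := [set x : 'rV[R]_n | ball x k.+1%:R^-1 `<=` U].
have k0 (k : nat) : 0 < k.+1%:R^-1 :> R by rewrite invr_gt0.
have cF k : closed (F k).
  move=> x Fx y xy; move: xy; rewrite -ball_normE /ball_/= => xy.
  have d0 : 0 < k.+1%:R^-1 - `|x - y| by rewrite subr_gt0.
  have [z [Fz xz]] := Fx _ (nbhsx_ballx x _ d0).
  apply: Fz; rewrite -ball_normE /ball_/=; move: xz; rewrite -ball_normE /ball_/= => xz.
  by have := ler_normD (z - x) (x - y); rewrite subrKA (distrC z x) => H; apply: le_lt_trans H _; rewrite -ltrBrDr.
have FU k : F k `<=` U by move=> x; apply; exact: ballxx.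
have UE : U = \bigcup_k F k.
  apply/seteqP; split=> [x Ux|x [k _ /FU]//].
  have /nbhs_ballP[r /= r0 Hr] := open_nbhs_nbhs (conj oU Ux).
  exists (Num.truncn r^-1) => // y xy; apply: Hr; apply: le_ball xy.
  exact: inv_truncn_le.
have [k Hk] : exists k, (sigma ((\bigcup_j F j) `\` F k) < e%:E)%E.
  apply: measure_inc_approx => // k; first by apply: closed_borel; exact: cF.
  move=> x Fx; apply: subset_trans Fx; apply: le_ball.
  by rewrite lef_pV2 ?posrE// ler_nat.
by exists (F k); split=> //; rewrite UE.
Qed.

(** The sets with this property form a sigma-algebra containing the open sets. For a countable union
    the closed sets must be cut to finitely many, which is harmless because [sigma] is finite. *)
Lemma borel_regular (A : set (borelT 'rV[R]_n)) : measurable A ->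
  forall e : R, 0 < e -> exists F G : set 'rV[R]_n,
    [/\ closed F, open G, F `<=` A, A `<=` G & (sigma (G `\` F) < e%:E)%E].
Proof.
pose C := [set A : set 'rV[R]_n | forall e : R, 0 < e -> exists F G : set 'rV[R]_n,
    [/\ closed F, open G, F `<=` A, A `<=` G & (sigma (G `\` F) < e%:E)%E]].
move=> mA; suff : C A by [].
move: A mA; apply: smallest_sub => [|U oU e e0]; last first.
  by have [F [cF FU HF]] := open_closed_approx oU e0; exists F, U; split.
split.
- move=> e e0; exists set0, set0; split=> //; [exact: closed0|].
  by rewrite setD0 measure0 lte_fin.
- move=> A CA e e0; have [F [G [cF oG FA AG H]]] := CA e e0.
  exists (~` G), (~` F); split.
  + exact: open_closedC.
  + exact: closed_openC.
  + by rewrite setTD; exact: subsetC.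
  + by rewrite setTD; exact: subsetC.
  by rewrite (_ : ~` F `\` ~` G = G `\` F)// setDE setCK setIC.
move=> A CA e e0; have e20 : 0 < e / 2 by rewrite divr_gt0.
have /choice[FG H] : forall k, exists FG : set 'rV[R]_n * set 'rV[R]_n,
   [/\ closed FG.1, open FG.2, FG.1 `<=` A k, A k `<=` FG.2 &
     (sigma (FG.2 `\` FG.1) < (e / 2 / (2 ^ k.+1)%:R)%:E)%E].
  move=> k; have ek : 0 < e / 2 / (2 ^ k.+1)%:R by rewrite divr_gt0// ltr0n expn_gt0.
  by have [F [G HFG]] := CA k _ ek; exists (F, G).
pose F k := \big[setU/set0]_(j < k) (FG j).1.
pose G := \bigcup_k (FG k).2.
have cFk k : closed (F k).
  by apply: closed_bigsetU => j _; have [] := H j.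
have mF k : measurable (F k : set (borelT 'rV[R]_n)) by exact: closed_borel.
have FS k : F k `<=` F k.+1 by rewrite /F big_ord_recr; exact: subsetUl.
have [k Hk] := measure_inc_approx mF FS e20.
have FkA : \bigcup_j F j `<=` \bigcup_j A j.
  move=> x [j _]; rewrite /F -(bigcup_mkord j (fun j => (FG j).1)) => -[i _ Fx]; exists i => //.
  by have [_ _ FA _ _] := H i; exact: FA.
have oG : open G by apply: bigcup_open => j _; have [] := H j.
exists (F k), G; split=> //.
- by apply: subset_trans FkA => x Fx; exists k.
- by move=> x [j _ Ax]; exists j => //; have [_ _ _ AG _] := H j; exact: AG.
pose D j : set (borelT 'rV[R]_n) := (FG j).2 `\` (FG j).1.
have mD j : measurable (D j).
  by have [cF oG' _ _ _] := H j; apply: measurableD; [exact: open_borel|exact: closed_borel].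
have mUF : measurable (\bigcup_j F j : set (borelT 'rV[R]_n)) by exact: bigcup_measurable.
have sub : G `\` F k `<=` (\bigcup_j D j) `|` ((\bigcup_j F j) `\` F k).
  move=> x [[j _ Gx] nF]; have [Fx|nFx] := pselect ((\bigcup_j F j) x); [by right|left].
  exists j => //; split=> // Fjx; apply: nFx; exists j.+1 => //.
  by rewrite /F -(bigcup_mkord j.+1 (fun j => (FG j).1)); exists j => //=.
have mG : measurable (G : set (borelT 'rV[R]_n)) by exact: open_borel.
have mUD : measurable (\bigcup_j D j) by exact: bigcup_measurable.
apply: (@le_lt_trans _ _ (sigma (\bigcup_j D j) + sigma ((\bigcup_j F j) `\` F k))%E).
  apply: le_trans (measureU2 _ mUD (measurableD mUF (mF k))).
  by apply: sigma_le => //; [exact: measurableD|apply: measurableU => //; exact: measurableD].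
have E : (sigma (\bigcup_j D j) <= (e / 2)%:E)%E.
  apply: (le_trans (measure_sigma_subadditive _ mD mUD (@subset_refl _ _))).
  apply: le_trans (epsilon_trick0 xpredT (ltW e20)).
  by apply: lee_nneseries => // j _; have [_ _ _ _ /ltW] := H j.
apply: (@lt_le_trans _ _ ((e / 2)%:E + (e / 2)%:E)%E); last by rewrite -EFinD lee_fin; lra.
by apply: lee_ltD => //; exact: sigma_fin.
Qed.

Lemma measurable_ball_borel x r : measurable (ball x r : set (borelT 'rV[R]_n)).
Proof. by apply: open_borel; exact: ball_open. Qed.

Lemma leb_le0 (A : set 'rV[R]_n) (C : R) : (forall e, 0 < e -> (L A <= (C * e)%:E)%E) -> L A = 0.
Proof.
move=> H; apply/eqP; rewrite eq_le outer_measure_ge0 andbT.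
apply/lee_addgt0Pr => e e0; rewrite add0e.
have C0 : 0 < `|C| + 1 by rewrite ltr_wpDl.
apply: (le_trans (H _ (divr_gt0 e0 C0))); rewrite lee_fin mulrA ler_pdivrMr//.
by rewrite mulrC ler_wpM2l ?(ltW e0)// (le_trans (ler_norm C))// lerDl.
Qed.

Lemma leb_bigcup0 (A : nat -> set 'rV[R]_n) : (forall k, L (A k) = 0) -> L (\bigcup_k A k) = 0.
Proof.
move=> H; apply/eqP; rewrite eq_le outer_measure_ge0 andbT.
apply: (le_trans (outer_measure_sigma_subadditive L A)).
by rewrite (_ : (\sum_(k <oo) _)%E = 0%E)//; apply: eseries0 => k _ _; exact: H.
Qed.

(** [sigma] lives on the null set [N], so it gives mass less than [e] to the complement of some
    closed null set [F]. Off [F], the points where the density of [sigma] stays above [1 / (k + 1)]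
    are covered by the Vitali argument at a cost proportional to that mass. *)
Lemma singular_density U (N : set (borelT 'rV[R]_n)) : open U -> bounded_set U ->
  measurable N -> L N = 0 -> sigma (~` N) = 0 ->
  L [set x | U x /\ ~ (forall e : R, 0 < e -> exists2 d : R, 0 < d &
    forall r, 0 < r < d -> fine (sigma (ball x r)) <= e * r ^+ n)] = 0.
Proof.
move=> oU bU mN N0 sN.
pose E (k : nat) := [set x | U x /\ forall d : R, 0 < d -> exists2 r, 0 < r < d &
  k.+1%:R^-1 * r ^+ n <= fine (sigma (ball x r))].
suff HE k : L (E k) = 0.
  apply/eqP; rewrite eq_le outer_measure_ge0 andbT -(leb_bigcup0 HE).
  apply: le_outer_measure => x [Ux /existsNP[e /not_implyP[e0 He]]].
  exists (Num.truncn e^-1) => //; split=> // d d0; apply: contrapT => Hd; apply: He.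
  exists d => // r /andP[r0 rd]; rewrite leNgt; apply/negP => Hr; apply: Hd.
  exists r; first by rewrite r0.
  apply: le_trans (ltW Hr); rewrite ler_wpM2r ?exprn_ge0 ?(ltW r0)//.
  exact: inv_truncn_le.
have k0 : 0 < k.+1%:R^-1 :> R by rewrite invr_gt0.
apply: (@leb_le0 _ (6 ^+ n / k.+1%:R^-1)) => e e0.
have [F [G [cF oG FN NG HG]]] := borel_regular mN e0.
pose W := U `&` ~` F.
have oW : open W by apply: openI => //; exact: closed_openC.
have F0 : L F = 0.
  by apply/eqP; rewrite eq_le outer_measure_ge0 andbT -N0 le_outer_measure.
apply: (@le_trans _ _ (L F + L (E k `\` F))%E).
  apply: le_trans (outer_measureU2 _ _ _); apply: le_outer_measure => x Ex.
  by have [Fx|nFx] := pselect (F x); [left|right].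
rewrite F0 add0e -mulrA (mulrC _^-1).
apply: (@vitali_weak _ W (fun x r => fine (sigma (ball x r)))) => //.
- by apply: bounded_setS bU; exact: subIsetl.
- move=> x [[Ux Ex] nFx].
  have /nbhs_ballP[d /= d0 Hd] := open_nbhs_nbhs (conj oW (conj Ux nFx)).
  have [r /andP[r0 rd] Hr] := Ex d d0; exists r; split=> //.
  by apply: subset_trans Hd; apply: le_ball; exact: ltW.
move=> D uD dD DW.
have mW : measurable (W : set (borelT 'rV[R]_n)) by exact: open_borel.
apply: (@le_trans _ _ (fine (sigma W))).
  apply: (@disjoint_balls_sum (fun A => measurable (A : set (borelT 'rV[R]_n)))
     (fun A => fine (sigma A))) => //.
  - by move=> A; exact: fine_ge0.
  - by move=> A x r mA; apply: measurableD => //; exact: measurable_ball_borel.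
  - move=> A x r mA BA; have mB := measurable_ball_borel x r.
    rewrite -fineD ?sigma_fin//; last exact: measurableD.
    rewrite -measureU//; [|exact: measurableD|by rewrite setDIK].
    by rewrite setDUK.
  - by move=> p /DW[].
rewrite -lee_fin fineK; last exact: sigma_fin.
apply: ltW; apply: le_lt_trans HG.
have mF := closed_borel cF; have mG := open_borel oG.
apply: (@le_trans _ _ (sigma (~` F))); first by apply: sigma_le; [exact: open_borel|exact: measurableC|exact: subIsetr].
apply: (@le_trans _ _ (sigma (~` N `|` (G `\` F)))).
  apply: sigma_le; first exact: measurableC.
    by apply: measurableU; [exact: measurableC|exact: measurableD].
  by move=> x nF; have [Nx|] := pselect (N x); [right; split=> //; exact: NG|left].
apply: (le_trans (measureU2 _ (measurableC mN) (measurableD mG mF))).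
by rewrite [X in (X + _)%E](_ : _ = 0%E) ?add0e//; exact: sN.
Qed.

End measure_density.

Lemma leb_ball_real x r : 0 < r -> fine (L (ball x r)) = (2 * r) ^+ n.
Proof. by move=> r0; rewrite leb_ball. Qed.

(** [a] is split into a Lipschitz test function [p] and a remainder small in L1, to which the
    weak-type estimate and the Markov inequality apply. *)
Lemma lebesgue_point_null U (a : 'rV[R]_n -> R) : open U -> bounded_set U -> rint mu U a ->
  L [set x | U x /\ ~ (forall e : R, 0 < e -> exists2 d : R, 0 < d &
    forall r, 0 < r < d -> ball x r `<=` U /\
      \int[mu]_(y in ball x r) `|a y - a x| <= e * r ^+ n)] = 0.
Proof.
move=> oU bU Ia; have mU := open_measurable_leb oU; have Ufin := bounded_leb_fin bU.
pose E (k : nat) := [set x | U x /\ forall d : R, 0 < d -> exists r,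
  [/\ 0 < r < d, ball x r `<=` U &
  k.+1%:R^-1 * r ^+ n <= \int[mu]_(y in ball x r) `|a y - a x|]].
suff HE k : L (E k) = 0.
  apply/eqP; rewrite eq_le outer_measure_ge0 andbT -(leb_bigcup0 HE).
  apply: le_outer_measure => x [Ux /existsNP[e /not_implyP[e0 He]]].
  exists (Num.truncn e^-1) => //; split=> // d d0; apply: contrapT => Hd; apply: He.
  have /nbhs_ballP[d1 /= d10 Hd1] := open_nbhs_nbhs (conj oU Ux).
  exists (Num.min d d1); first by rewrite lt_min d0.
  move=> r /andP[r0]; rewrite lt_min => /andP[rd rd1].
  have rU : ball x r `<=` U by apply: subset_trans Hd1; apply: le_ball; exact: ltW.
  split=> //; rewrite leNgt; apply/negP => Hr; apply: Hd.
  exists r; split=> //; first by rewrite r0.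
  apply: le_trans (ltW Hr); rewrite ler_wpM2r ?exprn_ge0 ?(ltW r0)//.
  exact: inv_truncn_le.
pose t : R := k.+1%:R^-1; have t0 : 0 < t by rewrite /t invr_gt0.
have t4 : 0 < t / 4 by rewrite divr_gt0.
have t42 : 0 < t / 4 / 2 ^+ n by rewrite divr_gt0// exprn_gt0.
apply: (@leb_le0 _ (6 ^+ n / (t / 4) + (t / 4 / 2 ^+ n)^-1)) => e e0.
have [_ /(_ _ e0)[p tp ap]] := L1_density oU bU Ia.
have Ip := rint_test mU Ufin tp.
have Iap := rint_norm mU (rintB mU Ia Ip).
have [M M0 HM] := test_lipschitz tp.
(* The mean deviation of [a] from [a x] has three sources: the remainder on the ball ([E1]), the
   remainder at [x] ([E2]), and the oscillation of [p], small with [r]. If each is below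
   [t / 4 * r ^+ n], their sum cannot reach [t * r ^+ n]. *)
pose E1 := [set x | exists r, [/\ 0 < r, ball x r `<=` U &
  t / 4 * r ^+ n <= \int[mu]_(y in ball x r) `|a y - p y|]].
pose E2 := U `&` [set x | t / 4 / 2 ^+ n <= `|a x - p x|].
have L1 : (L E1 <= (6 ^+ n * (e / (t / 4)))%:E)%E.
  apply: (@vitali_weak _ U (fun x r => \int[mu]_(y in ball x r) `|a y - p y|)) => //.
  move=> D uD dD DU; apply: le_trans (ltW ap).
  apply: (@disjoint_balls_sum (fun A => measurable (A : set T) /\ A `<=` U)
     (fun A => \int[mu]_(y in A) `|a y - p y|)) => //.
  - by move=> A; apply: Rint_ge0.
  - move=> A x r [mA AU]; split; first by apply: measurableD => //; exact: measurable_ball_leb.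
    by apply: subset_trans AU; exact: subDsetl.
  - move=> A x r [mA AU] BA; have mB := measurable_ball_leb x r.
    have mAB : measurable (A `\` ball x r : set T) by exact: measurableD.
    rewrite -Rint_setU//; last 2 first.
    + by rewrite setDIK.
    + by rewrite setDUK//; exact: (rint_sub mU mA AU Iap).
    by rewrite setDUK.
  - by split.
  - by move=> p0 /DU[].
have L2 : (L E2 <= ((t / 4 / 2 ^+ n)^-1 * e)%:E)%E.
  have := Rint_markov mU Iap t42 (fun x _ => normr_ge0 _).
  have E2fin : L E2 \is a fin_num.
    by rewrite ge0_fin_numE ?outer_measure_ge0//; apply: le_lt_trans Ufin; apply: le_outer_measure; exact: subIsetl.
  rewrite -(fineK E2fin) lee_fin ler_pdivlMl// => H; apply: (le_trans H); exact: ltW.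
apply: (@le_trans _ _ (L E1 + L E2)%E); last first.
  by apply: (le_trans (leeD L1 L2)); rewrite -EFinD lee_fin mulrDl -!mulrA (mulrC e).
apply: le_trans (outer_measureU2 _ _ _); apply: le_outer_measure => x [Ux Ex].
have [H2|H2] := leP (t / 4 / 2 ^+ n) `|a x - p x|; [by right|left].
have k0 : 0 < M * 2 ^+ n + 1 by rewrite ltr_wpDl// mulr_ge0// exprn_ge0.
have [r [/andP[r0 rd] rU Hr]] := Ex (t / 4 / (M * 2 ^+ n + 1)) (divr_gt0 t4 k0).
exists r; split=> //.
have mB := measurable_ball_leb x r.
have Bfin : (L (ball x r) < +oo)%E by exact: leb_ball_fin.
have Icst (c : R) : rint mu (ball x r) (fun=> c).
  exact: (@rint_bounded _ T R mu (ball x r) _ `|c| mB Bfin).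
have IaB := rint_sub mU mB rU Ia; have IapB := rint_sub mU mB rU Iap.
have : \int[mu]_(y in ball x r) `|a y - a x| <=
    \int[mu]_(y in ball x r) (`|a y - p y| + (M * r + `|a x - p x|)).
  apply: (le_Rintegral mB (rint_norm mB (rintB mB IaB (Icst _))) (rintD mB IapB (Icst _))) => y xy.
  have := HM y x; have := ler_normD (a y - p y) ((p y - p x) + (p x - a x)).
  have := ler_normD (p y - p x) (p x - a x); rewrite (distrC (p x)).
  have : `|y - x| <= r by move: xy; rewrite -ball_normE /ball_/= distrC => /ltW.
  move=> /(ler_wpM2l M0).
  rewrite (_ : a y - p y + _ = a y - a x); last by ring.
  by lra.
rewrite (RintegralD mB IapB (Icst _)) Rintegral_cst// leb_ball_real// exprMn.
have rn : 0 < r ^+ n by rewrite exprn_gt0.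
have h1 : `|a x - p x| * 2 ^+ n <= t / 4 by rewrite -ler_pdivlMr ?exprn_gt0// ltW.
have h2 : M * r * 2 ^+ n <= t / 4.
  move: rd; rewrite ltr_pdivlMr// => /ltW; apply: le_trans.
  by rewrite mulrDr mulr1 mulrA (mulrC M) lerDl ltW.
have h3 := ler_wpM2r (ltW rn) h1; have h4 := ler_wpM2r (ltW rn) h2.
have -> : (M * r + `|a x - p x|) * (2 ^+ n * r ^+ n) =
  M * r * 2 ^+ n * r ^+ n + `|a x - p x| * 2 ^+ n * r ^+ n by ring.
move=> H; have {H Hr}H : t * r ^+ n <= _ := le_trans Hr H.
have h5 : 0 < t * r ^+ n by rewrite mulr_gt0.
by clear -H h3 h4 h5; clearbody t; lra.
Qed.

End differentiation.

Lemma ereal_between (R : realType) (a b : \bar R) : (a < b)%E ->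
  exists s : R, (a < s%:E < b)%E.
Proof.
case: a => [a||]; case: b => [b||] //; rewrite ?lte_fin => ab.
- by exists ((a + b) / 2); rewrite !lte_fin; lra.
- by exists (a + 1); rewrite lte_fin ltry ltrDl ltr01.
- by exists (b - 1); rewrite lte_fin ltNyr gtrBl ltr01.
- by exists 0; rewrite ltNyr ltry.
Qed.

(** * Approximate differentiability *)

Section density.
Context (R : realType) (n : nat).
Hypothesis n_gt0 : (0 < n)%N.
Implicit Types (x y v xi : 'rV[R]_n) (r s : R) (U V W K A B : set 'rV[R]_n)
  (u f g phi psi : 'rV[R]_n -> R).
Local Notation L := (@leb_outer R n).
Local Notation T := (lebT R n).
Local Notation mu := (@leb R n).

Lemma eball_ball x r : eball x r `<=` ball x r.
Proof.
move=> y; rewrite /eball/= -ball_normE /ball_/= distrC.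
exact: le_lt_trans (norm_le_enorm _).
Qed.

Lemma ball_eball x r : ball x r `<=` eball x (n%:R * r).
Proof.
move=> y; rewrite /eball/= -ball_normE /ball_/= distrC => xy.
by apply: (le_lt_trans (enorm_le _)); rewrite ltr_pM2l// ltr0n.
Qed.

(** Cubes and Euclidean balls are comparable up to the factor [n], so densities may be computed on
    cubes. *)
Lemma density0P A x : density0 A x <-> forall e : R, 0 < e -> exists2 d : R, 0 < d &
  forall r, 0 < r < d -> (L (A `&` ball x r) <= (e * r ^+ n)%:E)%E.
Proof.
have nR0 : 0 < n%:R :> R by rewrite ltr0n.
have fin r : L (A `&` eball x r) \is a fin_num.
  rewrite ge0_fin_numE ?outer_measure_ge0//; apply: (@leb_fin_ball _ _ _ x r).
  by move=> y [_ /eball_ball].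
split=> [H e e0|H].
  have e'0 : 0 < e / n%:R ^+ n by rewrite divr_gt0// exprn_gt0.
  move: H; rewrite /density0 => /fine_cvgP[_ /cvgrPdist_lt/(_ _ e'0)].
  move=> [d /= d0 Hd]; exists (d / n%:R); first by rewrite divr_gt0.
  move=> r /andP[r0 rd]; have nr0 : 0 < n%:R * r by rewrite mulr_gt0.
  have nrd : n%:R * r < d by rewrite mulrC -ltr_pdivlMr.
  have := Hd (n%:R * r); rewrite /= sub0r normrN gtr0_norm// => /(_ nrd nr0).
  rewrite sub0r normrN fineM//= => /ltW/(le_trans (ler_norm _)).
  rewrite ler_pdivrMr ?exprn_gt0// => H1.
  apply: (@le_trans _ _ (L (A `&` eball x (n%:R * r)))).
    by apply: le_outer_measure; apply: setIS; exact: ball_eball.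
  rewrite -[leLHS]fineK ?fin// lee_fin; apply: (le_trans H1).
  by rewrite exprMn mulrA divfK// gt_eqF// exprn_gt0.
apply/fine_cvgP; split.
  by apply: nearW => r; rewrite fin_numM// fin.
apply/cvgrPdist_le => e e0; have [d d0 Hd] := H e e0.
exists d => //= r; rewrite /= sub0r normrN => rd r0.
rewrite gtr0_norm// in rd.
rewrite sub0r normrN fineM//= ger0_norm; last first.
  by rewrite mulr_ge0 ?fine_ge0 ?outer_measure_ge0// invr_ge0 exprn_ge0// ltW.
rewrite ler_pdivrMr ?exprn_gt0// -lee_fin fineK; last exact: fin.
apply: le_trans (Hd r _); last by rewrite r0.
by apply: le_outer_measure; apply: setIS; exact: eball_ball.
Qed.

Lemma density0_near A B x d : 0 < d -> A `&` ball x d `<=` B ->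
  density0 B x -> density0 A x.
Proof.
move=> d0 AB /density0P HB; apply/density0P => e e0; have [d' d'0 Hd'] := HB e e0.
exists (Num.min d d'); first by rewrite lt_min d0.
move=> r /andP[r0]; rewrite lt_min => /andP[rd rd'].
apply: le_trans (Hd' r _); last by rewrite r0.
apply: le_outer_measure => y [Ay xy]; split=> //; apply: AB; split=> //.
by apply: le_ball xy; exact: ltW.
Qed.

Lemma density0S A B x : A `<=` B -> density0 B x -> density0 A x.
Proof. by move=> AB; apply: (@density0_near _ _ _ 1) => // y [/AB]. Qed.

Lemma density0U A B x : density0 A x -> density0 B x -> density0 (A `|` B) x.
Proof.
move=> /density0P HA /density0P HB; apply/density0P => e e0.
have e20 : 0 < e / 2 by rewrite divr_gt0.
have [d d0 Hd] := HA _ e20; have [d' d'0 Hd'] := HB _ e20.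
exists (Num.min d d'); first by rewrite lt_min d0.
move=> r /andP[r0]; rewrite lt_min => /andP[rd rd'].
rewrite setIUl; apply: (le_trans (outer_measureU2 _ _ _)).
apply: (le_trans (leeD (Hd r _) (Hd' r _))); rewrite ?r0//.
by rewrite -EFinD lee_fin -mulrDl -splitr.
Qed.

Lemma density0_0 x : density0 (set0 : set 'rV[R]_n) x.
Proof.
apply/density0P => e e0; exists 1 => // r /andP[r0 _].
by rewrite set0I outer_measure0 lee_fin mulr_ge0 ?exprn_ge0 ?ltW.
Qed.

Lemma not_density0 A x (k : R) : 0 < k ->
  (forall r, 0 < r -> exists y, ball y (k * r) `<=` A `&` ball x r) -> ~ density0 A x.
Proof.
move=> k0 HA /density0P HD.
have e0 : 0 < (2 * k) ^+ n / 2 by rewrite divr_gt0// exprn_gt0// mulr_gt0.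
have [d d0 Hd] := HD _ e0.
have r0 : 0 < d / 2 by rewrite divr_gt0.
have [|y Hy] := HA (d / 2); first by [].
have := Hd (d / 2); rewrite r0 ltr_pdivrMr// mulr_natr mulr2n ltrDl d0 => /(_ isT).
apply/negP; rewrite -ltNge.
have H1 : (L (ball y (k * (d / 2))) <= L (A `&` ball x (d / 2)))%E by exact: le_outer_measure.
apply: lt_le_trans H1; rewrite leb_ball ?mulr_gt0// lte_fin [2 * (k * _)]mulrA [ltRHS]exprMn.
rewrite ltr_pM2r ?exprn_gt0//.
by rewrite ltr_pdivrMr// ltr_pMr ?ltr1n// exprn_gt0// mulr_gt0.
Qed.

(** At scale [r] the cone contains a cube of side proportional to [r] around [x + (r / 2 |xi|) xi].
    This gives both the uniqueness of the approximate gradient and its vanishing where a truncation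
    saturates. *)
Lemma not_density0_cone xi x : xi != 0 -> exists2 c : R, 0 < c &
  ~ density0 [set y | c * enorm (y - x) < dot xi (y - x)] x.
Proof.
move=> xi0; have N0 : 0 < `|xi| by rewrite normr_gt0.
have nR0 : 0 < n%:R :> R by rewrite ltr0n.
have nR1 : 1 <= n%:R :> R by rewrite ler1n.
have k0 : 0 < (4 * n%:R)^-1 :> R by rewrite invr_gt0 mulr_gt0.
have k1 : (4 * n%:R)^-1 <= 4^-1 :> R by rewrite lef_pV2 ?posrE ?mulr_gt0// ler_pMr.
exists (`|xi| / (8 * n%:R)); first by rewrite divr_gt0// mulr_gt0.
apply: (not_density0 k0) => r r0.
pose p := (r / 2 / `|xi|) *: xi; exists (x + p) => y; rewrite -ball_normE /ball_/= => Hy.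
have np : `|p| = r / 2.
  by rewrite normrZ ger0_norm ?divr_ge0 ?(ltW r0)// divfK// gt_eqF.
set q := y - x - p.
have Hq : `|q| < (4 * n%:R)^-1 * r by rewrite /q -addrA -opprD distrC.
have yx : y - x = p + q by rewrite /q [RHS]addrC subrK.
have nyx : `|y - x| < r.
  rewrite yx (le_lt_trans (ler_normD _ _))// np.
  by have := ler_wpM2r (ltW r0) k1; lra.
split; last by rewrite distrC.
have h1 : enorm (y - x) <= n%:R * r.
  by apply: (le_trans (enorm_le _)); rewrite ler_wpM2l// ltW.
have h2 : r / 2 * `|xi| <= dot xi p.
  rewrite dotZr -enorm_sqr -!mulrA ler_wpM2l ?(ltW r0)// ler_wpM2l ?invr_ge0//.
  rewrite ler_pdivlMl// -expr2 lerXn2r ?nnegrE ?enorm_ge0//; exact: norm_le_enorm.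
have h3 : `|dot xi q| <= r / 4 * `|xi|.
  apply: (le_trans (dot_le _ _)).
  apply: (@le_trans _ _ (n%:R * `|xi| * ((4 * n%:R)^-1 * r))).
    by rewrite ler_wpM2l ?mulr_ge0// ltW.
  rewrite le_eqVlt; apply/orP; left; apply/eqP.
  by rewrite invfM; field; rewrite pnatr_eq0 -lt0n.
have h4 : `|xi| / (8 * n%:R) * enorm (y - x) <= r / 8 * `|xi|.
  apply: (@le_trans _ _ (`|xi| / (8 * n%:R) * (n%:R * r))).
    by rewrite ler_wpM2l// divr_ge0// mulr_ge0.
  rewrite le_eqVlt; apply/orP; left; apply/eqP.
  by field; rewrite pnatr_eq0 -lt0n.
have h5 : 0 < r * `|xi| by rewrite mulr_gt0.
rewrite /= in h4 *; apply: (le_lt_trans h4); rewrite yx dotDr.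
by move: h3; rewrite ler_norml => /andP[h3 _]; move: h2 h3 h5; lra.
Qed.

Lemma approx_lim_unique u x (z z' : R) : approx_lim u setT x z -> approx_lim u setT x z' -> z = z'.
Proof.
move=> Hz Hz'; apply/eqP; rewrite -subr_eq0 -normr_le0 leNgt; apply/negP => d0.
have e0 : 0 < `|z - z'| / 3 by rewrite divr_gt0.
suff : ~ density0 (setT : set 'rV[R]_n) x.
  apply; apply: density0S (density0U (Hz _ e0) (Hz' _ e0)) => y _ /=.
  have [h|h] := ltP (`|z - z'| / 3) `|u y - z|; [by left|right; split=> //].
  have := ler_normD (z - u y) (u y - z'); rewrite subrKA (distrC z (u y)); lra.
apply: (not_density0 (@ltr01 R)) => r r0; exists x.
by rewrite mul1r setTI.
Qed.

Lemma approx_gradE u x xi : is_approx_grad u x xi -> approx_grad u x = xi.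
Proof.
move=> H; apply: xget_unique => // eta [z' L' D']; have [z Lz D] := H.
move: D'; rewrite (approx_lim_unique L' Lz) => D'.
apply/eqP; rewrite -subr_eq0; apply/negP => /negP /(not_density0_cone x)[c c0].
apply; have c20 : 0 < c / 2 by rewrite divr_gt0.
apply: density0S (density0U (D _ c20) (D' _ c20)) => y /=.
rewrite dotBl => Hy; apply: contrapT => /not_orP[/negP + /negP].
rewrite -!leNgt !ler_norml; lra.
Qed.

Lemma approx_lim_of_grad u x z xi :
  (forall e : R, 0 < e -> density0 [set y | e * enorm (y - x) < `|u y - z - dot xi (y - x)|] x) ->
  approx_lim u setT x z.
Proof.
move=> H e e0; rewrite setTI.
pose k := 1 + n%:R * `|xi| + n%:R.
have k0 : 0 < k by rewrite /k -addrA ltr_pwDl// addr_ge0// mulr_ge0.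
apply: (@density0_near _ _ _ (e / k)) (H 1 ltr01); first by rewrite divr_gt0.
move=> y [/= Hy]; rewrite -ball_normE /ball_/= distrC ltr_pdivlMr// => yx.
rewrite mul1r; have h1 := enorm_le (y - x); have h2 := dot_le xi (y - x).
have := ler_normD (u y - z - dot xi (y - x)) (dot xi (y - x)); rewrite subrK.
have E : `|y - x| * k = `|y - x| + n%:R * `|xi| * `|y - x| + n%:R * `|y - x| by rewrite /k; ring.
have : 0 <= `|y - x| by [].
by move: yx; rewrite E; lra.
Qed.

Lemma truncation_id u (m : nat) y : `|truncation m u y| < m%:R -> truncation m u y = u y.
Proof.
rewrite /truncation; case: (leP (u y) m%:R) => h1.
  case: (leP (u y) (- m%:R)) => h2 //; rewrite normrN ltr_norml; lra.
case: (leP m%:R (- m%:R)) => h2; rewrite ?normrN ltr_norml; lra.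
Qed.

Lemma truncation_le u (m : nat) y : `|truncation m u y| <= m%:R.
Proof.
have m0 : 0 <= m%:R :> R by [].
by rewrite /truncation ler_norml le_max lexx orbT ge_max ge_min lexx orbT /= lerNl; lra.
Qed.

(** If [|z| < m], truncation changes nothing up to density 0, and the gradients agree. Otherwise the
    truncated function stays on one side of [z], and an approximate gradient other than 0 would
    contradict [not_density0_cone]. *)
Lemma truncation_grad u (m : nat) x xi :
  is_approx_grad (truncation m u) x xi -> enorm xi <= enorm (approx_grad u x).
Proof.
move=> [z Lz D].
have zero : xi = 0 -> enorm xi <= enorm (approx_grad u x).
  by move=> ->; rewrite [enorm 0](_ : _ = 0) ?enorm_ge0// /enorm /dot big1 ?sqrtr0// => i _; rewrite mxE mul0r.
have [zm|mz] := ltP `|z| m%:R.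
  have d0 : 0 < (m%:R - `|z|) / 2 by rewrite divr_gt0// subr_gt0.
  have eq1 y : `|truncation m u y - z| <= (m%:R - `|z|) / 2 -> truncation m u y = u y.
    move=> h; apply: truncation_id.
    by have := ler_normD (truncation m u y - z) z; rewrite subrK; lra.
  suff H : is_approx_grad u x xi by rewrite (approx_gradE H).
  exists z => [e e0|e e0].
    apply: density0S (density0U (Lz _ e0) (Lz _ d0)) => y [_ /= Hy].
    have [h|h] := ltP ((m%:R - `|z|) / 2) `|truncation m u y - z|; first by right.
    by left; split=> //=; rewrite eq1.
  apply: density0S (density0U (D _ e0) (Lz _ d0)) => y /= Hy.
  have [h|h] := ltP ((m%:R - `|z|) / 2) `|truncation m u y - z|; first by right.
  by left; rewrite /= eq1.
apply: zero; apply/eqP; apply/negP => /negP xi0.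
have := truncation_le u m; move=> tm.
move: mz; rewrite ler_normr => /orP[mz|mz].
  have [c c0] := not_density0_cone x xi0; apply; apply: density0S (D _ c0) => y /= Hy.
  by rewrite ltr_normr; have := tm y; rewrite ler_norml; lra.
have nxi : - xi != 0 by rewrite oppr_eq0.
have [c c0] := not_density0_cone x nxi; apply; apply: density0S (D _ c0) => y /=.
by rewrite dotNl => Hy; rewrite ltr_normr; have := tm y; rewrite ler_norml; lra.
Qed.

(** Two levels are inserted between the approximate limits of the truncation. They necessarily lie
    between [- m] and [m], where the level sets of the truncation and of [u] agree. *)
Lemma disc_set_truncation u (m : nat) : disc_set (truncation m u) `<=` disc_set u.
Proof.
move=> x; rewrite /disc_set/= => H.
have [s /andP[Hs1 Hs2]] : exists s : R, (approx_inf (truncation m u) x < s%:E < approx_sup (truncation m u) x)%E.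
  exact: ereal_between.
have [s' /andP[Hs'1 Hs'2]] := ereal_between Hs2.
rewrite lte_fin in Hs'1.
have ns : ~ density0 [set y | truncation m u y < s] x.
  move=> D; move: Hs1; apply/negP; rewrite -leNgt; apply: ereal_sup_ubound; by exists s.
have ns' : ~ density0 [set y | s' < truncation m u y] x.
  move=> D; move: Hs'2; apply/negP; rewrite -leNgt; apply: ereal_inf_lbound; by exists s'.
have sm : - m%:R < s.
  rewrite ltNge; apply/negP => sm; apply: ns; apply: density0S (density0_0 x) => y /=.
  by have := truncation_le u m y; rewrite ler_norml; lra.
have sm' : s' < m%:R.
  rewrite ltNge; apply/negP => sm'; apply: ns'; apply: density0S (density0_0 x) => y /=.
  by have := truncation_le u m y; rewrite ler_norml; lra.
have nu : ~ density0 [set y | u y < s] x.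
  move=> D; apply: ns; apply: density0S D => y /=; rewrite /truncation.
  by rewrite gt_max gt_min => /andP[/orP[] // h _]; lra.
have nu' : ~ density0 [set y | s' < u y] x.
  move=> D; apply: ns'; apply: density0S D => y /=; rewrite /truncation.
  by rewrite lt_max lt_min => /orP[/andP[]//|h]; lra.
apply: (@le_lt_trans _ _ s%:E).
  apply: ge_ereal_sup => _ [t Dt <-]; rewrite lee_fin leNgt; apply/negP => st.
  by apply: nu; apply: density0S Dt => y /= h; exact: lt_trans st.
apply: (@lt_le_trans _ _ s'%:E); first by rewrite lte_fin.
apply: le_ereal_inf_tmp => _ [t Dt <-]; rewrite lee_fin leNgt; apply/negP => st.
by apply: nu'; apply: density0S Dt => y /= h; exact: lt_trans h.
Qed.

Lemma small_forall (I : finType) (P : I -> R -> Prop) :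
  (forall i, exists2 d : R, 0 < d & forall r, 0 < r < d -> P i r) ->
  exists2 d : R, 0 < d & forall r, 0 < r < d -> forall i, P i r.
Proof.
move=> H; have /choice[d Hd] i : exists d : R, 0 < d /\ forall r, 0 < r < d -> P i r.
  by have [d d0 Hd] := H i; exists d.
have s0 : 0 <= \sum_i (d i)^-1 by apply: sumr_ge0 => i _; rewrite invr_ge0 ltW// (Hd i).1.
exists (1 + \sum_i (d i)^-1)^-1; first by rewrite invr_gt0 ltr_pwDl.
move=> r /andP[r0 rd] i; apply: (Hd i).2; rewrite r0/=; apply: (lt_le_trans rd).
rewrite invf_ple ?posrE ?ltr_pwDl ?(Hd i).1//.
rewrite (bigD1 i)//= addrCA lerDl addr_ge0//.
by apply: sumr_ge0 => j _; rewrite invr_ge0 ltW// (Hd j).1.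
Qed.

Lemma exp2_gt (d : R) : 0 < d -> exists N : nat, forall k, (N <= k)%N -> 2 ^- k < d.
Proof.
move=> d0; exists (Num.truncn d^-1).+1 => k Nk.
apply: lt_le_trans (inv_truncn_le d0); rewrite ltf_pV2 ?posrE ?exprn_gt0//.
by rewrite -natrX ltr_nat; apply: (leq_ltn_trans Nk); exact: ltn_expl.
Qed.

Lemma dyadic_between (s r : R) : 0 < s -> s < r ->
  exists j : nat, r / 2 ^+ j.+1 <= s < r / 2 ^+ j.
Proof.
move=> s0 sr; have r0 := lt_trans s0 sr.
have ex : exists j : nat, r / 2 ^+ j.+1 <= s.
  have [N HN] := exp2_gt (divr_gt0 s0 r0); exists N.
  by rewrite -ler_pdivlMl// mulrC; apply: ltW; exact: HN.
have [j Hj jmin] := ex_minnP ex; exists j; rewrite Hj/=.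
case: j Hj jmin => [|j] Hj jmin; first by rewrite expr0 divr1.
by rewrite ltNge; apply/negP => /jmin; rewrite ltnn.
Qed.

Lemma leb_point x : L [set x] = 0.
Proof.
apply: (@leb_le0 _ _ _ 1) => e e0; rewrite mul1r.
pose r := Num.min 1 e / 2; have m0 : 0 < Num.min 1 e by rewrite lt_min ltr01.
have r0 : 0 < r by rewrite divr_gt0.
apply: (@le_trans _ _ (L (ball x r))).
  by apply: le_outer_measure => y ->; apply: ballxx.
rewrite leb_ball// lee_fin (_ : 2 * r = Num.min 1 e); last by rewrite /r; field.
apply: (@le_trans _ _ (Num.min 1 e)); last by rewrite ge_min lexx orbT.
have m1 : 0 <= Num.min 1 e <= 1 by rewrite (ltW m0) ge_min lexx.
by case: (n) n_gt0 => // m _; rewrite exprS ler_piMr ?(ltW m0)// exprn_ile1; case/andP: m1.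
Qed.

Section approximate_differentiability.
Variables (U : set 'rV[R]_n) (u : 'rV[R]_n -> R) (a : 'I_n -> 'rV[R]_n -> R)
  (sigma : {finite_measure set (borelT 'rV[R]_n) -> \bar R}) (x : 'rV[R]_n).
Hypotheses (oU : open U) (bU : bounded_set U) (bv : bv_on U u a sigma) (Ux : U x).
Hypothesis sing : forall e : R, 0 < e -> exists2 d : R, 0 < d &
    forall r, 0 < r < d -> fine (sigma (ball x r)) <= e * r ^+ n.
Hypothesis leb_pt : forall i (e : R), 0 < e -> exists2 d : R, 0 < d &
    forall r, 0 < r < d -> ball x r `<=` U /\
      \int[mu]_(y in ball x r) `|a i y - a i x| <= e * r ^+ n.

Let xi : 'rV[R]_n := \row_i a i x.
Let w y := u y - (dot xi y + - dot xi x).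

Let B (r : R) := fine (sigma (ball x r)) + \sum_i \int[mu]_(y in ball x r) `|a i y - a i x|.

Let mU := open_measurable_leb oU.
Let mB r : measurable (ball x r : set T) := measurable_ball_leb x r.

Let rint_w : rint mu U w.
Proof. by have [] := bv_on_affine xi (- dot xi x) oU bU bv. Qed.

Let rint_ball r (c : R) : ball x r `<=` U -> rint mu (ball x r) (fun y => `|w y - c|).
Proof.
move=> rU; apply: (rint_norm (mB r)); apply: (rintB (mB r)).
  exact: (rint_sub mU (mB r) rU rint_w).
exact: (@rint_bounded _ T R mu (ball x r) _ `|c| (mB r) (leb_ball_fin x r)).
Qed.

Let B_small (e : R) : 0 < e -> exists2 d : R, 0 < d & forall r, 0 < r < d ->
  ball x r `<=` U /\ B r <= e * r ^+ n.
Proof.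
move=> e0; have n1 : 0 < n.+1%:R :> R by [].
have e10 : 0 < e / n.+1%:R by rewrite divr_gt0.
have [d d0 Hd] := sing e10.
have [d' d'0 Hd'] := small_forall (fun i => leb_pt i e10).
have /nbhs_ballP[d1 /= d10 Hd1] := open_nbhs_nbhs (conj oU Ux).
exists (Num.min d (Num.min d' d1)); first by rewrite !lt_min d0 d'0.
move=> r /andP[r0]; rewrite !lt_min => /and3P[rd rd' rd1]; split.
  by apply: subset_trans Hd1; apply: le_ball; exact: ltW.
have h1 : fine (sigma (ball x r)) <= e / n.+1%:R * r ^+ n by apply: Hd; rewrite r0.
have h2 : \sum_i \int[mu]_(y in ball x r) `|a i y - a i x| <= n%:R * (e / n.+1%:R * r ^+ n).
  rewrite mulr_natl -[X in _ *+ X](card_ord n) -sumr_const; apply: ler_sum => i _.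
  by have [|_] := Hd' r _ i; first by rewrite r0.
apply: (le_trans (lerD h1 h2)); rewrite -[X in X + _]mul1r -mulrDl nat1r.
by rewrite mulrA [n.+1%:R * _]mulrC divfK// gt_eqF.
Qed.

Let C : R := 3 ^+ n * (2 * n%:R).

(** The free error of [poincare] is taken equal to [r ^+ n.+2], negligible against the target order
    [r ^+ n.+1]. *)
Let poinc (r : R) : 0 < r -> ball x r `<=` U -> exists c,
  \int[mu]_(y in ball x r) `|w y - c| <= C * r * B r + r ^+ n.+2.
Proof.
move=> r0 rU; have oB : open (ball x r : set 'rV[R]_n) by exact: ball_open.
have [Iw Ib Hb] := bv_on_sub oU oB rU (bv_on_affine xi (- dot xi x) oU bU bv).
have [|c Hc] := @poincare R n x r w (B r) (r ^+ n.+2) r0 Iw _ (exprn_gt0 _ r0).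
  move=> i psi tp p1; have := Hb _ psi i oB (@subset_refl _ _) tp p1.
  set I1 := \int[mu]_(y in ball x r) _; set I2 := \int[mu]_(y in ball x r) _ => H.
  have H2 : `|I2| <= \int[mu]_(y in ball x r) `|a i y - a i x|.
    apply: (Rint_norm_le (mB r)).
    - exact: (rintM_test (mB r) (Ib i) tp).
    - by have := rint_norm (mB r) (Ib i); congr rint; apply/funext => y; rewrite mxE.
    - by move=> y _; rewrite normrM mxE ler_piMr.
  have H3 : \int[mu]_(y in ball x r) `|a i y - a i x| <=
      \sum_i \int[mu]_(y in ball x r) `|a i y - a i x|.
    rewrite [leRHS](bigD1 i)//= lerDl; apply: sumr_ge0 => j _; exact: Rint_ge0.
  have := ler_normB (I1 + I2) I2; rewrite addrK /B.
  by lra.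
exists c; apply: (le_trans Hc); rewrite lerD2r le_eqVlt; apply/orP; left; apply/eqP.
by rewrite /C; ring.
Qed.

Let C0 : 0 <= C. Proof. by rewrite mulr_ge0 ?exprn_ge0// mulr_ge0. Qed.

Let poinc_small : exists c : nat -> R, forall e : R, 0 < e -> exists N : nat, forall k,
  (N <= k)%N -> ball x (2 ^- k) `<=` U /\
    \int[mu]_(y in ball x (2 ^- k)) `|w y - c k| <= e * (2 ^- k) ^+ n.+1.
Proof.
have r0 k : 0 < 2 ^- k :> R by rewrite invr_gt0 exprn_gt0.
have /choice[c Hc] (k : nat) : exists c, ball x (2 ^- k) `<=` U ->
    \int[mu]_(y in ball x (2 ^- k)) `|w y - c| <= C * 2 ^- k * B (2 ^- k) + (2 ^- k) ^+ n.+2.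
  have [H|nH] := pselect (ball x (2 ^- k : R) `<=` U); last by exists 0.
  by have [c Hc] := poinc (r0 k) H; exists c.
exists c => e e0; have C1 : 0 < 2 * (C + 1) by rewrite mulr_gt0// ltr_wpDl.
have [d d0 Hd] := B_small (divr_gt0 e0 C1).
have de : 0 < Num.min d (e / 2) by rewrite lt_min d0 divr_gt0.
have [N HN] := exp2_gt de; exists N => k Nk.
have := HN k Nk; rewrite lt_min => /andP[kd ke].
have [|kU Bk] := Hd (2 ^- k); first by rewrite r0.
split=> //; apply: (le_trans (Hc k kU)); move: (2 ^- k : R) (r0 k) ke Bk => r {}r0 re Br.
have rn1 : 0 < r ^+ n.+1 by rewrite exprn_gt0.
have h1 : C * r * B r <= e / 2 * r ^+ n.+1.
  apply: (@le_trans _ _ (C * r * (e / (2 * (C + 1)) * r ^+ n))).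
    by rewrite ler_wpM2l// mulr_ge0// ltW.
  rewrite (_ : _ * _ = C / (C + 1) * (e / 2 * r ^+ n.+1)); last first.
    by rewrite exprS invfM; ring.
  rewrite ler_piMl ?mulr_ge0 ?divr_ge0 ?(ltW e0) ?(ltW rn1)//.
  by rewrite ler_pdivrMr ?ltr_wpDl// mul1r lerDl.
have h2 : r ^+ n.+2 <= e / 2 * r ^+ n.+1 by rewrite exprS ler_wpM2r ?(ltW rn1)// ltW.
lra.
Qed.

(** The constants on consecutive dyadic cubes are compared on the smaller cube, where both
    approximate [w]. Their differences are a small multiple of [2 ^- j], so they converge
    geometrically, fast enough to be replaced by their limit; an intermediate radius is bounded by
    the next dyadic one. *)
Let mean_limit : exists z, forall e : R, 0 < e -> exists2 d : R, 0 < d & forall r, 0 < r < d ->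
  ball x r `<=` U /\ \int[mu]_(y in ball x r) `|w y - z| <= e * r ^+ n.+1.
Proof.
have r0 k : 0 < 2 ^- k :> R by rewrite invr_gt0 exprn_gt0.
have [c Hc] := poinc_small.
have rS k : 2 ^- k.+1 = 2 ^- k / 2 :> R by rewrite exprS invfM mulrC.
have rle k : 2 ^- k.+1 <= 2 ^- k :> R by rewrite rS; have := r0 k; lra.
have lebQ k : fine (L (ball x (2 ^- k))) = (2 * 2 ^- k) ^+ n by exact: leb_ball_real.
have Icst r (k : R) : rint mu (ball x r) (fun=> k).
  exact: (@rint_bounded _ T R mu (ball x r) _ `|k| (mB r) (leb_ball_fin x r)).
have step e : 0 < e -> exists N : nat, forall k, (N <= k)%N -> ball x (2 ^- k) `<=` U /\
    \int[mu]_(y in ball x (2 ^- k)) `|w y - c k| <= e * (2 ^- k) ^+ n.+1 /\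
    forall m, `|c (k + m)%N - c k| <= 4 * e * 2 ^- k.
  move=> e0; have [N HN] := Hc e e0; exists N => k Nk; have [kU Hk] := HN k Nk; split=> //; split=> //.
  have one j : (N <= j)%N -> `|c j.+1 - c j| <= 2 * e * 2 ^- j.
    move=> Nj; have [jU Hj] := HN j Nj; have [jU' Hj'] := HN j.+1 (leqW Nj).
    have sub : ball x (2 ^- j.+1) `<=` (ball x (2 ^- j) : set 'rV[R]_n).
      by apply: le_ball; exact: rle.
    have := @le_Rintegral _ T R mu (ball x (2 ^- j.+1)) (fun=> `|c j.+1 - c j|)
      (fun y => `|w y - c j.+1| + `|w y - c j|) (mB _) (Icst _ _)
      (rintD (mB _) (rint_ball _ jU') (rint_sub (mB _) (mB _) sub (rint_ball _ jU))).
    have I1 := rint_ball (c j.+1) jU'.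
    have I2 := rint_sub (mB _) (mB _) sub (rint_ball (c j) jU).
    rewrite (RintegralD (mB _) I1 I2) Rintegral_cst// lebQ => H.
    have {}H := H (fun y _ => _).
    have h3 := Rint_sub (mB _) (mB _) sub (rint_ball (c j) jU) (fun y _ => normr_ge0 _).
    have rj := r0 j; have rn : 0 < (2 ^- j : R) ^+ n by rewrite exprn_gt0.
    have E : 2 * 2 ^- j.+1 = 2 ^- j :> R by rewrite rS; field.
    rewrite E in H.
    have h4 : e * 2 ^- j.+1 ^+ n.+1 <= e * (2 ^- j) ^+ n.+1.
      rewrite ler_wpM2l ?(ltW e0)// lerXn2r ?nnegrE ?(ltW (r0 _))//.
    rewrite -(ler_pM2r rn); apply: le_trans (H _) _.
      move=> y; have := ler_normB (w y - c j) (w y - c j.+1).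
      by rewrite [leRHS]addrC; congr (`|_| <= _); ring.
    have -> : 2 * e * 2 ^- j * (2 ^- j) ^+ n = 2 * (e * (2 ^- j) ^+ n.+1).
      by rewrite [in RHS]exprS; ring.
    by rewrite mulr_natl mulr2n; apply: lerD; [exact: le_trans Hj' h4|exact: le_trans h3 Hj].
  move=> m; suff : `|c (k + m)%N - c k| <= 4 * e * (2 ^- k - 2 ^- (k + m)).
    by move/le_trans; apply; rewrite ler_wpM2l ?mulr_ge0 ?(ltW e0)// gerBl ltW.
  elim: m => [|m IH]; first by rewrite addn0 !subrr normr0 mulr0.
  rewrite addnS rS; have := one _ (leq_trans Nk (leq_addr m k)).
  have := ler_normD (c (k + m).+1 - c (k + m)%N) (c (k + m)%N - c k); rewrite subrKA.
  by lra.
have cv : cvg (c @ \oo).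
  apply/cauchy_cvgP/cauchy_exP => e e0.
  have [N HN] := step (e / 8) (divr_gt0 e0 (ltr0n R 8)).
  have [_ [_ H]] := HN N (leqnn N); exists (c N); exists N => // k Nk.
  rewrite -ball_normE /ball_/= distrC -(subnKC Nk).
  apply: (le_lt_trans (H _)); have h : 2 ^- N <= 1 :> R.
    by rewrite invf_le1 ?exprn_gt0// exprn_ege1// ler1n.
  have := ler_wpM2l (ltW e0) h; lra.
exists (lim (c @ \oo)); set z := lim _ => e e0.
pose M : R := (1 + 4 * 2 ^+ n) * 2 ^+ n.+1.
have M0 : 0 < M.
  by rewrite /M mulr_gt0 ?exprn_gt0// ltr_pwDl// mulr_ge0// exprn_ge0.
have e'0 : 0 < e / M by rewrite divr_gt0.
have [N HN] := step _ e'0.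
exists (2 ^- N) => // r /andP[rp rN].
have r1 : r < 1.
  by apply: (lt_le_trans rN); rewrite invf_le1 ?exprn_gt0// exprn_ege1// ler1n.
have [k /andP[k1 k2]] := dyadic_between rp r1; rewrite !div1r in k1 k2.
have Nk : (N <= k)%N.
  rewrite -ltnS -(ltr_eXn2l (_ : 1 < 2 :> R)) ?ltr1n//.
  by rewrite -ltf_pV2 ?posrE ?exprn_gt0//; exact: le_lt_trans k1 rN.
have [kU [Hk ck]] := HN k Nk.
have rk : ball x r `<=` (ball x (2 ^- k) : set 'rV[R]_n) by apply: le_ball; exact: ltW.
split; first exact: subset_trans rk kU.
have zk : `|z - c k| <= 4 * (e / M) * 2 ^- k.
  apply/ler_addgt0Pr => t t0.
  have /cvgrPdist_lt/(_ _ t0)[N' _ HN'] := cv.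
  have := HN' (k + N')%N (leq_addl _ _); rewrite /= => h.
  have := ler_normD (z - c (k + N')%N) (c (k + N')%N - c k); rewrite subrKA.
  by have := ck N'; move: h; rewrite -/z; lra.
have I1 := rint_ball (c k) kU.
apply: (@le_trans _ _ (\int[mu]_(y in ball x (2 ^- k)) `|w y - z|)).
  by apply: (Rint_sub (mB _) (mB _) rk (rint_ball z kU)).
apply: (@le_trans _ _ (\int[mu]_(y in ball x (2 ^- k)) (`|w y - c k| + `|z - c k|))).
  apply: (le_Rintegral (mB _) (rint_ball z kU) (rintD (mB _) I1 (Icst _ _))) => y _.
  by rewrite (distrC z) ler_distD.
rewrite (RintegralD (mB _) I1 (Icst _ _)) Rintegral_cst// lebQ exprMn.
rewrite rS in k1; move: (2 ^- k : R) (r0 k) k1 Hk zk => s s0 k1 Hk zk.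
apply: (@le_trans _ _ (e / M * (1 + 4 * 2 ^+ n) * s ^+ n.+1)).
  rewrite mulrDr mulr1 mulrDl lerD//.
  apply: (@le_trans _ _ (4 * (e / M) * s * (2 ^+ n * s ^+ n))).
    by rewrite ler_wpM2r// mulr_ge0// exprn_ge0// ltW.
  by rewrite exprS le_eqVlt; apply/orP; left; apply/eqP; ring.
have h : s ^+ n.+1 <= (2 * r) ^+ n.+1.
  by rewrite lerXn2r ?nnegrE ?mulr_ge0 ?(ltW s0) ?(ltW rp)//; lra.
have k0 : 0 <= e / M * (1 + 4 * 2 ^+ n).
  by rewrite mulr_ge0 ?(ltW e'0)// addr_ge0// mulr_ge0// exprn_ge0.
apply: (le_trans (ler_wpM2l k0 h)).
rewrite exprMn (_ : e / M * _ * _ = e / M * M * r ^+ n.+1); last by rewrite /M; ring.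
by rewrite divfK// gt_eqF.
Qed.

(** The punctured cube is cut into dyadic shells. On the shell of radius [rj j] the threshold is at
    least [e * rj j.+1], so the Markov inequality bounds the bad set by [e2 * r ^+ n / 2 ^ j.+1],
    which sums to the required bound. *)
Let density_grad : exists z, forall e : R, 0 < e ->
  density0 [set y | e * enorm (y - x) < `|w y - z|] x.
Proof.
have [z Hz] := mean_limit; exists z => e e0; apply/density0P => e2 e20.
have e'0 : 0 < e * e2 / 4 by rewrite divr_gt0// mulr_gt0.
have [d d0 Hd] := Hz _ e'0; exists d => // r /andP[r0 rd].
pose rj j := r / 2 ^+ j.
have rj0 j : 0 < rj j by rewrite divr_gt0// exprn_gt0.
have rjr j : rj j <= r by rewrite /rj ler_pdivrMr ?exprn_gt0// ler_peMr ?(ltW r0)// exprn_ege1// ler1n.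
pose A j := ball x (rj j) `&` [set y | e * rj j.+1 <= `|w y - z|].
have LA j : (L (A j) <= ((e2 * r ^+ n) / (2 ^ j.+1)%:R)%:E)%E.
  have [|jU Hj] := Hd (rj j); first by rewrite rj0 (le_lt_trans (rjr j)).
  have t0 : 0 < e * rj j.+1 by rewrite mulr_gt0.
  have := Rint_markov (mB _) (rint_ball z jU) t0 (fun y _ => normr_ge0 _).
  have Afin : L (A j) \is a fin_num.
    rewrite ge0_fin_numE ?outer_measure_ge0//; apply: (@leb_fin_ball _ _ _ x (rj j)).
    by move=> y [].
  rewrite -(fineK Afin) lee_fin => H; have {H Hj}H := le_trans H Hj.
  rewrite -ler_pdivlMl// in H; apply: (le_trans H).
  have E1 : rj j = 2 * rj j.+1 by rewrite /rj exprS invfM; field; rewrite expf_neq0.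
  have -> : (e * rj j.+1)^-1 * (e * e2 / 4 * rj j ^+ n.+1) = e2 / 2 * rj j ^+ n.
    rewrite exprS [X in X * _ ^+ n]E1; field.
    by rewrite (gt_eqF e0) gt_eqF.
  rewrite natrX exprS invfM mulrA [leRHS]mulrAC -!mulrA ler_wpM2l ?(ltW e20)//.
  rewrite mulrA [leRHS]mulrC ler_wpM2l// /rj expr_div_n ler_wpM2l ?exprn_ge0 ?(ltW r0)//.
  rewrite lef_pV2 ?posrE ?exprn_gt0// -exprM ler_eXn2l ?ltr1n//.
  by rewrite leq_pmulr.
have cov : [set y | e * enorm (y - x) < `|w y - z|] `&` ball x r `<=` [set x] `|` \bigcup_j A j.
  move=> y [/= Hy]; rewrite -ball_normE /ball_/= distrC => yr.
  have [->|yx] := eqVneq y x; [by left|right].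
  have yx0 : 0 < `|y - x| by rewrite normr_gt0 subr_eq0.
  have [j /andP[j1 j2]] := dyadic_between yx0 yr; exists j => //; split.
    by rewrite -ball_normE /ball_/= distrC.
  apply: ltW; apply: le_lt_trans Hy; rewrite ler_wpM2l ?(ltW e0)//.
  exact: le_trans j1 (norm_le_enorm _).
have e2n : 0 <= e2 * r ^+ n by rewrite mulr_ge0 ?(ltW e20)// exprn_ge0// ltW.
apply: (le_trans (le_outer_measure L _ _ cov)).
apply: (@le_trans _ _ (L [set x] + L (\bigcup_j A j))%E); first exact: outer_measureU2.
rewrite leb_point add0e.
apply: (le_trans (outer_measure_sigma_subadditive L A)).
apply: le_trans (epsilon_trick0 xpredT e2n).
by apply: lee_nneseries => // j _; exact: LA.
Qed.

Lemma approx_differentiable : is_approx_grad u x xi.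
Proof.
have [z Hz] := density_grad.
have Hz' e : 0 < e -> density0 [set y | e * enorm (y - x) < `|u y - z - dot xi (y - x)|] x.
  move=> e0; have := Hz e e0; congr density0; apply/seteqP; split=> y /=;
  by rewrite /w dotBr (_ : u y - z - _ = u y - (dot xi y - dot xi x) - z)//; ring.
by exists z => //; exact: approx_lim_of_grad Hz'.
Qed.

End approximate_differentiability.

Lemma approx_grad_ae (U : set 'rV[R]_n) (u : 'rV[R]_n -> R) (a : 'I_n -> 'rV[R]_n -> R)
  (sigma : {finite_measure set (borelT 'rV[R]_n) -> \bar R}) (Z : set (borelT 'rV[R]_n)) :
  open U -> bounded_set U -> bv_on U u a sigma ->
  measurable Z -> L Z = 0 -> sigma (~` Z) = 0 ->
  L [set x | U x /\ ~ is_approx_grad u x (\row_i a i x)] = 0.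
Proof.
move=> oU bU bv mZ Z0 sZ.
have h1 := singular_density oU bU mZ Z0 sZ.
have [_ Ia _] := bv; have h2 i := lebesgue_point_null oU bU (Ia i).
apply/eqP; rewrite eq_le outer_measure_ge0 andbT.
set S1 := [set x | _] in h1; pose S2 i := [set x | U x /\ ~ (forall e : R, 0 < e -> exists2 d : R, 0 < d &
    forall r, 0 < r < d -> ball x r `<=` U /\
      \int[mu]_(y in ball x r) `|a i y - a i x| <= e * r ^+ n)].
have h3 : L (\bigcup_(k in [set: nat]) (if insub k is Some i then S2 i else set0)) = 0.
  by apply: leb_bigcup0 => k; case: insubP => [i _ _|_]; [exact: h2|exact: outer_measure0].
apply: (@le_trans _ _ (L S1 + L (\bigcup_(k in [set: nat]) (if insub k is Some i then S2 i else set0)))%E);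
  last by rewrite h1 h3 add0e.
apply: le_trans (outer_measureU2 _ _ _); apply: le_outer_measure => x [Ux Hx].
apply: contrapT => /not_orP[n1 n2]; apply: Hx.
apply: (approx_differentiable oU bU bv Ux) => [|i].
  by apply: contrapT => H; apply: n1; split.
apply: contrapT => H; apply: n2; exists i => //.
by rewrite valK.
Qed.

End density.

Lemma ereal_sub_swap (R : realType) (p q j k : \bar R) : p \is a fin_num ->
  q \is a fin_num -> j \is a fin_num -> k \is a fin_num ->
  (p - q = j - k -> j + q = p + k)%E.
Proof.
case: p q j k => [p||] [q||] [j||] [k||] //= _ _ _ _ [H].
by congr EFin; lra.
Qed.

(** * From SBV to a domination of the singular part *)

Section charge_integrals.
Context d (T : measurableType d) (R : realType).
Implicit Types (f : T -> R).

Lemma rint_finite (m : {measure set T -> \bar R}) f (M : R) : (m setT < +oo)%E ->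
  measurable_fun [set: T] f -> (forall x, `|f x| <= M) -> rint m setT f.
Proof. by move=> mfin mf fM; apply: (rint_bounded measurableT mfin mf (fun x _ => fM x)). Qed.

Lemma measure_add_fin (m1 m2 : {measure set T -> \bar R}) :
  (m1 setT < +oo)%E -> (m2 setT < +oo)%E -> (measure_add m1 m2 setT < +oo)%E.
Proof. by move=> h1 h2; rewrite measure_addE lte_add_pinfty. Qed.

Lemma Rint_measure_add (m1 m2 : {measure set T -> \bar R}) f (M : R) :
  (m1 setT < +oo)%E -> (m2 setT < +oo)%E -> measurable_fun [set: T] f ->
  (forall x, `|f x| <= M) ->
  \int[measure_add m1 m2]_x f x = \int[m1]_x f x + \int[m2]_x f x.
Proof.
move=> h1 h2 mf fM.
have I1 := rint_finite h1 mf fM; have I2 := rint_finite h2 mf fM.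
rewrite /Rintegral (integral_measure_add measurableT I1 I2).
by rewrite fineD//; exact: integrable_fin_num.
Qed.

Lemma Rint_eq_measure (m1 m2 : {measure set T -> \bar R}) f :
  (forall A, measurable A -> m1 A = m2 A) -> \int[m1]_x f x = \int[m2]_x f x.
Proof. by move=> h; rewrite /Rintegral; congr fine; apply: eq_measure_integral => A mA _; exact: h. Qed.

Lemma finT (m : {finite_measure set T -> \bar R}) : (m setT < +oo)%E.
Proof. by rewrite ltey_eq fin_num_measure. Qed.

(* Both sides of [nu = P - N] are moved to where they become measures, because
   the Jordan decomposition chosen in [charge_integral] is arbitrary. *)
Lemma charge_integralE (nu : {charge set T -> \bar R}) (P N : {measure set T -> \bar R}) f (M : R) :
  (P setT < +oo)%E -> (N setT < +oo)%E ->
  (forall A, measurable A -> nu A = (P A - N A)%E) ->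
  measurable_fun [set: T] f -> (forall x, `|f x| <= M) ->
  charge_integral nu f = \int[P]_x f x - \int[N]_x f x.
Proof.
move=> Pfin Nfin nuE mf fM; rewrite /charge_integral.
case: cid => P' [N' HN]; case: cid => N'' HN'' /=.
set J := jordan_pos _; set K := jordan_neg _.
have fin (m : {measure set T -> \bar R}) A : (m setT < +oo)%E -> measurable A -> m A \is a fin_num.
  move=> mfin mA; rewrite ge0_fin_numE//; apply: le_lt_trans mfin.
  exact: (le_measure m (mem_set mA) (mem_set measurableT) (@subsetT _ _)).
have E A : measurable A -> measure_add J N A = measure_add P K A.
  move=> mA; rewrite !measure_addE.
  have := jordan_decomp HN'' mA; rewrite nuE// /cadd/= cscaleN1/=.
  exact: (ereal_sub_swap (fin P A Pfin mA) (fin N A Nfin mA) (fin J A (finT J) mA)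
    (fin K A (finT K) mA)).
have := Rint_eq_measure f E.
rewrite (Rint_measure_add (finT J) Nfin mf fM) (Rint_measure_add Pfin (finT K) mf fM).
lra.
Qed.

Lemma finite_measure_sum (I : finType) (m : I -> {finite_measure set T -> \bar R}) :
  exists s : {finite_measure set T -> \bar R}, forall A, s A = (\sum_i m i A)%E.
Proof.
pose m' k : {measure set T -> \bar R} := 
  if (insub k : option 'I_#|I|) is Some j then m (@enum_val I predT j) else mzero.
pose s0 := msum m' #|I|.
have sE A : s0 A = (\sum_i m i A)%E.
  rewrite /s0 /msum/= [RHS](reindex_onto (@enum_val I predT) enum_rank)/=; last by move=> i _; rewrite enum_rankK.
  rewrite [RHS](eq_bigl xpredT); last by move=> k; rewrite enum_valK eqxx.
  by apply: eq_bigr => k _; rewrite /m' valK.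
have sfin : fin_num_fun s0.
  by move=> A mA; rewrite sE; apply/sum_fin_numP => i _ _; exact: fin_num_measure.
exists (HB.pack_for {finite_measure set T -> \bar R} s0 (Measure_isFinite.Build _ _ _ s0 sfin)).
exact: sE.
Qed.

End charge_integrals.

Section sbv.
Context (R : realType) (n : nat).
Implicit Types (U K : set 'rV[R]_n) (u f phi : 'rV[R]_n -> R).
Local Notation L := (@leb_outer R n).
Local Notation T := (lebT R n).
Local Notation Bo := (borelT 'rV[R]_n).
Local Notation mu := (@leb R n).

(** The Radon-Nikodym theorem needs both measures on one sigma-algebra, and distributional
    derivatives are charges on Borel sets. *)
Definition leb_borel (A : set Bo) : \bar R := mu (A : set T).

Let leb_borel0 : leb_borel set0 = 0%E. Proof. exact: measure0. Qed.

Let leb_borel_ge0 A : (0 <= leb_borel A)%E. Proof. exact: measure_ge0. Qed.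

Let leb_borel_sigma_additive : semi_sigma_additive leb_borel.
Proof.
move=> F mF tF mUF; apply: (@measure_semi_sigma_additive _ _ _ mu F).
- by move=> k; exact: borel_measurable_leb.
- exact: tF.
- exact: borel_measurable_leb.
Qed.

HB.instance Definition _ := isMeasure.Build _ _ _ leb_borel
  leb_borel0 leb_borel_ge0 leb_borel_sigma_additive.

Let leb_borel_sigma_finite : sigma_finite setT leb_borel.
Proof.
exists (fun k => ball (0 : 'rV[R]_n) k.+1%:R : set Bo).
  apply/seteqP; split=> // x _; exists (Num.truncn `|x|) => //.
  rewrite -ball_normE /ball_/= sub0r normrN.
  by have /andP[] := truncn_itv (normr_ge0 x).
move=> k; split; first exact: measurable_ball_borel.
exact: leb_ball_fin.
Qed.

HB.instance Definition _ := Measure_isSigmaFinite.Build _ _ _ leb_borel leb_borel_sigma_finite.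

Lemma borel_fun_leb (f : 'rV[R]_n -> \bar R) :
  measurable_fun [set: Bo] f -> measurable_fun [set: T] f.
Proof. by move=> mf _ B mB; apply: borel_measurable_leb; apply: mf. Qed.

Lemma continuous_borel f : continuous f -> measurable_fun [set: Bo] f.
Proof.
move=> cf; apply: (measurability _ (RGenOInfty.measurableE R)) => // _ [_ [a ->] <-].
by rewrite setTI; apply: open_borel; apply: open_comp => // x _; exact: cf.
Qed.

(** The identity from the Lebesgue to the Borel sigma-algebra is measurable and pushes [leb] forward
    to [leb_borel]. *)
Lemma integral_leb_borel (f : 'rV[R]_n -> \bar R) : measurable_fun [set: Bo] f ->
  leb_borel.-integrable setT f ->
  mu.-integrable setT f /\ (\int[leb_borel]_x f x = \int[mu]_x f x)%E.
Proof.
move=> mf If; pose phi (x : T) : Bo := x.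
have mphi : measurable_fun [set: T] phi.
  by move=> _ B mB; rewrite setTI; exact: borel_measurable_leb.
have E (g : Bo -> \bar R) : measurable_fun [set: Bo] g -> (forall x, 0 <= g x)%E ->
    (\int[leb_borel]_x g x = \int[mu]_x g x)%E.
  move=> mg g0; have H := @ge0_integral_pushforward _ _ _ _ R phi mphi mu setT g measurableT mg
    (fun y _ => g0 y).
  by rewrite -[RHS]H; apply: eq_measure_integral.
split.
  apply/integrableP; split; first exact: borel_fun_leb.
  have /integrableP[_] := If; rewrite E//.
  exact: measurableT_comp.
rewrite integralE [RHS]integralE !E//; [exact: measurable_funeneg|exact: measurable_funepos].
Qed.

Lemma finite_measure_density (P : {finite_measure set Bo -> \bar R}) :
  P `<< (L : set Bo -> \bar R) ->
  exists2 g : 'rV[R]_n -> R, rint mu setT g &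
    forall phi (M : R), continuous phi -> (forall x, `|phi x| <= M) ->
      \int[P]_x phi x = \int[mu]_x (g x * phi x).
Proof.
move=> Pac.
have Pac' : charge_of_finite_measure P `<< leb_borel by exact: Pac.
pose G := Radon_Nikodym (charge_of_finite_measure P) leb_borel.
have IG : leb_borel.-integrable setT G by exact: Radon_Nikodym_integrable.
have Gfin x : G x \is a fin_num by exact: Radon_Nikodym_fin_num.
have GE : G = fun x => (fine (G x))%:E by apply/funext => x; rewrite fineK.
have mG : measurable_fun [set: Bo] G by exact: measurable_int IG.
have [IG' _] := integral_leb_borel mG IG.
exists (fine \o G); first by rewrite /rint; rewrite GE in IG'.
move=> phi M cphi phiM; have mphi := continuous_borel cphi.
have Iphi : P.-integrable setT (fun x => (phi x)%:E) := rint_finite (finT P) mphi phiM.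
have Pac0 : P `<< leb_borel by exact: Pac.
have := Radon_Nikodym_change_of_variables Pac0 measurableT Iphi.
rewrite -/G => E; rewrite /Rintegral -E.
have mf : measurable_fun [set: Bo] (fun x => (phi x)%:E * G x)%E.
  by apply: emeasurable_funM => //; exact/measurable_EFinP.
have If : leb_borel.-integrable setT (fun x => (phi x)%:E * G x)%E.
  have IG2 : rint leb_borel setT (fine \o G) by rewrite /rint; rewrite GE in IG.
  have := rintMr measurableT IG2 mphi (fun x _ => phiM x).
  by rewrite /rint; congr (_.-integrable _ _); apply/funext => x; rewrite mulrC EFinM /= fineK.
have [_ ->] := integral_leb_borel mf If.
by congr fine; apply: eq_integral => x _; rewrite [in LHS]GE -EFinM mulrC.
Qed.

Lemma Rint_finite_support (s : {finite_measure set Bo -> \bar R}) (O' : set 'rV[R]_n) phi :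
  open O' -> test_fun O' phi -> (forall x, `|phi x| <= 1) ->
  `|\int[s]_x phi x| <= fine (s O').
Proof.
move=> oO tp p1; have [_ [K [_ KO K0]]] := tp.
have mO := open_borel oO.
rewrite (@Rint_support _ Bo R s setT (O' : set Bo) phi (@subsetT _ _)); last first.
  by move=> x _ nO; apply: K0 => /KO.
have mphi := continuous_borel (smooth_continuous (test_fun_smooth tp)).
have := @Rint_bound _ Bo R s (O' : set Bo) phi 1 mO; rewrite mul1r; apply=> //.
- by rewrite ltey_eq fin_num_measure.
- exact: measurable_funTS.
Qed.

(** [a] gathers the densities of the absolutely continuous components, and [sigma] is the sum over
    the components of the positive and negative parts of [Ds]. It is therefore concentrated on a
    null set and does not charge Borel sets off the discontinuity set. *)
Lemma SBV_bv_on U u : open U -> bounded_set U -> SBV U u ->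
  exists (a : 'I_n -> 'rV[R]_n -> R) (sigma : {finite_measure set Bo -> \bar R}) (Z : set Bo),
    [/\ bv_on U u a sigma, measurable Z, L Z = 0 /\ sigma (~` Z) = 0 &
      forall B : set Bo, measurable B -> B `<=` U `\` disc_set u -> sigma B = 0].
Proof.
move=> oU bU [Iu [Da [Ds [DD Dac [Z [mZ Z0 DZ]] Dd]]]].
have mU := open_measurable_leb oU.
(* Recorded together with the decomposition: a set all of whose Borel subsets are null for [Ds i] is
   null for both parts. The two concentration properties of [SBV] are of this form. *)
have /choice[PN HPN] : forall i, exists PN : {finite_measure set Bo -> \bar R} *
     {finite_measure set Bo -> \bar R},
   [/\ forall A, measurable A -> Ds i A = (PN.1 A - PN.2 A)%E,
     forall A, measurable A -> (forall B, measurable B -> B `<=` A -> Ds i B = 0%E) ->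
       (PN.1 A + PN.2 A = 0)%E & True].
  move=> i; have [P [N H]] := Hahn_decomposition (Ds i).
  exists (jordan_pos H : {finite_measure set Bo -> \bar R},
    jordan_neg H : {finite_measure set Bo -> \bar R}); split=> //= A mA.
    by rewrite [LHS](jordan_decomp H mA) /cadd/= cscaleN1.
  move=> HA; have [[mP _] [mN _] _ _] := H.
  rewrite jordan_posE cjordan_posE jordan_negE cjordan_negE /crestr0 mem_set// /crestr.
  by rewrite !HA ?oppe0 ?adde0//; [exact: measurableI|exact: measurableI].
have /choice[b Hb] : forall i, exists b : 'rV[R]_n -> R, rint mu setT b /\
    forall phi, test_fun U phi -> (forall x, `|phi x| <= 1) ->
      charge_integral (cadd (Da i) (Ds i)) phi =
        \int[mu]_x (b x * phi x) + \int[(PN i).1]_x phi x - \int[(PN i).2]_x phi x.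
  move=> i; have [P [N H]] := Hahn_decomposition (Da i).
  have Dac' : Da i `<< leb_borel by exact: Dac.
  have [gp Ip Ep] := finite_measure_density (jordan_pos_dominates H Dac').
  have [gn In En] := finite_measure_density (jordan_neg_dominates H Dac').
  exists (fun x => gp x - gn x); split; first exact: rintB.
  move=> phi tp p1; have cphi := smooth_continuous (test_fun_smooth tp).
  have mphi := continuous_borel cphi.
  rewrite (@charge_integralE _ _ _ _ (measure_add (jordan_pos H) (PN i).1)
    (measure_add (jordan_neg H) (PN i).2) phi 1) //.
  - have f1 := finT (jordan_pos H); have f2 := finT (jordan_neg H).
    rewrite (Rint_measure_add f1 (finT _) mphi p1) (Rint_measure_add f2 (finT _) mphi p1).
    rewrite (Ep _ _ cphi p1) (En _ _ cphi p1).
    have -> : \int[mu]_x ((gp x - gn x) * phi x) =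
        \int[mu]_x (gp x * phi x) - \int[mu]_x (gn x * phi x).
      have I1 := rintM_test measurableT Ip tp; have I2 := rintM_test measurableT In tp.
      by rewrite -(RintegralB measurableT I1 I2); apply: (@Rint_eq _ T R mu) => x _; rewrite mulrBl.
    by ring.
  - by apply: measure_add_fin; exact: finT.
  - by apply: measure_add_fin; exact: finT.
  move=> A mA; transitivity ((jordan_pos H A + (PN i).1 A) - (jordan_neg H A + (PN i).2 A))%E;
    last by congr (_ - _)%E; symmetry; exact: measure_addE.
  have [HS _ _] := HPN i.
  transitivity ((jordan_pos H A - jordan_neg H A) + ((PN i).1 A - (PN i).2 A))%E.
    congr (_ + _)%E; last exact: HS.
    by rewrite [LHS](jordan_decomp H mA) /cadd/= cscaleN1.
  have f1 := fin_num_measure (jordan_pos H) A mA; have f2 := fin_num_measure (jordan_neg H) A mA.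
  have f3 := fin_num_measure (PN i).1 A mA; have f4 := fin_num_measure (PN i).2 A mA.
  by rewrite oppeD ?fin_num_adde_defl// addeACA.
have [sigma sE] := finite_measure_sum (fun j : 'I_n + 'I_n =>
  match j with inl i => (PN i).1 | inr i => (PN i).2 end).
have {}sE A : sigma A = (\sum_i ((PN i).1 A + (PN i).2 A))%E.
  by rewrite sE big_sumType/= big_split.
exists b, sigma, Z; split=> //.
- split=> //; first by move=> i; exact: (rint_sub measurableT mU (@subsetT _ _) (Hb i).1).
  move=> O' phi i oO OU tp p1; have tpU := test_fun_sub OU tp.
  have -> : \int[mu]_(x in U) (u x * partial i phi x) + \int[mu]_(x in U) (b i x * phi x) =
      - (\int[(PN i).1]_x phi x) + \int[(PN i).2]_x phi x.
    have := DD phi i tpU; rewrite (Hb i).2// => ->.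
    have [_ [K [_ KU K0]]] := tpU.
    rewrite (@Rint_support _ T R mu setT U (fun x => b i x * phi x) (@subsetT _ _)); last first.
      by move=> x _ nU; rewrite K0 ?mulr0// => /KU.
    by ring.
  apply: (le_trans (ler_normD _ _)); rewrite normrN.
  apply: (le_trans (lerD (Rint_finite_support _ oO tp p1) (Rint_finite_support _ oO tp p1))).
  have mO := open_borel oO.
  rewrite -fineD ?fin_num_measure//; apply: fine_le; rewrite ?fin_numD ?fin_num_measure//.
  rewrite sE (bigD1 i)//= leeDl//; apply: sume_ge0 => j _; exact: adde_ge0.
- split=> //; rewrite sE big1// => i _; have [_ H _] := HPN i.
  by apply: H; [exact: measurableC|move=> B mB BZ; exact: DZ].
move=> B mB BU; rewrite sE big1// => i _; have [_ H _] := HPN i.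
by apply: H => // C mC CB; apply: Dd => //; exact: subset_trans CB BU.
Qed.

End sbv.

Lemma is_derive_eps (R : realType) (f : R -> R) (x d e : R) :
  is_derive x (1 : R) f d -> 0 < e -> exists2 c : R, 0 < c &
  forall h, h != 0 -> `|h| < c -> `|h^-1 * (f (h + x) - f x) - d| <= e.
Proof.
move=> [dv dE] e0.
have H : (fun h => h^-1 *: (f (h *: (1 : R) + x) - f x)) @ 0^' --> d by rewrite -dE; exact: dv.
move/cvgrPdist_le : H => /(_ _ e0)/nbhs_ballP[c /= c0 Hc]; exists c => // h h0 hc.
have := Hc h; rewrite /ball/= sub0r normrN => /(_ hc h0).
by rewrite distrC /GRing.scale/= mulr1.
Qed.

Lemma Rint_dominated0 d (T : measurableType d) (R : realType) (mu : {measure set T -> \bar R})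
    (D : set T) (f : nat -> T -> R) (g : T -> R) (e : R) : measurable D ->
  (forall k, measurable_fun D (f k)) -> rint mu D g ->
  (forall x k, D x -> `|f k x| <= g x) -> (forall x, D x -> f ^~ x @ \oo --> (0 : R)) ->
  0 < e -> exists N, forall k, (N <= k)%N -> \int[mu]_(x in D) `|f k x| <= e.
Proof.
move=> mD mf Ig fg f0 e0.
have If k : rint mu D (f k) by apply: rint_le (mf k) Ig _ => // x Dx; exact: fg.
have H1 k : measurable_fun D (fun x => (f k x)%:E) by apply/measurable_EFinP.
have H2 : {ae mu, forall x, D x -> (fun k => (f k x)%:E) @ \oo --> (cst 0%E : T -> \bar R) x}.
  by apply: aeW => x Dx; apply: cvg_EFin; [exact: nearW|exact: f0].
have H3 : {ae mu, forall x k, D x -> (`|(f k x)%:E| <= (g x)%:E)%E}.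
  by apply: aeW => x k Dx; rewrite lee_fin fg.
have [_ H _] := dominated_convergence mD H1 (measurable_cst _) H2 Ig H3.
have /fine_cvgP[_ /cvgrPdist_le/(_ _ e0)[N _ HN]] := H.
exists N => k Nk; have := HN k Nk; rewrite /= sub0r normrN => /(le_trans (ler_norm _)).
by congr (fine _ <= _); apply: eq_integral => x _; rewrite subr0.
Qed.

(** * Chain rule across the jump set *)

Section chain_rule.
Context (R : realType) (n : nat).
Implicit Types (x y v : 'rV[R]_n) (r s : R) (U V K : set 'rV[R]_n)
  (w f g phi psi : 'rV[R]_n -> R).
Local Notation L := (@leb_outer R n).
Local Notation T := (lebT R n).
Local Notation mu := (@leb R n).
Local Notation e_ i := (delta_mx 0 i : 'rV[R]_n).

Lemma compact_margin K U : compact K -> open U -> K `<=` U ->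
  exists2 d : R, 0 < d & forall x y, K x -> `|x - y| < d -> U y.
Proof.
move=> cK oU KU.
have /choice[rho Hrho] x : exists r : R, K x -> 0 < r /\ ball x (2 * r) `<=` U.
  have [Kx|nKx] := pselect (K x); last by exists 0.
  have /nbhs_ballP[r /= r0 Hr] := open_nbhs_nbhs (conj oU (KU _ Kx)).
  by exists (r / 2) => _; rewrite divr_gt0// mulrC divfK.
have [s [sK Hs]] := compact_cover_balls cK (fun x Kx => (Hrho x Kx).1).
have [d d0 Hd] : exists2 d : R, 0 < d & forall x, x \in s -> d <= rho x.
  elim: s sK {Hs} => [|z s IH] sK; first by exists 1.
  have [|d d0 Hd] := IH; first by move=> x xs; apply: sK; rewrite inE xs orbT.
  exists (Num.min d (rho z)).
    by rewrite lt_min d0 (Hrho z _).1//; apply: sK; exact: mem_head.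
  by move=> x; rewrite inE => /predU1P[->|/Hd h]; rewrite ge_min ?lexx ?orbT// h.
exists d => // x y Kx xy; have [z zs zx] := Hs x Kx.
apply: (Hrho z (sK z zs)).2; move: zx; rewrite -!ball_normE /ball_/= => zx.
have := ler_normD (z - x) (x - y); rewrite subrKA => /le_lt_trans; apply.
by rewrite mulr_natl mulr2n ltrD// (lt_le_trans xy)// Hd.
Qed.

Lemma difference_quotient_cvg (G : R -> R) (w b d : R) : is_derive w (1 : R) G d ->
  (fun k : nat => k.+1%:R * (G (w - k.+1%:R^-1 * b) - G w) + d * b) @ \oo --> (0 : R).
Proof.
move=> dG; apply/cvgrPdist_le => e e0.
have [b0|b0] := eqVneq b 0.
  by apply: nearW => k; rewrite b0 !mulr0 subr0 subrr mulr0 addr0 subrr normr0 ltW.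
have nb : 0 < `|b| by rewrite normr_gt0.
have [c c0 Hc] := is_derive_eps dG (divr_gt0 e0 nb).
have cb : 0 < c / `|b| by rewrite divr_gt0.
exists (Num.truncn (c / `|b|)^-1).+1 => // k /= Nk.
have kc : k.+1%:R^-1 < c / `|b|.
  apply: lt_le_trans (inv_truncn_le cb); rewrite ltf_pV2 ?posrE// ltr_nat.
  exact: leq_trans Nk _.
pose h := - (k.+1%:R^-1 * b).
have h0 : h != 0 by rewrite oppr_eq0 mulf_neq0.
have hc : `|h| < c by rewrite normrN normrM gtr0_norm// -ltr_pdivlMr.
have := Hc h h0 hc; rewrite (addrC h) ler_pdivlMr//.
rewrite sub0r normrN -normrM -[X in X <= _ -> _]normrN; congr (`|_| <= _).
have k0 : 1 + k%:R != 0 :> R by rewrite nat1r.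
by rewrite /h; move: (G _ - G w) => A; rewrite -nat1r; field; rewrite k0.
Qed.

Lemma continuous_comp_measurable D w (G : R -> R) : measurable (D : set T) ->
  continuous G -> measurable_fun (D : set T) w -> measurable_fun (D : set T) (fun x => G (w x)).
Proof.
move=> mD cG mw; apply: (measurableT_comp _ mw).
exact: continuous_measurable_fun.
Qed.

(* The difference quotient of [G \o w] is compared with that of [w] by
   [L]-Lipschitz continuity and with [G (w - h b)] by dominated convergence. *)
Lemma bv_on_comp U w b sigma (G G' : R -> R) (M : R) : open U -> bounded_set U ->
  bv_on U w b sigma -> (forall t, is_derive t (1 : R) G (G' t)) -> continuous G' ->
  (forall t, `|G' t| <= M) -> forall O' phi i, open O' -> O' `<=` U -> test_fun O' phi ->
      (forall x, `|phi x| <= 1) ->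
      `|\int[mu]_(x in U) (G (w x) * partial i phi x)
        + \int[mu]_(x in U) (G' (w x) * b i x * phi x)| <= M * fine (sigma O').
Proof.
move=> oU bU bv dG cG' G'M O' phi i oO OU tp p1.
have mU := open_measurable_leb oU; have mO := open_measurable_leb oO.
have M0 : 0 <= M by exact: le_trans (G'M 0).
have cG : continuous G.
  by move=> t; apply: differentiable_continuous; apply/derivable1_diffP; exact: ex_derive.
have Glip s t : `|G t - G s| <= M * `|t - s|.
  have lip a c : a < c -> `|G c - G a| <= M * (c - a).
    move=> ac; have [q _ ->] := MVT ac (fun t _ => dG t) (continuous_subspaceT cG).
    by rewrite normrM (gtr0_norm (_ : 0 < c - a)) ?subr_gt0// ler_wpM2r// subr_ge0 ltW.
  have [st|ts|->] := ltgtP s t; last by rewrite !subrr !normr0 mulr0.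
    by rewrite (gtr0_norm (_ : 0 < t - s)) ?subr_gt0// lip.
  by rewrite distrC (distrC t) (gtr0_norm (_ : 0 < s - t)) ?subr_gt0// lip.
have bO := bounded_setS OU bU; have Ofin := bounded_leb_fin bO.
have [Iw Ib Hb] := bv_on_sub oU oO OU bv.
have [sp [K [cK KO K0]]] := tp.
have [d d0 Hd] := compact_margin cK oO KO.
(* A neighbourhood of the support that remains inside [O'] under all translations shorter than
   [d / 2]. *)
pose V := \bigcup_(x in K) (ball x (d / 2) : set 'rV[R]_n).
have oV : open V by apply: bigcup_open => x _; exact: ball_open.
have KV : K `<=` V by move=> x Kx; exists x => //; apply: ballxx; rewrite divr_gt0.
have VO y v : V y -> `|v| < d / 2 -> O' (y - v).
  move=> [x Kx]; rewrite -ball_normE /ball_/= => xy vd; apply: (Hd x _ Kx).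
  by rewrite opprB addrA (addrC x) -addrA (le_lt_trans (ler_normD _ _))//; lra.
have VsubO : V `<=` O' by move=> y Vy; have := VO y 0 Vy; rewrite subr0 normr0 divr_gt0//; apply.
have mV := open_measurable_leb oV; have bV := bounded_setS VsubO bO.
have tV : test_fun V phi by split=> //; exists K.
have mw := rint_measurable Iw; have mb i := rint_measurable (Ib i).
have mGw : measurable_fun (O' : set T) (fun x => G (w x)) by exact: continuous_comp_measurable.
have mG'w : measurable_fun (O' : set T) (fun x => G' (w x)) by exact: continuous_comp_measurable.
have IGw : rint mu O' (fun x => G (w x)).
  have I1 : rint mu O' (fun x => M * `|w x| + `|G 0|).
    apply: (rintD mO (rintZ M mO (rint_norm mO Iw))).
    exact: (@rint_bounded _ T R mu O' _ `| `|G 0| | mO Ofin).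
  apply: (rint_le mO mGw I1) => x _.
  have := Glip 0 (w x); rewrite subr0 => h.
  by have := ler_normD (G (w x) - G 0) (G 0); rewrite subrK; lra.
have IG'b : rint mu O' (fun x => G' (w x) * b i x).
  have := rintMr mO (Ib i) mG'w (fun x _ => G'M (w x)).
  by congr rint; apply/funext => x; rewrite mulrC.
have -> : \int[mu]_(x in U) (G (w x) * partial i phi x) = \int[mu]_(x in O') (G (w x) * partial i phi x).
  have [_ [K1 [_ KW K10]]] := test_fun_partial i tp.
  by apply: (@Rint_support _ T R mu U O' _ OU) => x _ nO; rewrite K10 ?mulr0// => /KW.
have -> : \int[mu]_(x in U) (G' (w x) * b i x * phi x) = \int[mu]_(x in V) (G' (w x) * b i x * phi x).
  apply: (@Rint_support _ T R mu U V _ (subset_trans VsubO OU)) => x _ nO.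
  by rewrite K0 ?mulr0// => /KV.
(* [M + 2] counts the errors: [M] times the translation error of [b], the difference quotient of the
   integral, and the remainder [F]. *)
apply/ler_addgt0Pr => e e0; have e1 : 0 < e / (M + 2).
  by rewrite divr_gt0// ltr_wpDl.
set eta := e / (M + 2) in e1.
have [c c0 Hc] := is_derive_eps (derive_shift_integral i 0 mO IGw tp) e1.
have [c' c'0 Hc'] := translation_continuity i oO bO oV (Ib i) e1.
(* Remainder of the one-variable chain rule for the increment [- b i x / (k + 1)]: it tends to 0
   pointwise and is dominated by [2 * M * |b i|]. *)
pose F k x : R := k.+1%:R * (G (w x - k.+1%:R^-1 * b i x) - G (w x)) + G' (w x) * b i x.
have IbV := rint_sub mO mV VsubO (Ib i).
have mwV := measurable_funS mO VsubO mw; have mbV := measurable_funS mO VsubO (mb i).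
have mFk k : measurable_fun (V : set T) (F k).
  have m1 : measurable_fun (V : set T) (fun x => w x - k.+1%:R^-1 * b i x).
    exact: (measurable_funB mwV (measurable_funM (measurable_cst _) mbV)).
  have m2 := continuous_comp_measurable mV cG m1.
  have m3 := continuous_comp_measurable mV cG mwV.
  have m4 := continuous_comp_measurable mV cG' mwV.
  exact: (measurable_funD (measurable_funM (measurable_cst _) (measurable_funB m2 m3))
    (measurable_funM m4 mbV)).
have IgF : rint mu V (fun x => 2 * M * `|b i x|) by apply: rintZ => //; exact: rint_norm.
have Fb x k : V x -> `|F k x| <= 2 * M * `|b i x|.
  move=> _; rewrite /F (le_trans (ler_normD _ _))// !normrM.
  have := Glip (w x) (w x - k.+1%:R^-1 * b i x); rewrite addrAC subrr sub0r normrN normrM => h.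
  have := ler_wpM2l (normr_ge0 (k.+1%:R : R)) h.
  have -> : `|k.+1%:R| * (M * (`|k.+1%:R^-1| * `|b i x|)) = M * `|b i x|.
    by rewrite normfV; field; rewrite normr_eq0 pnatr_eq0.
  have := ler_wpM2r (normr_ge0 (b i x)) (G'M (w x)); lra.
have F0 x : V x -> F ^~ x @ \oo --> (0 : R) by move=> _; exact: difference_quotient_cvg.
have [N HN] := Rint_dominated0 mV mFk IgF Fb F0 e1.
pose q := Num.min c (Num.min c' (d / 2)).
have q0 : 0 < q by rewrite !lt_min c0 c'0 divr_gt0.
pose k := maxn N (Num.truncn q^-1).+1.
have Nk : (N <= k)%N by rewrite leq_maxl.
pose h : R := k.+1%:R^-1.
have h0 : 0 < h by rewrite invr_gt0.
have hq : h < q.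
  apply: lt_le_trans (inv_truncn_le q0); rewrite ltf_pV2 ?posrE// ltr_nat ltnS.
  exact: leq_maxr.
move: hq; rewrite !lt_min => /and3P[hc hc' hd].
have hn0 : h != 0 by rewrite gt_eqF.
have hc1 : `|h| < c by rewrite (gtr0_norm h0).
have := Hc h hn0 hc1.
have small (t : R) : 0 <= t <= 1 -> `|(t * h) *: e_ i| < d / 2.
  move=> /andP[t0 t1]; rewrite normrZ.
  have := ler_wpM2l (normr_ge0 (t * h)) (@norm_delta_le R n i); rewrite mulr1 => /le_lt_trans; apply.
  by rewrite ger0_norm ?mulr_ge0 ?(ltW h0)//; apply: le_lt_trans hd; rewrite ler_piMl ?(ltW h0).
have small1 : `|h *: e_ i| < d / 2 by have := small 1; rewrite mul1r lexx ler01; apply.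
have pV : preshift (h *: e_ i) V `<=` O'.
  by move=> y; rewrite /preshift/= => Vy; have := VO _ _ Vy small1; rewrite addrK.
rewrite addr0 (Rint_test_shift mO mV IGw tV (@subset_refl _ V) pV).
rewrite (@Rint_eq _ T R mu O' (fun x => G (w x) * phi (x + 0 *: e_ i)) (fun x => G (w x) * phi x)); last first.
  by move=> x _; rewrite scale0r addr0.
rewrite (@Rint_eq _ T R mu O' (fun x => G (w x) * partial i phi (x + 0 *: e_ i))
  (fun x => G (w x) * partial i phi x)); last by move=> x _; rewrite scale0r addr0.
rewrite (@Rint_support _ T R mu O' V (fun x => G (w x) * phi x) VsubO); last first.
  by move=> x _ nV; rewrite K0 ?mulr0// => /KV.
have IGs : rint mu V (fun y => G (w (y - h *: e_ i))).
  exact: (rint_shift_sub oO oV pV IGw).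
have IGV := rint_sub mO mV VsubO IGw; have IGbV := rint_sub mO mV VsubO IG'b.
have J1 := rintM_test mV IGs tp; have J2 := rintM_test mV IGV tp; have J3 := rintM_test mV IGbV tp.
set X := \int[mu]_(x in O') _; set Y := \int[mu]_(x in V) (G' _ * _ * _).
rewrite -(RintegralB mV J1 J2).
set Z := \int[mu]_(x in V) _ => HX.
have HY : `|h^-1 * Z + Y| <= M * (fine (sigma O') + eta) + eta.
  have Iws : rint mu V (fun y => w (y - h *: e_ i)) by exact: (rint_shift_sub oO oV pV Iw).
  have IwV := rint_sub mO mV VsubO Iw.
  have I5 : rint mu V (fun y => `|w (y - h *: e_ i) - w y + h * b i y|).
    by apply: (rint_norm mV); apply: (rintD mV (rintB mV Iws IwV)); exact: rintZ.
  have I6 := rint_norm mV (rint_le mV (mFk k) IgF (fun x Vx => Fb x k Vx)).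
  have HB := @bv_shift R n O' V w b sigma i h eta oO bO oV (And3 Iw Ib Hb).
  have {HB} : \int[mu]_(y in V) `|w (y - h *: e_ i) - w y + h * b i y| <= `|h| * (fine (sigma O') + eta).
    apply: HB => [y t Vy t01|t /andP[t0 t1]]; first exact: VO (small t t01).
    have th : `|t * h| < c'.
      by rewrite ger0_norm ?mulr_ge0 ?(ltW h0)//; apply: le_lt_trans hc'; rewrite ler_piMl ?(ltW h0).
    apply: Hc' => // y; rewrite /preshift/= => Vy.
    have := VO _ _ Vy (small t _); rewrite addrK; apply; by rewrite t0.
  rewrite (gtr0_norm h0) => HB.
  have HF := HN k Nk.
  apply: (@le_trans _ _ (\int[mu]_(y in V) (M * h^-1 * `|w (y - h *: e_ i) - w y + h * b i y| + `|F k y|))).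
    have -> : h^-1 * Z + Y = \int[mu]_(y in V)
       (h^-1 * (G (w (y - h *: e_ i)) * phi y - G (w y) * phi y) + G' (w y) * b i y * phi y).
      by rewrite (RintegralD mV (rintZ _ mV (rintB mV J1 J2)) J3) (RintegralZl _ mV (rintB mV J1 J2)).
    apply: (Rint_norm_le mV).
    - by apply: (rintD mV _ J3); apply: rintZ => //; exact: rintB.
    - by apply: (rintD mV _ I6); exact: rintZ.
    move=> y _; have kh : k.+1%:R = h^-1 by rewrite /h invrK.
    rewrite -mulrBl mulrA -mulrDl normrM.
    apply: (le_trans (ler_piMr (normr_ge0 _) (p1 y))).
    rewrite /F -/h kh.
    set Gs := G (w (y - h *: e_ i)); set Gb := G (w y - h * b i y).
    have -> : h^-1 * (Gs - G (w y)) + G' (w y) * b i y =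
      h^-1 * (Gs - Gb) + (h^-1 * (Gb - G (w y)) + G' (w y) * b i y) by ring.
    apply: (le_trans (ler_normD _ _)); rewrite lerD2r normrM gtr0_norm ?invr_gt0//.
    rewrite [leRHS]mulrAC [leRHS]mulrC ler_wpM2l ?invr_ge0 ?(ltW h0)//.
    apply: (le_trans (Glip _ _)); rewrite ler_wpM2l//.
    by rewrite (_ : w _ - w _ + _ = w (y - h *: e_ i) - (w y - h * b i y))//; ring.
  rewrite (RintegralD mV (rintZ _ mV I5) I6) (RintegralZl _ mV I5); apply: lerD HF.
  rewrite -mulrA ler_wpM2l// ler_pdivrMl//.
have EM : M * eta + 2 * eta = e by rewrite -mulrDl /eta mulrC divfK// gt_eqF// ltr_wpDl.
have := ler_normD (X - h^-1 * Z) (h^-1 * Z + Y).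
rewrite (_ : X - _ + _ = X + Y); last by rewrite addrA subrK.
rewrite (distrC X); lra.
Qed.

End chain_rule.

(** * Coverings of the jump set and the cost of cutoffs *)

Section hausdorff.
Context (R : realType) (n : nat).
Hypothesis n_ge2 : (2 <= n)%N.
Implicit Types (x y v : 'rV[R]_n) (r s : R) (U V K A E S : set 'rV[R]_n)
  (w f g phi psi : 'rV[R]_n -> R).
Local Notation L := (@leb_outer R n).
Local Notation T := (lebT R n).
Local Notation mu := (@leb R n).
Local Notation H := (@haus_outer R n n.-1).

Let n_gt0 : (0 < n)%N. Proof. exact: leq_trans n_ge2. Qed.

Lemma unit_ball_volume_gt0 : 0 < unit_ball_volume R n.-1.
Proof.
rewrite /unit_ball_volume; set m := n.-1.
have m0 : (0 < m)%N by rewrite /m; case: (n) n_ge2 => [|[]].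
have mR : 0 < m%:R :> R by rewrite ltr0n.
have sub1 : ball (0 : 'rV[R]_m) m%:R^-1 `<=` eball 0 1.
  have := @ball_eball R m m0 0 m%:R^-1.
  by rewrite mulfV// gt_eqF.
have Efin : leb_outer (eball (0 : 'rV[R]_m) 1) \is a fin_num.
  rewrite ge0_fin_numE ?outer_measure_ge0//; apply: (@leb_fin_ball _ _ _ 0 1).
  exact: eball_ball.
have le1 : (leb_outer (ball (0%R : 'rV[R]_m) m%:R^-1%R) <= leb_outer (eball (0%R : 'rV[R]_m) 1%R))%E.
  exact: le_outer_measure.
rewrite -lte_fin fineK//; apply: lt_le_trans le1.
by rewrite leb_ball ?invr_gt0// lte_fin exprn_gt0// mulr_gt0// invr_gt0.
Qed.

Lemma exprn_pred (t : R) : t ^+ n = t * t ^+ n.-1.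
Proof. by case: (n) n_gt0 => // m _; rewrite exprS. Qed.

Let alpha : R := unit_ball_volume R n.-1.

Lemma diam_ge E (d : R) x y : (forall x y, E x -> E y -> enorm (x - y) <= d) -> E x -> E y ->
  enorm (x - y) <= diam E.
Proof.
move=> Ed Ex Ey; apply: ub_le_sup; last by exists (x, y).
by exists d => _ [[a b] [/= Ea Eb] <-]; exact: Ed.
Qed.

Lemma diam_le E (d : R) x : (forall x y, E x -> E y -> enorm (x - y) <= d) -> E x ->
  diam E <= d.
Proof.
move=> Ed Ex; apply: ge_sup; first by exists (enorm (x - x)), (x, x).
by move=> _ [[a b] [/= Ea Eb] <-]; exact: Ed.
Qed.

Lemma sum_half_le (e : R) N : 0 <= e -> \sum_(k < N) e / 2 ^+ k.+1 <= e.
Proof.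
move=> e0; suff -> : \sum_(k < N) e / 2 ^+ k.+1 = e * (1 - 2 ^- N).
  by rewrite ler_piMr// gerBl invr_ge0 exprn_ge0.
elim: N => [|N IH]; first by rewrite big_ord0 expr0 invr1 subrr mulr0.
by rewrite big_ord_recr /= IH exprS invfM; field; rewrite expf_neq0.
Qed.

Definition obal (p : option ('rV[R]_n * R)) : set 'rV[R]_n := oapp (fun p => ball p.1 p.2) set0 p.

(** Each set [E] of a Hausdorff cover is put in a cube centred at one of its points, of radius
    [2 * diam E]. The constant is the ratio between [(2 * diam E) ^+ n.-1] and the normalised weight
    of [E]. *)
Lemma haus_cover A (h eta d : R) : (H A <= h%:E)%E -> 0 < eta -> 0 < d ->
  exists c : nat -> option ('rV[R]_n * R),
    [/\ forall k p, c k = Some p -> 0 < p.2 <= 2 * d, A `<=` \bigcup_k obal (c k) &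
      forall N, \sum_(k < N) oapp (fun p => p.2 ^+ n.-1) 0 (c k) <=
        4 ^+ n.-1 / alpha * (h + eta) + eta].
Proof.
move=> Hh eta0 d0; have a0 : 0 < alpha := unit_ball_volume_gt0.
have Hd : (haus_delta n.-1 d A <= h%:E)%E.
  by apply: le_trans Hh; apply: ereal_sup_ubound; exists d.
pose wt (E : set 'rV[R]_n) : R := alpha * (diam E / 2) ^+ n.-1.
have diam0 E : 0 <= diam E.
  have [[E0 Eb]|nE] := pselect (has_sup [set enorm (p.1 - p.2) | p in E `*` E]).
    have [_ [p Ep _]] := E0; apply: (@le_trans _ _ (enorm (p.1 - p.2))); first exact: enorm_ge0.
    by apply: ub_le_sup => //; exists p.
  by rewrite /diam sup_out.
have wt0 E : 0 <= wt E by rewrite mulr_ge0 ?(ltW a0)// exprn_ge0// divr_ge0.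
have Dfin : haus_delta n.-1 d A \is a fin_num.
  by rewrite ge0_fin_numE; [exact: le_lt_trans Hd (ltry _)|exact: cover_outer_ge0].
have [_ [F [DF AF] <-] Fe] := lb_ereal_inf_adherent eta0 Dfin.
have Fsum N : \sum_(k < N) oapp wt 0 (F k) <= h + eta.
  rewrite -lee_fin -sumEFin; apply: le_trans (_ : _ <= haus_delta n.-1 d A + eta%:E)%E _; last by rewrite EFinD leeD2r.
  apply: le_trans (ltW Fe).
  have := @nneseries_lim_ge R (fun k => (oapp wt 0 (F k))%:E) xpredT 0 N.
  rewrite big_mkord; apply=> k _ _.
  by rewrite lee_fin; case: (F k) => //= E; exact: wt0.
(* A positive radius for sets of diameter 0. The bound by 1 gives [tau ^+ n.-1 <= tau] since
   [n >= 2], the bound by [d] keeps the radii small, and the last one makes the extra cost sum up to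
   at most [eta]. *)
pose tau k := Num.min 1 (Num.min d (eta / 2 ^+ k.+1)).
have tau0 k : 0 < tau k by rewrite !lt_min ltr01 d0 divr_gt0// exprn_gt0.
pose rho k E := Num.max (2 * diam E) (tau k).
have rho0 k E : 0 < rho k E by rewrite lt_max tau0 orbT.
have /choice[c Hc] k : exists c : option ('rV[R]_n * R),
    match F k with
    | Some E => if c is Some p then E p.1 /\ p.2 = rho k E else E = set0
    | None => c = None end.
  case: (F k) => [E|]; last by exists None.
  by have [->|/set0P[x Ex]] := eqVneq E set0; [exists None|exists (Some (x, rho k E))].
have m0 : (0 < n.-1)%N by case: (n) n_ge2 => [|[]].
exists c; split.
- move=> k p ck; move: (Hc k) (DF k); rewrite ck; case: (F k) => [E|//] [Ep ->] /(_ E erefl) DE.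
  rewrite rho0 /=; have := diam_le DE Ep => hd.
  by rewrite ge_max ler_pM2l// hd /= ge_min; apply/orP; right; rewrite ge_min; apply/orP; left; lra.
- move=> x /AF[k _]; move: (Hc k) (DF k); case: (F k) => [E|//] /= + /(_ E erefl) DE Ex.
  case ck : (c k) => [p|]; last by move=> E0; move: Ex; rewrite E0.
  move=> [Ep rE]; exists k => //; rewrite ck /= -ball_normE /ball_/= rE.
  apply: (le_lt_trans (norm_le_enorm _)); apply: (le_lt_trans (diam_ge DE Ep Ex)).
  have := diam0 E; rewrite le_eqVlt => /predU1P[<-|dE].
    by rewrite lt_max tau0 orbT.
  by rewrite lt_max; apply/orP; left; lra.
move=> N.
apply: (@le_trans _ _ (\sum_(k < N) (4 ^+ n.-1 / alpha * oapp wt 0 (F k) + eta / 2 ^+ k.+1))).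
  apply: ler_sum => k _; have e0 : 0 <= eta / 2 ^+ k.+1 by rewrite divr_ge0 ?(ltW eta0)// exprn_ge0.
  have a40 : 0 <= 4 ^+ n.-1 / alpha by rewrite divr_ge0 ?(ltW a0)// exprn_ge0.
  move: (Hc k); case: (F k) => [E|] /=; last by move=> ->; rewrite /= mulr0 add0r.
  case: (c k) => [p|] /=; last by move=> _; rewrite addr_ge0// mulr_ge0.
  move=> [_ ->].
  have -> : 4 ^+ n.-1 / alpha * wt E = (2 * diam E) ^+ n.-1.
    rewrite /wt mulrA divfK ?gt_eqF// -exprMn; congr (_ ^+ _); by field.
  rewrite /rho; case: (leP (2 * diam E) (tau k)) => h1.
    apply: ler_wpDl; first by rewrite exprn_ge0// mulr_ge0.
    apply: (@le_trans _ _ (tau k)).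
      have t01 : 0 <= tau k <= 1 by rewrite (ltW (tau0 k)) ge_min lexx.
      case: (n.-1) m0 => // m _; rewrite exprS ler_piMr ?(ltW (tau0 k))//.
      by rewrite exprn_ile1; case/andP: t01.
    by rewrite /tau ge_min; apply/orP; right; rewrite ge_min lexx orbT.
  by rewrite lerDl.
rewrite big_split/= -mulr_sumr lerD//; last exact: sum_half_le (ltW eta0).
apply: ler_wpM2l (Fsum N); by rewrite divr_ge0 ?(ltW a0)// exprn_ge0.
Qed.

Lemma partial_bump_support x r i y : 0 < r -> ~ ccube x (3 / 2 * r) y ->
  partial i (bump x r) y = 0.
Proof.
move=> r0 ny; rewrite /partial.
rewrite (@near_eq_derive _ _ _ _ (cst 0)) ?derive_cst//.
have oK : open (~` ccube x (3 / 2 * r)).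
  by apply: closed_openC; apply: compact_closed_rV; exact: compact_ccube.
by have := open_nbhs_nbhs (conj oK ny); apply: filterS => z; exact: bump0.
Qed.

Lemma ccube_ball2 x r : 0 < r -> ccube x (3 / 2 * r) `<=` ball x (2 * r).
Proof. by move=> r0; apply: ccube_ball; lra. Qed.

Lemma Rint_partial_bump : exists2 C : R, 0 < C & forall U x r i, measurable (U : set T) ->
  0 < r -> \int[mu]_(y in U) `|partial i (bump x r) y| <= C * r ^+ n.-1.
Proof.
have [C C0 HC] := @partial_bump_le R n; exists (C * 4 ^+ n); first by rewrite mulr_gt0// exprn_gt0.
move=> U x r i mU r0; pose B : set 'rV[R]_n := ball x (2 * r).
have mB : measurable (B : set T) by exact: measurable_ball_leb.
have mUB : measurable (U `&` B : set T) by exact: measurableI.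
have Bfin : (L (U `&` B) < +oo)%E.
  by apply: (@leb_fin_ball _ _ _ x (2 * r)); exact: subIsetr.
rewrite (@Rint_support _ T R mu U (U `&` B) _ (@subIsetl _ _ _)); last first.
  move=> y Uy nUB; rewrite partial_bump_support ?normr0// => yc; apply: nUB.
  by split=> //; exact: ccube_ball2.
have mp : measurable_fun (U `&` B : set T) (fun y => `|partial i (bump x r) y|).
  apply: (measurableT_comp (@normr_measurable R setT)).
  by apply: smooth_measurable => //; apply: smooth_partial; exact: smooth_bump.
apply: le_trans (ler_norm _) _.
have := @Rint_bound _ T R mu (U `&` B) _ (C / r) mUB Bfin mp.
move=> /(_ (fun y _ => _))/le_trans; apply.
  by move=> y; rewrite normr_id; exact: HC.
have Cr : 0 <= C / r by rewrite divr_ge0 ?(ltW C0)// ltW.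
apply: (@le_trans _ _ (C / r * (4 * r) ^+ n)).
  rewrite ler_wpM2l// (_ : 4 * r = 2 * (2 * r)); last by ring.
  have r2 : 0 < 2 * r by rewrite mulr_gt0.
  rewrite -(leb_ball_real x r2); apply: fine_le; last exact: le_outer_measure.
  - by rewrite ge0_fin_numE// outer_measure_ge0.
  - by rewrite ge0_fin_numE ?outer_measure_ge0//; exact: leb_ball_fin.
rewrite exprMn; case: (n) n_gt0 => // m _ /=.
by rewrite [r ^+ m.+1]exprS le_eqVlt; apply/orP; left; apply/eqP; field; rewrite gt_eqF.
Qed.

Lemma Rint_partial_bumps : exists2 C : R, 0 < C & forall U (s : seq ('rV[R]_n * R)) i,
  measurable (U : set T) -> (L U < +oo)%E -> (forall p, p \in s -> 0 < p.2) ->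
  rint mu U (fun y => \sum_(p <- s) `|partial i (bump p.1 p.2) y|) /\
  \int[mu]_(y in U) (\sum_(p <- s) `|partial i (bump p.1 p.2) y|) <=
    C * \sum_(p <- s) p.2 ^+ n.-1.
Proof.
have [C C0 HC] := Rint_partial_bump; exists C => // U s i mU Ufin.
have [C' _ HC'] := @partial_bump_le R n.
elim: s => [|p s IH] s0.
  have E : (fun y => \sum_(p <- [::]) `|partial i (bump p.1 p.2) y|) = (fun=> 0).
    by apply/funext => y; rewrite big_nil.
  by rewrite E big_nil mulr0; split; [exact: integrable0|rewrite Rintegral_cst ?mul0r].
have [|Is Hs] := IH; first by move=> q qs; apply: s0; rewrite inE qs orbT.
have p0 := s0 p (mem_head _ _).
have Ip : rint mu U (fun y => `|partial i (bump p.1 p.2) y|).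
  apply: (rint_norm mU); apply: (@rint_bounded _ T R mu U _ (C' / p.2) mU Ufin).
    by apply: smooth_measurable => //; apply: smooth_partial; exact: smooth_bump.
  by move=> x _; exact: HC'.
have E : (fun y => \sum_(p <- p :: s) `|partial i (bump p.1 p.2) y|) =
    (fun y => `|partial i (bump p.1 p.2) y| + \sum_(p <- s) `|partial i (bump p.1 p.2) y|).
  by apply/funext => y; rewrite big_cons.
rewrite E big_cons mulrDr; split; first exact: rintD.
by rewrite (RintegralD mU Ip Is) lerD// HC.
Qed.

(** [phi] is split by a cutoff [zeta] equal to 1 on finitely many cubes covering most of [sigma].
    The part with [1 - zeta] sees little of [sigma] and falls under [bv_on_comp]; the part with
    [zeta] costs the oscillation of [G] times the L1 norm of the gradient of [zeta], a sum of
    [r ^+ n.-1]. [K] is fixed before [eta] and may depend on all the data. *)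
Lemma chain_rule_jump_aux : exists2 C : R, 0 < C & forall U w b
    (sigma : {finite_measure set (borelT 'rV[R]_n) -> \bar R}) S
    (G G' : R -> R) (M o : R) phi i, open U -> bounded_set U ->
  bv_on U w b sigma ->
  (forall B : set (borelT 'rV[R]_n), measurable B -> B `<=` U `\` S -> sigma B = 0%E) ->
  (H (S `&` U) < +oo)%E ->
  (forall t, is_derive t (1 : R) G (G' t)) -> continuous G' -> (forall t, `|G' t| <= M) ->
  (forall s t, `|G s - G t| <= o) -> test_fun U phi -> (forall x, `|phi x| <= 1) ->
  exists2 K : R, 0 <= K & forall eta : R, 0 < eta ->
  `|\int[mu]_(x in U) (G (w x) * partial i phi x)
    + \int[mu]_(x in U) (G' (w x) * b i x * phi x)| <=
    C * o * fine (H (S `&` U)) + K * eta.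
Proof.
have [C C0 HC] := Rint_partial_bumps.
have a0 : 0 < alpha := unit_ball_volume_gt0.
pose c1 := 4 ^+ n.-1 / alpha.
have c10 : 0 < c1 by rewrite divr_gt0// exprn_gt0.
exists (C * c1); first by rewrite mulr_gt0.
move=> U w b sigma S G G' M o phi i oU bU bv sS Hfin dG cG' G'M Go tp p1.
have mU := open_measurable_leb oU; have Ufin := bounded_leb_fin bU.
have o0 : 0 <= o by apply: le_trans (Go 0 0).
have M0 : 0 <= M by exact: le_trans (G'M 0).
set h := fine (H (S `&` U)).
have Hh : (H (S `&` U) <= h%:E)%E by rewrite fineK// ge0_fin_numE// outer_measure_ge0.
have h0 : 0 <= h by rewrite fine_ge0// outer_measure_ge0.
have [Mp Mp0 HMp] := test_bounded (test_fun_partial i tp).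
have Cc := mulr_ge0 (ltW C0) (ltW c10).
exists (o * (C * c1 + C + Mp) + 2 * M).
  apply: addr_ge0; last exact: mulr_ge0.
  by apply: mulr_ge0 => //; apply: addr_ge0 => //; apply: addr_ge0 => //; exact: ltW.
move=> eta eta0.
have [Iw Ib _] := bv.
have [delta delta0 Hdelta] := rint_abs_cont mU (Ib i) eta0.
pose B := c1 * (h + eta) + eta.
have B0 : 0 < B by rewrite /B ltr_wpDl// mulr_ge0 ?(ltW c10)// addr_ge0// ltW.
(* With radii at most [2 * d], the doubled cubes have total volume at most [4 ^+ n * (2 * d) * B],
   less than both [eta] and [delta]; the latter makes the integral of [|b i|] over them small. *)
pose d := Num.min eta delta / (2 * 4 ^+ n * (B + 1)).
have k0 : 0 < 2 * 4 ^+ n * (B + 1) by rewrite !mulr_gt0 ?exprn_gt0// ltr_wpDl// ltW.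
have d0 : 0 < d by rewrite divr_gt0// lt_min eta0.
have [c [c_pos c_cov c_sum]] := haus_cover Hh eta0 d0.
pose V := U `&` \bigcup_k obal (c k).
have oob k : open (obal (c k)) by rewrite /obal; case: (c k) => [p|] /=; [exact: ball_open|exact: open0].
have oV : open V by apply: openI => //; apply: bigcup_open => k _.
have sUV : sigma (U `\` V) = 0%E.
  apply: sS; first by apply: measurableD; exact: open_borel.
  by move=> x [Ux nVx]; split=> // Sx; apply: nVx; split=> //; apply: c_cov.
(* The cutoff can only use finitely many cubes. [F] is compact, lies in the cover and carries
   [sigma] up to [eta]. *)
have [F [W [cF oW FV VW sWF]]] := borel_regular sigma (open_borel oV) eta0.
have VU : V `<=` U by exact: subIsetl.
have cptF : compact F.
  by apply: bounded_closed_compact cF; exact: bounded_setS (subset_trans FV VU) bU.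
have [N HN] : exists N, F `<=` \bigcup_(k < N) obal (c k).
  by apply: compact_cover_nat => // x /FV[].
pose s := pmap c (iota 0 N).
have sP p : p \in s -> exists2 k, (k < N)%N & c k = Some p.
  by rewrite mem_pmap => /mapP[k]; rewrite mem_iota => /andP[_ kN] E; exists k.
have s0 p : p \in s -> 0 < p.2 <= 2 * d by move=> /sP[k _ /c_pos].
have Fs x : F x -> exists2 p, p \in s & ball p.1 p.2 x.
  move=> /HN[k /= kN]; rewrite /obal; case ck : (c k) => [p|//] /= px; exists p => //.
  by rewrite mem_pmap; apply/mapP; exists k => //; rewrite mem_iota.
have sumB : \sum_(p <- s) p.2 ^+ n.-1 <= B.
  apply: le_trans (c_sum N); rewrite /s -(big_mkord xpredT (fun k => oapp (fun p => p.2 ^+ n.-1) 0 (c k))).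
  rewrite /index_iota subn0; elim: (iota 0 N) => [|k q IH]; first by rewrite !big_nil.
  rewrite /= big_cons; case: (c k) => [p|] /=; last by rewrite add0r.
  by rewrite big_cons lerD2l.
pose zeta := bumps s.
have sz : smooth zeta by exact: smooth_bumps.
have z01 y : 0 <= zeta y <= 1 by exact: bumps_itv.
have zle y : `|zeta y| <= 1 by rewrite ger0_norm; case/andP: (z01 y).
have t1 : test_fun U (fun y => phi y * zeta y) by exact: test_funMr.
have s1z : smooth (fun y => 1 + -1 * zeta y) by apply: smoothD; [exact: smooth_cst|exact: smoothZ].
have t2U : test_fun U (fun y => phi y * (1 + -1 * zeta y)) by exact: test_funMr.
pose BB := \bigcup_(p in [set` s]) (ball p.1 p.2 : set 'rV[R]_n).
have oBB : open BB by apply: bigcup_open => p _; exact: ball_open.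
have FBB : F `<=` BB by move=> x /Fs[p ps px]; exists p.
have t2 : test_fun (U `\` F) (fun y => phi y * (1 + -1 * zeta y)).
  have [sp [K1 [cK1 K1U K10]]] := tp; split; first exact: smoothM.
  exists (K1 `\` BB); split.
  - apply: (subclosed_compact _ cK1); last exact: subDsetl.
    by apply: closedI; [exact: compact_closed_rV|exact: open_closedC].
  - by move=> x [K1x nB]; split; [exact: K1U|move=> /FBB].
  move=> x nK; have [K1x|nK1] := pselect (K1 x); last by rewrite K10 ?mul0r.
  have [p ps px] : BB x by apply: contrapT => nB; apply: nK.
  have /andP[p0 _] := s0 p ps.
  by rewrite /zeta (bumps1 ps p0 (ball_ccube px)); ring.
have oUF : open (U `\` F) by apply: openD_compact.
have two y : `|phi y * (1 + -1 * zeta y)| <= 1.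
  rewrite normrM -[leRHS]mulr1; apply: ler_pM => //.
  by have := z01 y; rewrite ler_norml; lra.
have one y : `|phi y * zeta y| <= 1.
  by rewrite normrM -[leRHS]mulr1; apply: ler_pM.
have part2 := bv_on_comp oU bU bv dG cG' G'M i oUF (@subDsetl _ _ _) t2 two.
have sUF : fine (sigma (U `\` F)) <= eta.
  have mUV : measurable (U `\` V : set (borelT 'rV[R]_n)) by apply: measurableD; exact: open_borel.
  have mVF : measurable (W `\` F : set (borelT 'rV[R]_n)).
    by apply: measurableD; [exact: open_borel|exact: closed_borel].
  rewrite -lee_fin fineK; last by apply: sigma_fin; exact: open_borel.
  apply: (@le_trans _ _ (sigma (U `\` V) + sigma (W `\` F))%E); last by rewrite sUV add0e ltW.
  apply: le_trans (measureU2 _ mUV mVF); apply: sigma_le; [exact: open_borel|exact: measurableU|].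
  move=> x [Ux nFx]; have [Vx|nVx] := pselect (V x); [right|left]; split=> //; exact: VW.
have mw := rint_measurable Iw.
have cG : continuous G.
  by move=> t; apply: differentiable_continuous; apply/derivable1_diffP; exact: ex_derive.
have mGw := continuous_comp_measurable mU cG mw.
have mG'w := continuous_comp_measurable mU cG' mw.
have IGw : rint mu U (fun x => G (w x)).
  apply: (@rint_bounded _ T R mu U _ (o + `|G 0|) mU Ufin mGw) => x _.
  have := Go (w x) 0; have := ler_normD (G (w x) - G 0) (G 0); rewrite subrK; lra.
have IG'b : rint mu U (fun x => G' (w x) * b i x).
  have := rintMr mU (Ib i) mG'w (fun x _ => G'M (w x)).
  by congr rint; apply/funext => x; rewrite mulrC.
pose A : set 'rV[R]_n := U `&` \bigcup_(p in [set` s]) ball p.1 (2 * p.2).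
have oA : open A by apply: openI => //; apply: bigcup_open => p _; exact: ball_open.
have mA := open_measurable_leb oA; have AU : A `<=` U by exact: subIsetl.
have Afin : (L A < +oo)%E by apply: le_lt_trans Ufin; exact: le_outer_measure.
have z0 y : U y -> ~ A y -> zeta y = 0.
  move=> Uy nA; apply: bumps0 => p ps; have /andP[p0 _] := s0 p ps; split=> // yc.
  by apply: nA; split=> //; exists p => //; exact: ccube_ball2.
have dB : 4 ^+ n * (2 * d * B) < Num.min eta delta.
  rewrite /d; have m0 : 0 < Num.min eta delta by rewrite lt_min eta0.
  have -> : 4 ^+ n * (2 * (Num.min eta delta / (2 * 4 ^+ n * (B + 1))) * B) =
     Num.min eta delta * (B / (B + 1)).
    by field; rewrite expf_neq0//= gt_eqF// ltr_wpDl// ltW.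
  by rewrite gtr_pMr// ltr_pdivrMr ?mul1r ?ltrDl// ltr_wpDl// ltW.
have LA1 : (L A < (Num.min eta delta)%:E)%E.
  apply: (@le_lt_trans _ _ (4 ^+ n * (2 * d * B))%:E); last by rewrite lte_fin.
  apply: (@le_trans _ _ (L (\bigcup_(p in [set` s]) ball p.1 (2 * p.2)))).
    by apply: le_outer_measure; exact: subIsetr.
  apply: (@le_trans _ _ (\sum_(p <- s) (4 * p.2) ^+ n)%:E).
    elim: s s0 {sP Fs sumB zeta sz z01 zle t1 s1z t2U BB oBB FBB t2 two one part2 A oA mA AU Afin z0} => [|p s IH] s0.
      rewrite big_nil (_ : \bigcup_(_ in _) _ = set0) ?outer_measure0//.
      by apply/seteqP; split=> // y [].
    rewrite big_cons (_ : \bigcup_(_ in _) _ = ball p.1 (2 * p.2) `|`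
       \bigcup_(p in [set` s]) ball p.1 (2 * p.2)); last first.
      apply/seteqP; split=> y.
        by move=> [q /=]; rewrite inE => /predU1P[->|qD]; [left|right; exists q].
      by move=> [py|[q qD qy]]; [exists p => //=; rewrite mem_head|exists q => //=; rewrite inE (qD : is_true _) orbT].
    rewrite EFinD; apply: (@le_trans _ _ (L (ball p.1 (2 * p.2)) + L (\bigcup_(p in [set` s]) ball p.1 (2 * p.2)))%E).
      exact: outer_measureU2.
    apply: leeD; last by apply: IH => q qs; apply: s0; rewrite inE qs orbT.
    have /andP[p0 _] := s0 p (mem_head _ _).
    rewrite (_ : 4 * p.2 = 2 * (2 * p.2)); last by ring.
    by apply: leb_ball_le; rewrite mulr_gt0.
  rewrite lee_fin; apply: (@le_trans _ _ (4 ^+ n * (2 * d) * \sum_(p <- s) p.2 ^+ n.-1)); last first.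
    rewrite [leRHS]mulrA; apply: ler_wpM2l sumB.
    by rewrite mulr_ge0 ?exprn_ge0// mulr_ge0// ltW.
  rewrite mulr_sumr big_seq [leRHS]big_seq; apply: ler_sum => p ps.
  have /andP[p0 pd] := s0 p ps; rewrite exprMn -mulrA ler_wpM2l ?exprn_ge0//.
  by rewrite exprn_pred ler_wpM2r// exprn_ge0// ltW.
move: LA1; rewrite -(fineK (_ : L A \is a fin_num)) ?ge0_fin_numE ?outer_measure_ge0// lte_fin lt_min => /andP[LAeta LAdelta].
have part1b : `|\int[mu]_(x in U) (G' (w x) * b i x * (phi x * zeta x))| <= M * eta.
  rewrite (@Rint_support _ T R mu U A _ AU); last by move=> x Ux nA; rewrite z0// !mulr0.
  have HdA := Hdelta A mA AU.
  apply: (@le_trans _ _ (\int[mu]_(x in A) (M * `|b i x|))).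
    apply: (Rint_norm_le mA).
    - by apply: (rintM_test mA _ t1); exact: (rint_sub mU mA AU IG'b).
    - by apply: (rintZ _ mA); apply: (rint_norm mA); exact: (rint_sub mU mA AU (Ib i)).
    move=> x _; rewrite normrM (le_trans (ler_piMr (normr_ge0 _) (one x)))//.
    by rewrite normrM ler_wpM2r.
  rewrite (RintegralZl _ mA (rint_norm mA (rint_sub mU mA AU (Ib i)))) ler_wpM2l//.
  apply: ltW; apply: HdA; rewrite -(fineK (_ : L A \is a fin_num)) ?lte_fin//.
  by rewrite ge0_fin_numE ?outer_measure_ge0.
have part1a : `|\int[mu]_(x in U) (G (w x) * partial i (fun y => phi y * zeta y) x)| <=
    o * (Mp * eta + C * B).
  have tp1 := test_fun_partial i t1.
  have Ip1 := rint_test mU Ufin tp1.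
  (* The derivative of a test function has zero integral, so a constant may be subtracted from [G]:
     this is how the oscillation replaces the size of [G]. *)
  have -> : \int[mu]_(x in U) (G (w x) * partial i (fun y => phi y * zeta y) x) =
      \int[mu]_(x in U) ((G (w x) - G 0) * partial i (fun y => phi y * zeta y) x).
    have I1 := rintM_test mU IGw tp1.
    have -> : \int[mu]_(x in U) ((G (w x) - G 0) * partial i (fun y => phi y * zeta y) x) =
      \int[mu]_(x in U) (G (w x) * partial i (fun y => phi y * zeta y) x -
         G 0 * partial i (fun y => phi y * zeta y) x).
      by apply: (@Rint_eq _ T R mu) => x _; rewrite mulrBl.
    rewrite (RintegralB mU I1 (rintZ _ mU Ip1)) (RintegralZl _ mU Ip1).
    by rewrite Rint_partial0// mulr0 subr0.
  have IGw0 : rint mu U (fun x => G (w x) - G 0).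
    by apply: (rintB mU IGw); exact: (@rint_bounded _ T R mu U _ `|G 0| mU Ufin).
  have [Izb izb] := HC U s i mU Ufin (fun p ps => proj1 (andP (s0 p ps))).
  have Iz : rint mu U (fun x => Mp * zeta x).
    apply: (rintZ _ mU); apply: (@rint_bounded _ T R mu U _ 1 mU Ufin) => [|x _]; last exact: zle.
    by apply: smooth_measurable.
  apply: (@le_trans _ _ (\int[mu]_(x in U) (o * (Mp * zeta x + \sum_(p <- s) `|partial i (bump p.1 p.2) x|)))).
    apply: (Rint_norm_le mU).
    - exact: (rintM_test mU IGw0 tp1).
    - by apply: (rintZ _ mU); exact: (rintD mU Iz Izb).
    move=> x _; rewrite normrM; apply: ler_pM => //.
    rewrite (partialM i (test_fun_smooth tp) sz).
    rewrite (le_trans (ler_normD _ _))// !normrM lerD//.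
      by rewrite (ger0_norm (proj1 (andP (z01 x)))) ler_wpM2r//; case/andP: (z01 x).
    apply: le_trans (partial_bumps_le s i x); exact: ler_piMl.
  rewrite (RintegralZl _ mU (rintD mU Iz Izb)) ler_wpM2l// (RintegralD mU Iz Izb).
  apply: lerD.
    rewrite RintegralZl//; last first.
      apply: (@rint_bounded _ T R mu U _ 1 mU Ufin) => [|x _]; last exact: zle.
      by apply: smooth_measurable.
    rewrite ler_wpM2l// (@Rint_support _ T R mu U A _ AU) //.
    apply: le_trans (ler_norm _) _.
    apply: le_trans (@Rint_bound _ T R mu A zeta 1 mA Afin _ _) _ => //.
    - by apply: smooth_measurable.
    - by rewrite mul1r ltW.
  by apply: (le_trans izb); rewrite ler_wpM2l// ltW.
have -> : \int[mu]_(x in U) (G (w x) * partial i phi x) =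
    \int[mu]_(x in U) (G (w x) * partial i (fun y => phi y * zeta y) x) +
    \int[mu]_(x in U) (G (w x) * partial i (fun y => phi y * (1 + -1 * zeta y)) x).
  have I1 := rintM_test mU IGw (test_fun_partial i t1).
  have I2 := rintM_test mU IGw (test_fun_partial i t2U).
  rewrite -(RintegralD mU I1 I2); apply: (@Rint_eq _ T R mu) => x _.
  rewrite -mulrDr; congr (_ * _).
  rewrite -[RHS](congr1 (fun h => h x) (@partialD R n _ _ i (test_fun_smooth t1) (test_fun_smooth t2U))).
  by congr (partial i _ x); apply/funext => y; ring.
have -> : \int[mu]_(x in U) (G' (w x) * b i x * phi x) =
    \int[mu]_(x in U) (G' (w x) * b i x * (phi x * zeta x)) +
    \int[mu]_(x in U) (G' (w x) * b i x * (phi x * (1 + -1 * zeta x))).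
  have I1 := rintM_test mU IG'b t1; have I2 := rintM_test mU IG'b t2U.
  rewrite -(RintegralD mU I1 I2); apply: (@Rint_eq _ T R mu) => x _.
  by ring.
have part2' := le_trans part2 (ler_wpM2l M0 sUF).
set X1 := \int[mu]_(x in U) _ in part1a *; set X2 := \int[mu]_(x in U) _ in part2' *.
set Y1 := \int[mu]_(x in U) _ in part1b *; set Y2 := \int[mu]_(x in U) _ in part2' *.
rewrite addrACA.
have := ler_normD (X1 + Y1) (X2 + Y2); have := ler_normD X1 Y1.
move: part1a part1b part2'; rewrite /B => k1 k2 k3 k4 k5.
apply: (le_trans k5); apply: (le_trans (lerD k4 k3)).
apply: (le_trans (lerD (lerD k1 k2) (lexx _))).
by rewrite le_eqVlt; apply/orP; left; apply/eqP; ring.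
Qed.

(* The jump part is paid by the oscillation of [G] and not by its Lipschitz
   constant: near a fine cover of the jump set, [G \o w] is replaced by a
   constant, at the price of the gradient of the cutoff. *)
Lemma chain_rule_jump : exists2 C : R, 0 < C & forall U w b
    (sigma : {finite_measure set (borelT 'rV[R]_n) -> \bar R}) S
    (G G' : R -> R) (M o : R) phi i, open U -> bounded_set U ->
  bv_on U w b sigma ->
  (forall B : set (borelT 'rV[R]_n), measurable B -> B `<=` U `\` S -> sigma B = 0%E) ->
  (H (S `&` U) < +oo)%E ->
  (forall t, is_derive t (1 : R) G (G' t)) -> continuous G' -> (forall t, `|G' t| <= M) ->
  (forall s t, `|G s - G t| <= o) -> test_fun U phi -> (forall x, `|phi x| <= 1) ->
  `|\int[mu]_(x in U) (G (w x) * partial i phi x)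
    + \int[mu]_(x in U) (G' (w x) * b i x * phi x)| <=
    C * o * fine (H (S `&` U)).
Proof.
have [C C0 HC] := chain_rule_jump_aux; exists C => // U w b sigma S G G' M o phi i.
move=> oU bU bv sS Hfin dG cG' G'M Go tp p1.
have [K K0 HK] := HC U w b sigma S G G' M o phi i oU bU bv sS Hfin dG cG' G'M Go tp p1.
apply/ler_addgt0Pr => e e0; have K1 : 0 < K + 1 by rewrite ltr_wpDl.
apply: (le_trans (HK (e / (K + 1)) (divr_gt0 e0 K1))); rewrite lerD2l.
by rewrite mulrA ler_pdivrMr// mulrC ler_wpM2l ?(ltW e0)// lerDl.
Qed.

End hausdorff.

(** * Estimates in a periodicity cell *)

Section profile.
Context (R : realType).
Implicit Types (s t x h : R).

Lemma is_derive_quad (f : R -> R) (x d C : R) : 0 < C ->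
  (forall h, `|f (h + x) - f x - d * h| <= C * h ^+ 2) -> is_derive x (1 : R) f d.
Proof.
move=> C0 H.
have cv : (fun h => h^-1 *: (f (h *: (1 : R) + x) - f x)) @ 0^' --> d.
  apply/cvgrPdist_le => e e0; apply/nbhs_ballP; exists (e / C); first by rewrite /= divr_gt0.
  move=> h; rewrite /ball/= sub0r normrN ltr_pdivlMr// => hC h0.
  have hn : 0 < `|h| by rewrite normr_gt0.
  rewrite /GRing.scale/= mulr1 -(ler_pM2r hn) -normrM.
  rewrite mulrBl mulrAC mulVf// mul1r distrC; apply: (le_trans (H h)).
  by rewrite -[h ^+ 2]real_normK ?num_real// expr2 mulrA ler_wpM2r// mulrC ltW.
by apply: DeriveDef; [apply/cvg_ex; exists d|exact/cvg_lim].
Qed.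

Lemma is_derive_sgnsq x : is_derive x (1 : R) (fun s : R => s * `|s|) (2 * `|x|).
Proof.
apply: (@is_derive_quad _ _ _ 2) => // h; rewrite ler_norml.
have [x0|x0] := leP 0 x; have [y0|y0] := leP 0 (h + x).
- by rewrite !ger0_norm//; apply/andP; split; nra.
- by rewrite (ger0_norm x0) (ltr0_norm y0); apply/andP; split; nra.
- by rewrite (ltr0_norm x0) (ger0_norm y0); apply/andP; split; nra.
- by rewrite !ltr0_norm//; apply/andP; split; nra.
Qed.

(* [gs] is the bounded odd profile for which [|gs| = Theta] and
   [gs' ^ 2 <= 4 Theta]: the error terms of the chain rule for [gs] can then be
   absorbed by the integral of [Theta] itself. *)
Definition Theta s : R := s ^+ 2 / (1 + s ^+ 2).
Definition gs s : R := s * `|s| / (1 + s ^+ 2).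
Definition gs' s : R := 2 * `|s| / (1 + s ^+ 2) ^+ 2.

Lemma den_gt0 s : 0 < 1 + s ^+ 2.
Proof. by rewrite ltr_pwDl// sqr_ge0. Qed.

Lemma Theta_ge0 s : 0 <= Theta s.
Proof. by rewrite divr_ge0 ?sqr_ge0// ltW// den_gt0. Qed.

Lemma Theta_le1 s : Theta s <= 1.
Proof. by rewrite ler_pdivrMr ?den_gt0// mul1r lerDr. Qed.

Lemma Theta_le_norm s : Theta s <= `|s|.
Proof.
rewrite ler_pdivrMr ?den_gt0// -real_normK ?num_real//; move: `|s| (normr_ge0 s) => t t0.
have := sqr_ge0 (t - 1); nra.
Qed.

Lemma norm_gs s : `|gs s| = Theta s.
Proof.
rewrite /gs /Theta normrM normfV (gtr0_norm (den_gt0 s)) normrM normr_id -expr2.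
by rewrite real_normK ?num_real.
Qed.

Lemma is_derive_gs x : is_derive x (1 : R) gs (gs' x).
Proof.
have H1 := is_derive_sgnsq x.
have H2 : is_derive x (1 : R) (fun s : R => 1 + s ^+ 2) (2 * x).
  apply: (@is_derive_quad _ _ _ 1) => // h.
  by rewrite (_ : _ - _ - _ = h ^+ 2); [rewrite ger0_norm ?sqr_ge0// mul1r|ring].
have n0 : 1 + x ^+ 2 != 0 by rewrite gt_eqF// den_gt0.
have H3 := @is_deriveV _ (fun s : R => 1 + s ^+ 2) x _ 1 n0 H2.
apply: (is_derive_eq (is_deriveM H1 H3)).
rewrite /GRing.scale/= /gs'; have := real_normK (num_real x); move: `|x| => t tx.
by field: tx; rewrite n0.
Qed.

Lemma gs'_ge0 s : 0 <= gs' s.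
Proof.
rewrite /gs'; apply: divr_ge0; first by rewrite mulr_ge0.
by rewrite exprn_ge0// ltW// den_gt0.
Qed.

Lemma gs'_le1 s : gs' s <= 1.
Proof.
rewrite ler_pdivrMr ?exprn_gt0 ?den_gt0// mul1r.
rewrite -[s ^+ 2]real_normK ?num_real//; move: `|s| (normr_ge0 s) => t t0.
have := sqr_ge0 (t - 1); have := sqr_ge0 (t ^+ 2); have := sqr_ge0 t; nra.
Qed.

Lemma gs'_sqr_le s : gs' s ^+ 2 <= 4 * Theta s.
Proof.
rewrite /gs' /Theta -[s ^+ 2]real_normK ?num_real//; move: `|s| (normr_ge0 s) => t t0.
have d1 : 1 <= 1 + t ^+ 2 by rewrite lerDl sqr_ge0.
have d0 : 0 < 1 + t ^+ 2 by exact: lt_le_trans d1.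
rewrite expr_div_n -exprM ler_pdivrMr ?exprn_gt0//.
rewrite exprMn (_ : 4 * _ * _ = 2 ^+ 2 * t ^+ 2 * (1 + t ^+ 2) ^+ 3); last by field; rewrite gt_eqF.
by rewrite ler_peMr ?mulr_ge0 ?sqr_ge0// exprn_ege1.
Qed.

Lemma continuous_gs' : continuous gs'.
Proof.
move=> s; have c1 : {for s, continuous (fun s : R => 1 + s ^+ 2)}.
  apply: continuousD; first exact: cst_continuous.
  exact: exprn_continuous.
have c2 : {for s, continuous (fun s : R => ((1 + s ^+ 2) ^+ 2)^-1)}.
  apply: continuousV; first by rewrite expf_neq0// gt_eqF// den_gt0.
  exact: (continuousM c1 c1).
have c3 : {for s, continuous (fun s : R => 2 * `|s|)}.
  by apply: continuousM; [exact: cst_continuous|exact: norm_continuous].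
exact: (continuousM c3 c2).
Qed.

Lemma gs_lipschitz s t : `|gs s - gs t| <= `|s - t|.
Proof.
have cg : continuous gs.
  by move=> u; apply: differentiable_continuous; apply/derivable1_diffP; exact: (@ex_derive _ _ _ _ _ _ _ (is_derive_gs u)).
have lip a c : a < c -> `|gs c - gs a| <= c - a.
  move=> ac; have [q _ ->] := MVT ac (fun t _ => is_derive_gs t) (continuous_subspaceT cg).
  rewrite normrM (gtr0_norm (_ : 0 < c - a)) ?subr_gt0// ger0_norm ?gs'_ge0//.
  by rewrite ler_piMl ?gs'_le1// subr_ge0 ltW.
have [st|ts|->] := ltgtP s t; last by rewrite !subrr normr0.
  by rewrite distrC (distrC s) (gtr0_norm (_ : 0 < t - s)) ?subr_gt0// lip.
by rewrite (gtr0_norm (_ : 0 < s - t)) ?subr_gt0// lip.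
Qed.

Lemma gs_osc s t : `|gs s - gs t| <= 2.
Proof.
have h1 : `|gs s| <= 1 by rewrite norm_gs Theta_le1.
have h2 : `|gs t| <= 1 by rewrite norm_gs Theta_le1.
by apply: (le_trans (ler_normB _ _)); lra.
Qed.

Lemma gs_ge0 s : 0 <= s -> 0 <= gs s.
Proof. by move=> s0; rewrite /gs !mulr_ge0// invr_ge0 ltW// den_gt0. Qed.

Lemma gs_le0 s : s <= 0 -> gs s <= 0.
Proof.
move=> s0; rewrite /gs -mulrA; apply: mulr_le0_ge0 => //.
by rewrite mulr_ge0// invr_ge0 ltW// den_gt0.
Qed.

End profile.

Lemma is_derive_scaled (R : realType) (G G' : R -> R) (c lam k : R) : lam != 0 ->
  (forall t, is_derive t (1 : R) G (G' t)) ->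
  forall t, is_derive t (1 : R) (fun t => k * G ((t - c) / lam)) (k / lam * G' ((t - c) / lam)).
Proof.
move=> l0 dG t.
have H1 : is_derive t (1 : R) (fun t => (t - c) / lam) lam^-1.
  apply: (@is_derive_quad _ _ _ _ 1) => // h.
  rewrite (_ : _ - _ - _ = 0); last by field.
  by rewrite normr0 mul1r sqr_ge0.
have H2 := @is_derive1_comp _ G (fun t => (t - c) / lam) t _ _ (dG _) H1.
apply: (is_derive_eq (is_deriveZ k H2)).
by rewrite /GRing.scale/=; ring.
Qed.

Lemma continuous_scaled (R : realType) (G' : R -> R) (c lam k : R) :
  continuous G' -> continuous (fun t => k * G' ((t - c) / lam)).
Proof.
move=> cG t; apply: continuousM; first exact: cst_continuous.
apply: (@continuous_comp _ _ _ (fun t => (t - c) / lam) G'); last exact: cG.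
apply: continuousM; last exact: cst_continuous.
by apply: continuousB => //; exact: cst_continuous.
Qed.

Section cell.
Context (R : realType) (n : nat).
Hypothesis n_ge2 : (2 <= n)%N.
Implicit Types (x y v : 'rV[R]_n) (r s : R) (U V K A E S : set 'rV[R]_n)
  (w f g phi psi : 'rV[R]_n -> R).
Local Notation L := (@leb_outer R n).
Local Notation T := (lebT R n).
Local Notation mu := (@leb R n).
Local Notation H := (@haus_outer R n n.-1).

(* A zero-mean choice of [c] makes the oscillation of [gs ((w - c) / lam)],
   controlled by [poincare], bound its L1 norm, which is the integral of
   [Theta]. *)
Lemma zero_mean w U (lam W : R) : measurable (U : set T) -> (L U < +oo)%E -> 0 < lam ->
  measurable_fun (U : set T) w -> (forall x, U x -> `|w x| <= W) ->
  exists c, \int[mu]_(x in U) gs ((w x - c) / lam) = 0.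
Proof.
move=> mU Ufin lam0 mw wW.
have cgs : continuous (@gs R).
  by move=> u; apply: differentiable_continuous; apply/derivable1_diffP; exact: (@ex_derive _ _ _ _ _ _ _ (is_derive_gs u)).
have mg c : measurable_fun (U : set T) (fun x => gs ((w x - c) / lam)).
  have m1 : measurable_fun (U : set T) (fun x => (w x - c) / lam).
    exact: (measurable_funM (measurable_funB mw (measurable_cst _)) (measurable_cst _)).
  exact: (continuous_comp_measurable mU cgs m1).
have Ig c : rint mu U (fun x => gs ((w x - c) / lam)).
  by apply: (@rint_bounded _ T R mu U _ 1 mU Ufin (mg c)) => x _; rewrite norm_gs Theta_le1.
pose F c := \int[mu]_(x in U) gs ((w x - c) / lam).
have Flip c d : `|F c - F d| <= `|c - d| * (fine (L U) / lam).
  rewrite /F -(RintegralB mU (Ig c) (Ig d)).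
  have Icst : rint mu U (fun=> `|c - d| / lam).
    exact: (@rint_bounded _ T R mu U _ `| `|c - d| / lam| mU Ufin).
  apply: (le_trans (Rint_norm_le mU (rintB mU (Ig c) (Ig d)) Icst _)).
    move=> x _; apply: (le_trans (gs_lipschitz _ _)).
    rewrite (_ : _ - _ = (d - c) / lam); last by field; rewrite gt_eqF.
    by rewrite normrM normfV (gtr0_norm lam0) distrC.
  by rewrite Rintegral_cst// mulrA mulrAC.
have cF : continuous F.
  move=> c; apply/cvgrPdist_le => e e0; pose k := fine (L U) / lam + 1.
  have f0 : 0 <= fine (L U) by rewrite fine_ge0// outer_measure_ge0.
  have k0 : 0 < k by rewrite ltr_wpDl// divr_ge0// ltW.
  apply/nbhs_ballP; exists (e / k); first by rewrite /= divr_gt0.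
  move=> d; rewrite /ball/= ltr_pdivlMr// => cd.
  apply: (le_trans (Flip c d)); apply: le_trans (ltW cd); rewrite ler_wpM2l//.
  by rewrite /k lerDl.
have W0 : - (`|W| + 1) <= `|W| + 1 by rewrite ge0_cp// addr_ge0.
have Fl : 0 <= F (- (`|W| + 1)).
  apply: Rint_ge0 => x Ux; apply: gs_ge0; rewrite divr_ge0 ?(ltW lam0)//.
  by have := wW x Ux; have := ler_norm W; rewrite ler_norml; lra.
have Fr : F (`|W| + 1) <= 0.
  have I0 : rint mu U (fun=> 0) by exact: integrable0.
  have -> : 0 = \int[mu]_(x in U) (0 : R) by rewrite Rintegral_cst// mul0r.
  apply: (le_Rintegral mU (Ig _) I0) => x Ux; apply: gs_le0.
  rewrite pmulr_lle0 ?invr_gt0//.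
  by have := wW x Ux; have := ler_norm W; rewrite ler_norml; lra.
have [|c _ Fc] := @IVT R F _ _ 0 W0 (continuous_subspaceT cF).
  by rewrite ge_min le_max Fr Fl orbT.
by exists c.
Qed.

End cell.

Section odd_profile.
Context (R : realType).
Implicit Types (s t x : R).

(* A bounded substitute for the identity, with chain rule defect
   [|1 - gz'| <= 3 Theta]. *)
Definition gz s : R := s / (1 + s ^+ 2).
Definition gz' s : R := (1 - s ^+ 2) / (1 + s ^+ 2) ^+ 2.

Lemma is_derive_gz x : is_derive x (1 : R) gz (gz' x).
Proof.
have H2 : is_derive x (1 : R) (fun s : R => 1 + s ^+ 2) (2 * x).
  apply: (@is_derive_quad _ _ _ _ 1) => // h.
  by rewrite (_ : _ - _ - _ = h ^+ 2); [rewrite ger0_norm ?sqr_ge0// mul1r|ring].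
have n0 : 1 + x ^+ 2 != 0 by rewrite gt_eqF// den_gt0.
have H3 := @is_deriveV _ (fun s : R => 1 + s ^+ 2) x _ 1 n0 H2.
apply: (is_derive_eq (is_deriveM (is_derive_id x (1 : R)) H3)).
by rewrite /GRing.scale/= /gz'; field; rewrite n0.
Qed.

Lemma continuous_gz' : continuous gz'.
Proof.
move=> s; have c0 : {for s, continuous (fun s : R => s ^+ 2)} by exact: exprn_continuous.
have c1 : {for s, continuous (fun s : R => 1 + s ^+ 2)}.
  by apply: continuousD => //; exact: cst_continuous.
have c2 : {for s, continuous (fun s : R => ((1 + s ^+ 2) ^+ 2)^-1)}.
  apply: continuousV; first by rewrite expf_neq0// gt_eqF// den_gt0.
  exact: (continuousM c1 c1).
have c3 : {for s, continuous (fun s : R => 1 - s ^+ 2)}.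
  by apply: continuousB => //; exact: cst_continuous.
exact: (continuousM c3 c2).
Qed.

Lemma norm_gz_half s : `|gz s| <= 2^-1.
Proof.
rewrite normrM normfV (gtr0_norm (den_gt0 s)) ler_pdivrMr ?den_gt0//.
rewrite -[s ^+ 2]real_normK ?num_real//; have := sqr_ge0 (`|s| - 1); nra.
Qed.

Lemma norm_gz_le s : `|gz s| <= `|s|.
Proof.
by rewrite normrM normfV (gtr0_norm (den_gt0 s)) ler_piMr// invf_le1 ?den_gt0// lerDl sqr_ge0.
Qed.

Lemma gz_osc s t : `|gz s - gz t| <= 1.
Proof.
apply: (le_trans (ler_normB _ _)); have := norm_gz_half s; have := norm_gz_half t; lra.
Qed.

Lemma norm_gz'_le s : `|gz' s| <= 1.
Proof.
rewrite normrM normfV (gtr0_norm (_ : 0 < (1 + s ^+ 2) ^+ 2)) ?exprn_gt0 ?den_gt0//.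
rewrite ler_pdivrMr ?exprn_gt0 ?den_gt0// mul1r ler_norml.
have := sqr_ge0 s; move: (s ^+ 2) => t t0; apply/andP; split; nra.
Qed.

Lemma gz'_Theta s : `|1 - gz' s| <= 3 * Theta s.
Proof.
have d0 := den_gt0 s; have n0 : 1 + s ^+ 2 != 0 by rewrite gt_eqF.
have -> : 1 - gz' s = (3 * s ^+ 2 + (s ^+ 2) ^+ 2) / (1 + s ^+ 2) ^+ 2.
  by rewrite /gz'; field.
have t0 := sqr_ge0 s; have t2 := sqr_ge0 (s ^+ 2).
rewrite ger0_norm; last by rewrite divr_ge0 ?sqr_ge0// addr_ge0// mulr_ge0.
rewrite ler_pdivrMr ?exprn_gt0// /Theta.
rewrite (_ : 3 * _ * _ = 3 * s ^+ 2 * (1 + s ^+ 2)); last by field.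
nra.
Qed.

End odd_profile.

(** * Gradient and field estimates for SBV functions *)

Section sbv.
Context (R : realType) (n : nat).
Hypothesis n_ge2 : (2 <= n)%N.
Implicit Types (x y v : 'rV[R]_n) (r s : R) (U V K A E S : set 'rV[R]_n)
  (w f g phi psi : 'rV[R]_n -> R).
Local Notation L := (@leb_outer R n).
Local Notation T := (lebT R n).
Local Notation mu := (@leb R n).
Local Notation H := (@haus_outer R n n.-1).

(** [S] is a parameter rather than the discontinuity set of [w]: it will remain that of the
    competitor [u], while [w] is a truncation of [u] minus an affine function. *)
Definition sbv_on U w (b : 'I_n -> 'rV[R]_n -> R) S :=
  exists sigma : {finite_measure set (borelT 'rV[R]_n) -> \bar R}, [/\ bv_on U w b sigma,
    forall B : set (borelT 'rV[R]_n), measurable B -> B `<=` U `\` S -> sigma B = 0%E &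
    (H (S `&` U) < +oo)%E].

Lemma sbv_on_rint U w b S : sbv_on U w b S -> rint mu U w /\ forall i, rint mu U (b i).
Proof. by case=> s [[Iw Ib _] _ _]. Qed.

Lemma sbv_on_sub U V w b S : open U -> open V -> V `<=` U -> sbv_on U w b S -> sbv_on V w b S.
Proof.
move=> oU oV VU [s [bv s0 Hfin]]; exists s; split.
- exact: (bv_on_sub oU oV VU bv).
- by move=> B mB BV; apply: s0 => // x /BV[/VU].
- by apply: le_lt_trans Hfin; apply: le_outer_measure; exact: setIS.
Qed.

Lemma chain_rule_sbv : exists2 C : R, 0 < C & forall U w b S
    (G G' : R -> R) (M o m : R) phi i, open U -> bounded_set U -> sbv_on U w b S ->
  (forall t, is_derive t (1 : R) G (G' t)) -> continuous G' -> (forall t, `|G' t| <= M) ->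
  (forall s t, `|G s - G t| <= o) -> test_fun U phi -> 0 < m -> (forall x, `|phi x| <= m) ->
  `|\int[mu]_(x in U) (G (w x) * partial i phi x)
    + \int[mu]_(x in U) (G' (w x) * b i x * phi x)| <=
    C * o * m * fine (H (S `&` U)).
Proof.
have [C C0 HC] := @chain_rule_jump R n n_ge2; exists C => //.
move=> U w b S G G' M o m phi i oU bU [s [bv s0 Hfin]] dG cG' G'M Go tp m0 pm.
have mU := open_measurable_leb oU; have Ufin := bounded_leb_fin bU.
have [[Iw Ib _] mn0] := (bv, lt0r_neq0 m0).
have mw := rint_measurable Iw.
have tp' : test_fun U (fun x => m^-1 * phi x) by exact: test_funZ.
have p1 x : `|m^-1 * phi x| <= 1.
  by rewrite normrM gtr0_norm ?invr_gt0// ler_pdivrMl// mulr1.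
have cG : continuous G.
  move=> u; apply: differentiable_continuous; apply/derivable1_diffP.
  exact: (@ex_derive _ _ _ _ _ _ _ (dG u)).
have mG := continuous_comp_measurable mU cG mw.
have mG' := continuous_comp_measurable mU cG' mw.
have GB x : `|G (w x)| <= `|G 0| + o.
  by rewrite -[G (w x)](subrK (G 0)) addrC (le_trans (ler_normD _ _))// lerD2l.
have := HC U w b s S G G' M o (fun x => m^-1 * phi x) i oU bU bv s0 Hfin dG cG' G'M Go tp' p1.
have I0 : rint mu U (fun x => G (w x)).
  exact: (@rint_bounded _ T R mu U _ _ mU Ufin mG (fun x _ => GB x)).
have I1 := rintM_test mU I0 (test_fun_partial i tp).
have I2 := rintM_test mU (rintMr mU (Ib i) mG' (fun x _ => G'M (w x))) tp.
have -> : \int[mu]_(x in U) (G (w x) * partial i (fun x => m^-1 * phi x) x) =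
    m^-1 * \int[mu]_(x in U) (G (w x) * partial i phi x).
  rewrite -(RintegralZl _ mU I1); apply: (@Rint_eq _ T R mu U) => x _.
  rewrite (partialZ m^-1 i (test_fun_smooth tp)); exact: mulrCA.
have -> : \int[mu]_(x in U) (G' (w x) * b i x * (m^-1 * phi x)) =
    m^-1 * \int[mu]_(x in U) (G' (w x) * b i x * phi x).
  have I2' : rint mu U (fun x => G' (w x) * b i x * phi x).
    by apply: (rint_eq mU _ I2) => x _; rewrite [b i x * _]mulrC.
  rewrite -(RintegralZl _ mU I2'); apply: (@Rint_eq _ T R mu U) => x _.
  exact: mulrCA.
rewrite -mulrDr normrM gtr0_norm ?invr_gt0// ler_pdivrMl// => h.
by rewrite [_ * m]mulrC -mulrA.
Qed.

(** Young's inequality produces [t ^+ 2], and [t ^+ 2 <= t] on [0, 1] brings it back to first order;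
    [t] will be [Theta]. *)
Lemma young_le (A b t : R) : 0 <= t <= 1 -> A * t * `|b| <= b ^+ 2 / 16 + 4 * A ^+ 2 * t.
Proof.
move=> /andP[t0 t1]; rewrite -[b ^+ 2]real_normK ?num_real//; move: `|b| => c.
have h1 := sqr_ge0 (c / 4 - 2 * A * t).
have h3 : 0 <= A ^+ 2 * (t - t ^+ 2) by rewrite mulr_ge0 ?sqr_ge0// expr2; nra.
nra.
Qed.

Lemma is_derive_continuous (G G' : R -> R) :
  (forall t, is_derive t (1 : R) G (G' t)) -> continuous G.
Proof.
move=> dG u; apply: differentiable_continuous; apply/derivable1_diffP.
exact: (@ex_derive _ _ _ _ _ _ _ (dG u)).
Qed.

(* The zero-mean normalisation of [gs] and the Poincare inequality turn the
   chain rule into a bound on the integral of [Theta], which is absorbed. *)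
Lemma cell_estimate : exists2 C : R, 0 < C & forall x r M W w b S, 0 < r -> 0 < M ->
  sbv_on (ball x r) w b S -> (forall i, rint mu (ball x r) (fun y => b i y ^+ 2)) ->
  (forall y, ball x r y -> `|w y| <= W) ->
  exists c, \int[mu]_(y in ball x r) Theta ((w y - c) / (M * r)) <=
    C / M ^+ 2 * \int[mu]_(y in ball x r) (\sum_i b i y ^+ 2) +
    C * r * fine (H (S `&` ball x r)).
Proof.
have [C0 C0p HC] := chain_rule_sbv.
(* Twice the constant [2 * n * 3 ^+ n] of [poincare]: since [gs (Q y)] has zero mean, the constant
   [k] that it provides costs at most as much as the deviation from it. *)
pose A : R := 4 * n%:R * 3 ^+ n.
have n0 : 0 < n%:R :> R by rewrite ltr0n; lia.
have A0 : 0 < A by rewrite /A !mulr_gt0// exprn_gt0.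
pose C := 4 * n%:R * A ^+ 2 + 4 * A * C0.
exists C; first by rewrite addr_gt0// !mulr_gt0// exprn_gt0.
move=> x r M W w b S r0 M0 sb Ib2 wW.
set U := ball x r; have oU : open U by exact: ball_open.
have bU : bounded_set U := bounded_ball x r.
have mU := open_measurable_leb oU; have Ufin := bounded_leb_fin bU.
have [Iw Ib] := sbv_on_rint sb; have mw := rint_measurable Iw.
pose lam := M * r; have lam0 : 0 < lam by rewrite mulr_gt0.
have [c Hc] := zero_mean mU Ufin lam0 mw wW; exists c; rewrite -/lam.
set h := fine (H (S `&` U)).
pose Q y := (w y - c) / lam.
have mQ : measurable_fun (U : set T) Q.
  exact: (measurable_funM (measurable_funB mw (measurable_cst _)) (measurable_cst _)).
have mg : measurable_fun (U : set T) (fun y => gs (Q y)).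
  exact: (continuous_comp_measurable mU (is_derive_continuous (@is_derive_gs R)) mQ).
have mg' : measurable_fun (U : set T) (fun y => gs' (Q y)).
  exact: (continuous_comp_measurable mU (@continuous_gs' R) mQ).
have Ig : rint mu U (fun y => gs (Q y)).
  by apply: (@rint_bounded _ T R mu U _ 1 mU Ufin mg) => y _; rewrite norm_gs Theta_le1.
have g'b y : `|gs' (Q y)| <= 1 by rewrite ger0_norm ?gs'_le1// gs'_ge0.
have Ibg i : rint mu U (fun y => `|b i y| * gs' (Q y)).
  exact: (rintMr mU (rint_norm mU (Ib i)) mg' (fun y _ => g'b y)).
have ID : rint mu U (fun y => \sum_i `|b i y| * gs' (Q y)) by exact: rint_sum.
pose D := \int[mu]_(y in U) (\sum_i `|b i y| * gs' (Q y)).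
pose B := D / lam + 2 * C0 * h.
have key i psi : test_fun U psi -> (forall y, `|psi y| <= 1) ->
    `|\int[mu]_(y in U) (gs (Q y) * partial i psi y)| <= B.
  move=> tpsi p1.
  have dG := is_derive_scaled c 1 (lt0r_neq0 lam0) (@is_derive_gs R).
  have cG := @continuous_scaled R _ c lam (1 / lam) (@continuous_gs' R).
  have G'M t : `|1 / lam * gs' ((t - c) / lam)| <= lam^-1.
    rewrite mul1r normrM gtr0_norm ?invr_gt0// ler_piMr ?invr_ge0 ?(ltW lam0)//.
    by rewrite ger0_norm ?gs'_le1// gs'_ge0.
  have Go s t : `|1 * gs ((s - c) / lam) - 1 * gs ((t - c) / lam)| <= 2.
    by rewrite !mul1r gs_osc.
  have := HC U w b S _ _ _ _ _ psi i oU bU sb dG cG G'M Go tpsi ltr01 p1.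
  rewrite mulr1 -/h => K1.
  have -> : \int[mu]_(y in U) (gs (Q y) * partial i psi y) =
    \int[mu]_(y in U) (1 * gs ((w y - c) / lam) * partial i psi y).
    by apply: (@Rint_eq _ T R mu U) => y _; rewrite mul1r.
  have mlg : measurable_fun (U : set T) (fun y => 1 / lam * gs' (Q y)).
    exact: (measurable_funM (measurable_cst _) mg').
  have I2 : rint mu U (fun y => 1 / lam * gs' ((w y - c) / lam) * b i y * psi y).
    have I1 := rintM_test mU (rintMr mU (Ib i) mlg (fun y _ => G'M (w y))) tpsi.
    by apply: (rint_eq mU _ I1) => y _; rewrite [b i y * _]mulrC.
  have ID' : rint mu U (fun y => lam^-1 * \sum_i `|b i y| * gs' (Q y)) by exact: (rintZ _ mU ID).
  have K2 : `|\int[mu]_(y in U) (1 / lam * gs' ((w y - c) / lam) * b i y * psi y)| <= D / lam.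
    rewrite [D / lam]mulrC /D -(RintegralZl _ mU ID).
    apply: (Rint_norm_le mU I2 ID') => y Uy.
    rewrite -/(Q y); move: (gs' (Q y)) (gs'_ge0 (Q y)) => g g0.
    rewrite mul1r !normrM (gtr0_norm (_ : 0 < lam^-1)) ?invr_gt0// -!mulrA.
    rewrite ler_wpM2l ?invr_ge0 ?(ltW lam0)// (ger0_norm g0).
    rewrite (bigD1 i)//= -[leLHS]addr0 lerD//.
      by rewrite [leLHS]mulrCA ler_wpM2l// ler_piMr.
    by apply: sumr_ge0 => j _; rewrite mulr_ge0.
  have K1' : C0 * 2 * h = 2 * C0 * h by rewrite [C0 * 2]mulrC.
  rewrite K1' in K1.
  move: K1 K2; rewrite /B.
  move: (\int[mu]_(_ in _) _) (\int[mu]_(_ in _) _) => X Y K1 K2.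
  rewrite -[Y](addrK X) (le_trans (ler_normB _ _))// [leRHS]addrC; exact: lerD.
have ITh : rint mu U (fun y => Theta (Q y)).
  by apply: (rint_eq mU _ (rint_norm mU Ig)) => y _; exact: norm_gs.
have K : \int[mu]_(y in U) Theta (Q y) <= A * r * B.
  apply/ler_addgt0Pr => eta eta0; have e2 : 0 < eta / 2 by rewrite divr_gt0.
  have [k Hk] := poincare r0 Ig key e2.
  rewrite -/U in Hk.
  have Ik : rint mu U (fun=> k) by exact: (@rint_bounded _ T R mu U _ `|k| mU Ufin).
  have If := rintB mU Ig Ik.
  have f0 : 0 <= fine (L U) by rewrite fine_ge0// outer_measure_ge0.
  have E1 : \int[mu]_(y in U) (gs (Q y) - k) = - (k * fine (L U)).
    by rewrite (RintegralB mU Ig Ik) Hc sub0r Rintegral_cst.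
  have E2 : `|k| * fine (L U) <= \int[mu]_(y in U) `|gs (Q y) - k|.
    by rewrite -[fine _]ger0_norm// -normrM -normrN -E1; exact: (le_normr_Rintegral mU If).
  have E3 : \int[mu]_(y in U) Theta (Q y) <= \int[mu]_(y in U) `|gs (Q y) - k| + `|k| * fine (L U).
    have Ik' : rint mu U (fun=> `|k|) by exact: (@rint_bounded _ T R mu U _ `| `|k| | mU Ufin).
    have -> : `|k| * fine (L U) = \int[mu]_(y in U) `|k| by rewrite Rintegral_cst.
    rewrite -(RintegralD mU (rint_norm mU If) Ik').
    apply: (le_Rintegral mU ITh (rintD mU (rint_norm mU If) Ik')) => y _.
    by rewrite -norm_gs -{1}[gs (Q y)](subrK k) ler_normD.
  apply: (le_trans E3); apply: (le_trans (lerD Hk (le_trans E2 Hk))).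
  rewrite /A; set X := 3 ^+ n; lra.
have BE : A * r * B = A / M * D + 2 * A * C0 * r * h.
  by rewrite /B /lam; field; rewrite !gt_eqF.
pose V := \int[mu]_(y in U) (\sum_i b i y ^+ 2).
have IV : rint mu U (fun y => \sum_i b i y ^+ 2) by exact: rint_sum.
(* Young's inequality with [gs' ^+ 2 <= 4 * Theta]. The weights are chosen so that exactly one half
   of the integral of [Theta] reappears, to be absorbed by the left-hand side. *)
have DE : A / M * D <= 2^-1 * \int[mu]_(y in U) Theta (Q y) + 2 * n%:R * A ^+ 2 / M ^+ 2 * V.
  rewrite /D /V -!(RintegralZl _ mU) // -(RintegralD mU (rintZ _ mU ITh) (rintZ _ mU IV)).
  apply: (le_Rintegral mU (rintZ _ mU ID) (rintD mU (rintZ _ mU ITh) (rintZ _ mU IV))) => y _.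
  have T0 := Theta_ge0 (Q y); have G4 := gs'_sqr_le (Q y).
  apply: (@le_trans _ _ (\sum_i (Theta (Q y) / (2 * n%:R) + 2 * n%:R * A ^+ 2 / M ^+ 2 * b i y ^+ 2))).
    rewrite mulr_sumr; apply: ler_sum => i _.
    rewrite -[b i y ^+ 2]real_normK ?num_real//; move: (`|b i y|) (gs' (Q y)) G4 => t g' G4.
    rewrite -subr_ge0.
    have -> : Theta (Q y) / (2 * n%:R) + 2 * n%:R * A ^+ 2 / M ^+ 2 * t ^+ 2 - A / M * (t * g') =
      (4 * Theta (Q y) - g' ^+ 2) / (8 * n%:R) + (g' - 4 * n%:R * A / M * t) ^+ 2 / (8 * n%:R).
      by field; rewrite !gt_eqF.
    by rewrite addr_ge0// divr_ge0 ?sqr_ge0 ?subr_ge0// mulr_ge0// ltW.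
  rewrite big_split/= [in leRHS]mulr_sumr lerD2r sumr_const card_ord -[X in X <= _]mulr_natr.
  by rewrite le_eqVlt; apply/orP; left; apply/eqP; field; rewrite gt_eqF.
have h0 : 0 <= h by rewrite fine_ge0// outer_measure_ge0.
have V0 : 0 <= V.
  by apply: (@Rint_ge0 _ T R mu U) => y _; apply: sumr_ge0 => i _; exact: sqr_ge0.
have X1 : 0 <= A * C0 / M ^+ 2 * V.
  by rewrite mulr_ge0// divr_ge0 ?sqr_ge0// mulr_ge0 ?ltW.
have X2 : 0 <= n%:R * A ^+ 2 * r * h.
  exact: (mulr_ge0 (mulr_ge0 (mulr_ge0 (ltW n0) (sqr_ge0 A)) (ltW r0)) h0).
have CE : C / M ^+ 2 * V + C * r * h = 2 * (2 * n%:R * A ^+ 2 / M ^+ 2 * V) + 4 * (A * C0 / M ^+ 2 * V)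
   + 4 * (n%:R * A ^+ 2 * r * h) + 2 * (2 * A * C0 * r * h) by rewrite /C; field; rewrite gt_eqF.
rewrite -/V CE.
move: K; rewrite BE; move: DE X1 X2.
move: (A / M * D) (2 * n%:R * A ^+ 2 / M ^+ 2 * V) (A * C0 / M ^+ 2 * V) (n%:R * A ^+ 2 * r * h)
  (2 * A * C0 * r * h) (\int[mu]_(y in U) Theta (Q y)) => a1 a2 a3 a4 a5 a6; clear; lra.
Qed.

(** With [G] the profile [gz] rescaled to height [lam] around [c], [b] is split into [G' (w) b] and
    a defect. The first goes through the chain rule and leaves the divergence of [Psi] and [lam * m]
    times the jump measure. The second is bounded by [3 * m * Theta * |b|], and [36 = 4 * 3 ^+ 2]
    comes from [young_le]. *)
Lemma field_estimate : exists2 C : R, 0 < C & forall U w b S (Psi : 'I_n -> 'rV[R]_n -> R)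
    (c lam m : R), open U -> bounded_set U -> sbv_on U w b S ->
  (forall i, rint mu U (fun y => b i y ^+ 2)) -> 0 < lam -> 0 < m ->
  (forall i, test_fun U (Psi i)) -> (forall i x, `|Psi i x| <= m) ->
  `|\int[mu]_(x in U) (\sum_i b i x * Psi i x)| <=
    `|\int[mu]_(x in U) (lam * gz ((w x - c) / lam) * \sum_i partial i (Psi i) x)| +
    C * lam * m * fine (H (S `&` U)) + 16^-1 * \int[mu]_(x in U) (\sum_i b i x ^+ 2) +
    36 * n%:R * m ^+ 2 * \int[mu]_(x in U) Theta ((w x - c) / lam).
Proof.
have [C0 C0p HC] := chain_rule_sbv.
have n0 : 0 < n%:R :> R by rewrite ltr0n; lia.
exists (n%:R * C0); first exact: mulr_gt0.
move=> U w b S Psi c lam m oU bU sb Ib2 lam0 m0 tP Pm.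
have mU := open_measurable_leb oU; have Ufin := bounded_leb_fin bU.
have [Iw Ib] := sbv_on_rint sb; have mw := rint_measurable Iw.
have ln0 : lam != 0 by rewrite gt_eqF.
set h := fine (H (S `&` U)).
pose Q y := (w y - c) / lam.
have mQ : measurable_fun (U : set T) Q.
  exact: (measurable_funM (measurable_funB mw (measurable_cst _)) (measurable_cst _)).
pose G t := lam * gz ((t - c) / lam); pose G' t := lam / lam * gz' ((t - c) / lam).
have dG : forall t, is_derive t (1 : R) G (G' t).
  exact: (is_derive_scaled c lam ln0 (@is_derive_gz R)).
have cG' : continuous G' by exact: (@continuous_scaled R _ c lam (lam / lam) (@continuous_gz' R)).
have G'M t : `|G' t| <= 1 by rewrite /G' divff// mul1r norm_gz'_le.
have Go s t : `|G s - G t| <= lam.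
  by rewrite /G -mulrBr normrM gtr0_norm// ler_piMr ?(ltW lam0)// gz_osc.
have cG := is_derive_continuous dG.
have mG := continuous_comp_measurable mU cG mw.
have mG' := continuous_comp_measurable mU cG' mw.
have GB x : `|G (w x)| <= `|G 0| + lam.
  by rewrite -[G (w x)](subrK (G 0)) addrC (le_trans (ler_normD _ _))// lerD2l.
have IG : rint mu U (fun x => G (w x)).
  exact: (@rint_bounded _ T R mu U _ _ mU Ufin mG (fun x _ => GB x)).
have IGd i : rint mu U (fun x => G (w x) * partial i (Psi i) x).
  exact: (rintM_test mU IG (test_fun_partial i (tP i))).
have IbG i : rint mu U (fun x => G' (w x) * b i x).
  have I1 := rintMr mU (Ib i) mG' (fun y _ => G'M (w y)).
  by apply: (rint_eq mU _ I1) => y _; exact: mulrC.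
have IbGP i : rint mu U (fun x => G' (w x) * b i x * Psi i x) by exact: (rintM_test mU (IbG i) (tP i)).
have IbP i : rint mu U (fun x => b i x * Psi i x) by exact: (rintM_test mU (Ib i) (tP i)).
have mg := continuous_comp_measurable mU (is_derive_continuous (@is_derive_gs R)) mQ.
have Ig : rint mu U (fun y => gs (Q y)).
  by apply: (@rint_bounded _ T R mu U _ 1 mU Ufin mg) => y _; rewrite norm_gs Theta_le1.
have ITh : rint mu U (fun y => Theta (Q y)).
  by apply: (rint_eq mU _ (rint_norm mU Ig)) => y _; exact: norm_gs.
pose X i := \int[mu]_(x in U) (G (w x) * partial i (Psi i) x).
pose Y i := \int[mu]_(x in U) (G' (w x) * b i x * Psi i x).
pose Z i := \int[mu]_(x in U) (b i x * Psi i x - G' (w x) * b i x * Psi i x).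
have XY i : `|X i + Y i| <= C0 * lam * m * h.
  exact: (HC U w b S G G' 1 lam m (Psi i) i oU bU sb dG cG' G'M Go (tP i) m0 (Pm i)).
have ZB i : `|Z i| <= \int[mu]_(x in U) (16^-1 * b i x ^+ 2 + 36 * m ^+ 2 * Theta (Q x)).
  apply: (Rint_norm_le mU (rintB mU (IbP i) (IbGP i)) (rintD mU (rintZ _ mU (Ib2 i)) (rintZ _ mU ITh))) => x _.
  have -> : b i x * Psi i x - G' (w x) * b i x * Psi i x = (1 - gz' (Q x)) * Psi i x * b i x.
    by rewrite /G' divff// mul1r -/(Q x); ring.
  have := young_le (3 * m) (b i x) (_ : 0 <= Theta (Q x) <= 1).
  rewrite Theta_ge0 Theta_le1 => /(_ isT) Y1.
  rewrite (_ : 16^-1 * _ + _ = b i x ^+ 2 / 16 + 4 * (3 * m) ^+ 2 * Theta (Q x)); last by field.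
  apply: le_trans Y1; rewrite 2!normrM ler_wpM2r// (_ : 3 * m * _ = 3 * Theta (Q x) * m); last by ring.
  by apply: ler_pM => //; exact: gz'_Theta.
have E1 : \int[mu]_(x in U) (\sum_i b i x * Psi i x) = \sum_i (X i + Y i) - \sum_i X i + \sum_i Z i.
  rewrite (Rint_sum _ mU IbP) -sumrB -big_split/=; apply: eq_bigr => i _.
  by rewrite /Z (RintegralB mU (IbP i) (IbGP i)) /X /Y; ring.
have E2 : \int[mu]_(x in U) (lam * gz ((w x - c) / lam) * \sum_i partial i (Psi i) x) = \sum_i X i.
  rewrite -(Rint_sum _ mU IGd); apply: (@Rint_eq _ T R mu U) => x _.
  exact: mulr_sumr.
have E3 : \sum_i \int[mu]_(x in U) (16^-1 * b i x ^+ 2 + 36 * m ^+ 2 * Theta (Q x)) =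
    16^-1 * \int[mu]_(x in U) (\sum_i b i x ^+ 2) +
    36 * n%:R * m ^+ 2 * \int[mu]_(x in U) Theta (Q x).
  have -> : 36 * n%:R * m ^+ 2 * \int[mu]_(x in U) Theta (Q x) =
      \sum_(i < n) 36 * m ^+ 2 * \int[mu]_(x in U) Theta (Q x).
    by rewrite sumr_const card_ord -[RHS]mulr_natl; ring.
  rewrite (Rint_sum _ mU Ib2) mulr_sumr -big_split/=; apply: eq_bigr => i _.
  rewrite (RintegralD mU (rintZ _ mU (Ib2 i)) (rintZ _ mU ITh)).
  by rewrite (RintegralZl _ mU (Ib2 i)) (RintegralZl _ mU ITh).
rewrite E1 E2 -[leRHS]addrA -E3.
apply: (le_trans (ler_normD _ _)); apply: lerD; last first.
  by apply: (le_trans (ler_norm_sum _ _ _)); apply: ler_sum => i _; exact: ZB.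
apply: (le_trans (ler_normB _ _)); rewrite [leLHS]addrC lerD2l.
apply: (le_trans (ler_norm_sum _ _ _)); apply: (le_trans (ler_sum _ (fun i _ => XY i))).
by rewrite sumr_const card_ord -[leLHS]mulr_natl !mulrA.
Qed.

End sbv.

(** * Hausdorff measure of separated sets and perforated domains *)

Section hausdorff_separated.
Context (R : realType) (n s : nat).
Implicit Types (A B : set 'rV[R]_n) (d : R).
Local Open Scope ereal_scope.
Local Notation H := (@haus_outer R n s).

Lemma haus_weight_ge0 (E : set 'rV[R]_n) : (0 <= unit_ball_volume R s * (diam E / 2) ^+ s)%R.
Proof.
apply: mulr_ge0; first by rewrite fine_ge0// outer_measure_ge0.
apply: exprn_ge0; apply: divr_ge0 => //.
have [[E0 Eb]|nE] := pselect (has_sup [set enorm (p.1 - p.2) | p in E `*` E]).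
  have [_ [p Ep _]] := E0; apply: (@le_trans _ _ (enorm (p.1 - p.2))); first exact: enorm_ge0.
  by apply: ub_le_sup => //; exists p.
by rewrite /diam sup_out.
Qed.

Lemma haus_delta_ge0 d A : 0 <= haus_delta s d A.
Proof. by apply: cover_outer_ge0 => E; exact: haus_weight_ge0. Qed.

Lemma haus_delta_anti d d' A : (d <= d')%R -> haus_delta s d' A <= haus_delta s d A.
Proof.
move=> dd'; apply: le_ereal_inf_tmp => _ [F [DF AF] <-]; apply: ereal_inf_lbound.
exists F => //; split=> // k E /DF DE x y Ex Ey; exact: le_trans (DE x y Ex Ey) dd'.
Qed.

(* A covering set of diameter at most d meets at most one of A and B. *)
Lemma haus_delta_separated d A B : (forall x y, A x -> B y -> (d < enorm (x - y))%R) ->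
  haus_delta s d A + haus_delta s d B <= haus_delta s d (A `|` B).
Proof.
move=> AB; apply: le_ereal_inf_tmp => _ [F [DF ABF] <-].
pose sel C k := if `[< oapp id set0 (F k) `&` C !=set0 >] then F k else None.
pose wt (E : set 'rV[R]_n) := (unit_ball_volume R s * (diam E / 2) ^+ s)%R.
have wt0 (o : option (set 'rV[R]_n)) : 0 <= (oapp wt 0%R o)%:E.
  by rewrite lee_fin; case: o => //= E; exact: haus_weight_ge0.
have selP C : C `<=` A `|` B -> haus_delta s d C <= \sum_(k <oo) (oapp wt 0%R (sel C k))%:E.
  move=> CAB; apply: ereal_inf_lbound; exists (sel C) => //; split=> [k E|x Cx].
    by rewrite /sel; case: ifP => // _; exact: DF.
  have [k _ Fx] := ABF _ (CAB _ Cx); exists k => //.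
  by rewrite /sel; case: asboolP => // -[]; exists x.
apply: (le_trans (leeD (selP A (@subsetUl _ A B)) (selP B (@subsetUr _ A B)))).
rewrite -nneseriesD//; apply: lee_nneseries => [k _ _|k _]; first by rewrite adde_ge0.
rewrite /sel; case: asboolP => [[x [Fx Ax]]|_]; case: asboolP => [[y [Fy By]]|_];
  rewrite /= ?add0e ?adde0//.
move: Fx Fy (DF k); case: (F k) => //= E Ex Ey /(_ E erefl)/(_ x y Ex Ey).
by have := AB x y Ax By => /lt_le_trans h /h; rewrite ltxx.
Qed.

Lemma ereal_sup_add_le (S : set \bar R) (c X : \bar R) : S !=set0 -> (forall x, S x -> 0 <= x) ->
  0 <= c -> (forall x, S x -> x + c <= X) -> ereal_sup S + c <= X.
Proof.
move=> [x0 Sx0] S0 c0 SX.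
have [cf|] := boolP (c \is a fin_num).
  by rewrite -leeBrDr//; apply: ge_ereal_sup => x Sx; rewrite leeBrDr// SX.
rewrite ge0_fin_numE// -leNgt leye_eq => /eqP cy.
by have := SX _ Sx0; rewrite cy addey ?leye_eq => [/eqP ->|]; rewrite ?leey// gt_eqF// (lt_le_trans (ltNyr 0%R))// S0.
Qed.

Lemma haus_separated d A B : (0 < d)%R -> (forall x y, A x -> B y -> (d < enorm (x - y))%R) ->
  H A + H B <= H (A `|` B).
Proof.
move=> d0 AB.
apply: ereal_sup_add_le.
- by exists (haus_delta s 1%R A), 1%R => //=.
- by move=> _ [e _ <-]; exact: haus_delta_ge0.
- exact: outer_measure_ge0.
move=> _ [e /= e0 <-]; rewrite addeC; apply: ereal_sup_add_le.
- by exists (haus_delta s 1%R B), 1%R => //=.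
- by move=> _ [e' _ <-]; exact: haus_delta_ge0.
- exact: haus_delta_ge0.
move=> _ [e' /= e'0 <-]; rewrite addeC.
(* The two suprema are taken at unrelated scales; both are dominated at a common smaller scale,
   below the separation distance. *)
pose m := Num.min d (Num.min e e').
have m0 : (0 < m)%R by rewrite !lt_min d0 e0.
have md : (m <= d)%R by rewrite /m ge_min lexx.
have me : (m <= e)%R by rewrite /m !ge_min lexx orbT.
have me' : (m <= e')%R by rewrite /m !ge_min lexx !orbT.
apply: (le_trans (leeD (haus_delta_anti A me) (haus_delta_anti B me'))).
apply: (@le_trans _ _ (haus_delta s m (A `|` B))).
  by apply: haus_delta_separated => x y Ax By; exact: le_lt_trans md (AB x y Ax By).
by apply: ereal_sup_ubound; exists m.
Qed.

(** The jump sets are not assumed measurable: superadditivity of the outer measure comes from the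
    positive distance between the pieces, which will be the cells around the holes. *)
Lemma haus_separated_sum (I : eqType) (D : seq I) (F : I -> set 'rV[R]_n) d W : (0 < d)%R -> uniq D ->
  (forall i j x y, i \in D -> j \in D -> i != j -> F i x -> F j y -> (d < enorm (x - y))%R) ->
  (forall i, i \in D -> F i `<=` W) -> \sum_(i <- D) H (F i) <= H W.
Proof.
move=> d0 uD sep FW.
suff : \sum_(i <- D) H (F i) <= H [set x | exists2 i, i \in D & F i x].
  by move=> /le_trans; apply; apply: le_outer_measure => x [i iD Fx]; exact: FW iD _ Fx.
elim: D uD sep {FW} => [|i D IH] /=; first by rewrite big_nil outer_measure_ge0.
move=> /andP[iD uD] sep; rewrite big_cons.
have IHD := IH uD (fun j k x y jD kD => sep j k x y (mem_behead (s := i :: D) jD) (mem_behead (s := i :: D) kD)).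
apply: (le_trans (leeD (lexx _) IHD)).
apply: (le_trans (haus_separated d0 _)) => [x y Fx [j jD Fy]|].
  apply: (sep i j x y) => //; rewrite ?mem_head// ?inE ?jD ?orbT//.
  by apply: contraNneq iD => ->.
apply: le_outer_measure => x [Fx|[j jD Fx]]; first by exists i => //; rewrite mem_head.
by exists j => //; rewrite inE jD orbT.
Qed.

End hausdorff_separated.

Section perforated_domain.
Context (R : realType) (n : nat).
Implicit Types (x y : 'rV[R]_n) (e : R).

Lemma closure_cube_half : closure (@cube R n (1 / 2)) = ccube 0 4^-1.
Proof.
have -> : @cube R n (1 / 2) = ball 0 4^-1.
  apply/seteqP; split=> y.
    move=> yc; apply/ball_rVP; split=> [|i]; first by rewrite invr_gt0.
    by have := yc i; rewrite mxE sub0r normrN ltr_norml; lra.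
  by move=> /ball_rVP[_ yb] i; have := yb i; rewrite mxE sub0r normrN ltr_norml; lra.
have := @closed_ballE R 'rV[R]_n 0 4^-1; rewrite /closed_ball invr_gt0 => -> //.
apply/seteqP; split=> y; rewrite /closed_ball_/= sub0r normrN => H.
  by move=> i; rewrite mxE subr0; exact: le_trans (rV_coord_le y i) H.
by apply: rV_norm_le => // i; have := H i; rewrite mxE subr0.
Qed.

(** A hole is a product, so a point lies in some hole as soon as each coordinate separately is
    within [e / 4] of a multiple of [e]; the multiples found are the coordinates of its index. *)
Lemma perforatedP e x : 0 < e ->
  dilation e (@perforated R n) x <-> exists j, forall k : int, e / 4 < `|x 0 j - e * k%:~R|.
Proof.
move=> e0; have en : e != 0 by rewrite gt_eqF.
have sc (t : R) (k : int) : `|e * t - e * k%:~R| = e * `|t - k%:~R|.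
  by rewrite -mulrBr normrM gtr0_norm.
split.
  move=> [p np <-]; apply: contrapT => /forallNP nx; apply: np.
  have /choice[z Hz] j : exists k : int, `|p 0 j - k%:~R| <= 4^-1.
    have /existsNP[k /negP] := nx j; rewrite mxE sc -leNgt ler_pM2l// => pk.
    by exists k.
  exists (\row_j z j) => //; exists (p - map_mx intr (\row_j z j)).
    by rewrite closure_cube_half => j; rewrite !mxE subr0 Hz.
  by rewrite addrC subrK.
move=> [j Hj]; exists (e^-1 *: x); last by rewrite scalerA divff// scale1r.
move=> [z _ [y]]; rewrite closure_cube_half => /(_ j); rewrite mxE subr0 => yj.
move=> /(congr1 (fun v : 'rV[R]_n => v 0 j)); rewrite !mxE => E.
have := Hj (z 0 j); have -> : x 0 j = e * ((z 0 j)%:~R + y 0 j) by rewrite E mulrA divff// mul1r.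
rewrite sc addrAC subrr add0r ltr_pM2l// => h.
by have := lt_le_trans h yj; rewrite ltxx.
Qed.

Lemma not_perforated e x : 0 < e -> ~ dilation e (@perforated R n) x ->
  exists z : 'rV[int]_n, forall j, `|x 0 j - e * (z 0 j)%:~R| <= e / 4.
Proof.
move=> e0 nP; have /choice[z Hz] j : exists k : int, `|x 0 j - e * k%:~R| <= e / 4.
  apply: contrapT => /forallNP H; apply: nP; apply/(perforatedP _ e0); exists j => k.
  by rewrite ltNge; apply/negP; exact: H.
by exists (\row_j z j) => j; rewrite mxE.
Qed.

Lemma open_perforated e : 0 < e -> open (dilation e (@perforated R n)).
Proof.
move=> e0; rewrite openE => x /(perforatedP _ e0)[j Hj].
(* The multiples of [e] enclosing [x 0 j] are the nearest ones, so the margin with respect to these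
   two serves for all [k]. *)
pose m := Num.floor (x 0 j / e); have := Num.Theory.floor_itv (x 0 j / e); rewrite -/m.
have en : e != 0 by rewrite gt_eqF.
move=> /andP[]; rewrite ler_pdivlMr// ltr_pdivrMr// => m1 m2.
have := Hj m; have := Hj (m + 1); rewrite ltr0_norm; last first.
  by rewrite subr_lt0 mulrC.
rewrite ger0_norm; last by rewrite subr_ge0 mulrC.
move: m1 m2; rewrite intrD [_ * e]mulrC [_ * e]mulrC => m1 m2 h2 h1.
pose t := Num.min (x 0 j - e * m%:~R - e / 4) (e * (m%:~R + 1) - x 0 j - e / 4).
have t0 : 0 < t by rewrite lt_min; apply/andP; split; lra.
apply/nbhs_ballP; exists t => //= y /ball_rVP[_ /(_ j)]; rewrite lt_min !ltr_norml => /andP[y1 y2].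
apply/(perforatedP _ e0); exists j => k.
have [km|mk] := leP k m.
  have : e * k%:~R <= e * m%:~R by rewrite ler_pM2l// ler_int.
  by move=> ?; apply: lt_le_trans (ler_norm _); lra.
have : e * (m%:~R + 1) <= e * k%:~R by rewrite ler_pM2l// -[1]/(1%:~R) -intrD ler_int lezD1.
by move=> ?; rewrite -normrN; apply: lt_le_trans (ler_norm _); lra.
Qed.

End perforated_domain.

(** * Divergence free fields avoiding the holes *)

Section solenoidal_cell.
Context (R : realType) (n : nat).
Hypothesis n_ge2 : (2 <= n)%N.
Implicit Types (x y p : 'rV[R]_n) (r : R).

Lemma is_derive_max (f : R -> R) (t d : R) : (forall s, derivable f s 1) ->
  is_derive t (1 : R) f d -> (forall s, f s <= f t) -> d = 0.
Proof.
move=> df [_ <-] ft.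
have [] := @derive1_at_max R f (t - 1) (t + 1) t => //; first by rewrite lerD2l ge0_cp.
by rewrite in_itv/= ltrBlDr !ltrDl ltr01.
Qed.

Lemma is_derive_min (f : R -> R) (t d : R) : (forall s, derivable f s 1) ->
  is_derive t (1 : R) f d -> (forall s, f t <= f s) -> d = 0.
Proof.
move=> df [_ <-] ft.
have [] := @derive1_at_min R f (t - 1) (t + 1) t => //; first by rewrite lerD2l ge0_cp.
by rewrite in_itv/= ltrBlDr !ltrDl ltr01.
Qed.

(** [theta] takes its extreme values 1 and 0 on the plateaus, so its derivative vanishes there, end
    points included. *)
Lemma theta_deriv_plateau : exists2 g : R -> R, smooth1 g & exists2 C : R, 0 < C &
  [/\ forall t, is_derive (t : R) (1 : R) (@theta R) (g t), forall t, `|g t| <= C,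
      forall t, `|t| <= 1 -> g t = 0 & forall t, 3 / 2 <= `|t| -> g t = 0].
Proof.
have [g sg [C C0 HC]] := theta_deriv R; exists g => //; exists C => //.
have dg s : derivable (@theta R) s 1 by have [[]] := HC s.
split=> t; [exact: (HC t).1|exact: (HC t).2| |] => tt.
  by apply: (is_derive_max dg (HC t).1) => s; rewrite (theta1 tt) theta_le1.
by apply: (is_derive_min dg (HC t).1) => s; rewrite (theta0 tt) theta_ge0.
Qed.

Lemma smooth_bigsum (I : Type) (q : seq I) (f : I -> 'rV[R]_n -> R) :
  (forall i, smooth (f i)) -> smooth (fun x => \sum_(i <- q) f i x).
Proof.
move=> sf; elim: q => [|i q IH].
  rewrite (_ : (fun x => _) = fun=> 0); first exact: smooth_cst.
  by apply/funext => x; rewrite big_nil.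
rewrite (_ : (fun x => _) = fun x => f i x + \sum_(i <- q) f i x); first exact: smoothD.
by apply/funext => x; rewrite big_cons.
Qed.

Lemma partial_bigsum (I : Type) (q : seq I) (f : I -> 'rV[R]_n -> R) k :
  (forall i, smooth (f i)) ->
  partial k (fun x => \sum_(i <- q) f i x) = fun x => \sum_(i <- q) partial k (f i) x.
Proof.
move=> sf; elim: q => [|i q IH].
  rewrite (_ : (fun x => _) = fun=> 0); last by apply/funext => x; rewrite big_nil.
  by rewrite partial_cst; apply/funext => x; rewrite big_nil.
rewrite (_ : (fun x => _) = fun x => f i x + \sum_(i <- q) f i x); last first.
  by apply/funext => x; rewrite big_cons.
rewrite (partialD _ (sf i) (smooth_bigsum q sf)) IH.
by apply/funext => x; rewrite big_cons.
Qed.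

Lemma prodfun_le (h : 'I_n -> R -> R) (B : 'I_n -> R) x :
  (forall l t, `|h l t| <= B l) -> `|prodfun h x| <= \prod_l B l.
Proof. by move=> hB; rewrite normr_prod; apply: ler_prod => l _; rewrite normr_ge0 hB. Qed.

Lemma prodfun0 (h : 'I_n -> R -> R) x l : h l (x 0 l) = 0 -> prodfun h x = 0.
Proof. by move=> h0; rewrite /prodfun (bigD1 l)//= h0 mul0r. Qed.

(* A field equal to [xi] near [p], divergence free and compactly supported:
   the two-dimensional rotated gradient of a cut-off coordinate, in one
   coordinate plane for each component of [xi]. *)
Lemma solenoidal_cutoff : exists2 A : R, 0 < A & forall p r (xi : 'rV[R]_n), 0 < r ->
  exists kappa : 'I_n -> 'rV[R]_n -> R,
  [/\ forall k, smooth (kappa k), forall x, \sum_k partial k (kappa k) x = 0,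
      forall k x, `|kappa k x| <= A * enorm xi,
      forall x, ccube p r x -> forall k, kappa k x = xi 0 k &
      forall x, ~ ccube p (3 / 2 * r) x -> forall k, kappa k x = 0].
Proof.
have [g sg [C C0 [dg gC g1 g0]]] := theta_deriv_plateau.
(* A second coordinate [ot j] for each [j], available since [n >= 2]: in dimension 1 a compactly
   supported divergence free field vanishes. *)
have /choice[ot Ho] j : exists i : 'I_n, i != j.
  have [j0|j0] := eqVneq (j : nat) 0%N.
    have n1 : (1 < n)%N by [].
    by exists (Ordinal n1); rewrite -val_eqE/= j0.
  have n0 : (0 < n)%N by lia.
  by exists (Ordinal n0); rewrite -val_eqE/= eq_sym.
have n0 : 0 < n%:R :> R by rewrite ltr0n; lia.
exists (n%:R * (1 + 3 * C)); first by rewrite mulr_gt0// addr_gt0// mulr_gt0.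
move=> p r xi r0; have rn : r != 0 by rewrite gt_eqF.
pose th l (t : R) := theta (r^-1 * (t + - p 0 l)).
pose th' l (t : R) := r^-1 * g (r^-1 * (t + - p 0 l)).
pose mm l (t : R) := (t + - p 0 l) * th l t.
pose mm' l (t : R) := th l t + (t + - p 0 l) * th' l t.
have sth l : smooth1 (th l) by exact: (smooth1_affine _ _ (@smooth1_theta R)).
have sth' l : smooth1 (th' l).
  by apply: smooth1M; [exact: smooth1_cst|exact: (smooth1_affine _ _ sg)].
have sid l : smooth1 (fun t : R => t + - p 0 l).
  by apply: smooth1D; [exact: smooth1_id|exact: smooth1_cst].
have smm l : smooth1 (mm l) by exact: smooth1M.
have smm' l : smooth1 (mm' l) by apply: smooth1D => //; exact: smooth1M.
have dth l (t : R) : is_derive (t : R) (1 : R) (th l) (th' l t).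
  by apply: is_derive_affine; exact: dg.
have dmm l (t : R) : is_derive (t : R) (1 : R) (mm l) (mm' l t).
  have d1 : is_derive (t : R) (1 : R) (fun t : R => t + - p 0 l) 1.
    apply: (@is_derive_quad _ _ _ _ 1) => // h.
    by rewrite (_ : _ - _ - _ = 0) ?normr0 ?mul1r ?sqr_ge0//; ring.
  apply: (is_derive_eq (is_deriveM d1 (dth l t))).
  by rewrite /GRing.scale/= /mm' mulr1 addrC.
(* [h i] is the coordinate [x_i - p_i] times a cutoff; [D1 i] and [D2 i j] are its derivatives in
   the directions [i] and [j], and [D12 i j] is their common mixed derivative. *)
pose h i := prodfun (fun l => if l == i then mm l else th l) : 'rV[R]_n -> R.
pose D1 i := prodfun (fun l => if l == i then mm' l else th l) : 'rV[R]_n -> R.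
pose D2 i j := prodfun (fun l => if l == j then th' l else if l == i then mm l else th l)
  : 'rV[R]_n -> R.
pose D12 i j := prodfun (fun l => if l == j then th' l else if l == i then mm' l else th l)
  : 'rV[R]_n -> R.
have sD1 i : smooth (D1 i) by apply: smooth_prodfun => l; case: ifP.
have sD2 i j : smooth (D2 i j).
  by apply: smooth_prodfun => l; case: ifP => // _; case: ifP.
have pD1 i j : i != j -> partial j (D1 i) = D12 i j.
  move=> ij; pose hh l := if l == i then mm' l else th l.
  have dj t : is_derive (t : R) (1 : R) (hh j) (th' j t).
    by rewrite /hh eq_sym (negbTE ij); exact: dth.
  rewrite /D1 (partial_prodfun dj).
  by congr prodfun; apply/funext => l; case: eqP => // ->.
have pD2 i j : i != j -> partial i (D2 i j) = D12 i j.
  move=> ij; pose hh l := if l == j then th' l else if l == i then mm l else th l.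
  have di t : is_derive (t : R) (1 : R) (hh i) (mm' i t).
    by rewrite /hh (negbTE ij) eqxx; exact: dmm.
  rewrite /D2 (partial_prodfun di).
  congr prodfun; apply/funext => l; have [->|li] := eqVneq l i; first by rewrite (negbTE ij).
  by rewrite /= /hh (negbTE li).
have th01 l t : `|th l t| <= 1 by rewrite ger0_norm ?theta_ge0// theta_le1.
have sE l t : `|r^-1 * (t + - p 0 l)| = `|t - p 0 l| / r.
  by rewrite normrM gtr0_norm ?invr_gt0// mulrC.
have th'B l t : `|th' l t| <= C / r.
  by rewrite normrM gtr0_norm ?invr_gt0// mulrC ler_wpM2r// invr_ge0 ltW.
have mmB l t : `|mm l t| <= 3 / 2 * r.
  have [tl|tl] := leP (3 / 2) `|r^-1 * (t + - p 0 l)|.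
    by rewrite /mm /th (theta0 tl) mulr0 normr0 mulr_ge0// ltW.
  rewrite normrM -[leRHS]mulr1; apply: ler_pM => //.
  by move: tl; rewrite sE ltr_pdivrMr// => /ltW.
have mm'B l t : `|mm' l t| <= 1 + 3 / 2 * C.
  apply: (le_trans (ler_normD _ _)); apply: lerD => //.
  rewrite (_ : _ * th' l t = r^-1 * (t + - p 0 l) * g (r^-1 * (t + - p 0 l))); last first.
    by rewrite /th'; ring.
  have [tl|tl] := leP (3 / 2) `|r^-1 * (t + - p 0 l)|.
    by rewrite (g0 _ tl) mulr0 normr0 mulr_ge0// ltW.
  by rewrite normrM; apply: ler_pM => //; exact: ltW.
have D1B i x : `|D1 i x| <= 1 + 3 / 2 * C.
  apply: (le_trans (@prodfun_le _ (fun l => if l == i then 1 + 3 / 2 * C else 1) _ _)).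
    by move=> l t; case: ifP.
  rewrite (bigD1 i)//= eqxx big1 ?mulr1// => l /negbTE ->//.
have D2B i j x : i != j -> `|D2 i j x| <= 3 / 2 * C.
  move=> ij; apply: (le_trans (@prodfun_le _ (fun l => if l == j then C / r else
      if l == i then 3 / 2 * r else 1) _ _)).
    by move=> l t; case: ifP => // _; case: ifP.
  rewrite (bigD1 j)//= eqxx (bigD1 i)//= (negbTE ij) eqxx big1 ?mulr1//.
    by rewrite le_eqVlt; apply/orP; left; apply/eqP; field; rewrite rn.
  by move=> l /andP[/negbTE -> /negbTE ->].
(* The summand for [j] is [xi_j] times the rotated gradient of [h (ot j)] in the plane of [j] and
   [ot j]. Its divergence is a difference of equal mixed derivatives, and near [p] it is [xi_j]
   times the unit vector of index [j]. *)
pose k1 (k j : 'I_n) := xi 0 j * (k == j)%:R.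
pose k2 (k j : 'I_n) := - (xi 0 j * (k == ot j)%:R).
pose kappa k x := \sum_j (k1 k j * D1 (ot j) x + k2 k j * D2 (ot j) j x).
have sk k j : smooth (fun x => k1 k j * D1 (ot j) x + k2 k j * D2 (ot j) j x).
  by apply: smoothD; exact: smoothZ.
exists kappa; split.
- by move=> k; apply: smooth_bigsum.
- move=> x; rewrite (eq_bigr (fun k => \sum_j (k1 k j * partial k (D1 (ot j)) x +
    k2 k j * partial k (D2 (ot j) j) x))); last first.
    move=> k _; rewrite /kappa (partial_bigsum _ _ (sk k)); apply: eq_bigr => j _.
    by rewrite (partialD _ (smoothZ _ (sD1 _)) (smoothZ _ (sD2 _ _))) !partialZ.
  rewrite exchange_big/= big1// => j _; rewrite big_split/=.
  rewrite (bigD1 j)//= [X in _ + X + _]big1 => [|k /negbTE kj]; last by rewrite /k1 kj mulr0 mul0r.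
  rewrite [X in _ + X](bigD1 (ot j))//= [X in _ + (_ + X)]big1 => [|k /negbTE kj]; last first.
    by rewrite /k2 kj mulr0 oppr0 mul0r.
  by rewrite /k1 /k2 !eqxx pD1// pD2// !addr0; ring.
- move=> k x; apply: (le_trans (ler_norm_sum _ _ _)).
  apply: (@le_trans _ _ (\sum_(j < n) (1 + 3 * C) * enorm xi)); last first.
    by rewrite sumr_const card_ord -[leLHS]mulr_natl mulrA.
  apply: ler_sum => j _; apply: (le_trans (ler_normD _ _)).
  have xB : `|xi 0 j| <= enorm xi.
    by apply: le_trans (norm_le_enorm xi); exact: rV_coord_le.
  have k1B : `|k1 k j| <= enorm xi.
    by rewrite normrM; case: (_ == _); rewrite ?normr1 ?mulr1// normr0 mulr0 enorm_ge0.
  have k2B : `|k2 k j| <= enorm xi.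
    by rewrite normrN normrM; case: (_ == _); rewrite ?normr1 ?mulr1// normr0 mulr0 enorm_ge0.
  have := ler_pM (normr_ge0 _) (normr_ge0 _) k1B (D1B (ot j) x).
  have := ler_pM (normr_ge0 _) (normr_ge0 _) k2B (D2B (ot j) j x (Ho j)).
  rewrite !normrM; lra.
- move=> x xp k; have tx l : `|r^-1 * (x 0 l + - p 0 l)| <= 1.
    by rewrite sE ler_pdivrMr// mul1r xp.
  rewrite /kappa (eq_bigr (k1 k)); last first.
    move=> j _; rewrite (_ : D2 _ _ _ = 0); last first.
      by apply: (@prodfun0 _ _ j); rewrite eqxx /th' g1// mulr0.
    rewrite (_ : D1 _ _ = 1) ?mulr1 ?mulr0 ?addr0//.
    rewrite /D1 /prodfun big1// => l _; case: ifP => _; last exact: theta1.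
    by rewrite /mm' /th' /th theta1// g1// !mulr0 addr0.
  by rewrite (bigD1 k)//= big1 => [|j /negbTE jk]; rewrite /k1 ?eqxx ?mulr1 ?addr0// eq_sym jk mulr0.
move=> x /existsNP[l /negP]; rewrite -ltNge => xl k.
have tx : 3 / 2 <= `|r^-1 * (x 0 l + - p 0 l)| by rewrite sE ler_pdivlMr// ltW.
rewrite /kappa big1// => j _.
rewrite (_ : D1 _ _ = 0); last first.
  apply: (@prodfun0 _ _ l); case: ifP => _; last exact: theta0.
  by rewrite /mm' /th' /th theta0// g0// !mulr0 addr0.
rewrite (_ : D2 _ _ _ = 0) ?mulr0 ?addr0//.
apply: (@prodfun0 _ _ l); case: ifP => _; first by rewrite /th' g0// mulr0.
by case: ifP => _; rewrite /mm /th theta0// mulr0.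
Qed.

End solenoidal_cell.

(** * Integration by parts in the cells and off the holes *)

Section flux.
Context (R : realType) (n : nat).
Hypothesis n_ge2 : (2 <= n)%N.
Implicit Types (x y p : 'rV[R]_n) (r s q : R) (U V K S : set 'rV[R]_n)
  (w f phi : 'rV[R]_n -> R).
Local Notation L := (@leb_outer R n).
Local Notation T := (lebT R n).
Local Notation mu := (@leb R n).
Local Notation H := (@haus_outer R n n.-1).

Let n0 : 0 < n%:R :> R.
Proof. by rewrite ltr0n; lia. Qed.

Lemma divergence_mul phi (Psi : 'I_n -> 'rV[R]_n -> R) x : smooth phi -> (forall i, smooth (Psi i)) ->
  \sum_i partial i (Psi i) x = 0 ->
  \sum_i partial i (fun y => phi y * Psi i y) x = \sum_i partial i phi x * Psi i x.
Proof.
move=> sp sP dP.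
rewrite (eq_bigr (fun i => partial i phi x * Psi i x + phi x * partial i (Psi i) x)); last first.
  by move=> i _; rewrite partialM.
by rewrite big_split/= -mulr_sumr dP mulr0 addr0.
Qed.

Lemma divergence_le phi (Psi : 'I_n -> 'rV[R]_n -> R) x (C m : R) :
  (forall i x, `|partial i phi x| <= C) -> (forall i x, `|Psi i x| <= m) ->
  `|\sum_i partial i phi x * Psi i x| <= n%:R * C * m.
Proof.
move=> pC Pm; apply: (le_trans (ler_norm_sum _ _ _)).
apply: (@le_trans _ _ (\sum_(i < n) C * m)).
  by apply: ler_sum => i _; rewrite normrM; exact: ler_pM.
by rewrite sumr_const card_ord -[leLHS]mulr_natl mulrA.
Qed.

(** [field_estimate] and [cell_estimate] are combined at the same height [K * q * r] and around the
    same constant [c]. As [kappa] is divergence free, the divergence of [phi * kappa] contains only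
    derivatives of [phi], which gives the last term. *)
Lemma cell_flux : exists2 C : R, 0 < C & forall p r q Cphi W w b S phi
    (kappa : 'I_n -> 'rV[R]_n -> R), 0 < r -> 0 < q ->
  sbv_on (ball p r) w b S -> (forall i, rint mu (ball p r) (fun y => b i y ^+ 2)) ->
  (forall y, ball p r y -> `|w y| <= W) ->
  smooth phi -> (forall x, `|phi x| <= 1) -> (forall i x, `|partial i phi x| <= Cphi) ->
  (forall i, test_fun (ball p r) (kappa i)) -> (forall x, \sum_i partial i (kappa i) x = 0) ->
  (forall i x, `|kappa i x| <= q) ->
  `|\int[mu]_(x in ball p r) (\sum_i b i x * (phi x * kappa i x))| <=
    8^-1 * \int[mu]_(x in ball p r) (\sum_i b i x ^+ 2) +
    C * q ^+ 2 * r * fine (H (S `&` ball p r)) + C * Cphi * q ^+ 2 * r * fine (L (ball p r)).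
Proof.
have [C1 C1p HC1] := @cell_estimate R n n_ge2; have [C2 C2p HC2] := @field_estimate R n n_ge2.
have k0 : 0 < 16 * (36 * n%:R * C1) by exact: (mulr_gt0 _ (mulr_gt0 (mulr_gt0 _ n0) C1p)).
(* Makes [36 * n * q ^+ 2] times the coefficient [C1 / (K * q) ^+ 2] of [cell_estimate] at most
   [1 / 16]; the factor [q ^+ 2] cancels, so that [K] is independent of the field. *)
pose K := 16 * (36 * n%:R * C1) + 1.
have K1 : 1 <= K by rewrite lerDr (ltW k0).
have K0 : 0 < K by exact: lt_le_trans K1.
exists (C2 * K + 36 * n%:R * C1 + K * n%:R); first by rewrite !addr_gt0// !mulr_gt0.
move=> p r q Cphi W w b S phi kappa r0 q0 sb Ib2 wW sp p1 pC tk dk kq.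
set U := ball p r; have oU : open U by exact: ball_open.
have bU : bounded_set U := bounded_ball p r.
have mU := open_measurable_leb oU; have Ufin := bounded_leb_fin bU.
have Kq : 0 < K * q by rewrite mulr_gt0.
have [c Hc] := HC1 p r (K * q) W w b S r0 Kq sb Ib2 wW.
have lam0 : 0 < K * q * r by rewrite mulr_gt0.
have tP i : test_fun U (fun x => phi x * kappa i x).
  by under eq_fun do rewrite mulrC; exact: test_funMr.
have Pq i x : `|phi x * kappa i x| <= q.
  by rewrite normrM -[leRHS]mul1r; apply: ler_pM.
have := HC2 U w b S (fun i x => phi x * kappa i x) c (K * q * r) q oU bU sb Ib2 lam0 q0 tP Pq.
have Cp0 : 0 <= Cphi.
  exact: le_trans (normr_ge0 _) (pC (Ordinal (ltnW n_ge2)) 0).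
have [Iw Ib] := sbv_on_rint sb; have mw := rint_measurable Iw.
have D1 : `|\int[mu]_(x in U) (K * q * r * gz ((w x - c) / (K * q * r)) *
     \sum_i partial i (fun x0 => phi x0 * kappa i x0) x)| <= K * q * r * (n%:R * Cphi * q) * fine (L U).
  apply: (@Rint_bound _ T R mu U _ _ mU Ufin).
    have mQ : measurable_fun (U : set T) (fun x => (w x - c) / (K * q * r)).
      exact: (measurable_funM (measurable_funB mw (measurable_cst _)) (measurable_cst _)).
    have mg := continuous_comp_measurable mU (is_derive_continuous (@is_derive_gz R)) mQ.
    have sd : smooth (fun x => \sum_i partial i (fun x0 => phi x0 * kappa i x0) x).
      by apply: smooth_bigsum => i; apply: smooth_partial; exact: test_fun_smooth (tP i).
    exact: (measurable_funM (measurable_funM (measurable_cst _) mg) (smooth_measurable mU sd)).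
  move=> x _; rewrite normrM; apply: ler_pM => //.
    rewrite normrM (gtr0_norm lam0) ler_piMr ?(ltW lam0)//.
    by apply: (le_trans (norm_gz_half _)); rewrite invf_le1// ler1n.
  rewrite (divergence_mul sp _ (dk x)) => [|i]; last exact: test_fun_smooth (tk i).
  exact: divergence_le.
have V0 : 0 <= \int[mu]_(x in U) (\sum_i b i x ^+ 2).
  by apply: (@Rint_ge0 _ T R mu U) => y _; apply: sumr_ge0 => i _; exact: sqr_ge0.
have h0 : 0 <= fine (H (S `&` U)) by rewrite fine_ge0// outer_measure_ge0.
have l0 : 0 <= fine (L U) by rewrite fine_ge0// outer_measure_ge0.
move: Hc D1 V0 h0 l0; rewrite -/U.
move: (\int[mu]_(x in U) Theta _) (\int[mu]_(x in U) (K * q * r * _ * _))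
  (\int[mu]_(x in U) (\sum_i b i x ^+ 2)) (fine (H _)) (fine (L U)) => Th D V h l Hc D1 V0 h0 l0 X.
apply: (le_trans X).
have q2 : 0 <= 36 * n%:R * q ^+ 2 by rewrite !mulr_ge0 ?sqr_ge0 ?ltW.
have X1 := ler_wpM2l q2 Hc.
have X2 : 36 * n%:R * q ^+ 2 * (C1 / (K * q) ^+ 2 * V + C1 * r * h) <=
    16^-1 * V + 36 * n%:R * C1 * q ^+ 2 * r * h.
  have -> : 36 * n%:R * q ^+ 2 * (C1 / (K * q) ^+ 2 * V + C1 * r * h) =
     (16 * (36 * n%:R * C1) / K ^+ 2) * (16^-1 * V) + 36 * n%:R * C1 * q ^+ 2 * r * h.
    by field; rewrite !gt_eqF.
  rewrite lerD2r ler_piMl//; first by rewrite mulr_ge0.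
  rewrite ler_pdivrMr ?exprn_gt0// mul1r expr2.
  apply: (@le_trans _ _ (K * 1)); last by rewrite ler_pM2l.
  by rewrite mulr1 /K lerDl ler01.
have c3 : 0 <= C2 * K + 36 * n%:R * C1.
  by apply: ltW; apply: addr_gt0; [exact: mulr_gt0|exact: (mulr_gt0 (mulr_gt0 _ n0) C1p)].
have qr0 : 0 <= q ^+ 2 * r by rewrite mulr_ge0 ?sqr_ge0 ?(ltW r0).
have X3 : 0 <= K * n%:R * (q ^+ 2 * r) * h.
  exact: (mulr_ge0 (mulr_ge0 (mulr_ge0 (ltW K0) (ltW n0)) qr0) h0).
have X4 : 0 <= (C2 * K + 36 * n%:R * C1) * Cphi * (q ^+ 2 * r) * l.
  exact: (mulr_ge0 (mulr_ge0 (mulr_ge0 c3 Cp0) qr0) l0).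
clear -X1 X2 X3 X4 D1.
apply: (le_trans (lerD (lerD (lerD D1 (lexx _)) (lexx _)) (le_trans X1 X2))).
rewrite -subr_ge0; apply: le_trans (addr_ge0 X3 X4) _; rewrite le_eqVlt; apply/orP; left.
by apply/eqP; field.
Qed.

Lemma int_box (N : nat) : exists D : seq 'rV[int]_n, uniq D /\
  forall z : 'rV[int]_n, (forall j, `|z 0 j| <= N%:Z) -> z \in D.
Proof.
pose F (f : {ffun 'I_n -> 'I_(N + N).+1}) : 'rV[int]_n := \row_j ((f j : nat)%:Z - N%:Z).
exists (undup (map F (enum {: {ffun 'I_n -> 'I_(N + N).+1}}))).
split=> [|z zN]; first exact: undup_uniq.
rewrite mem_undup; apply/mapP; exists [ffun j => inord (absz (z 0 j + N%:Z))].
  by rewrite mem_enum.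
apply/rowP => j; rewrite mxE ffunE; move: (z 0 j) (zN j) => t.
rewrite ler_norml => /andP[h1 h2]; rewrite inordK; first by lia.
lia.
Qed.

Lemma Rint_disjoint_sum (I : eqType) (D : seq I) (O : I -> set 'rV[R]_n) U f : uniq D ->
  measurable (U : set T) -> rint mu U f -> (forall x, U x -> 0 <= f x) ->
  (forall i, i \in D -> measurable (O i : set T) /\ O i `<=` U) ->
  (forall i j x, i \in D -> j \in D -> i != j -> O i x -> ~ O j x) ->
  \sum_(i <- D) \int[mu]_(x in O i) f x <= \int[mu]_(x in U) f x.
Proof.
move=> uD mU If f0 OU dis.
pose B (E : seq I) := [set x : 'rV[R]_n | exists2 i, i \in E & O i x].
suff [mB ->] : measurable (B D : set T) /\ \sum_(i <- D) \int[mu]_(x in O i) f x = \int[mu]_(x in B D) f x.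
  apply: (Rint_sub mU mB _ If f0) => x [i iD Oi]; exact: (OU i iD).2.
elim: D uD OU dis => [|i D IH] /=.
  have -> : B [::] = set0 by apply/seteqP; split=> x // [].
  by rewrite big_nil Rintegral_set0; split=> //; exact: measurable0.
move=> /andP[iD uD] OU dis.
have [||mB E] := IH uD.
- by move=> j jD; apply: OU; rewrite inE jD orbT.
- by move=> j k x jD kD; apply: dis; rewrite inE ?jD ?kD orbT.
have [mi iU] := OU i (mem_head _ _).
have BE : B (i :: D) = O i `|` B D.
  apply/seteqP; split=> x.
    by move=> [j]; rewrite inE => /predU1P[->|jD] Oj; [left|right; exists j].
  by move=> [Oi|[j jD Oj]]; [exists i; rewrite ?mem_head|exists j; rewrite ?inE ?jD ?orbT].
have mBi : measurable (B (i :: D) : set T) by rewrite BE; exact: measurableU.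
split=> //; rewrite big_cons E BE; symmetry; apply: Rint_setU => //.
  apply/seteqP; split=> x // -[Oi [j jD Oj]].
  apply: (dis i j x _ _ _ Oi Oj); rewrite ?mem_head// ?inE ?jD ?orbT//.
  by apply: contraNneq iD => ->.
rewrite -BE; apply: (rint_sub mU mBi _ If) => x [j jD Oj]; exact: (OU j jD).2.
Qed.

Definition cell_center (e : R) (z : 'rV[int]_n) : 'rV[R]_n := e *: map_mx intr z.

Lemma cell_center_far e z z' x y : 0 < e -> z != z' ->
  ball (cell_center e z) (7 / 16 * e) x -> ball (cell_center e z') (7 / 16 * e) y ->
  e / 16 < enorm (x - y).
Proof.
move=> e0 zz' /ball_rVP[_ zx] /ball_rVP[_ zy].
have /existsP[j zj] : [exists j, z 0 j != z' 0 j].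
  apply: contraNT zz' => /existsPn H; apply/eqP/rowP => j; apply/eqP.
  by have := H j; rewrite negbK.
have := zx j; have := zy j; rewrite !mxE.
have d1 : e <= `|e * (z 0 j)%:~R - e * (z' 0 j)%:~R|.
  rewrite -mulrBr normrM (gtr0_norm e0) ler_peMr ?(ltW e0)// -intrB -intr_norm.
  by rewrite -[1]/(1%:~R) ler_int -gtz0_ge1 normr_gt0 subr_eq0.
move=> y1 x1; apply: lt_le_trans (norm_le_enorm _); apply: lt_le_trans (rV_coord_le _ j).
rewrite !mxE.
have := ler_distD (x 0 j) (e * (z 0 j)%:~R) (e * (z' 0 j)%:~R).
have := ler_distD (y 0 j) (x 0 j) (e * (z' 0 j)%:~R).
have := distrC (y 0 j) (e * (z' 0 j)%:~R).
move: d1 y1 x1.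
move: (`|e * (z 0 j)%:~R - e * (z' 0 j)%:~R|) (`|e * (z 0 j)%:~R - x 0 j|)
  (`|e * (z' 0 j)%:~R - y 0 j|) (`|y 0 j - e * (z' 0 j)%:~R|) (`|x 0 j - e * (z' 0 j)%:~R|)
  (`|x 0 j - y 0 j|) => t1 t2 t3 t4 t5 t6.
by clear -e0; lra.
Qed.

(** Only the cells contained in the domain are modified. Holes closer to the boundary are kept off
    by the support of [phi]. *)
Lemma cells_in_ball e x0 r0 : 0 < e -> exists D : seq 'rV[int]_n, uniq D /\
  forall z, z \in D <-> ball (cell_center e z) (7 / 16 * e) `<=` ball x0 r0.
Proof.
move=> e0; have e7 : 0 < 7 / 16 * e by rewrite mulr_gt0.
pose M := (`|x0| + `|r0|) / e; have M0 : 0 <= M by rewrite divr_ge0 ?addr_ge0// ltW.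
pose N := (Num.truncn M).+1; have [D [uD HD]] := int_box N.
exists [seq z <- D | `[< ball (cell_center e z) (7 / 16 * e) `<=` ball x0 r0 >]].
split=> [|z]; first exact: filter_uniq.
rewrite mem_filter; split=> [/andP[/asboolP]//|zU].
rewrite (introT (asboolP _) zU) HD// => j.
have /zU/ball_rVP[_ /(_ j)] := @ballxx _ _ (cell_center e z) _ e7.
rewrite !mxE => zj.
have h1 : e * `|(z 0 j)%:~R| < e * N%:R :> R.
  rewrite -[e in e * `|_|](gtr0_norm e0) -normrM.
  apply: (@lt_le_trans _ _ (e * M)); last first.
    by rewrite ler_pM2l// ltW// /N; have /andP[] := Num.Theory.truncn_itv M0.
  rewrite /M mulrCA divff ?gt_eqF// mulr1.
  have := ler_distD (x0 0 j) (e * (z 0 j)%:~R) 0; rewrite !subr0 distrC.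
  have := rV_coord_le x0 j; have := ler_norm r0; move: zj.
  move: (`|x0 0 j - e * (z 0 j)%:~R|) (`|e * (z 0 j)%:~R|) (`|r0|) (`|x0 0 j|) (`|x0|) => t1 t2 t3 t4 t5.
  by clear; lra.
move: h1; rewrite ltr_pM2l// -intr_norm -[N%:R]/((N%:Z)%:~R) ltr_int; exact: ltW.
Qed.

(** The coefficient [3 / 16] is [1 / 16] from the field avoiding the holes plus [1 / 8] from the
    cells. It has to be at most [1 / 4] in order to be absorbed in [energy_lower], where this
    integral enters twice. *)
Lemma flux_estimate : exists2 C : R, 0 < C & forall x0 r0 K phi Cphi W e delta (xi : 'rV[R]_n) w b S,
    0 < e -> 0 < delta -> 0 < enorm xi ->
  smooth phi -> compact K -> (forall x, ~ K x -> phi x = 0) -> (forall x, K x -> ball x e `<=` ball x0 r0) ->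
  (forall x, `|phi x| <= 1) -> (forall i x, `|partial i phi x| <= Cphi) ->
  sbv_on (ball x0 r0) w b S -> (forall i, rint mu (ball x0 r0) (fun y => b i y ^+ 2)) ->
  (forall y, ball x0 r0 y -> `|w y| <= W) ->
  `|\int[mu]_(x in ball x0 r0) (\sum_i b i x * (phi x * xi 0 i))| <=
    3 / 16 * \int[mu]_(x in ball x0 r0) (\sum_i b i x ^+ 2) +
    C * delta * enorm xi * fine (H (S `&` (ball x0 r0 `&` dilation e (@perforated R n)))) +
    C * enorm xi ^+ 2 * e * fine (H (S `&` ball x0 r0)) +
    C * (Cphi * enorm xi + enorm xi ^+ 2 / delta) *
      \int[mu]_(x in ball x0 r0 `&` dilation e (@perforated R n)) `|w x| +
    C * Cphi * enorm xi ^+ 2 * e * fine (L (ball x0 r0)).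
Proof.
have [A A0 HA] := @solenoidal_cutoff R n n_ge2.
have [C1 C1p HC1] := cell_flux; have [C2 C2p HC2] := @field_estimate R n n_ge2.
exists (C1 * A ^+ 2 + (C2 + n%:R + 36 * n%:R * (1 + A)) * (1 + A)).
  have A1 : 0 < 1 + A by rewrite addr_gt0.
  apply: addr_gt0; first exact: (mulr_gt0 C1p (exprn_gt0 _ A0)).
  apply: mulr_gt0 => //; apply: addr_gt0; first exact: addr_gt0.
  exact: (mulr_gt0 (mulr_gt0 _ n0) A1).
move=> x0 r0 K phi Cphi W e delta xi w b S e0 d0 q0 sp cK K0 KU p1 pC sb Ib2 wW.
set q := enorm xi in q0 *; set U := ball x0 r0 in KU sb Ib2 wW *.
set U' := U `&` _; set I := \int[mu]_(x in U') `|w x|.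
have oU : open U by exact: ball_open.
have bU : bounded_set U := bounded_ball x0 r0.
have oU' : open U' by apply: openI => //; exact: open_perforated.
have U'U : U' `<=` U by move=> x [].
have bU' : bounded_set U' := bounded_setS U'U bU.
have mU := open_measurable_leb oU; have Ufin := bounded_leb_fin bU.
have mU' := open_measurable_leb oU'.
have [D [uD HD]] := @cells_in_ball e x0 r0 e0.
(* The holes have half-side [e / 4 < 9 / 32 e], the fields [kap z] live in cubes of
   half-side [3 / 2 * (9 / 32) e < 7 / 16 e], and the cells of half-side [7 / 16 e]
   around distinct holes are at distance [e / 8]. *)
have re : 0 < 9 / 32 * e by rewrite mulr_gt0.
have rO : 0 < 7 / 16 * e by rewrite mulr_gt0.
have /choice[kap Hkap] z := HA (cell_center e z) (9 / 32 * e) xi re.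
pose O z := ball (cell_center e z) (7 / 16 * e).
have oO z : open (O z) by exact: ball_open.
have kO z k x : ~ O z x -> kap z k x = 0.
  move=> nO; have [_ _ _ _] := Hkap z; apply => xc; apply: nO.
  by apply: (ccube_ball _ _ xc); lra.
have sk z k : smooth (kap z k) by have [] := Hkap z.
have tk z k : test_fun (O z) (kap z k).
  split=> //; exists (ccube (cell_center e z) (3 / 2 * (9 / 32 * e))); split.
  - exact: compact_ccube.
  - by apply: ccube_ball; lra.
  - by move=> x nx; have [_ _ _ _] := Hkap z; apply.
have disO z z' x : z != z' -> O z x -> ~ O z' x.
  move=> zz' Oz Oz'; have := cell_center_far e0 zz' Oz Oz'; rewrite subrr.
  by rewrite /enorm /dot big1 ?sqrtr0 => [|i _]; rewrite ?mxE ?mul0r// ltNge divr_ge0// ltW.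
have OU z : z \in D -> O z `<=` U by move=> /HD.
pose sig k x := \sum_(z <- D) kap z k x.
have sigO z k x : z \in D -> O z x -> sig k x = kap z k x.
  move=> zD Oz; rewrite /sig (bigD1_seq z)//= big1 ?addr0// => z' z'z.
  by apply: kO => Oz'; exact: disO z'z Oz' Oz.
have sigB k x : `|sig k x| <= A * q.
  have [[z zD Oz]|nO] := pselect (exists2 z, z \in D & O z x).
    by rewrite (sigO z)//; have [_ _ + _ _] := Hkap z; apply.
  rewrite /sig big_seq big1 ?normr0 ?mulr_ge0 ?ltW// => z zD.
  by apply: kO => Oz; apply: nO; exists z.
pose zeta k x := xi 0 k + -1 * sig k x.
have ssig k : smooth (sig k) by exact: smooth_bigsum.
have szeta k : smooth (zeta k) by apply: smoothD; [exact: smooth_cst|exact: smoothZ].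
have dzeta x : \sum_k partial k (zeta k) x = 0.
  rewrite (eq_bigr (fun k => - \sum_(z <- D) partial k (kap z k) x)); last first.
    move=> k _; rewrite (partialD _ (smooth_cst _) (smoothZ _ (ssig k))) partial_cst.
    by rewrite (partialZ _ _ (ssig k)) add0r mulN1r (partial_bigsum _ _ (sk ^~ k)).
  rewrite sumrN exchange_big/= big1 ?oppr0// => z _; by have [_ -> _ _ _] := Hkap z.
pose m := (1 + A) * q; have m0 : 0 < m by rewrite mulr_gt0// addr_gt0.
have zetaB k x : `|zeta k x| <= m.
  apply: (le_trans (ler_normD _ _)); rewrite mulN1r normrN /m mulrDl mul1r; apply: lerD => //.
  by apply: le_trans (norm_le_enorm xi); exact: rV_coord_le.
(* The test functions must be compactly supported in the perforated set. Each component of [zeta]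
   vanishes on open cubes slightly larger than the holes, so these cubes can be removed from [K]. *)
have tpz k : test_fun U' (fun x => phi x * zeta k x).
  split; first exact: smoothM.
  exists (K `&` ~` \bigcup_(z in [set` D]) ball (cell_center e z) (9 / 32 * e)); split.
  - apply: compact_closedI => //; apply: open_closedC.
    by apply: bigcup_open => z _; exact: ball_open.
  - move=> x [Kx nx]; split; first exact: (KU x Kx _ (ballxx x e0)).
    (* A hole meeting [K] at [x] has its cell inside [ball x e], because [e / 4 + 7 / 16 * e < e];
       hence it is one of the holes listed in [D]. *)
    apply: contrapT => /(not_perforated e0)[z Hz]; apply: nx; exists z => /=.
      apply/HD => y /ball_rVP[_ zy]; apply: (KU x Kx); apply/ball_rVP; split=> // j.
      have := ler_distD (e * (z 0 j)%:~R) (x 0 j) (y 0 j).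
      have := Hz j; have := zy j; rewrite !mxE.
      move: (`|x 0 j - y 0 j|) (`|x 0 j - e * (z 0 j)%:~R|) (`|e * (z 0 j)%:~R - y 0 j|) => t1 t2 t3.
      by clear -e0; lra.
    apply/ball_rVP; split=> // j; rewrite !mxE distrC; apply: (le_lt_trans (Hz j)).
    by clear -e0; lra.
  move=> x /not_andP[/K0->|]; first by rewrite mul0r.
  move=> /contrapT[z /= zD zx].
  have xc : ccube (cell_center e z) (9 / 32 * e) x by exact: ball_ccube.
  have Oz : O z x by apply: (ccube_ball _ _ xc); lra.
  have [_ _ _ + _] := Hkap z => /(_ x xc k) kx.
  by rewrite /zeta (sigO z)// kx mulN1r subrr mulr0.
have pzB k x : `|phi x * zeta k x| <= m by rewrite normrM -[leRHS]mul1r; exact: ler_pM.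
have sb' : sbv_on U' w b S by exact: (sbv_on_sub oU oU' U'U sb).
have Ib2' k : rint mu U' (fun y => b k y ^+ 2) by exact: (rint_sub mU mU' U'U (Ib2 k)).
have [Iw Ib] := sbv_on_rint sb; have [Iw' Ib'] := sbv_on_rint sb'.
have n1 : (0 < n)%N := ltnW n_ge2.
have Cp0 : 0 <= Cphi by exact: le_trans (normr_ge0 _) (pC (Ordinal n1) 0).
pose V := \int[mu]_(x in U) (\sum_i b i x ^+ 2).
have IV : rint mu U (fun x => \sum_i b i x ^+ 2) by exact: rint_sum.
have V0 x : U x -> 0 <= \sum_i b i x ^+ 2 by move=> _; apply: sumr_ge0 => i _; exact: sqr_ge0.
have I0 : 0 <= I by apply: (@Rint_ge0 _ T R mu U').
have mw' := rint_measurable Iw'.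
have mQ : measurable_fun (U' : set T) (fun x => (w x - 0) / delta).
  exact: (measurable_funM (measurable_funB mw' (measurable_cst _)) (measurable_cst _)).
have partz : `|\int[mu]_(x in U) (\sum_i b i x * (phi x * zeta i x))| <=
    16^-1 * V + C2 * delta * m * fine (H (S `&` U')) + (n%:R * Cphi * m + 36 * n%:R * m ^+ 2 / delta) * I.
  have -> : \int[mu]_(x in U) (\sum_i b i x * (phi x * zeta i x)) =
      \int[mu]_(x in U') (\sum_i b i x * (phi x * zeta i x)).
    apply: (@Rint_support _ T R mu U U' _ U'U) => x _ nx; rewrite big1// => i _.
    have [_ [K' [_ K'U K'0]]] := tpz i.
    by rewrite K'0 ?mulr0// => /K'U.
  have := HC2 U' w b S (fun i x => phi x * zeta i x) 0 delta m oU' bU' sb' Ib2' d0 m0 tpz pzB.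
  (* Here and in [E2] the linear bounds [|gz s| <= |s|] and [Theta s <= |s|] are used with [c = 0]:
     off the holes [w] tends to 0 in L1 along the sequence. *)
  have E1 : `|\int[mu]_(x in U') (delta * gz ((w x - 0) / delta) *
      \sum_i partial i (fun y => phi y * zeta i y) x)| <= n%:R * Cphi * m * I.
    have mg := continuous_comp_measurable mU' (is_derive_continuous (@is_derive_gz R)) mQ.
    have sd : smooth (fun x => \sum_i partial i (fun y => phi y * zeta i y) x).
      by apply: smooth_bigsum => i; apply: smooth_partial; exact: smoothM.
    have md := measurable_funM (measurable_funM (measurable_cst delta) mg) (smooth_measurable mU' sd).
    have bd x : U' x -> `|delta * gz ((w x - 0) / delta) * \sum_i partial i (fun y => phi y * zeta i y) x| <=
        n%:R * Cphi * m * `|w x|.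
      move=> _; rewrite mulrC normrM; apply: ler_pM => //.
        by rewrite (divergence_mul sp szeta (dzeta x)); exact: divergence_le.
      rewrite normrM (gtr0_norm d0); apply: (le_trans (ler_wpM2l (ltW d0) (norm_gz_le _))).
      by rewrite subr0 normrM (gtr0_norm (_ : 0 < delta^-1)) ?invr_gt0// mulrCA divff ?mulr1// gt_eqF.
    have Iw1 := rintZ (n%:R * Cphi * m) mU' (rint_norm mU' Iw').
    rewrite /I -(RintegralZl _ mU' (rint_norm mU' Iw')).
    exact: (Rint_norm_le mU' (rint_le mU' md Iw1 bd) Iw1 bd).
  have E2 : \int[mu]_(x in U') Theta ((w x - 0) / delta) <= delta^-1 * I.
    have mg := continuous_comp_measurable mU' (is_derive_continuous (@is_derive_gs R)) mQ.
    have Ig : rint mu U' (fun x => Theta ((w x - 0) / delta)).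
      have U'fin := bounded_leb_fin bU'.
      have Igs : rint mu U' (fun x => gs ((w x - 0) / delta)).
        by apply: (@rint_bounded _ T R mu U' _ 1 mU' U'fin mg) => y _; rewrite norm_gs Theta_le1.
      by apply: (rint_eq mU' _ (rint_norm mU' Igs)) => y _; exact: norm_gs.
    rewrite /I -(RintegralZl _ mU' (rint_norm mU' Iw')).
    apply: (le_Rintegral mU' Ig (rintZ _ mU' (rint_norm mU' Iw'))) => x _.
    apply: (le_trans (Theta_le_norm _)).
    by rewrite subr0 normrM (gtr0_norm (_ : 0 < delta^-1)) ?invr_gt0// mulrC.
  have E3 : \int[mu]_(x in U') (\sum_i b i x ^+ 2) <= V by exact: (Rint_sub mU mU' U'U IV V0).
  have c36 : 0 <= 36 * n%:R * m ^+ 2 by exact: (mulr_ge0 (ltW (mulr_gt0 _ n0)) (sqr_ge0 m)).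
  move=> X; apply: (le_trans X).
  have X3 := ler_wpM2l c36 E2.
  have X2 : 16^-1 * \int[mu]_(x in U') (\sum_i b i x ^+ 2) <= 16^-1 * V by rewrite ler_pM2l.
  apply: (le_trans (lerD (lerD (lerD E1 (lexx _)) X2) X3)).
  by rewrite le_eqVlt; apply/orP; left; apply/eqP; field; rewrite gt_eqF.
have partk : `|\int[mu]_(x in U) (\sum_i b i x * (phi x * sig i x))| <=
    8^-1 * V + C1 * (A * q) ^+ 2 * e * fine (H (S `&` U)) + C1 * Cphi * (A * q) ^+ 2 * e * fine (L U).
  have Aq0 : 0 < A * q by exact: mulr_gt0.
  have Ik z i : rint mu U (fun x => b i x * (phi x * kap z i x)).
    have Ip := rintM_test mU (Ib i) (test_funMr (tk z i) sp).
    by apply: (rint_eq mU _ Ip) => x _; rewrite [phi x * _]mulrC.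
  have Ikk z : rint mu U (fun x => \sum_i b i x * (phi x * kap z i x)) by exact: (rint_sum _ mU (Ik z)).
  have -> : \int[mu]_(x in U) (\sum_i b i x * (phi x * sig i x)) =
      \sum_(z <- D) \int[mu]_(x in O z) (\sum_i b i x * (phi x * kap z i x)).
    transitivity (\int[mu]_(x in U) (\sum_(z <- D) \sum_i b i x * (phi x * kap z i x))).
      apply: (@Rint_eq _ T R mu U) => x _; rewrite exchange_big/=; apply: eq_bigr => i _.
      by rewrite /sig mulr_sumr mulr_sumr.
    rewrite (Rint_sum _ mU Ikk) big_seq [RHS]big_seq; apply: eq_bigr => z zD.
    apply: (@Rint_support _ T R mu U (O z) _ (OU z zD)) => x _ nx; rewrite big1// => i _.
    by rewrite kO// !mulr0.
  have cell z : z \in D -> `|\int[mu]_(x in O z) (\sum_i b i x * (phi x * kap z i x))| <=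
      8^-1 * \int[mu]_(x in O z) (\sum_i b i x ^+ 2) + C1 * (A * q) ^+ 2 * e * fine (H (S `&` O z)) +
      C1 * Cphi * (A * q) ^+ 2 * e * fine (L (O z)).
    move=> zD; have sbO := sbv_on_sub oU (oO z) (OU z zD) sb.
    have mO := open_measurable_leb (oO z).
    have Ib2O i : rint mu (O z) (fun y => b i y ^+ 2) by exact: (rint_sub mU mO (OU z zD) (Ib2 i)).
    have wO y : O z y -> `|w y| <= W by move=> /(OU z zD); exact: wW.
    have [_ dk kB _ _] := Hkap z.
    have := HC1 (cell_center e z) (7 / 16 * e) (A * q) Cphi W w b S phi (kap z) rO Aq0 sbO Ib2O wO
      sp p1 pC (tk z) dk kB.
    have c1 : 0 <= C1 * (A * q) ^+ 2 * fine (H (S `&` O z)).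
      apply: mulr_ge0; first exact: (mulr_ge0 (ltW C1p) (sqr_ge0 _)).
      by rewrite fine_ge0// outer_measure_ge0.
    have c2 : 0 <= C1 * Cphi * (A * q) ^+ 2 * fine (L (O z)).
      apply: mulr_ge0; first exact: (mulr_ge0 (mulr_ge0 (ltW C1p) Cp0) (sqr_ge0 _)).
      by rewrite fine_ge0// outer_measure_ge0.
    have c1e := mulr_ge0 c1 (ltW e0); have c2e := mulr_ge0 c2 (ltW e0).
    move=> X; apply: (le_trans X); rewrite -/(O z) -subr_ge0.
    apply: (le_trans (addr_ge0 (mulr_ge0 (ltW (_ : 0 < 9 / 16)) c1e) (mulr_ge0 (ltW (_ : 0 < 9 / 16)) c2e))) => //.
    by rewrite le_eqVlt; apply/orP; left; apply/eqP; field.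
  apply: (le_trans (ler_norm_sum _ _ _)); rewrite big_seq.
  apply: (le_trans (ler_sum _ cell)); rewrite -big_seq !big_split/= -!mulr_sumr.
  have OD z : z \in D -> measurable (O z : set T) /\ O z `<=` U.
    by move=> zD; split; [exact: open_measurable_leb|exact: OU].
  have S1 : \sum_(z <- D) \int[mu]_(x in O z) (\sum_i b i x ^+ 2) <= V.
    exact: (Rint_disjoint_sum uD mU IV V0 OD (fun z z' x _ _ => @disO z z' x)).
  have S2 : \sum_(z <- D) fine (L (O z)) <= fine (L U).
    have I1 : rint mu U (fun=> 1) by exact: (@rint_bounded _ T R mu U _ `|1| mU Ufin).
    have := Rint_disjoint_sum uD mU I1 (fun _ _ => ler01) OD (fun z z' x _ _ => @disO z z' x).
    rewrite Rintegral_cst// mul1r; apply: le_trans; rewrite big_seq [leRHS]big_seq.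
    by apply: ler_sum => z /OD[mO _]; rewrite Rintegral_cst// mul1r.
  have [_ [_ _ HUfin]] := sb.
  have HOfin z : z \in D -> (H (S `&` O z) \is a fin_num)%E.
    move=> zD; rewrite ge0_fin_numE ?outer_measure_ge0//.
    by apply: le_lt_trans HUfin; apply: le_outer_measure; apply: setIS; exact: OU.
  have S3 : \sum_(z <- D) fine (H (S `&` O z)) <= fine (H (S `&` U)).
    rewrite -lee_fin fineK ?ge0_fin_numE ?outer_measure_ge0// -sumEFin big_seq.
    rewrite (eq_bigr (fun z => H (S `&` O z))); last by move=> z zD; rewrite fineK// HOfin.
    rewrite -big_seq; apply: (@haus_separated_sum R n n.-1 _ D (fun z => S `&` O z) (e / 16)) => //.
    - by rewrite divr_gt0.
    - by move=> z z' x y _ _ zz' [_ Ox] [_ Oy]; exact: cell_center_far zz' Ox Oy.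
    - by move=> z zD; apply: setIS; exact: OU.
  apply: lerD; [apply: lerD|]; apply: ler_wpM2l => //.
    exact: (mulr_ge0 (mulr_ge0 (ltW C1p) (sqr_ge0 _)) (ltW e0)).
  exact: (mulr_ge0 (mulr_ge0 (mulr_ge0 (ltW C1p) Cp0) (sqr_ge0 _)) (ltW e0)).
have split_xi : \int[mu]_(x in U) (\sum_i b i x * (phi x * xi 0 i)) =
    \int[mu]_(x in U) (\sum_i b i x * (phi x * zeta i x)) + \int[mu]_(x in U) (\sum_i b i x * (phi x * sig i x)).
  have Iz i : rint mu U (fun x => b i x * (phi x * zeta i x)).
    exact: (rintM_test mU (Ib i) (test_fun_sub U'U (tpz i))).
  have tU : test_fun U phi by split=> //; exists K; split=> // x Kx; exact: (KU x Kx _ (ballxx x e0)).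
  have Is i : rint mu U (fun x => b i x * (phi x * sig i x)).
    exact: (rintM_test mU (Ib i) (test_funMr tU (ssig i))).
  rewrite -(RintegralD mU (rint_sum _ mU Iz) (rint_sum _ mU Is)).
  apply: (@Rint_eq _ T R mu U) => x _; rewrite -big_split/=; apply: eq_bigr => i _.
  by rewrite /zeta; ring.
rewrite split_xi; apply: (le_trans (ler_normD _ _)); apply: (le_trans (lerD partz partk)).
have h0 : 0 <= fine (H (S `&` U)) by rewrite fine_ge0// outer_measure_ge0.
have h0' : 0 <= fine (H (S `&` U')) by rewrite fine_ge0// outer_measure_ge0.
have l0 : 0 <= fine (L U) by rewrite fine_ge0// outer_measure_ge0.
rewrite -/V /m; clear partz partk split_xi; move: V (fine (H (S `&` U))) (fine (H (S `&` U'))) (fine (L U)) I I0 h0 h0' l0 => v h h' l i i0 h0 h0' l0.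
clear -v h h' l i i0 h0 h0' l0 A0 C1p C2p n0 d0 q0 e0 Cp0.
have A1 : 0 <= 1 + A by rewrite addr_ge0// ltW.
have N0 := ltW n0; have [a0 c10 c20 dd0 qq0] := And5 (ltW A0) (ltW C1p) (ltW C2p) (ltW d0) (ltW q0).
have ee0 := ltW e0; have di0 : 0 <= delta^-1 by rewrite invr_ge0.
have a2 : 0 <= A ^+ 2 by exact: sqr_ge0.
have q2 : 0 <= q ^+ 2 by exact: sqr_ge0.
have T1 : 0 <= C1 * A ^+ 2 by exact: mulr_ge0.
have T2 : 0 <= C2 * (1 + A) by exact: mulr_ge0.
have T3 : 0 <= n%:R * (1 + A) by exact: mulr_ge0.
have T4 : 0 <= 36 * n%:R * (1 + A) ^+ 2 by exact: (mulr_ge0 (mulr_ge0 _ N0) (sqr_ge0 _)).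
have -> : C1 * A ^+ 2 + (C2 + n%:R + 36 * n%:R * (1 + A)) * (1 + A) =
  C1 * A ^+ 2 + C2 * (1 + A) + n%:R * (1 + A) + 36 * n%:R * (1 + A) ^+ 2 by ring.
have Y1 := mulr_ge0 (mulr_ge0 dd0 qq0) h0'.
have Y2 := mulr_ge0 (mulr_ge0 q2 ee0) h0.
have Y3 := mulr_ge0 (mulr_ge0 Cp0 qq0) i0.
have Y4 := mulr_ge0 (mulr_ge0 q2 di0) i0.
have Y5 := mulr_ge0 (mulr_ge0 (mulr_ge0 Cp0 q2) ee0) l0.
rewrite -subr_ge0.
set c1 := C1 * A ^+ 2 in T1 *; set c2 := C2 * (1 + A) in T2 *; set c3 := n%:R * (1 + A) in T3 *.
set c4 := 36 * n%:R * (1 + A) ^+ 2 in T4 *.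
have -> : 3 / 16 * v + (c1 + c2 + c3 + c4) * delta * q * h' + (c1 + c2 + c3 + c4) * q ^+ 2 * e * h +
    (c1 + c2 + c3 + c4) * (Cphi * q + q ^+ 2 / delta) * i + (c1 + c2 + c3 + c4) * Cphi * q ^+ 2 * e * l -
    (16^-1 * v + C2 * delta * ((1 + A) * q) * h' +
      (n%:R * Cphi * ((1 + A) * q) + 36 * n%:R * ((1 + A) * q) ^+ 2 / delta) * i +
     (8^-1 * v + C1 * (A * q) ^+ 2 * e * h + C1 * Cphi * (A * q) ^+ 2 * e * l)) =
   (c1 + c3 + c4) * (delta * q * h') + (c2 + c3 + c4) * (q ^+ 2 * e * h) +
   (c1 + c2 + c4) * (Cphi * q * i) + (c1 + c2 + c3) * (q ^+ 2 / delta * i) +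
   (c2 + c3 + c4) * (Cphi * q ^+ 2 * e * l).
  by rewrite /c1 /c2 /c3 /c4; field; rewrite gt_eqF.
have P3 (s t u : R) : 0 <= s -> 0 <= t -> 0 <= u -> 0 <= s + t + u.
  by move=> s0 t0 u0; exact: (addr_ge0 (addr_ge0 s0 t0) u0).
exact: (addr_ge0 (addr_ge0 (addr_ge0 (addr_ge0 (mulr_ge0 (P3 _ _ _ T1 T3 T4) Y1)
  (mulr_ge0 (P3 _ _ _ T2 T3 T4) Y2)) (mulr_ge0 (P3 _ _ _ T1 T2 T4) Y3))
  (mulr_ge0 (P3 _ _ _ T1 T2 T3) Y4)) (mulr_ge0 (P3 _ _ _ T2 T3 T4) Y5)).
Qed.

End flux.

(** * Affine functions and the lower bound of the energy *)

Section affine.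
Context (R : realType) (n : nat).
Hypothesis n_gt0 : (0 < n)%N.
Implicit Types (x y xi : 'rV[R]_n) (U : set 'rV[R]_n) (u f phi : 'rV[R]_n -> R).
Local Notation L := (@leb_outer R n).
Local Notation T := (lebT R n).
Local Notation Bo := (borelT 'rV[R]_n).
Local Notation mu := (@leb R n).
Local Notation lb := (@leb_borel R n).

(** Connects the integral against a multiple of Lebesgue measure on Borel sets, as it occurs in
    distributional derivatives, with integrals over [U] in the Lebesgue sigma-algebra. *)
Lemma Rint_leb_restr U (mU : measurable (U : set Bo)) (Ufin : (lb U < +oo)%E) (k : {nonneg R}) f (M : R) :
  measurable_fun [set: Bo] f -> (forall x, 0 <= f x <= M) ->
  \int[mscale k (mfrestr mU Ufin)]_x f x = k%:num * \int[mu]_(x in U) f x.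
Proof.
move=> mf f0M; pose m := mfrestr mU Ufin.
have f0 x : 0 <= f x by have /andP[] := f0M x.
have fM x : `|f x| <= M by rewrite ger0_norm//; have /andP[] := f0M x.
have mfE : measurable_fun [set: Bo] (fun x => (f x)%:E) by exact/measurable_EFinP.
have mTU := borel_measurable_leb mU.
have IU : rint mu U f.
  apply: (@rint_bounded _ T R mu U f M mTU Ufin) => // _ B mB.
  by apply: measurableI => //; apply: borel_measurable_leb; rewrite -[_ @^-1` _]setTI; exact: mf.
rewrite /Rintegral ge0_integral_mscale//=; last by move=> x _; rewrite lee_fin.
have Im : m.-integrable setT (fun x => (f x)%:E).
  by apply: (rint_finite _ mf fM); rewrite /m/= /mfrestr /mrestr setTI.
have -> : (\int[m]_x (f x)%:E = \int[mu]_(x in U) (f x)%:E)%E.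
  have mC : m (~` U) = 0%E by rewrite /m/= /mfrestr /mrestr setICl measure0.
  rewrite (negligible_integral (measurableC mU) measurableT Im mC) setDE setTI setCK.
  transitivity (\int[lb]_(x in U) (f x)%:E)%E.
    by apply: eq_measure_integral => A mA AU; rewrite /m/= /mfrestr /mrestr setIidl.
  rewrite integral_mkcond [RHS]integral_mkcond.
  pose g := ((fun x => (f x)%:E) \_ U)%E.
  have mg : measurable_fun [set: Bo] g.
    have mfU : measurable_fun (U : set Bo) (fun x => (f x)%:E) by exact: measurable_funTS.
    by apply/(measurable_restrictT _ mU).
  suff Ig : lb.-integrable setT g by have [_ ->] := integral_leb_borel mg Ig.
  apply/(integrable_mkcond _ mU).
  have mfU : measurable_fun (U : set Bo) f by exact: measurable_funTS.
  exact: (@rint_bounded _ Bo R lb U f M mU Ufin mfU (fun x _ => fM x)).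
by rewrite -(Rint_EFin mTU IU).
Qed.

Lemma Rint_leb_restr_bounded U (mU : measurable (U : set Bo)) (Ufin : (lb U < +oo)%E)
    (k : {nonneg R}) f (M : R) : measurable_fun [set: Bo] f -> (forall x, `|f x| <= M) ->
  \int[mscale k (mfrestr mU Ufin)]_x f x = k%:num * \int[mu]_(x in U) f x.
Proof.
move=> mf fM; pose m := mscale k (mfrestr mU Ufin); have mTU := borel_measurable_leb mU.
have mfin : (m setT < +oo)%E.
  by rewrite /m /mscale/= /mfrestr /mrestr setTI lte_mul_pinfty// ?lee_fin.
have M0 : 0 <= M by exact: le_trans (normr_ge0 _) (fM 0).
pose g x := f x + M.
have mg : measurable_fun [set: Bo] g by exact: (measurable_funD mf (measurable_cst _)).
have g0 x : 0 <= g x <= M + M.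
  by have := fM x; rewrite ler_norml /g => /andP[h1 h2]; apply/andP; split; lra.
have gM x : `|g x| <= M + M by have /andP[h1 h2] := g0 x; rewrite ger0_norm.
have mM : measurable_fun [set: Bo] (fun=> M : R) by exact: measurable_cst.
have c0 (x : Bo) : 0 <= M <= M by rewrite M0 lexx.
have cM (x : Bo) : `|M| <= M by rewrite ger0_norm.
have Ig : rint m setT g by exact: (rint_finite mfin mg gM).
have Ic : rint m setT (fun=> M) by exact: (rint_finite mfin mM cM).
have bT (h : 'rV[R]_n -> R) : measurable_fun [set: Bo] h -> measurable_fun (U : set T) h.
  move=> mh _ B mB; apply: measurableI => //; apply: borel_measurable_leb.
  by rewrite -[_ @^-1` _]setTI; exact: mh.
have IgU : rint mu U g by exact: (@rint_bounded _ T R mu U g _ mTU Ufin (bT _ mg) (fun x _ => gM x)).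
have IcU : rint mu U (fun=> M) by exact: (@rint_bounded _ T R mu U _ _ mTU Ufin (bT _ mM) (fun x _ => cM x)).
have -> : \int[m]_x f x = \int[m]_x (g x - M).
  by apply: (@Rint_eq _ Bo R m setT) => x _; rewrite /g addrK.
have -> : \int[mu]_(x in U) f x = \int[mu]_(x in U) (g x - M).
  by apply: (@Rint_eq _ T R mu U) => x _; rewrite /g addrK.
rewrite (RintegralB measurableT Ig Ic) (RintegralB mTU IgU IcU) mulrBr.
by rewrite (Rint_leb_restr mU Ufin k mg g0) (Rint_leb_restr mU Ufin k mM c0).
Qed.

(** Linearity is asked on [U] only, because the lemma is applied to truncations of [dot xi], which
    saturate far away. *)
Lemma SBV_affine U u xi : open U -> bounded_set U -> (forall x, U x -> u x = dot xi x) -> SBV U u.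
Proof.
move=> oU bU uE; have mU := open_borel oU; have Ufin : (lb U < +oo)%E by exact: bounded_leb_fin bU.
have mTU := open_measurable_leb oU.
have cd : continuous (fun x => dot xi x + 0)  by exact: linear_continuous.
have Id : rint mu U (fun x => dot xi x + 0).
  have [N [rN HN]] := bU.
  apply: (@rint_bounded _ T R mu U _ (n%:R * `|xi| * (`|N| + 1)) mTU Ufin).
    exact: continuous_measurable_leb.
  move=> x Ux; rewrite addr0; apply: (le_trans (dot_le _ _)); rewrite ler_wpM2l ?mulr_ge0//.
  by apply: HN => //; rewrite (le_lt_trans (ler_norm N))// ltrDl.
split; first by apply: (rint_eq mTU _ Id) => x Ux; rewrite uE// addr0.
pose m := mfrestr mU Ufin; pose c := charge_of_finite_measure m.
exists (fun i => cscale (xi 0 i) c), (fun=> czero); split.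
- move=> phi i tp; have [M M0 phiM] := test_bounded tp.
  have mphi := continuous_borel (smooth_continuous (test_fun_smooth tp)).
  (* [charge_integralE] takes a difference of two measures: the coefficient [xi 0 i] is split into
     its positive and negative parts. *)
  have p0 : 0 <= Num.max (xi 0 i) 0 by rewrite le_max lexx orbT.
  have q0 : 0 <= Num.max (- xi 0 i) 0 by rewrite le_max lexx orbT.
  pose k1 := NngNum p0; pose k2 := NngNum q0.
  have kfin (k : {nonneg R}) : (mscale k m setT < +oo)%E.
    by rewrite /mscale/= /mfrestr /mrestr setTI lte_mul_pinfty// ?lee_fin.
  rewrite (@charge_integralE _ _ _ _ (mscale k1 m) (mscale k2 m) phi M) //.
  - rewrite (Rint_leb_restr_bounded mU Ufin k1 mphi phiM) (Rint_leb_restr_bounded mU Ufin k2 mphi phiM) /=.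
    rewrite -mulrBl (_ : Num.max _ _ - _ = xi 0 i); last first.
      by case: (leP (xi 0 i) 0) => h; case: (leP (- xi 0 i) 0) => h'; lra.
    rewrite -(Rint_linear_partial xi 0 i mTU Ufin tp).
    by apply: (@Rint_eq _ T R mu U) => x Ux; rewrite uE// addr0.
  - exact: kfin.
  - exact: kfin.
  - move=> A mA.
    suff : ((xi 0 i)%:E * m A + 0 = (Num.max (xi 0 i) 0)%:E * m A -
      (Num.max (- xi 0 i) 0)%:E * m A)%E by [].
    rewrite adde0.
    have Afin : m A \is a fin_num by exact: fin_num_measure.
    rewrite -[m A]fineK// -!EFinM -EFinB -mulrBl; congr ((_ * _)%:E).
    by case: (leP (xi 0 i) 0) => h; case: (leP (- xi 0 i) 0) => h'; lra.
- move=> i A A0 B mB BA.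
  have BU : lb (B `&` U) = 0%E by apply: A0; [exact: (measurableI _ _ mB mU)|move=> x [/BA]].
  suff : ((xi 0 i)%:E * lb (B `&` U) = 0)%E by [].
  by rewrite BU mule0.
- exists set0; split=> //; exact: measure0.
- by [].
Qed.

Lemma disc_set_approx_lim u x z : approx_lim u setT x z -> ~ disc_set u x.
Proof.
move=> Lz; rewrite /disc_set/=; apply/negP; rewrite -leNgt.
apply: (@le_trans _ _ z%:E).
  apply/lee_addgt0Pr => e e0; rewrite -EFinD; apply: ereal_inf_lbound; exists (z + e) => //.
  apply: (density0S n_gt0 _ (Lz _ e0)) => y /= h; split=> //=; apply: lt_le_trans (ler_norm _); lra.
apply/lee_addgt0Pr => e e0; rewrite -leeBlDr// -EFinB; apply: ereal_sup_ubound; exists (z - e) => //.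
apply: (density0S n_gt0 _ (Lz _ e0)) => y /= h; split=> //=; rewrite -normrN.
by apply: lt_le_trans (ler_norm _); lra.
Qed.

Lemma is_approx_grad_linear xi x : is_approx_grad (dot xi) x xi.
Proof.
have D (e : R) : 0 < e -> density0 [set y | e * enorm (y - x) < `|dot xi y - dot xi x - dot xi (y - x)|] x.
  move=> e0; apply: (density0S n_gt0 _ (density0_0 n_gt0 x)) => y /=.
  by rewrite -dotBr subrr normr0 ltNge mulr_ge0 ?(ltW e0)// enorm_ge0.
by exists (dot xi x) => //; exact: approx_lim_of_grad D.
Qed.

Lemma approx_grad_linear xi x : approx_grad (dot xi) x = xi.
Proof. exact: approx_gradE (is_approx_grad_linear xi x). Qed.

Lemma disc_set_linear xi : disc_set (dot xi) = set0.
Proof.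
apply/seteqP; split=> x //; have [z Lz _] := is_approx_grad_linear xi x.
exact: disc_set_approx_lim Lz.
Qed.

Lemma GSBV2_linear U xi : open U -> bounded_set U -> (forall x, U x -> `|dot xi x| < 1) ->
  GSBV2 U (dot xi).
Proof.
move=> oU bU x1; have [Iu _] : SBV U (dot xi) by exact: (SBV_affine oU bU (fun x _ => erefl)).
have mTU := open_measurable_leb oU; have Ufin := bounded_leb_fin bU.
split.
(* The truncation at level 0 is the zero function; at the other levels it leaves [dot xi] unchanged
   on [U], where its values are below 1 in modulus. *)
- split=> // -[|m].
    apply: (@SBV_affine U _ 0) => // x Ux; rewrite [RHS]big1 => [|i _]; last by rewrite mxE mul0r.
    by rewrite /truncation oppr0; case: (leP (dot xi x) 0) => h; case: leP => h' //; lra.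
  apply: (@SBV_affine U _ xi) => // x Ux; have := x1 x Ux; rewrite ltr_norml => /andP[h1 h2].
  have m1 : 1 <= m.+1%:R :> R by rewrite ler1n.
  by rewrite /truncation; case: (leP (dot xi x) m.+1%:R) => h; case: leP => h' //; lra.
- by move=> i; under eq_fun do rewrite approx_grad_linear; exact: measurable_cst.
- under eq_integral do rewrite approx_grad_linear.
  by rewrite integral_cst// lte_mul_pinfty// lee_fin sqr_ge0.
- by rewrite disc_set_linear set0I outer_measure0.
Qed.

End affine.

Section lower_bound.
Context (R : realType) (n : nat).
Hypothesis n_ge2 : (2 <= n)%N.
Implicit Types (x y xi : 'rV[R]_n) (U K : set 'rV[R]_n) (u v f g w phi : 'rV[R]_n -> R).
Local Notation L := (@leb_outer R n).
Local Notation T := (lebT R n).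
Local Notation mu := (@leb R n).
Local Notation H := (@haus_outer R n n.-1).

Lemma rint_ae_le (D N : set T) f g : measurable D -> L N = 0%E -> measurable_fun D f ->
  rint mu D g -> (forall x, D x -> ~ N x -> `|f x| <= g x) -> rint mu D f.
Proof.
move=> mD N0 mf Ig fg; have mN : measurable N by exact: null_measurable_leb.
have mDN : measurable (D `\` N) by exact: measurableD.
have DND : D `\` N `<=` D by move=> x [].
have mfE : measurable_fun D (fun x => (f x)%:E) by exact/measurable_EFinP.
apply/integrableP; split=> //.
have mfn : measurable_fun D (fun x => `|(f x)%:E|%E) by exact: measurableT_comp.
rewrite (ge0_negligible_integral mN mD mfn) //.
have If : rint mu (D `\` N) f.
  apply: (rint_le mDN (measurable_funS mD DND mf) (rint_sub mD mDN DND Ig)).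
  by move=> x [Dx Nx]; exact: fg.
by have /integrableP[] := If.
Qed.

Lemma Rint_ae_le (D N : set T) f g : measurable D -> L N = 0%E -> rint mu D f -> rint mu D g ->
  (forall x, D x -> ~ N x -> f x <= g x) -> \int[mu]_(x in D) f x <= \int[mu]_(x in D) g x.
Proof.
move=> mD N0 If Ig fg; have mN : measurable N by exact: null_measurable_leb.
have mDN : measurable (D `\` N) by exact: measurableD.
have DND : D `\` N `<=` D by move=> x [].
rewrite /Rintegral (negligible_integral mN mD If N0) (negligible_integral mN mD Ig N0).
apply: (le_Rintegral mDN (rint_sub mD mDN DND If) (rint_sub mD mDN DND Ig)).
by move=> x [Dx Nx]; exact: fg.
Qed.

Lemma truncation_dist (m : nat) u x (t : R) : `|t| <= m%:R -> `|truncation m u x - t| <= `|u x - t|.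
Proof.
rewrite ler_norml => /andP[t1 t2]; rewrite /truncation.
move: (u x) => s; have := ler_norm (s - t); have := ler_norm (- (s - t)); rewrite normrN.
move: m%:R `|s - t| t1 t2 => r N t1 t2 h1 h2; rewrite ler_norml.
case: (leP s r) => h; [case: (leP s (- r)) => h'|case: (leP r (- r)) => h'];
  by apply/andP; split; lra.
Qed.

(** [u] is truncated at level 2. This bounds [w] independently of [u], increases neither the
    gradient nor the jump set, and does not move [u] away from [dot xi], whose values lie in ]-1,
    1[; all costs are thus charged to the energy of [u]. The constant of [flux_estimate] is doubled
    by the cross term [2 * b . xi]. *)
Lemma energy_lower : exists2 C : R, 0 < C & forall x0 r0 K phi Cphi e delta xi u v (beta : R -> R),
    0 < e -> 0 < delta -> 0 < enorm xi ->
  smooth phi -> compact K -> (forall x, ~ K x -> phi x = 0) ->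
  (forall x, K x -> ball x e `<=` ball x0 r0) ->
  (forall x, 0 <= phi x <= 1) -> (forall i x, `|partial i phi x| <= Cphi) ->
  (forall x, ball x0 r0 x -> `|dot xi x| < 1) -> L1 (ball x0 r0) v ->
  ae_eq mu (ball x0 r0 `&` dilation e (@perforated R n)) v u ->
  C * delta * enorm xi <= 2^-1 -> C * enorm xi ^+ 2 * e <= 2^-1 ->
  C * enorm xi ^+ 2 * e <= beta e ->
  ((enorm xi ^+ 2 * fine (L (ball x0 r0)) -
    2 * enorm xi ^+ 2 * \int[mu]_(x in ball x0 r0) (1 - phi x) -
    C * (Cphi * enorm xi + enorm xi ^+ 2 / delta) *
      \int[mu]_(x in ball x0 r0) `|v x - dot xi x| -
    C * Cphi * enorm xi ^+ 2 * e * fine (L (ball x0 r0)))%:E <=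
  F_energy beta e u (ball x0 r0))%E.
Proof.
have [C C0 HC] := @flux_estimate R n n_ge2; exists (2 * C); first by rewrite mulr_gt0.
have n1 : (0 < n)%N := ltnW n_ge2.
move=> x0 r0 K phi Cphi e delta xi u v beta e0 d0 q0 sp cK K0 KU p01 pC xi1 Iv vu Hd He Hb.
rewrite /F_energy; case: asboolP => [G2|_]; last exact: leey.
set U := ball x0 r0 in KU xi1 Iv vu G2 *; set q := enorm xi in q0 Hd He Hb *.
have oU : open U by exact: ball_open.
have bU : bounded_set U := bounded_ball x0 r0.
have mU := open_measurable_leb oU; have Ufin := bounded_leb_fin bU.
have [[Iu HS] mag agfin Hfin] := G2.
pose w0 := truncation 2 u.
have [a [sigma [Z [bv mZ [Z0 sZ] s0]]]] := SBV_bv_on oU bU (HS 2%N).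
set U' := U `&` _ in vu *; set S := disc_set u in Hfin *.
have oU' : open U' by apply: openI => //; exact: open_perforated.
have mU' := open_measurable_leb oU'; have U'U : U' `<=` U by move=> x [].
pose w x := w0 x - (dot xi x + 0); pose b i x := a i x - xi 0 i.
have sb : sbv_on U w b S.
  exists sigma; split=> //; first exact: bv_on_affine.
  move=> B mB BU; apply: s0 => // x /BU[Ux nx]; split=> //.
  by apply: contra_not nx; exact: disc_set_truncation.
have [Iw Ib] := sbv_on_rint sb; have [_ Ia _] := bv.
(* Off a null set the density [a] of the truncation is its approximate gradient, which
   [truncation_grad] compares with that of [u], the one in the energy. *)
have Lbad := approx_grad_ae n1 oU bU bv mZ Z0 sZ.
set N := [set x | _] in Lbad.
pose g x := enorm (approx_grad u x) ^+ 2.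
have ag_le x : U x -> ~ N x -> \sum_i a i x ^+ 2 <= g x.
  move=> Ux nN; have Gx : is_approx_grad w0 x (\row_i a i x) by apply: contrapT => h; exact: nN.
  have := truncation_grad n1 Gx; rewrite -ler_sqr ?nnegrE ?enorm_ge0// enorm_sqr.
  by congr (_ <= _); apply: eq_bigr => i _; rewrite !mxE expr2.
have mg : measurable_fun (U : set T) g.
  rewrite (_ : g = fun x => \sum_i approx_grad u x 0 i * approx_grad u x 0 i); last first.
    by apply/funext => x; rewrite /g enorm_sqr.
  by apply: measurable_sum => i; exact: measurable_funM.
have g0 x : 0 <= g x by exact: sqr_ge0.
have Ig : rint mu U g.
  apply/integrableP; split; first exact/measurable_EFinP.
  by under eq_integral do rewrite /= ger0_norm ?g0//.
have ma i : measurable_fun (U : set T) (fun x => a i x ^+ 2).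
  by under eq_fun do rewrite expr2; apply: measurable_funM; exact: rint_measurable (Ia i).
have Ia2 i : rint mu U (fun x => a i x ^+ 2).
  apply: (rint_ae_le mU Lbad (ma i) Ig) => x Ux nN; rewrite ger0_norm ?sqr_ge0//.
  apply: le_trans (ag_le x Ux nN); rewrite (bigD1 i)//= lerDl.
  by apply: sumr_ge0 => j _; exact: sqr_ge0.
have Icst (k : R) : rint mu U (fun=> k) by exact: (@rint_bounded _ T R mu U _ `|k| mU Ufin).
have Ib2 i : rint mu U (fun x => b i x ^+ 2).
  have I1 := rintD mU (rintB mU (Ia2 i) (rintZ (2 * xi 0 i) mU (Ia i))) (Icst (xi 0 i ^+ 2)).
  by apply: (rint_eq mU _ I1) => x _; rewrite /b; ring.
have Isa : rint mu U (fun x => \sum_i a i x ^+ 2) by exact: rint_sum.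
have Isb : rint mu U (fun x => \sum_i b i x ^+ 2) by exact: rint_sum.
pose X := \int[mu]_(x in U) (\sum_i a i x ^+ 2).
have Xg : (X%:E <= \int[mu]_(x in U) (enorm (approx_grad u x) ^+ 2)%:E)%E.
  by rewrite -(Rint_EFin mU Ig) lee_fin; exact: (Rint_ae_le mU Lbad Isa Ig ag_le).
have wW x : U x -> `|w x| <= 3.
  move=> Ux; rewrite /w addr0; apply: (le_trans (ler_normB _ _)).
  have := truncation_le u 2 x; have := xi1 x Ux; rewrite -/w0; lra.
have p1 x : `|phi x| <= 1 by have /andP[h1 h2] := p01 x; rewrite ger0_norm.
have := HC x0 r0 K phi Cphi 3 e delta xi w b S e0 d0 q0 sp cK K0 KU p1 pC sb Ib2 wW.
rewrite -/U -/U' -/q.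
set Y := \int[mu]_(x in U) _; set V := \int[mu]_(x in U) (\sum_i b i x ^+ 2).
set h1 := fine (H (S `&` U')); set h := fine (H (S `&` U)); set I := \int[mu]_(x in U') `|w x|.
set l := fine (L U) => HY.
have Cp0 : 0 <= Cphi by exact: le_trans (normr_ge0 _) (pC (Ordinal n1) 0).
(* On the perforated set [v = u], and the truncation moves [u] towards
   [dot xi], which takes values in ]-1, 1[. *)
have Iv' : rint mu U (fun x => dot xi x).
  have md : measurable_fun (U : set T) (fun x => dot xi x).
    have cd : continuous (fun x => dot xi x + 0) by exact: linear_continuous.
    by have := continuous_measurable_leb mU cd; under eq_fun do rewrite addr0.
  by apply: (@rint_bounded _ T R mu U _ 1 mU Ufin md) => x /xi1 /ltW.
have Ivx : rint mu U (fun x => `|v x - dot xi x|) by exact: (rint_norm mU (rintB mU Iv Iv')).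
pose J := \int[mu]_(x in U) `|v x - dot xi x|.
have IJ : I <= J.
  apply: (@le_trans _ _ (\int[mu]_(x in U') `|v x - dot xi x|)); last first.
    by apply: (Rint_sub mU mU' U'U Ivx) => x _; exact: normr_ge0.
  have N0 := ae_leb_null vu.
  apply: (Rint_ae_le mU' N0 (rint_sub mU mU' U'U (rint_norm mU Iw)) (rint_sub mU mU' U'U Ivx)) => x U'x.
  move=> /contrapT /(_ U'x) ->; rewrite /w addr0; apply: truncation_dist.
  by apply: (le_trans (ltW (xi1 x (U'U _ U'x)))); rewrite ler1n.
(* [|a|^2 = |xi + b|^2] is used with weight [phi], and [|b|^2 <= 2 |a|^2 + 2 |xi|^2]
   with weight [1 - phi]. *)
have XY : q ^+ 2 * l - 2 * q ^+ 2 * \int[mu]_(x in U) (1 - phi x) + 2 * Y + 2^-1 * V <= X.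
  have tU : test_fun U phi by split=> //; exists K; split=> // x Kx; exact: (KU x Kx _ (ballxx x e0)).
  have Ip : rint mu U (fun x => 1 - phi x) by exact: (rintB mU (Icst 1) (rint_test mU Ufin tU)).
  have IY i : rint mu U (fun x => b i x * (phi x * xi 0 i)).
    have I1 := rintZ (xi 0 i) mU (rintM_test mU (Ib i) tU).
    by apply: (rint_eq mU _ I1) => x _; ring.
  have IYs : rint mu U (fun x => \sum_i b i x * (phi x * xi 0 i)) by exact: rint_sum.
  have -> : q ^+ 2 * l = \int[mu]_(x in U) (q ^+ 2) by rewrite Rintegral_cst.
  rewrite /Y /V -(RintegralZl _ mU Ip) -(RintegralZl _ mU IYs) -(RintegralZl _ mU Isb).
  have A1 := rintB mU (Icst (q ^+ 2)) (rintZ (2 * q ^+ 2) mU Ip).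
  have A2 := rintZ 2 mU IYs; have A3 := rintZ 2^-1 mU Isb; have A12 := rintD mU A1 A2.
  rewrite -(RintegralB mU (Icst (q ^+ 2)) (rintZ (2 * q ^+ 2) mU Ip)) -(RintegralD mU A1 A2).
  rewrite -(RintegralD mU A12 A3).
  apply: (le_Rintegral mU (rintD mU A12 A3) Isa) => x _.
  rewrite /q enorm_sqr /dot; have /andP[f0 f1] := p01 x; move: (phi x) f0 f1 => f f0 f1.
  rewrite -[leLHS]/(_ - 2 * _ * (1 - f) + _ + _).
  rewrite [2 * _ * (1 - f)]mulrAC !mulr_sumr -sumrB -!big_split/=; apply: ler_sum => i _.
  rewrite /b -subr_ge0; move: (a i x) (xi 0 i) => s t.
  rewrite (_ : _ - _ = 2^-1 * ((1 - f) * (s + t) ^+ 2 + f * (s - t) ^+ 2)); last by field.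
  by rewrite mulr_ge0// addr_ge0// mulr_ge0 ?sqr_ge0// subr_ge0.
have Hle A : A `<=` S `&` U -> (H A \is a fin_num)%E.
  move=> AU; rewrite ge0_fin_numE ?outer_measure_ge0//.
  by apply: le_lt_trans Hfin; exact: le_outer_measure.
have U'fin : (H (S `&` U') \is a fin_num)%E by apply: Hle; exact: setIS.
set h2 := fine (H (S `&` (U `\` dilation e (@perforated R n)))).
have Dfin : (H (S `&` (U `\` dilation e (@perforated R n))) \is a fin_num)%E.
  by apply: Hle; apply: setIS => x [].
(* The cell term charges the whole jump set. Its part off the holes and the [delta] term share the
   unit coefficient of [h1], one half each; its part in the holes is paid by [beta e * h2]. *)
have hh : h <= h1 + h2.
  rewrite -lee_fin EFinD !fineK//; last exact: Hle.
  apply: le_trans (outer_measureU2 H _ _); apply: le_outer_measure.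
  move=> x [Sx Ux]; have [Px|Px] := pselect (dilation e (@perforated R n) x); first by left.
  by right.
have h10 : 0 <= h1 by rewrite fine_ge0// outer_measure_ge0.
have h20 : 0 <= h2 by rewrite fine_ge0// outer_measure_ge0.
apply: (@le_trans _ _ (X + h1 + beta e * h2)%:E); last first.
  rewrite EFinD [(X + h1)%:E]EFinD EFinM.
  rewrite (fineK U'fin) (fineK Dfin); exact: (leeD (leeD Xg (lexx _)) (lexx _)).
rewrite lee_fin -/J.
have V0 : 0 <= V.
  by apply: (@Rint_ge0 _ T R mu U) => x _; apply: sumr_ge0 => i _; exact: sqr_ge0.
have c1 : 0 <= C * (Cphi * q + q ^+ 2 / delta).
  apply: (mulr_ge0 (ltW C0) (addr_ge0 (mulr_ge0 Cp0 (ltW q0)) _)).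
  by apply: divr_ge0; [exact: sqr_ge0|exact: ltW].
have P1 := ler_wpM2l c1 IJ.
have P2 := ler_wpM2r h10 Hd.
have c2 : 0 <= 2 * C * q ^+ 2 * e.
  exact: (mulr_ge0 (mulr_ge0 (mulr_ge0 (ler0n _ 2) (ltW C0)) (sqr_ge0 q)) (ltW e0)).
have P3 := ler_wpM2l c2 hh.
have P4 := ler_wpM2r h10 He; have P5 := ler_wpM2r h20 Hb.
move: HY; rewrite ler_norml => /andP[HY _].
have E1 : 2 * C * q ^+ 2 * e * (h1 + h2) = 2 * C * q ^+ 2 * e * h1 + 2 * C * q ^+ 2 * e * h2 by rewrite mulrDr.
rewrite E1 in P3.
have E2 : 2 * C * delta * q * h1 = 2 * (C * delta * q * h1) by ring.
have E3 : 2 * C * q ^+ 2 * e * h = 2 * (C * q ^+ 2 * e * h) by ring.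
have E4 : 2 * C * (Cphi * q + q ^+ 2 / delta) * J = 2 * (C * (Cphi * q + q ^+ 2 / delta) * J) by ring.
have E5 : 2 * C * Cphi * q ^+ 2 * e * l = 2 * (C * Cphi * q ^+ 2 * e * l) by ring.
rewrite E2 in P2; rewrite E3 in P3; rewrite E4 E5.
move: XY HY P1 P2 P3 P4 P5 V0.
move: (C * (Cphi * q + q ^+ 2 / delta) * J) (C * (Cphi * q + q ^+ 2 / delta) * I)
  (C * delta * q * h1) (C * q ^+ 2 * e * h) (C * Cphi * q ^+ 2 * e * l)
  (2 * C * q ^+ 2 * e * h1) (2 * C * q ^+ 2 * e * h2) (beta e * h2)
  (2 * q ^+ 2 * \int[mu]_(x in U) (1 - phi x)) (q ^+ 2 * l) (X) (Y) (V) (h1).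
by clear => t1 t2 t3 t4 t5 t6 t7 t8 t9 t10 t11 t12 t13 t14; lra.
Qed.

End lower_bound.

(** * Lower bound for the homogenized functional *)

Section homogenized.
Context (R : realType) (n : nat).
Hypothesis n_ge2 : (2 <= n)%N.
Implicit Types (x y xi : 'rV[R]_n) (U K : set 'rV[R]_n) (u v phi : 'rV[R]_n -> R).
Local Notation L := (@leb_outer R n).
Local Notation T := (lebT R n).
Local Notation mu := (@leb R n).

Lemma limn_einf_ge (f : (\bar R)^nat) (A : \bar R) N :
  (forall k, (N <= k)%N -> (A <= f k)%E) -> (A <= limn_einf f)%E.
Proof.
move=> H; rewrite limn_einf_lim; apply: lime_ge; first exact: is_cvg_einfs.
exists N => // k /= Nk; apply: le_ereal_inf_tmp => _ [j /= kj <-].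
by apply: H; exact: leq_trans Nk kj.
Qed.

Lemma F_energy_linear beta e U xi : open U -> bounded_set U -> (forall x, U x -> `|dot xi x| < 1) ->
  F_energy beta e (dot xi) U = (enorm xi ^+ 2 * fine (L U))%:E.
Proof.
move=> oU bU x1; have mU := open_measurable_leb oU; have Ufin := bounded_leb_fin bU.
have n1 : (0 < n)%N := ltnW n_ge2.
rewrite /F_energy (asboolT (GSBV2_linear n1 oU bU x1)) (disc_set_linear n1) !set0I.
rewrite !outer_measure0 mule0 !adde0; under eq_integral do rewrite (approx_grad_linear n1).
by rewrite integral_cst// [RHS]EFinM fineK// ge0_fin_numE// outer_measure_ge0.
Qed.

Lemma F_hom_linear (f : 'rV[R]_n -> R) g U xi : open U -> bounded_set U ->
  F_hom f g (dot xi) U = (f xi * fine (L U))%:E.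
Proof.
move=> oU bU; have mU := open_measurable_leb oU; have Ufin := bounded_leb_fin bU.
have n1 : (0 < n)%N := ltnW n_ge2.
rewrite /F_hom (disc_set_linear n1) set0I integral_set0 adde0.
under eq_integral do rewrite (approx_grad_linear n1).
by rewrite integral_cst// EFinM fineK// ge0_fin_numE// outer_measure_ge0.
Qed.

Lemma cutoff U (eta : R) : open U -> bounded_set U -> 0 < eta -> exists phi, [/\ test_fun U phi,
  forall x, 0 <= phi x <= 1 & \int[mu]_(x in U) (1 - phi x) <= eta].
Proof.
move=> oU bU eta0; have mU := open_measurable_leb oU; have Ufin := bounded_leb_fin bU.
have [K [cK KU LK]] := leb_inner_compact mU bU eta0.
have [phi tp [p01 [V [_ KV] V1]]] := urysohn_test cK oU KU.
exists phi; split=> //; pose E := U `\` K.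
have mK : measurable (K : set T) by apply: closed_measurable_leb; exact: compact_closed_rV.
have mE : measurable (E : set T) by exact: measurableD.
rewrite (@Rint_support _ T R mu U E) => [|x []//|x Ux nE]; last first.
  by rewrite V1 ?subrr//; apply: KV; apply: contrapT => nK; exact: nE.
have Efin : (L E < +oo)%E by exact: lt_trans LK (ltry _).
have mphi := smooth_measurable mE (test_fun_smooth tp).
have m1 : measurable_fun (E : set T) (fun x => 1 - phi x) by exact: (measurable_funB (measurable_cst _) mphi).
have B x : E x -> `|1 - phi x| <= 1.
  by move=> _; have /andP[h1 h2] := p01 x; rewrite ger0_norm ?subr_ge0// lerBlDr lerDl.
apply: (le_trans (ler_norm _)); apply: (le_trans (@Rint_bound _ T R mu E _ 1 mE Efin m1 B)).
by rewrite mul1r -lee_fin fineK ?ge0_fin_numE ?outer_measure_ge0// ltW.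
Qed.

Lemma linear_small U : bounded_set U -> exists2 g : R, 0 < g &
  forall xi x, enorm xi <= g -> U x -> `|dot xi x| < 1.
Proof.
move=> [N [_ HN]]; pose M : R := `|N| + 1; have M0 : 0 < M by rewrite ltr_wpDl.
have nM : 0 < n%:R * M + 1 by rewrite ltr_wpDl// mulr_ge0// ltW.
exists (n%:R * M + 1)^-1; first by rewrite invr_gt0.
move=> xi x xig Ux; apply: (le_lt_trans (dot_le _ _)).
have xM : `|x| <= M by apply: HN => //; rewrite /M (le_lt_trans (ler_norm N))// ltrDl.
apply: (@le_lt_trans _ _ (n%:R * (n%:R * M + 1)^-1 * M)).
  apply: ler_pM => //; rewrite ler_wpM2l//; apply: le_trans xig; exact: norm_le_enorm.
by rewrite mulrAC ltr_pdivrMr// mul1r ltrDl.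
Qed.

Lemma partial_bounded U phi : test_fun U phi ->
  exists2 C : R, 0 <= C & forall i x, `|partial i phi x| <= C.
Proof.
move=> tp; have /choice[M HM] i : exists M : R, 0 <= M /\ forall x, `|partial i phi x| <= M.
  by have [M M0 HM] := test_bounded (test_fun_partial i tp); exists M.
exists (\sum_i M i); first by apply: sumr_ge0 => i _; exact: (HM i).1.
move=> i x; apply: (le_trans ((HM i).2 x)); rewrite (bigD1 i)//= lerDl.
by apply: sumr_ge0 => j _; exact: (HM j).1.
Qed.

Lemma eventually_small (s : R^nat) (C t : R) : s @ \oo --> (0 : R) -> 0 < t ->
  \forall k \near \oo, C * s k < t.
Proof.
move=> s0 t0; have C1 : 0 < `|C| + 1 by rewrite ltr_wpDl.
have /cvgrPdist_lt/(_ _ (divr_gt0 t0 C1)) := s0.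
apply: filterS => k; rewrite sub0r normrN ltr_pdivlMr// => h.
apply: le_lt_trans (ler_norm _) _; rewrite normrM; apply: le_lt_trans h.
by rewrite mulrC ler_wpM2l// lerDl.
Qed.

Lemma homogenized_lower (Omega : set 'rV[R]_n) (beta : R -> R) (eps : R^nat) (l : R) :
  open Omega -> bounded_set Omega -> (forall e, 0 < e -> 0 < beta e) -> 0 < l ->
  (fun e => beta e / e) @ 0^'+ --> l -> (forall k, 0 < eps k) -> eps @ \oo --> (0 : R) ->
  exists2 g0 : R, 0 < g0 & forall xi x0 r0 (t : R), 0 < r0 -> ball x0 r0 `<=` Omega ->
    0 < enorm xi <= g0 -> (forall x, Omega x -> `|dot xi x| < 1) -> 0 < t ->
    ((enorm xi ^+ 2 * fine (L (ball x0 r0)) - t)%:E <=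
       F_lower Omega beta eps (dot xi) (ball x0 r0))%E.
Proof.
move=> oO bO b0 l0 bl e0 ecvg; have [C C0 HC] := @energy_lower R n n_ge2.
(* Since [q ^+ 2 <= q <= l / (2 * C)], this gives [C * q ^+ 2 <= l / 2], while [beta e / e >= l / 2]
   for small [e]. The threshold is chosen before the cube, the cutoff and the error [t]. *)
exists (Num.min 1 (l / (2 * C))); first by rewrite lt_min ltr01 divr_gt0// mulr_gt0.
move=> xi x0 r0 t r00 BO /andP[q0 qg] xi1 t0; set q := enorm xi in q0 qg *.
set U := ball x0 r0 in BO *; have oU : open U by exact: ball_open.
have bU : bounded_set U := bounded_ball x0 r0.
have mU := open_measurable_leb oU; have mO := open_measurable_leb oO.
have Ufin := bounded_leb_fin bU; have Ofin := bounded_leb_fin bO.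
have Cq : C * q ^+ 2 <= l / 2.
  move: qg; rewrite le_min => /andP[q1]; rewrite ler_pdivlMr ?mulr_gt0// => q2.
  have : q ^+ 2 <= q by rewrite expr2 ler_piMr// ltW.
  by move=> /(ler_wpM2l (ltW C0)); lra.
have q2 : 0 < q ^+ 2 by rewrite exprn_gt0.
have eta0 : 0 < t / (8 * q ^+ 2) by rewrite divr_gt0// mulr_gt0.
have [phi [tp p01 peta]] := cutoff oU bU eta0.
have [sp [K [cK KU K0]]] := tp; have [Cphi Cp0 pC] := partial_bounded tp.
have [d d0 Hd] := compact_margin cK oU KU.
(* The value for which [C * delta * q] equals [1 / 2]. It is fixed along the sequence, so the factor
   [q ^+ 2 / delta] is harmless against the L1 convergence. *)
pose delta := (2 * (C * q))^-1; have delta0 : 0 < delta by rewrite invr_gt0 !mulr_gt0.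
have Hdelta : C * delta * q <= 2^-1.
  by rewrite le_eqVlt; apply/orP; left; apply/eqP; rewrite /delta; field; rewrite !gt_eqF.
have x1 x : U x -> `|dot xi x| < 1 by move=> /BO /xi1.
apply: le_ereal_inf_tmp => _ [u_ [Iu [v_ [Iv vu vcvg]]] <-].
have Id : rint mu Omega (dot xi) by have [[]] := GSBV2_linear (ltnW n_ge2) oO bO xi1.
have IvO k : rint mu Omega (fun x => `|v_ k x - dot xi x|) by exact: (rint_norm mO (rintB mO (Iv k) Id)).
pose J k := \int[mu]_(x in Omega) `|v_ k x - dot xi x|.
have Jcvg : J @ \oo --> (0 : R).
  have E : (fun k => \int[mu]_(x in Omega) `|v_ k x - dot xi x|%:E)%E = (fun k => (J k)%:E).
    by apply/funext => k; rewrite /J (Rint_EFin mO (IvO k)).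
  by rewrite E in vcvg; exact: fine_cvg vcvg.
have JU k : \int[mu]_(x in U) `|v_ k x - dot xi x| <= J k.
  by apply: (Rint_sub mO mU BO (IvO k)) => x _; exact: normr_ge0.
have t4 : 0 < t / 4 by rewrite divr_gt0.
have N1 := eventually_small (C * (Cphi * q + q ^+ 2 / delta)) Jcvg t4.
have N2 := eventually_small (C * Cphi * q ^+ 2 * fine (L U)) ecvg t4.
have N3 := eventually_small (C * q ^+ 2) ecvg (_ : 0 < 2^-1 :> R).
have N4 := eventually_small 1 ecvg d0.
have [d' d'0 Hd'] : exists2 d' : R, 0 < d' & forall e, 0 < e < d' -> l / 2 * e <= beta e.
  have /cvgrPdist_lt/(_ _ (divr_gt0 l0 (ltr0n R 2)))[d' /= d'0 Hd'] := bl.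
  exists d' => // e /andP[ep ed]; have := Hd' e; rewrite /= sub0r normrN gtr0_norm// => /(_ ed ep).
  rewrite ltr_distlC => /andP[+ _] => h; rewrite -ler_pdivlMr//; lra.
have N5 := eventually_small 1 ecvg d'0.
have [N _ HN] : \forall k \near \oo, [/\ C * (Cphi * q + q ^+ 2 / delta) * J k < t / 4,
    C * Cphi * q ^+ 2 * fine (L U) * eps k < t / 4, C * q ^+ 2 * eps k < 2^-1,
    1 * eps k < d & 1 * eps k < d'].
  by near=> k; split; near: k; [exact: N1|exact: N2|exact: N3|exact: N4|exact: N5].
apply: (@limn_einf_ge _ _ N) => k Nk; have [h1 h2 h3 h4 h5] := HN k Nk.
rewrite !mul1r in h4 h5.
have KUk x : K x -> ball x (eps k) `<=` U.
  move=> Kx y; rewrite -ball_normE /ball_/= => xy; exact: Hd Kx (lt_trans xy h4).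
have IvU : L1 U (v_ k) by exact: (rint_sub mO mU BO (Iv k)).
have vuU : ae_eq mu (U `&` dilation (eps k) (@perforated R n)) (v_ k) (u_ k).
  by apply: filterS (vu k) => x H [Ux Px]; apply: H; split=> //; exact: BO.
have Hb : C * q ^+ 2 * eps k <= beta (eps k).
  apply: le_trans (Hd' _ _); last by rewrite e0 h5.
  by rewrite ler_pM2r.
apply: le_trans (HC x0 r0 K phi Cphi (eps k) delta xi (u_ k) (v_ k) beta (e0 k) delta0 q0 sp cK K0
  KUk p01 pC x1 IvU vuU Hdelta (ltW h3) Hb).
rewrite lee_fin -/U -/q.
have c1 : 0 <= C * (Cphi * q + q ^+ 2 / delta).
  apply: (mulr_ge0 (ltW C0) (addr_ge0 (mulr_ge0 Cp0 (ltW q0)) _)).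
  by apply: divr_ge0; exact: ltW.
have P1 := le_lt_trans (ler_wpM2l c1 (JU k)) h1.
have P2 : 2 * q ^+ 2 * \int[mu]_(x in U) (1 - phi x) <= t / 4.
  have -> : t / 4 = 2 * q ^+ 2 * (t / (8 * q ^+ 2)) by field; rewrite gt_eqF.
  by rewrite ler_pM2l// mulr_gt0.
have E : C * Cphi * q ^+ 2 * eps k * fine (L U) = C * Cphi * q ^+ 2 * fine (L U) * eps k by ring.
rewrite E; move: P1 P2 h2 t0.
move: (q ^+ 2 * fine (L U)) (2 * q ^+ 2 * \int[mu]_(x in U) (1 - phi x))
  (C * (Cphi * q + q ^+ 2 / delta) * \int[mu]_(x in U) `|v_ k x - dot xi x|)
  (C * Cphi * q ^+ 2 * fine (L U) * eps k) => s1 s2 s3 s4.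
by clear; lra.
Unshelve. all: by end_near. Qed.

End homogenized.

Theorem corollary6p12 (R : realType) (n : nat) (n_ge2 : (2 <= n)%N)
    (Omega : set 'rV[R]_n) (Omega_open : open Omega)
    (Omega_neq0 : Omega !=set0) (Omega_bounded : bounded_set Omega)
    (Omega_lipschitz : lipschitz_boundary Omega)
    (beta : R -> R) (beta_itv : forall e, 0 < e -> 0 < beta e <= 1)
    (beta_mono : forall e1 e2, 0 < e1 -> e1 <= e2 -> beta e1 <= beta e2)
    (beta_cvg0 : beta @ 0^'+ --> (0 : R))
    (l : R) (l_gt0 : 0 < l) (beta_l : (fun e => beta e / e) @ 0^'+ --> l)
    (eps : R^nat) (eps_gt0 : forall k, 0 < eps k)
    (eps_decr : nonincreasing_seq eps) (eps_cvg0 : eps @ \oo --> (0 : R))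
    (f_hom : 'rV[R]_n -> R) (g_hom : R * 'rV[R]_n -> R)
    (hom : homogenized_integrands Omega beta eps f_hom g_hom) :
  exists2 gamma0 : R, 0 < gamma0 &
    forall xi : 'rV[R]_n, enorm xi <= gamma0 -> f_hom xi = enorm xi ^+ 2.
Proof.
have [f0 _ _ _ Hhom] := hom.
have beta_gt0 e : 0 < e -> 0 < beta e by move=> /beta_itv/andP[].
have [g1 g10 Hg1] := @homogenized_lower R n n_ge2 Omega beta eps l Omega_open Omega_bounded
  beta_gt0 l_gt0 beta_l eps_gt0 eps_cvg0.
have [g2 g20 Hg2] := @linear_small R n Omega Omega_bounded.
exists (Num.min g1 g2); first by rewrite lt_min g10.
move=> xi; rewrite le_min => /andP[xi1 xi2].
have x1 x : Omega x -> `|dot xi x| < 1 by exact: Hg2.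
have [x0 Ox0] := Omega_neq0.
have /nbhs_ballP[r0 /= r00 BO] := open_nbhs_nbhs (conj Omega_open Ox0).
have oU : open (ball x0 r0) by exact: ball_open.
have bU := bounded_ball x0 r0.
have G2 := GSBV2_linear (ltnW n_ge2) Omega_open Omega_bounded x1.
have [HF _] := Hhom _ G2 _ oU BO; rewrite (F_hom_linear n_ge2 f_hom g_hom xi oU bU) in HF.
set V := fine (@leb_outer R n (ball x0 r0)) in HF.
have V0 : 0 < V by rewrite /V leb_ball_real// exprn_gt0// mulr_gt0.
have up : f_hom xi <= enorm xi ^+ 2.
  rewrite -(ler_pM2r V0) -lee_fin -HF; apply: ereal_inf_lbound; exists (fun=> dot xi).
    have [[Id _] _ _ _] := G2; split=> //; exists (fun=> dot xi); split=> [//|k|].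
      exact: ae_eq_refl.
    under eq_integral do rewrite subrr normr0.
    by rewrite integral0; exact: cvg_cst.
  under eq_fun do rewrite (F_energy_linear n_ge2 _ _ oU bU (fun x Bx => x1 x (BO x Bx))).
  by have [-> _] := cvg_limn_einf_sup (cvg_cst (enorm xi ^+ 2 * V)%:E).
apply/eqP; rewrite eq_le up /= leNgt; apply/negP => lt_f.
(* At [xi = 0] the upper bound and the nonnegativity of [f_hom] already give equality. *)
have q0 : 0 < enorm xi.
  rewrite lt_neqAle enorm_ge0 andbT; apply/negP => /eqP q0.
  by move: lt_f; rewrite -q0 expr0n/= ltNge f0.
(* Half of the presumed gap between the two energies on the cube, so that the lower bound
   contradicts it. *)
pose t := (enorm xi ^+ 2 - f_hom xi) * V / 2.
have t0 : 0 < t by rewrite !mulr_gt0 ?subr_gt0.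
have := Hg1 xi x0 r0 t r00 BO (introT andP (conj q0 xi1)) x1 t0.
rewrite HF lee_fin -/V /t; have := mulr_gt0 (_ : 0 < enorm xi ^+ 2 - f_hom xi) V0.
rewrite subr_gt0 => /(_ lt_f); rewrite mulrBl; lra.
Qed.
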